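(* Let $I\Subset(0,+\infty)$. There exist constants $q_0,h_0,c,C>0$ depending only on $I$ such that the following holds for all real $q$ with $|q|\leq q_0$ and all $0<h\leq h_0$. Suppose that $u(x,t)$ is an even (in $x$) $H^1$ solution of $$ i\partial_t u+\tfrac12\partial_x^2u+q\delta_0(x)u+u|u|^2=0,\qquad x\in\mathbb R, $$ and that for some $\lambda\in I$ and $\vartheta\in\mathbb R$ the function $w_0(x):=u(x,0)-e^{i\vartheta}v_\lambda(x)$ satisfies $\|w_0\|_{H^1}\leq h$ and $P_\lambda(e^{-i\vartheta}w_0)=0$. Then $$\Big\|u(t)-e^{it\lambda^2/2}\Big(v_\lambda+e^{-it\mathcal L_{\lambda,q}}w_0\Big)\Big\|_{H^1_x}\leq C\,t(1+t)\,h^2\qquad\text{for all }0\leq t\leq c\,h^{-1/2}.$$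
   Context: For $\lambda>|q|$, $v_\lambda(x)=\lambda\,\mathrm{sech}(\lambda|x|+\tanh^{-1}(q/\lambda))$ (so $v_\lambda$ depends also on $q$). $H^1(\mathbb R;\mathbb C)$ is regarded as a real Hilbert space, and $\omega(u,v)=\mathrm{Im}\int_{\mathbb R}u\bar v\,dx$. $P_\lambda$ is the projection $$P_\lambda\varphi=\omega(\varphi,\partial_\lambda v_\lambda)\,iv_\lambda-\omega(\varphi,iv_\lambda)\,\partial_\lambda v_\lambda .$$ $\mathcal L_{\lambda,q}$ is the real-linear operator, self-adjoint for $\langle u,v\rangle=\mathrm{Re}\int u\bar v$, given on $w=w_1+iw_2$ ($w_1,w_2$ real) by $\mathcal L_{\lambda,q}w=L_{+}w_1+iL_{-}w_2$, with $$L_{+}=\tfrac12(\lambda^2-\partial_x^2-6v_\lambda^2-2q\delta_0),\qquad L_{-}=\tfrac12(\lambda^2-\partial_x^2-2v_\lambda^2-2q\delta_0).$$ Here $-\partial_x^2-2q\delta_0$ is the self-adjoint operator with domain the functions in $H^2(\mathbb R\setminus\{0\})$ continuous at $0$ with $u'(0+)-u'(0-)=-2qu(0)$. $e^{-it\mathcal L_{\lambda,q}}\varphi$ denotes the solution $w(t)$ of $\partial_tw=-i\mathcal L_{\lambda,q}w$, $w(0)=\varphi$, where $-i\mathcal L_{\lambda,q}$ is the real-linear composition of $\mathcal L_{\lambda,q}$ with multiplication by $-i$.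
   Formalization: The printed estimate fails at t=0 unless e^{iϑ}=1, since its left side is |e^{iϑ}-1|·‖v_λ‖; the formal conclusion bounds u(t) - e^{iϑ}e^{itλ²/2}(v_λ + e^{-itL}(e^{-iϑ}w_0)) instead, which agrees with the printed one for ϑ=0. *)

(* Defs.v *)
From HB Require Import structures.
From mathcomp Require Import all_boot all_order all_algebra.
From mathcomp Require Import complex.
From mathcomp Require Import all_classical all_reals all_analysis.
Set Implicit Arguments.
Unset Strict Implicit.
Unset Printing Implicit Defensive.
Import Order.TTheory GRing.Theory Num.Theory.
Import numFieldNormedType.Exports.
Local Open Scope classical_set_scope.
Local Open Scope ring_scope.
Local Open Scope complex_scope.

(* Functions on the line are genuine functions, not classes modulo null sets; a
   function in H^1 is always its continuous representative, so that evaluation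
   at 0 (the pairing with delta_0) is meaningful. *)

Section Sobolev.
Variable R : realType.
Notation mu := (@lebesgue_measure R).
Implicit Types (f g : R -> R) (u v : R -> R[i]).

Definition sqint f : Prop :=
  measurable_fun setT f /\
  mu.-integrable setT (fun x => (f x ^+ 2)%:E).

(* C^1 functions with compact support in Omega; in one dimension they define
   the same weak derivatives as smooth test functions. *)
Definition test_fun (Omega : set R) f : Prop :=
  [/\ forall x, derivable f x 1, continuous (derive1 f) &
      exists K : set R,
        [/\ compact K, K `<=` Omega & forall x, ~ K x -> f x = 0]].

Definition weak_deriv (Omega : set R) f g : Prop :=
  forall phi, test_fun Omega phi ->
    \int[mu]_x (f x * derive1 phi x) = - \int[mu]_x (g x * phi x).

Definition realH1 f : Prop :=
  [/\ continuous f, sqint f & exists2 g, sqint g & weak_deriv setT f g].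

(* A square integrable weak derivative of f on the line when there is one: it
   is unique almost everywhere, and only used under integrals. *)
Definition wder f : R -> R := get [set g | sqint g /\ weak_deriv setT f g].

Definition rpart u : R -> R := fun x => complex.Re (u x).
Definition ipart u : R -> R := fun x => complex.Im (u x).

Definition H1 u : Prop := realH1 (rpart u) /\ realH1 (ipart u).

Definition Dx u : R -> R[i] := fun x => wder (rpart u) x +i* wder (ipart u) x.

Definition rinner u v : R := \int[mu]_x complex.Re (u x * (v x)^*%C).

Definition omega u v : R := \int[mu]_x complex.Im (u x * (v x)^*%C).

Definition H1norm u : R := Num.sqrt (rinner u u + rinner (Dx u) (Dx u)).

Definition H1_curve (T : R) (u : R -> R -> R[i]) : Prop :=
  forall t, 0 <= t <= T ->
    H1 (u t) /\
    H1norm (fun x => u s x - u t x) @[s --> within `[0, T] (nbhs t)] --> (0 : R).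

Definition expi (theta : R) : R[i] := cos theta +i* sin theta.

End Sobolev.

Section Soliton.
Variable R : realType.
Implicit Types (q lam T x : R).

Definition sech x : R := 2 / (expR x + expR (- x)).

Definition artanh x : R := ln ((1 + x) / (1 - x)) / 2.

(* The soliton; meaningful for `|q| < lam. *)
Definition vsol lam q x : R := lam * sech (lam * `|x| + artanh (q / lam)).

Definition vsolC lam q : R -> R[i] := fun x => (vsol lam q x)%:C.
Definition ivsol lam q : R -> R[i] := fun x => 'i%C * vsolC lam q x.

Definition dvsol lam q : R -> R[i] :=
  fun x => (derive1 (fun l => vsol l q x) lam)%:C.

Definition Pproj lam q (phi : R -> R[i]) : R -> R[i] := fun x =>
  (omega phi (dvsol lam q))%:C * ivsol lam q x
  - (omega phi (ivsol lam q))%:C * dvsol lam q x.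

(* [u] is in C([0,T]; H^1) and solves, in the sense of H^{-1},
     i u_t + (1/2) u_xx + q delta_0 u + u |u|^2 = 0     on 0 < t < T,
   each term being paired with phi in H^1 by Re int (.) conj(phi); replacing
   phi by i phi gives the imaginary part of the complex pairing. *)
Definition NLS_solution q T (u : R -> R -> R[i]) : Prop :=
  H1_curve T u /\
  forall phi, H1 phi -> forall t, 0 < t < T ->
    is_derive t (1 : R) (fun s => rinner (fun x => 'i%C * u s x) phi)
      (2^-1 * rinner (Dx (u t)) (Dx phi)
       - q * complex.Re (u t 0 * (phi 0)^*%C)
       - rinner (fun x => u t x * `|u t x| ^+ 2) phi).

(* Graph of the self-adjoint operator - d^2/dx^2 - 2 q delta_0: f is in its
   domain and g is its image.  The function d is the continuous representative
   of f' off the origin, and - g is f'' off the origin; the point interaction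
   only enters through the jump condition. *)
Definition delta_op q (f g : R -> R) : Prop :=
  [/\ continuous f, sqint f, sqint g &
      exists d : R -> R,
        [/\ sqint d, {in [set~ 0], continuous d},
            weak_deriv [set~ 0] f d, weak_deriv [set~ 0] d (fun x => - g x) &
            exists dl dr : R,
              [/\ d x @[x --> 0^'-] --> dl, d x @[x --> 0^'+] --> dr &
                  dr - dl = - 2 * q * f 0]]].

Definition Lplus lam q (f Lf : R -> R) : Prop :=
  exists2 g, delta_op q f g &
    forall x, Lf x = 2^-1 * (lam ^+ 2 * f x + g x - 6 * vsol lam q x ^+ 2 * f x).

Definition Lminus lam q (f Lf : R -> R) : Prop :=
  exists2 g, delta_op q f g &
    forall x, Lf x = 2^-1 * (lam ^+ 2 * f x + g x - 2 * vsol lam q x ^+ 2 * f x).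

Definition Lop lam q (w Lw : R -> R[i]) : Prop :=
  Lplus lam q (rpart w) (rpart Lw) /\ Lminus lam q (ipart w) (ipart Lw).

(* [w] is t |-> e^{-itL} phi on [0,T]: it is in C([0,T]; H^1) and solves
   i w_t = L w, w(0) = phi.  As phi is only in H^1, w(t) need not be in the
   domain of L; the equation is the weak one against psi in the domain of the
   self-adjoint operator L, which characterizes the orbits of the group. *)
Definition linear_flow lam q T (phi : R -> R[i]) (w : R -> R -> R[i]) : Prop :=
  [/\ H1_curve T w, forall x, w 0 x = phi x &
      forall psi Lpsi, Lop lam q psi Lpsi -> forall t, 0 < t < T ->
        is_derive t (1 : R) (fun s => rinner (fun x => 'i%C * w s x) psi)
          (rinner (w t) Lpsi)].

End Soliton.

(* Main.v *)
(** Write u = e^{i(theta + t lam^2/2)} (v + w + r) with w the linear flow.  The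
    remainder solves i r_t = L r - N with r(0) = 0, where N is quadratic and
    cubic in w + r.  For any weak solution of i z_t = L z - N with z even, the
    energy <L z, z>, alpha = <z_1, v> and beta = <z_2, d_lam v> satisfy
      E' = 2 <L_- z_2, N_1> - 2 <L_+ z_1, N_2>,  alpha' = - <N_2, v>,
      beta' = lam alpha + <N_1, d_lam v>,
    because L_- v = 0 and L_+ d_lam v = - lam v; the projection condition says
    that alpha and beta vanish initially.  As <v, d_lam v> = 1, on even functions
    |f|_{H^1}^2 is bounded by <L_+ f, f> + C <f, v>^2 and by
    <L_- f, f> + C <f, d_lam v>^2: subtracting a multiple of d_lam v or of v makes
    f vanish at a point, after which a Riccati inequality on the half line gives
    coercivity.  Hence |w| <= C h, and as long as |r| <= h one has |N| <= C h^2 and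
    |r| <= C t (1 + t) h^2; this is < h for t <= c h^{-1/2}, which closes a
    continuity argument.  Evenness of w is uniqueness for the linear flow, a
    Gronwall estimate with the energy of - d^2/dx^2 - 2 q delta_0 + lam^2. *)
From HB Require Import structures.
Require Import Defs.
From mathcomp Require Import all_boot all_order all_algebra.
From mathcomp Require Import complex.
From mathcomp Require Import all_classical all_reals all_analysis.
From mathcomp Require Import measurable_realfun.
From mathcomp Require Import ring lra.
Set Implicit Arguments.
Unset Strict Implicit.
Unset Printing Implicit Defensive.
Import Order.TTheory GRing.Theory Num.Theory.
Import numFieldNormedType.Exports.
Local Open Scope classical_set_scope.
Local Open Scope ring_scope.

(** * Integration on the line *)

(** Solutions are merely continuous in H^1 and solve their equations against fixed test functions,
    so pairing the equation with L z has no meaning. The energy law is read off the two-time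
    function <z_1(t), z_2(s)> - <z_2(t), z_1(s)> instead, whose partial derivatives exist.

    The linear flow is tested only against the domain of L, whose elements carry a prescribed jump
    at 0. Explicit domain elements close to an arbitrary H^1 function extend its equation to all H^1
    test functions, so that it can be subtracted from the nonlinear one.

    Constants have to be uniform over I. Estimates therefore use only m <= lam <= M together with
    |q| <= m / 20 and |q| <= 1 / 2, and coercivity comes from explicit Riccati weights rather than
    from compactness or spectral perturbation. The point where f is made to vanish is 0 for L_-, and
    (5 lam)^{-1} with its mirror image for L_+.

    The factor t (1 + t) appears because alpha may grow linearly and beta integrates alpha once
    more; the time h^{-1/2} is where t^2 h^2 reaches the size h. *)

HB.lock Definition ip {R : realType} (f g : R -> R) : R :=
  \int[@lebesgue_measure R]_x (f x * g x).

Lemma ipE {R : realType} (f g : R -> R) :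
  ip f g = \int[@lebesgue_measure R]_x (f x * g x).
Proof. by rewrite ip.unlock. Qed.

Section RealIntegral.
Variable R : realType.
Notation mu := (@lebesgue_measure R).
Local Notation integ D f := (mu.-integrable D (EFin \o f)).
Implicit Types (f g h : R -> R) (a b x : R).

Lemma integ_meas D f : measurable D -> integ D f -> measurable_fun D f.
Proof. by move=> mD /integrableP[/measurable_EFinP]. Qed.

Lemma integ_le D f g : measurable D -> measurable_fun D f -> integ D g ->
  (forall x, D x -> `|f x| <= g x) -> integ D f.
Proof.
move=> mD mf ig fg; apply: le_integrable ig => //; first exact/measurable_EFinP.
move=> x Dx /=; rewrite lee_fin (le_trans (fg x Dx))//; exact: ler_norm.
Qed.

Lemma integD D f g : measurable D -> integ D f -> integ D g ->
  integ D (fun x => f x + g x).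
Proof. by move=> mD fi gi; have := integrableD mD fi gi. Qed.

Lemma integB D f g : measurable D -> integ D f -> integ D g ->
  integ D (fun x => f x - g x).
Proof. by move=> mD fi gi; have := integrableB mD fi gi. Qed.

Lemma integZ D f (k : R) : measurable D -> integ D f ->
  integ D (fun x => k * f x).
Proof. by move=> mD fi; have := integrableZl mD k fi. Qed.

Lemma integ_norm D f : measurable D -> integ D f -> integ D (fun x => `|f x|).
Proof. by move=> mD fi; have := integrable_norm fi. Qed.

Lemma integT D f : measurable D -> integ setT f -> integ D f.
Proof. by move=> mD; exact: integrableS. Qed.

Lemma mu_itvcc a b : a <= b -> mu `[a, b] = (b - a)%:E.
Proof.
move=> ab; rewrite [LHS](lebesgue_measure_itv `[a, b])/= lte_fin.
case: ltgtP ab => // -> _; by rewrite subrr.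
Qed.

Lemma integ_cst_itv a b (k : R) : integ `[a, b] (fun=> k).
Proof.
apply: measurable_bounded_integrable => //.
  have [ab|ba] := leP a b; first by rewrite [X in (X < _)%E]mu_itvcc// ltry.
  by rewrite set_itv_ge ?bnd_simp -?ltNge// measure0.
by exists `|k|; split=> // M kM x _ /=; exact: ltW.
Qed.

Lemma Rint_cst_itv a b (k : R) : a <= b -> \int[mu]_(x in `[a, b]) k = k * (b - a).
Proof.
rewrite le_eqVlt => /predU1P[<-|ab].
  by rewrite set_itv1 Rintegral_set1 subrr mulr0.
by rewrite Rintegral_cst// [X in fine X]mu_itvcc ?ltW.
Qed.

Lemma integ_sq D f g : measurable D -> measurable_fun D f -> measurable_fun D g ->
  integ D (fun x => f x ^+ 2) -> integ D (fun x => g x ^+ 2) ->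
  integ D (fun x => f x * g x).
Proof.
move=> mD mf mg f2 g2; apply: (integ_le mD _ (integD mD f2 g2)).
  exact: measurable_funM.
move=> x _; rewrite ler_norml.
have := sqr_ge0 (f x + g x); have := sqr_ge0 (f x - g x).
have := sqr_ge0 (f x); have := sqr_ge0 (g x); nra.
Qed.

Lemma sqint_mul f g : sqint f -> sqint g -> integ setT (fun x => f x * g x).
Proof. by move=> [mf f2] [mg g2]; exact: integ_sq. Qed.

Lemma sqint_bound f g (k : R) : measurable_fun setT f -> sqint g ->
  (forall x, `|f x| <= k * `|g x|) -> sqint f.
Proof.
move=> mf [mg g2] fg; split => //.
apply: (integ_le _ _ (integZ (k ^+ 2) _ g2)) => //.
  exact: measurable_funX.
move=> x _; rewrite normrX -(real_normK (num_real (g x))) -exprMn.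
by rewrite lerXn2r// nnegrE//; exact: le_trans (fg x).
Qed.

Lemma sqint0 : sqint (fun=> 0 : R).
Proof.
split => //; have -> : (fun x => (0 ^+ 2)%:E) = (cst 0%E : R -> \bar R).
  by apply/funext => x; rewrite expr0n.
exact: integrable0.
Qed.

Lemma sqintD f g : sqint f -> sqint g -> sqint (fun x => f x + g x).
Proof.
move=> [mf f2] [mg g2]; split; first exact: measurable_funD.
apply: (@integ_le _ _ (fun x => 2 * (f x ^+ 2 + g x ^+ 2))) => //.
- by apply: measurable_funX; exact: measurable_funD.
- by apply: integZ => //; exact: integD.
- move=> x _; rewrite ger0_norm ?sqr_ge0//.
  have := sqr_ge0 (f x - g x); nra.
Qed.

Lemma sqintZ (k : R) f : sqint f -> sqint (fun x => k * f x).
Proof.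
move=> sf; have [mf f2] := sf.
apply: (@sqint_bound _ f `|k|) => //; first exact: measurable_funM.
by move=> x; rewrite normrM.
Qed.

Lemma sqintN f : sqint f -> sqint (fun x => - f x).
Proof.
move/(sqintZ (-1)); congr sqint; apply/funext => x; exact: mulN1r.
Qed.

Lemma sqintB f g : sqint f -> sqint g -> sqint (fun x => f x - g x).
Proof. by move=> sf sg; apply: sqintD => //; exact: sqintN. Qed.

Lemma sqintMb f g (k : R) : measurable_fun setT f -> (forall x, `|f x| <= k) ->
  sqint g -> sqint (fun x => f x * g x).
Proof.
move=> mf fk sg; have [mg _] := sg.
apply: (sqint_bound (k := k) _ sg); first exact: measurable_funM.
by move=> x; rewrite normrM ler_wpM2r.
Qed.

Lemma sqint_itv f a b : sqint f -> integ `[a, b] f.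
Proof.
move=> [mf f2]; apply: (@integ_le _ _ (fun x => 1 + f x ^+ 2)) => //.
- exact: measurable_funS mf.
- by apply: integD => //; [exact: integ_cst_itv|exact: integT].
- move=> x _; rewrite ler_norml; have := sqr_ge0 (f x - 1).
  have := sqr_ge0 (f x + 1); nra.
Qed.

Lemma continuous_measurable f : continuous f -> measurable_fun setT f.
Proof. exact: measurable_realfun.continuous_measurable_fun. Qed.

Lemma ipC f g : ip f g = ip g f.
Proof. by rewrite !ipE; apply: eq_Rintegral => x _; exact: mulrC. Qed.

Lemma ipDl f g h : sqint f -> sqint g -> sqint h ->
  ip (fun x => f x + g x) h = ip f h + ip g h.
Proof.
move=> sf sg sh; rewrite !ipE -RintegralD//; [|exact: sqint_mul..].
by apply: eq_Rintegral => x _; exact: mulrDl.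
Qed.

Lemma ipZl k f h : sqint f -> sqint h -> ip (fun x => k * f x) h = k * ip f h.
Proof.
move=> sf sh; rewrite !ipE -RintegralZl//; last exact: sqint_mul.
by apply: eq_Rintegral => x _; rewrite mulrA.
Qed.

Lemma ipNl f h : sqint f -> sqint h -> ip (fun x => - f x) h = - ip f h.
Proof.
move=> sf sh; rewrite -mulN1r -ipZl//; congr ip.
by apply/funext => x; rewrite mulN1r.
Qed.

Lemma ipBl f g h : sqint f -> sqint g -> sqint h ->
  ip (fun x => f x - g x) h = ip f h - ip g h.
Proof.
by move=> sf sg sh; rewrite ipDl//; [rewrite ipNl|exact: sqintN].
Qed.

Lemma ipDr f g h : sqint f -> sqint g -> sqint h ->
  ip h (fun x => f x + g x) = ip h f + ip h g.
Proof. by move=> *; rewrite ipC ipDl// !(ipC h). Qed.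

Lemma ipZr k f h : sqint f -> sqint h -> ip h (fun x => k * f x) = k * ip h f.
Proof. by move=> *; rewrite ipC ipZl// !(ipC h). Qed.

Lemma ipBr f g h : sqint f -> sqint g -> sqint h ->
  ip h (fun x => f x - g x) = ip h f - ip h g.
Proof. by move=> *; rewrite ipC ipBl// !(ipC h). Qed.

Lemma ip_ge0 f : 0 <= ip f f.
Proof. by rewrite ipE; apply: Rintegral_ge0 => x _; rewrite -expr2 sqr_ge0. Qed.

(** The discriminant argument, stated for three numbers so that it serves both [ip] and the H^1
    product [hip]. When C = 0 there is no minimiser - B / C, hence the separate case. *)
Lemma quad_ge0_CS (A B C : R) : 0 <= C -> (forall t, 0 <= A + 2 * t * B + t ^+ 2 * C) ->
  `|B| <= Num.sqrt A * Num.sqrt C.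
Proof.
move=> C0 H; have A0 : 0 <= A by have := H 0; rewrite expr0n !Monoid.simpm.
rewrite -sqrtrM// -sqrtr_sqr ler_wsqrtr//.
have [C00|Cn0] := eqVneq C 0.
  subst C; rewrite mulr0.
  have [->|Bn0] := eqVneq B 0; first by rewrite expr0n.
  (* The polynomial is affine here and takes the value -1 at this t. *)
  have := H (- (A + 1) / (2 * B)); rewrite mulr0 addr0.
  have -> : 2 * (- (A + 1) / (2 * B)) * B = - (A + 1) by field.
  by move=> ?; exfalso; lra.
have {}C0 : 0 < C by rewrite lt_def Cn0.
have := H (- B / C).
have -> : A + 2 * (- B / C) * B + (- B / C) ^+ 2 * C = (A * C - B ^+ 2) / C.
  by field.
by rewrite pmulr_lge0 ?invr_gt0// subr_ge0.
Qed.

Lemma ip_CS f g : sqint f -> sqint g ->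
  `|ip f g| <= Num.sqrt (ip f f) * Num.sqrt (ip g g).
Proof.
move=> sf sg; apply: quad_ge0_CS; first exact: ip_ge0.
move=> t; have st := sqintZ t sg.
suff -> : ip f f + 2 * t * ip f g + t ^+ 2 * ip g g =
  ip (fun x => f x + t * g x) (fun x => f x + t * g x) by exact: ip_ge0.
have sft := sqintD sf st.
by rewrite ipDl// !ipDr// !ipZl// !ipZr// (ipC g f); ring.
Qed.

Lemma ae_mono (P Q : set R) : (forall x, P x -> Q x) ->
  {ae mu, forall x, P x} -> {ae mu, forall x, Q x}.
Proof. by move=> PQ; apply: filterS => //; exact: (ae_filter_ringOfSetsType mu). Qed.

Lemma ae_and (P Q : set R) : {ae mu, forall x, P x} -> {ae mu, forall x, Q x} ->
  {ae mu, forall x, P x /\ Q x}.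
Proof. by move=> aP aQ; apply: filterI => //; exact: (ae_filter_ringOfSetsType mu). Qed.

Lemma Rint_ae_eq D f g : measurable D -> measurable_fun D f -> measurable_fun D g ->
  {ae mu, forall x, D x -> f x = g x} ->
  \int[mu]_(x in D) f x = \int[mu]_(x in D) g x.
Proof.
move=> mD mf mg fg; congr fine; apply: ae_eq_integral => //;
  try exact/measurable_EFinP.
by apply: ae_mono fg => x fgx Dx; rewrite fgx.
Qed.

Lemma ip_ae f g h : sqint f -> sqint g -> sqint h ->
  {ae mu, forall x, f x = g x} -> ip f h = ip g h.
Proof.
move=> [mf _] [mg _] [mh _] fg; rewrite !ipE; apply: Rint_ae_eq => //;
  try exact: measurable_funM.
by apply: ae_mono fg => x -> _.
Qed.

(** Measure-preserving maps: translations and the reflection share the change of variables below. *)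
Definition isom (phi : measurableTypeR R -> measurableTypeR R) := measurable_fun setT phi /\
  forall A, measurable A -> pushforward mu phi A = mu A.

Lemma isom_integ (phi : measurableTypeR R -> measurableTypeR R) f :
  isom phi -> measurable_fun setT f ->
  integ setT f -> integ setT (f \o phi).
Proof.
move=> [mphi phimu] mf /integrableP[_ fi]; apply/integrableP; split.
  by apply/measurable_EFinP; exact: measurableT_comp.
apply: le_lt_trans fi.
have /= E := ge0_integral_pushforward mphi mu (D := setT)
  (f := fun y => `|(f y)%:E|%E).
rewrite -[X in (X <= _)%E]E//; last first.
  by apply/measurable_EFinP; exact: measurableT_comp.
rewrite le_eqVlt; apply/orP; left; apply/eqP.
by apply: eq_measure_integral => A mA _; exact: phimu.
Qed.

Lemma isom_Rint (phi : measurableTypeR R -> measurableTypeR R) f :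
  isom phi -> measurable_fun setT f ->
  integ setT f -> \int[mu]_x f (phi x) = \int[mu]_x f x.
Proof.
move=> iphi mf fi; have [mphi phimu] := iphi; congr fine.
have /= E := integral_pushforward mphi (mu := mu) (D := setT) (f := EFin \o f).
rewrite -[LHS]E//; [|exact/measurable_EFinP|exact: isom_integ].
by apply: eq_measure_integral => A mA _; exact: phimu.
Qed.

Lemma isom_shift c : isom (fun x => x + c).
Proof.
have mphi : measurable_fun setT (fun x : R => x + c : measurableTypeR R).
  by apply: measurable_funD => //; exact: measurable_id.
split => // A mA; apply/esym/lebesgue_measure_unique => //= _ [[a b] /= _ <-].
rewrite /pushforward; have -> : (fun x => x + c) @^-1` `]a, b] = `]a - c, b - c]%classic.
  by apply/seteqP; split=> x /=; rewrite !in_itv/= ltrBlDr lerBrDr.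
rewrite !lebesgue_measure_itv/= !lte_fin ltrD2r; case: ifP => // _.
by rewrite -!EFinB; congr EFin; lra.
Qed.

Lemma isom_opp : isom -%R.
Proof. by split; [exact: measurable_funN|exact: lebesgue_measureN]. Qed.

Lemma sqint_isom (phi : measurableTypeR R -> measurableTypeR R) f : isom phi -> sqint f -> sqint (f \o phi).
Proof.
move=> iphi [mf f2]; split; first by apply: measurableT_comp => //; case: iphi.
by have := isom_integ iphi (measurable_funX 2 mf) f2.
Qed.

Lemma ip_isom (phi : measurableTypeR R -> measurableTypeR R) f g : isom phi -> sqint f -> sqint g ->
  ip (f \o phi) (g \o phi) = ip f g.
Proof.
move=> iphi sf sg; have [mf _] := sf; have [mg _] := sg.
have := isom_Rint iphi _ (sqint_mul sf sg); rewrite !ipE; apply; exact: measurable_funM.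
Qed.

End RealIntegral.

(** * Absolutely continuous functions and the product rule *)

Section AbsCont.
Variable R : realType.
Notation mu := (@lebesgue_measure R).
Local Notation integ D f := (mu.-integrable D (EFin \o f)).
Implicit Types (f g h : R -> R) (a b x : R) (A : set R).

(* On an interval A: f is absolutely continuous, with derivative g a.e. *)
Definition acon A f g := forall a b, a <= b -> `[a, b] `<=` A ->
  integ `[a, b] g /\ f b - f a = \int[mu]_(x in `[a, b]) g x.

Lemma sub_itvcc a b c d : c <= a -> b <= d -> `[a, b]%classic `<=` `[c, d]%classic.
Proof.
move=> ca bd x /=; rewrite !in_itv/= => /andP[ax xb].
by rewrite (le_trans ca ax) (le_trans xb bd).
Qed.

Lemma Rint_split g a c b : a <= c -> c <= b -> integ `[a, b] g ->
  \int[mu]_(x in `[a, b]) g x =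
  \int[mu]_(x in `[a, c]) g x + \int[mu]_(x in `[c, b]) g x.
Proof.
move=> ac cb ig; have := @Rintegral_itvB _ g (BLeft a) (BRight b) c ig.
rewrite !bnd_simp => /(_ ac cb).
rewrite Rintegral_itv_obnd_cbnd; first by move=> /eqP; rewrite subr_eq addrC => /eqP.
by apply: integrableS ig => //; apply: subset_itvr; rewrite bnd_simp.
Qed.

Lemma Rint_itv_ge0 g a b : (forall x, a <= x <= b -> 0 <= g x) ->
  0 <= \int[mu]_(x in `[a, b]) g x.
Proof. by move=> g0; apply: Rintegral_ge0 => x /=; rewrite in_itv; exact: g0. Qed.

Lemma Rint_itv_le f g a b : integ `[a, b] f -> integ `[a, b] g ->
  (forall x, a <= x <= b -> f x <= g x) ->
  \int[mu]_(x in `[a, b]) f x <= \int[mu]_(x in `[a, b]) g x.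
Proof.
by move=> fi gi fg; apply: le_Rintegral => // x /=; rewrite in_itv; exact: fg.
Qed.

Lemma acon_sub A B f g : A `<=` B -> acon B f g -> acon A f g.
Proof. by move=> AB H a b ab abA; apply: H => //; exact: subset_trans AB. Qed.

Lemma acon_norm A f g a b : acon A f g -> a <= b -> `[a, b] `<=` A ->
  `|f b - f a| <= \int[mu]_(x in `[a, b]) `|g x|.
Proof.
by move=> H ab abA; have [gi ->] := H _ _ ab abA; exact: le_normr_Rintegral.
Qed.

Lemma within_itv_eps f a b x : {within `[a, b], continuous f} -> a <= x <= b ->
  forall e, 0 < e -> exists2 d, 0 < d &
    forall y, a <= y <= b -> `|y - x| < d -> `|f y - f x| < e.
Proof.
move=> cf axb e e0.
have xab : `[a, b]%classic x by rewrite /= in_itv.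
move: (cf x) => /cvgrPdist_lt/(_ e e0).
rewrite -[nbhs _]/(nbhs_subspace x) -(nbhs_subspace_in xab) near_withinE.
move=> /nbhs_ballP[d /= d0 H]; exists d => // y yab yx.
by rewrite distrC; apply: H; rewrite /= ?in_itv//= /ball/= distrC.
Qed.

Lemma acon_eps A f g a b x : acon A f g -> `[a, b] `<=` A -> a <= x <= b ->
  forall e, 0 < e -> exists2 d, 0 < d &
    forall y, a <= y <= b -> `|y - x| < d -> `|f y - f x| < e.
Proof.
move=> H abA axb e e0; have /andP[ax xb] := axb; have ab := le_trans ax xb.
have [gi _] := H _ _ ab abA.
have [d d0 K] := within_itv_eps (parameterized_integral_continuous ab gi) axb e0.
exists d => // y /andP[ay yb] yx.
have F z : a <= z <= b -> f z = f a + parameterized_integral mu a z g.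
  move=> /andP[az zb]; have [|_] := H a z az; last first.
    by rewrite /parameterized_integral => <-; rewrite subrKC.
  by apply: subset_trans abA; exact: sub_itvcc.
have yab : a <= y <= b by rewrite ay.
rewrite (F _ yab) (F _ axb) (_ : forall u v w : R, u + v - (u + w) = v - w).
  exact: K.
by move=> *; ring.
Qed.

Lemma acon_continuous f g : acon setT f g -> continuous f.
Proof.
move=> H x; apply/cvgrPdist_lt => e e0.
have [|d d0 K] := @acon_eps _ _ _ (x - 1) (x + 1) x H (@subsetT _ _) _ e e0.
  by rewrite gerBl// lerDl// ler01.
apply/nbhs_ballP; exists (Num.min d 1) => /=; first by rewrite lt_min d0 ltr01.
move=> y; rewrite /ball/= lt_min => /andP[xyd xy1]; rewrite distrC; apply: K.
  by rewrite -ler_distlC ltW.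
by rewrite distrC.
Qed.

Lemma eps_within f a b : (forall x, a <= x <= b -> forall e, 0 < e ->
  exists2 d, 0 < d & forall y, a <= y <= b -> `|y - x| < d -> `|f y - f x| < e) ->
  {within `[a, b], continuous f}.
Proof.
move=> H; apply/subspace_continuousP => x xab.
apply/cvgrPdist_lt => e e0; rewrite near_withinE.
have [|d d0 K] := H x _ e e0; first by move: xab; rewrite /= in_itv.
apply/nbhs_ballP; exists d => // y xy /=; rewrite in_itv/= => yab.
by rewrite distrC; apply: K => //; rewrite distrC.
Qed.

(** Let s be the supremum of the points up to which P holds throughout. Closure from the left gives
    P s, and the step to the right is incompatible with s < b. *)
Lemma real_induction (P : R -> Prop) a b : a <= b -> P a ->
  (forall x, a <= x < b -> P x ->
    exists2 d, 0 < d & forall y, x < y < x + d -> y <= b -> P y) ->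
  (forall x, a < x <= b -> (forall y, a <= y < x -> P y) -> P x) ->
  forall x, a <= x <= b -> P x.
Proof.
move=> ab Pa Pr Pl.
pose S := [set x | a <= x <= b /\ forall y, a <= y <= x -> P y].
have Sa : S a.
  split; first by rewrite lexx.
  by move=> y; rewrite -eq_le => /eqP <-.
have Sb : has_ubound S by exists b => x [/andP[]].
have supS : has_sup S by split => //; exists a.
pose s := sup S.
have as_ : a <= s by exact: ub_le_sup.
have sb : s <= b by apply: ge_sup => [|x [/andP[]]//]; exists a.
have Plt y : a <= y < s -> P y.
  move=> /andP[ay ys]; have ys0 : 0 < s - y by rewrite subr_gt0.
  have [z [zab Pz]] := sup_adherent ys0 supS; rewrite -/s subKr => yz.
  by apply: Pz; rewrite ay ltW.
have Ps : P s.
  have [<-//|ns] := eqVneq a s.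
  by apply: Pl => //; rewrite sb andbT lt_neqAle ns.
have Ss : S s.
  split=> [|y /andP[ay]]; first by rewrite as_ sb.
  by rewrite le_eqVlt => /predU1P[->//|ys]; apply: Plt; rewrite ay.
have [sb'|] := ltP s b; last first.
  move=> bs x /andP[ax xb]; apply: Ss.2; rewrite ax; exact: le_trans bs.
have [|d d0 Pd] := Pr s _ Ps; first by rewrite as_.
pose t := Num.min b (s + d / 2).
have st : s < t by rewrite lt_min sb' ltrDl divr_gt0.
suff : S t by move=> /(ub_le_sup Sb); rewrite leNgt st.
have tb : t <= b by rewrite ge_min lexx.
split=> [|y /andP[ay yt]]; first by rewrite (le_trans as_ (ltW st)).
have [ys|sy] := leP y s; first by apply: Ss.2; rewrite ay.
apply: Pd; last exact: le_trans tb.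
rewrite sy (le_lt_trans yt)// gt_min; apply/orP; right.
by rewrite ltrD2l ltr_pdivrMr// ltr_pMr// ltr1n.
Qed.

(** A function whose increments are locally negligible against those of an increasing G is constant:
    by real induction its total increment is at most e (G b - G a) for every e. Continuity of f is
    asked for separately because G may jump. *)
Lemma locally_flat f (G : R -> R) a b : a <= b ->
  (forall x, a <= x <= b -> forall e, 0 < e -> exists2 d, 0 < d &
    forall y, a <= y <= b -> `|y - x| < d -> `|f y - f x| <= e * `|G y - G x|) ->
  (forall x y, a <= x -> x <= y -> y <= b -> G x <= G y) ->
  (forall x, a <= x <= b -> forall e, 0 < e -> exists2 d, 0 < d &
    forall y, a <= y <= b -> `|y - x| < d -> `|f y - f x| < e) ->
  f b = f a.
Proof.
move=> ab H Gmon fc.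
suff K e : 0 < e -> `|f b - f a| <= e * (G b - G a).
  apply/eqP; rewrite -subr_eq0 -normr_le0 leNgt; apply/negP => fba.
  (* Small enough that e (G b - G a) stays below [|f b - f a|]; the 1 keeps the denominator
     positive. *)
  pose e := `|f b - f a| / (2 * (G b - G a + 1)).
  have Gab : 0 <= G b - G a by rewrite subr_ge0 Gmon.
  have e0 : 0 < e by rewrite divr_gt0// mulr_gt0//; lra.
  have := K e e0; rewrite leNgt => /negP; apply.
  rewrite /e mulrAC ltr_pdivrMr; last by lra.
  nra.
move=> e0.
apply: (@real_induction (fun x => `|f x - f a| <= e * (G x - G a)) a b) => //.
- by rewrite !subrr normr0 mulr0.
- move=> x /andP[ax xb] Px; have [|d d0 Hd] := H x _ e e0; first by rewrite ax ltW.
  exists d => // y /andP[xy yx] yb.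
  have -> : f y - f a = (f y - f x) + (f x - f a) by ring.
  apply: (le_trans (ler_normD _ _)).
  have -> : e * (G y - G a) = e * (G y - G x) + e * (G x - G a) by ring.
  apply: lerD => //; rewrite -(ger0_norm (x := G y - G x)).
    apply: Hd; first by rewrite yb andbT (le_trans ax)// ltW.
    by rewrite gtr0_norm ?subr_gt0// ltrBlDl.
  by rewrite subr_ge0 Gmon// ltW.
- move=> x /andP[ax xb] Py; apply/ler_addgt0Pr => r r0.
  have [|d d0 Hd] := fc x _ r r0; first by rewrite xb ltW.
  pose y := Num.max a (x - d / 2).
  have yx : y < x by rewrite gt_max ax ltrBlDr ltrDl divr_gt0.
  have ay : a <= y by rewrite le_max lexx.
  have := Py y; rewrite ay yx => /(_ isT) Pyy.
  have : `|f y - f x| < r.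
    apply: Hd; first by rewrite ay (le_trans (ltW yx)).
    rewrite distrC gtr0_norm ?subr_gt0// ltrBlDr -ltrBlDl.
    by rewrite lt_max ltrD2l ltrN2 orbC ltr_pdivrMr// ltr_pMr// ltr1n.
  have : G y <= G x by apply: Gmon => //; exact: ltW.
  have -> : f x - f a = (f y - f a) - (f y - f x) by ring.
  move=> GG fyx; apply: (le_trans (ler_normB _ _)).
  apply: lerD; last exact: ltW.
  by apply: (le_trans Pyy); rewrite ler_pM2l// lerD2r.
- by rewrite ab lexx.
Qed.

Lemma acon_within A f g a b : acon A f g -> `[a, b] `<=` A ->
  {within `[a, b], continuous f}.
Proof. by move=> H abA; apply: eps_within => x xab; exact: (acon_eps H abA xab). Qed.

Lemma acon_measurable A f g a b : acon A f g -> `[a, b] `<=` A ->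
  measurable_fun `[a, b] f.
Proof.
by move=> H abA; apply: subspace_continuous_measurable_fun => //; exact: acon_within H _.
Qed.

Lemma acon_bounded A f g a b : acon A f g -> a <= b -> `[a, b] `<=` A ->
  exists2 M, 0 <= M & forall x, a <= x <= b -> `|f x| <= M.
Proof.
move=> H ab abA; have [gi _] := H _ _ ab abA.
have I0 := @Rint_itv_ge0 (fun x => `|g x|) a b (fun x _ => normr_ge0 _).
exists (`|f a| + \int[mu]_(x in `[a, b]) `|g x|); first by rewrite addr_ge0.
move=> x /andP[ax xb].
have axA : `[a, x] `<=` A by apply: subset_trans abA; exact: sub_itvcc.
have := acon_norm H ax axA.
rewrite (Rint_split ax xb); last exact: integ_norm.
have := @Rint_itv_ge0 (fun x => `|g x|) x b (fun x _ => normr_ge0 _).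
have := ler_normD (f a) (f x - f a); rewrite subrKC; lra.
Qed.

Lemma integ_itvM f g a b M : measurable_fun `[a, b] f ->
  (forall x, a <= x <= b -> `|f x| <= M) -> integ `[a, b] g ->
  integ `[a, b] (fun x => f x * g x).
Proof.
move=> mf fM gi; apply: (@integ_le _ _ _ (fun x => M * `|g x|)) => //.
- by apply: measurable_funM => //; exact: integ_meas gi.
- by apply: integZ => //; exact: integ_norm.
- by move=> x /=; rewrite in_itv/= => xab; rewrite normrM ler_wpM2r// fM.
Qed.

Lemma acon_integM A f g h a b : acon A f g -> a <= b -> `[a, b] `<=` A ->
  integ `[a, b] h -> integ `[a, b] (fun x => f x * h x).
Proof.
move=> H ab abA hi; have [M _ HM] := acon_bounded H ab abA.
by apply: integ_itvM HM hi; exact: acon_measurable H abA.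
Qed.

(** No double integral is used. The product minus the candidate integral P is flat with respect to
    G, the primitive of [|g1| + |g2|], and [locally_flat] applies. *)
Lemma aconM A f1 g1 f2 g2 : acon A f1 g1 -> acon A f2 g2 ->
  acon A (fun x => f1 x * f2 x) (fun x => f1 x * g2 x + f2 x * g1 x).
Proof.
move=> H1 H2 a b ab abA.
have [g1i _] := H1 _ _ ab abA; have [g2i _] := H2 _ _ ab abA.
have Gi : integ `[a, b] (fun x => f1 x * g2 x + f2 x * g1 x).
  by apply: integD => //; [exact: acon_integM H1 _ _ _|exact: acon_integM H2 _ _ _].
split=> //.
have gi : integ `[a, b] (fun x => `|g1 x| + `|g2 x|).
  by apply: integD => //; exact: integ_norm.
have sub l r : a <= l -> r <= b -> `[l, r]%classic `<=` `[a, b]%classic.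
  exact: sub_itvcc.
pose P x := \int[mu]_(y in `[a, x]) (f1 y * g2 y + f2 y * g1 y).
pose G x := \int[mu]_(y in `[a, x]) (`|g1 y| + `|g2 y|).
have GB l r : a <= l -> l <= r -> r <= b ->
    G r - G l = \int[mu]_(y in `[l, r]) (`|g1 y| + `|g2 y|).
  move=> al lr rb; rewrite /G (Rint_split al lr); first by ring.
  by apply: integrableS gi => //; exact: sub.
have PB l r : a <= l -> l <= r -> r <= b ->
    P r - P l = \int[mu]_(y in `[l, r]) (f1 y * g2 y + f2 y * g1 y).
  move=> al lr rb; rewrite /P (Rint_split al lr); first by ring.
  by apply: integrableS Gi => //; exact: sub.
have Gmon x y : a <= x -> x <= y -> y <= b -> G x <= G y.
  move=> ax xy yb; rewrite -subr_ge0 GB//; apply: Rint_itv_ge0 => z _.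
  by rewrite addr_ge0.
pose h x := f1 x * f2 x - P x.
(* From f1(r) f2(r) - f1(l) f2(l) = f1(r) (f2(r) - f2(l)) + f2(l) (f1(r) - f1(l)), the increment of
   h is an integral of oscillations of f1 and f2 against g2 and g1. *)
have seg e l r : 0 <= e -> a <= l -> l <= r -> r <= b ->
    (forall z, l <= z <= r -> `|f1 z - f1 r| <= e /\ `|f2 z - f2 l| <= e) ->
    `|h r - h l| <= e * (G r - G l).
  move=> e0 al lr rb He; have slr := sub _ _ al rb.
  have lrA : `[l, r] `<=` A by exact: subset_trans abA.
  have [i1 E1] := H1 _ _ lr lrA; have [i2 E2] := H2 _ _ lr lrA.
  have Gi' : integ `[l, r] (fun x => f1 x * g2 x + f2 x * g1 x) by exact: integrableS Gi.
  have Ci' : integ `[l, r] (fun x => f1 r * g2 x + f2 l * g1 x).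
    by apply: integD => //; exact: integZ.
  have -> : h r - h l =
      \int[mu]_(y in `[l, r]) ((f1 r * g2 y + f2 l * g1 y) - (f1 y * g2 y + f2 y * g1 y)).
    rewrite RintegralB// RintegralD//; [|exact: integZ..].
    rewrite !RintegralZl// -E1 -E2 -PB// /h; ring.
  apply: (le_trans (le_normr_Rintegral _ _)) => //; first exact: integB.
  rewrite GB// -RintegralZl//; last by exact: integrableS gi.
  apply: Rint_itv_le.
  - by apply: integ_norm => //; exact: integB.
  - by apply: integZ => //; exact: integrableS gi.
  - move=> z /He[h1 h2].
    have -> : f1 r * g2 z + f2 l * g1 z - (f1 z * g2 z + f2 z * g1 z) =
      - ((f1 z - f1 r) * g2 z + (f2 z - f2 l) * g1 z) by ring.
    rewrite normrN; apply: (le_trans (ler_normD _ _)); rewrite !normrM.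
    by rewrite mulrDr addrC lerD// ler_wpM2r.
have hba : h b = h a.
  apply: (@locally_flat _ G) => //.
  - move=> x xab e e0; have e20 : 0 < e / 2 by rewrite divr_gt0.
    have [d1 d10 K1] := acon_eps H1 abA xab e20.
    have [d2 d20 K2] := acon_eps H2 abA xab e20.
    exists (Num.min d1 d2); first by rewrite lt_min d10.
    have tri (u v w : R) : `|u - w| < e / 2 -> `|v - w| < e / 2 -> `|u - v| <= e.
      move=> uw vw; rewrite (_ : u - v = (u - w) - (v - w)); last by ring.
      apply: (le_trans (ler_normB _ _)); lra.
    have self (u : R) : `|u - u| < e / 2 by rewrite subrr normr0.
    have /andP[ax xb] := xab.
    move=> y /andP[ay yb]; rewrite lt_min => /andP[yx1 yx2].
    have [xy|/ltW yx] := leP x y.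
      rewrite [X in e * X]ger0_norm ?subr_ge0 ?Gmon//.
      apply: seg => //; first exact: ltW.
      move=> z /andP[xz zy].
      have zab : a <= z <= b by rewrite (le_trans ax)// (le_trans zy).
      have zx : `|z - x| <= `|y - x| by rewrite !ger0_norm ?subr_ge0// lerD2r.
      split; last by apply: tri (self _); apply: K2 => //; exact: le_lt_trans yx2.
      apply: (@tri _ _ (f1 x)); first by apply: K1 => //; exact: le_lt_trans yx1.
      by apply: K1 => //; rewrite ay.
    rewrite distrC [X in e * X]distrC [X in e * X]ger0_norm ?subr_ge0 ?Gmon//.
    apply: seg => //; first exact: ltW.
    move=> z /andP[yz zx].
    have zab : a <= z <= b by rewrite (le_trans ay)// (le_trans zx).
    have zx' : `|z - x| <= `|y - x|.
      by rewrite !ler0_norm ?subr_le0// lerN2 lerD2r.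
    split; first by apply: tri (self _); apply: K1 => //; exact: le_lt_trans yx1.
    apply: (@tri _ _ (f2 x)); first by apply: K2 => //; exact: le_lt_trans yx2.
    by apply: K2 => //; rewrite ay.
  - move=> x xab e e0; have /andP[ax xb] := xab.
    have [M1 M10 HM1] := acon_bounded H1 ab abA.
    have [M2 M20 HM2] := acon_bounded H2 ab abA.
    have [d3 d30 K3] := within_itv_eps (parameterized_integral_continuous ab Gi)
      xab (divr_gt0 e0 (@ltr0n R 2)).
    pose k := e / (4 * (M1 + M2 + 1)).
    have k0 : 0 < k by rewrite divr_gt0// mulr_gt0//; lra.
    have [d1 d10 K1] := acon_eps H1 abA xab k0.
    have [d2 d20 K2] := acon_eps H2 abA xab k0.
    exists (Num.min d1 (Num.min d2 d3)); first by rewrite !lt_min d10 d20.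
    move=> y yab; rewrite !lt_min => /and3P[y1 y2 y3].
    have := K3 y yab y3; rewrite -/(P y) -/(P x) => PP.
    have A1 := K1 y yab y1; have A2 := K2 y yab y2.
    have -> : h y - h x = (f1 y * (f2 y - f2 x) + f2 x * (f1 y - f1 x)) - (P y - P x).
      by rewrite /h; ring.
    apply: (le_lt_trans (ler_normB _ _)).
    rewrite (_ : e = e / 2 + e / 2); last by field.
    apply: ltr_leD => //; last exact: ltW.
    apply: (le_lt_trans (ler_normD _ _)); rewrite !normrM.
    have B1 := HM1 y yab; have B2 := HM2 x xab.
    have C1 : `|f1 y| * `|f2 y - f2 x| <= M1 * k by rewrite ler_pM// ltW.
    have C2 : `|f2 x| * `|f1 y - f1 x| <= M2 * k by rewrite ler_pM// ltW.
    have C3 : (M1 + M2 + 1) * k = e / 4 by rewrite /k; field; lra.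
    nra.
have := PB a b (lexx a) ab (lexx b); rewrite /P set_itv1 Rintegral_set1 subr0.
by move: hba; rewrite /h /P set_itv1 Rintegral_set1; lra.
Qed.

Lemma aconD A f1 g1 f2 g2 : acon A f1 g1 -> acon A f2 g2 ->
  acon A (fun x => f1 x + f2 x) (fun x => g1 x + g2 x).
Proof.
move=> H1 H2 a b ab abA.
have [i1 E1] := H1 _ _ ab abA; have [i2 E2] := H2 _ _ ab abA.
split; first exact: integD.
by rewrite RintegralD// -E1 -E2; ring.
Qed.

Lemma aconZ A f g (k : R) : acon A f g ->
  acon A (fun x => k * f x) (fun x => k * g x).
Proof.
move=> H a b ab abA; have [i E] := H _ _ ab abA.
by split; [exact: integZ|rewrite RintegralZl// -E mulrBr].
Qed.

Lemma acon_cst A (k : R) : acon A (fun=> k) (fun=> 0).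
Proof.
move=> a b ab abA; split; first exact: integ_cst_itv.
by rewrite subrr Rint_cst_itv// mul0r.
Qed.

Lemma acon_eq A f1 g1 f2 g2 : (forall x, A x -> f1 x = f2 x) ->
  (forall x, A x -> g1 x = g2 x) -> acon A f1 g1 -> acon A f2 g2.
Proof.
move=> ff gg H a b ab abA; have [i E] := H _ _ ab abA.
have aA : A a by apply: abA; rewrite /= in_itv/= lexx.
have bA : A b by apply: abA; rewrite /= in_itv/= lexx ab.
split; last first.
  by rewrite -!ff// E; apply: eq_Rintegral => x /set_mem/abA; exact: gg.
by apply: eq_integrable i => // x /set_mem/abA/gg /= ->.
Qed.

Lemma aconN A f g : acon A f g -> acon A (fun x => - f x) (fun x => - g x).
Proof. by move=> /(aconZ (-1)); apply: acon_eq => x _; rewrite mulN1r. Qed.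

Lemma aconB A f1 g1 f2 g2 : acon A f1 g1 -> acon A f2 g2 ->
  acon A (fun x => f1 x - f2 x) (fun x => g1 x - g2 x).
Proof. by move=> H1 /aconN; exact: aconD H1. Qed.

Lemma acon_C1 f g a b : (forall x, a < x < b -> is_derive x (1 : R) f (g x)) ->
  {within `[a, b], continuous f} -> {within `[a, b], continuous g} ->
  acon `[a, b] f g.
Proof.
move=> df cf cg c d cd cdab.
have ci : a <= c <= b by have := cdab c; rewrite /= !in_itv/= lexx cd; exact.
have di : a <= d <= b by have := cdab d; rewrite /= !in_itv/= lexx cd; exact.
have cfs : {within `[c, d], continuous f} by exact: continuous_subspaceW cf.
have cgs : {within `[c, d], continuous g} by exact: continuous_subspaceW cg.
split; first by apply: continuous_compact_integrable => //; exact: segment_compact.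
have [<-|cd'] := eqVneq c d; first by rewrite set_itv1 Rintegral_set1 subrr.
have {}cd : c < d by rewrite lt_neqAle cd'.
rewrite /Rintegral (continuous_FTC2 cd cgs (F := f))//.
- have [_ cl cr] := (continuous_within_itvP f cd).1 cfs.
  split => // x /[!in_itv]/= /andP[cx xd].
  have xab : a < x < b.
    by case/andP: ci => ac _; case/andP: di => _ db; rewrite (le_lt_trans ac) ?(lt_le_trans xd).
  by have [] := df x xab.
- move=> x /[!in_itv]/= /andP[cx xd].
  have xab : a < x < b.
    by case/andP: ci => ac _; case/andP: di => _ db; rewrite (le_lt_trans ac) ?(lt_le_trans xd).
  by have [_ <-] := df x xab; rewrite derive1E.
Qed.

Lemma acon_local A f g : (forall a b, a <= b -> `[a, b] `<=` A -> acon `[a, b] f g) ->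
  acon A f g.
Proof. by move=> H a b ab abA; have := H a b ab abA a b ab; apply. Qed.

Lemma acon_derive A f g : (forall x, A x -> is_derive x (1 : R) f (g x)) ->
  (forall x, A x -> {for x, continuous g}) -> acon A f g.
Proof.
move=> df cg; apply: acon_local => a b ab abA; apply: acon_C1.
- move=> x /andP[ax xb]; apply: df; apply: abA; rewrite /= in_itv/=.
  by rewrite !ltW.
- apply/subspace_continuousP => x /abA Ax; apply: cvg_within_filter.
  by have [d _] := df x Ax; exact/differentiable_continuous/derivable1_diffP.
- by apply/subspace_continuousP => x /abA Ax; apply: cvg_within_filter; exact: cg.
Qed.

Lemma integ_setU (A B : set (measurableTypeR R)) f : measurable A -> measurable B ->
  integ A f -> integ B f -> integ (A `|` B) f.
Proof.
move=> mA mB iA iB.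
have mf : measurable_fun (A `|` B) f.
  by apply/measurable_funU => //; split; exact: integ_meas.
have mAB : measurable (A `|` B) by exact: measurableU.
apply/(integrable_mkcond _ mAB).2; rewrite restrict_EFin.
apply: (@integ_le _ _ _ (fun x => `|(f \_ A) x| + `|(f \_ B) x|)) => //.
- exact/(measurable_restrictT _ _).1.
- apply: integD => //; apply: integ_norm => //; rewrite -restrict_EFin.
    exact/(integrable_mkcond _ mA).1.
  exact/(integrable_mkcond _ mB).1.
- move=> x _; rewrite /patch in_setU; case: (x \in A) => /=.
    by rewrite lerDl.
  by case: ifP => _; rewrite ?lerDr// normr0 addr_ge0.
Qed.

Lemma acon_glue c f g : acon `]-oo, c] f g -> acon `[c, +oo[ f g -> acon setT f g.
Proof.
move=> Hl Hr a b ab _.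
have itvl x y : y <= c -> `[x, y]%classic `<=` `]-oo, c]%classic.
  by move=> yc z /=; rewrite !in_itv/= => /andP[_ zy]; exact: le_trans yc.
have itvr x y : c <= x -> `[x, y]%classic `<=` `[c, +oo[%classic.
  by move=> yc z /=; rewrite !in_itv/= andbT => /andP[zy _]; exact: le_trans zy.
have [bc|cb] := leP b c; first by apply: Hl => //; exact: itvl.
have [ca|ac] := leP c a; first by apply: Hr => //; exact: itvr.
have [i1 E1] := Hl a c (ltW ac) (itvl _ _ (lexx _)).
have [i2 E2] := Hr c b (ltW cb) (itvr _ _ (lexx _)).
have i : integ `[a, b] g.
  have -> : `[a, b]%classic = `[a, c] `|` `[c, b].
    apply/seteqP; split => x /=; rewrite !in_itv/=.
      move=> /andP[ax xb]; have [xc|/ltW cx] := leP x c.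
        by left; rewrite ax.
      by right; rewrite cx.
    move=> [/andP[ax xc]|/andP[cx xb]]; first by rewrite ax (le_trans xc)// ltW.
    by rewrite xb andbT (le_trans _ cx)// ltW.
  exact: integ_setU.
by split=> //; rewrite (Rint_split (ltW ac) (ltW cb))// -E1 -E2; ring.
Qed.

Lemma acon_prim g a : (forall b, integ `[a, b] g) ->
  acon `[a, +oo[ (fun x => \int[mu]_(y in `[a, x]) g y) g.
Proof.
move=> gi c d cd cdA.
have ac : a <= c by have := cdA c; rewrite /= !in_itv/= lexx cd !andbT; apply.
split; first by apply: integrableS (gi d) => //; exact: sub_itvcc.
by rewrite (Rint_split ac cd)//; ring.
Qed.

Lemma Rint_itv_opp g a b : a <= b -> measurable_fun `[a, b] g -> integ `[a, b] g ->
  integ `[- b, - a] (g \o -%R) /\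
  \int[mu]_(x in `[- b, - a]) g (- x) = \int[mu]_(x in `[a, b]) g x.
Proof.
move=> ab mg gi; pose h := g \_ `[a, b].
have mh : measurable_fun setT h by apply/(measurable_restrictT _ _).1.
have hi : integ setT h by rewrite /h -restrict_EFin; exact/(integrable_mkcond _ _).1.
have E : (h \o -%R) = (g \o -%R) \_ `[- b, - a].
  apply/funext => x; rewrite /h /comp /patch !mem_setE/= !in_itv/=.
  by rewrite lerNl lerNr andbC.
have hoi := isom_integ (@isom_opp R) mh hi.
split.
  by apply/(integrable_mkcond _ _).2 => //; rewrite restrict_EFin -E.
rewrite Rintegral_mkcond [RHS]Rintegral_mkcond -/h -(isom_Rint (@isom_opp R) mh hi).
by congr (Rintegral _ _ _); rewrite -E.
Qed.

Lemma acon_opp A f g : acon A f g ->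
  acon [set x | A (- x)] (fun x => f (- x)) (fun x => - g (- x)).
Proof.
move=> H a b ab abA.
have nab : - b <= - a by rewrite lerN2.
have nabA : `[- b, - a] `<=` A.
  move=> x /=; rewrite in_itv/= => /andP[bx xa]; rewrite -(opprK x); apply: abA.
  by rewrite /= in_itv/= lerNr xa lerNl bx.
have [i E] := H _ _ nab nabA.
have [i' E'] := Rint_itv_opp nab (integ_meas (measurable_itv _) i) i.
rewrite !opprK in i' E'.
split; first by have := integZ (-1) (measurable_itv _) i'; apply: eq_integrable => // x _ /=; rewrite mulN1r.
under eq_Rintegral do rewrite -mulN1r.
by rewrite RintegralZl// E' -E; ring.
Qed.

End AbsCont.

(** * Weak derivatives, absolute continuity and classical derivatives *)

Section WeakDerivative.
Variable R : realType.
Notation mu := (@lebesgue_measure R).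
Local Notation integ D f := (mu.-integrable D (EFin \o f)).
Implicit Types (f g h F G phi : R -> R) (a b x : R) (A : set R).

(** Quotient-free form of the derivative: it covers both sides and y = x at once, and it passes to
    limits in f. *)
Lemma is_derive_epsP f x l : is_derive x (1 : R) f l <->
  forall e, 0 < e -> exists2 d, 0 < d & forall y, `|y - x| < d ->
    `|f y - f x - l * (y - x)| <= e * `|y - x|.
Proof.
split=> [[df <-] e e0|H].
  have /cvgrPdist_lt/(_ e e0) : h^-1 *: (f (h *: (1 : R) + x) - f x) @[h --> 0^'] --> 'D_1 f x.
    exact: df.
  move=> /nbhs_ballP[d /= d0 K]; exists d => // y yx.
  have [->|ynx] := eqVneq y x; first by rewrite !subrr mulr0 subrr normr0 mulr0.
  have yx0 : y - x != 0 by rewrite subr_eq0.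
  have := K (y - x); rewrite /ball/= sub0r normrN => /(_ yx yx0).
  rewrite -[(y - x) *: (1 : R)]/((y - x) * 1) mulr1 subrK => Ky.
  rewrite (_ : _ - _ - _ = - (('D_1 f x - (y - x)^-1 * (f y - f x)) * (y - x))); last first.
    by rewrite mulrBl mulrAC mulVf//; ring.
  by rewrite normrN normrM ler_wpM2r// ltW.
have C : h^-1 *: (f (h *: (1 : R) + x) - f x) @[h --> 0^'] --> l.
  apply/cvgrPdist_le => e e0; have [d d0 K] := H e e0.
  apply/nbhs_ballP; exists d => // h; rewrite /ball/= sub0r normrN => hd h0.
  have := K (h + x); rewrite addrK => /(_ hd).
  rewrite -[h *: (1 : R)]/(h * 1) mulr1 -[_ *: _]/(_ * _).
  rewrite (_ : l - h^-1 * (f (h + x) - f x) = - (h^-1 * (f (h + x) - f x - l * h))); last first.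
    by field.
  by move=> Kh; rewrite normrN normrM normfV mulrC ler_pdivrMr ?normr_gt0.
split; first by apply/cvg_ex; exists l.
exact/cvg_lim.
Qed.

Lemma acon_is_derive A F G x d : acon A F G -> 0 < d ->
  (forall y, `|y - x| < d -> A y) -> {for x, continuous G} ->
  is_derive x (1 : R) F (G x).
Proof.
move=> H d0 Ad /cvgrPdist_lt Gc; apply/is_derive_epsP => e e0.
have /nbhs_ballP[d' /= d'0 K] := Gc e e0.
exists (Num.min d d'); first by rewrite lt_min d0.
have key l r : l <= r -> (forall z, l <= z <= r -> `|z - x| < d /\ `|z - x| < d') ->
    `|F r - F l - G x * (r - l)| <= e * (r - l).
  move=> lr near_x; have lrA : `[l, r] `<=` A.
    by move=> z /=; rewrite in_itv/= => /near_x[/Ad].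
  have [i ->] := H _ _ lr lrA.
  rewrite -Rint_cst_itv// -RintegralB//; last exact: integ_cst_itv.
  apply: (le_trans (le_normr_Rintegral _ _)) => //.
    by apply: integB => //; exact: integ_cst_itv.
  rewrite -Rint_cst_itv//; apply: Rint_itv_le.
  - by apply: integ_norm => //; apply: integB => //; exact: integ_cst_itv.
  - exact: integ_cst_itv.
  - move=> z /near_x[_ zx]; rewrite distrC ltW//; apply: K.
    by rewrite /ball/= distrC.
move=> y; rewrite lt_min => /andP[yd yd'].
have [xy|/ltW yx] := leP x y.
  rewrite [X in e * X]ger0_norm ?subr_ge0//; apply: key => // z /andP[xz zy].
  have zy' : `|z - x| <= `|y - x| by rewrite !ger0_norm ?subr_ge0// lerD2r.
  by split; [exact: le_lt_trans yd|exact: le_lt_trans yd'].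
rewrite [X in e * X]ler0_norm ?subr_le0// opprB.
rewrite (_ : F y - F x - G x * (y - x) = - (F x - F y - G x * (x - y))); last by ring.
rewrite normrN; apply: key => // z /andP[yz zx].
have zy' : `|z - x| <= `|y - x|.
  by rewrite !ler0_norm ?subr_le0// lerN2 lerD2r.
by split; [exact: le_lt_trans yd|exact: le_lt_trans yd'].
Qed.

Lemma acon_exists g : (forall a b, integ `[a, b] g) -> exists F, acon setT F g.
Proof.
move=> gi; pose F x := if 0 <= x then \int[mu]_(y in `[0, x]) g y
                      else - \int[mu]_(y in `[x, 0]) g y.
exists F; apply: (@acon_glue _ 0).
  move=> c d cd cdA; split=> //.
  have d0 : d <= 0 by have := cdA d; rewrite /= !in_itv/= lexx cd /=; apply.
  have E z : z <= 0 -> F z = - \int[mu]_(y in `[z, 0]) g y.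
    rewrite /F; case: ltgtP => // -> _; by rewrite set_itv1 Rintegral_set1 oppr0.
  by rewrite !E ?(le_trans cd)// (Rint_split cd d0)//; ring.
apply: acon_eq (acon_prim (a := 0) (gi 0)) => // x /=; rewrite in_itv/= andbT => x0.
by rewrite /F x0.
Qed.

Lemma continuous_integ_itv f a b : continuous f -> integ `[a, b] f.
Proof.
move=> cf; apply: continuous_compact_integrable; first exact: segment_compact.
exact: continuous_subspaceT.
Qed.

Lemma continuous_primitive g : continuous g ->
  exists F, acon setT F g /\ forall x, is_derive x (1 : R) F (g x).
Proof.
move=> cg; have [F HF] := acon_exists (fun a b => continuous_integ_itv a b cg).
by exists F; split=> // x; apply: (acon_is_derive HF ltr01) => //; exact: cg.
Qed.

Lemma Rint_support f a b : a <= b -> (forall x, ~ (a <= x <= b) -> f x = 0) ->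
  \int[mu]_x f x = \int[mu]_(x in `[a, b]) f x.
Proof.
move=> ab f0; rewrite [RHS]Rintegral_mkcond; apply: eq_Rintegral => x _.
rewrite /patch; case: ifPn => //; rewrite notin_setE/= in_itv/= => /negP xab.
by rewrite f0//; exact/negP.
Qed.

Lemma integ_support f a b : integ `[a, b] f -> (forall x, ~ (a <= x <= b) -> f x = 0) ->
  integ setT f.
Proof.
move=> fi f0; have : integ setT (f \_ `[a, b]).
  by rewrite -restrict_EFin; exact/(integrable_mkcond _ _).1.
apply: eq_integrable => // x _ /=; rewrite /patch; case: ifPn => //.
by rewrite notin_setE/= in_itv/= => /negP xab /=; rewrite f0//; exact/negP.
Qed.

Lemma test_fun_support Om phi : test_fun Om phi ->
  exists M, [/\ 0 < M, forall x, ~ (- M <= x <= M) -> phi x = 0 &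
    forall x, ~ (- M <= x <= M) -> derive1 phi x = 0].
Proof.
move=> [dphi cphi [K [cK _ K0]]].
have [N [Nr HN]] := compact_bounded cK.
pose M := Num.max 1 (`|N| + 1).
have NM : N < M by rewrite lt_max; apply/orP; right; have := ler_norm N; lra.
have M0 : 0 < M by rewrite lt_max ltr01.
have phi0 x : ~ (- M <= x <= M) -> phi x = 0.
  move=> xM; apply: K0 => Kx; apply: xM; rewrite -ler_norml; exact: HN NM _ Kx.
exists M; split => // x xM.
have : is_derive x (1 : R) phi 0.
  apply/is_derive_epsP => e e0.
  have d0 : 0 < `|x| - M by rewrite subr_gt0 ltNge ler_norml; apply/negP.
  exists (`|x| - M) => // y yx.
  have yM : ~ (- M <= y <= M).
    rewrite -ler_norml => yM; move: yx; rewrite ltNge => /negP; apply.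
    have := ler_normB y (y - x); rewrite opprB addrCA subrr addr0; lra.
  by rewrite (phi0 _ yM) (phi0 _ xM) mul0r !subr0 normr0 mulr_ge0// ltW.
by case=> _; rewrite derive1E.
Qed.

Lemma test_fun_acon Om phi : test_fun Om phi -> acon setT phi (derive1 phi).
Proof.
move=> [dphi cphi _]; apply: acon_derive => x _; last exact: cphi.
by split=> //; rewrite derive1E.
Qed.

Lemma acon_weak Om f g : acon setT f g -> weak_deriv Om f g.
Proof.
move=> H phi tphi; have P := test_fun_acon tphi.
have [M [M0 p0 dp0]] := test_fun_support tphi.
have NM : - M <= M by lra.
have [gi _] := H _ _ NM (@subsetT _ _).
rewrite (@Rint_support _ (- M) M)//; last by move=> x /dp0 ->; rewrite mulr0.
rewrite (@Rint_support (fun x => g x * phi x) (- M) M)//; last by move=> x /p0 ->; rewrite mulr0.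
have [ii EE] := aconM H P NM (@subsetT _ _); move: EE.
(* The support bound says nothing at the endpoints; there phi vanishes by continuity. *)
have pM : phi M = 0.
  have cp := acon_continuous P.
  apply/eqP; rewrite -normr_le0 leNgt; apply/negP => pM.
  have /cvgrPdist_lt/(_ _ pM)/nbhs_ballP[d /= d0] := cp M.
  move=> /(_ (M + d / 2)); rewrite /ball/= opprD addNKr normrN gtr0_norm ?divr_gt0//.
  rewrite ltr_pdivrMr// ltr_pMr// ltr1n => /(_ isT).
  by rewrite (p0 (M + d / 2)) ?subr0 ?ltxx// => /andP[_]; rewrite gerDl leNgt divr_gt0.
have pNM : phi (- M) = 0.
  have cp := acon_continuous P.
  apply/eqP; rewrite -normr_le0 leNgt; apply/negP => pM'.
  have /cvgrPdist_lt/(_ _ pM')/nbhs_ballP[d /= d0] := cp (- M).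
  move=> /(_ (- M - d / 2)); rewrite /ball/= opprB addrC subrK gtr0_norm ?divr_gt0//.
  rewrite ltr_pdivrMr// ltr_pMr// ltr1n => /(_ isT).
  by rewrite (p0 (- M - d / 2)) ?subr0 ?ltxx// => /andP[]; rewrite lerBrDr gerDl leNgt divr_gt0.
rewrite pM pNM !mulr0 subrr RintegralD//; last 2 first.
- have := acon_integM H NM (@subsetT _ _) (continuous_integ_itv (- M) M _); apply.
  by case: tphi.
- by have := acon_integM P NM (@subsetT _ _) gi.
under [X in _ = - X]eq_Rintegral do rewrite mulrC.
by move/eqP; rewrite eq_sym addr_eq0 => /eqP.
Qed.

Lemma Rint_continuous_eq0 h a b : continuous h -> (forall x, 0 <= h x) ->
  \int[mu]_(x in `[a, b]) h x = 0 -> forall x, a < x < b -> h x = 0.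
Proof.
move=> ch h0 I0 x /andP[ax xb]; apply/eqP; rewrite eq_le h0 andbT leNgt.
apply/negP => hx; have hx2 : 0 < h x / 2 by rewrite divr_gt0.
have /cvgrPdist_lt/(_ _ hx2)/nbhs_ballP[d /= d0 K] := ch x.
pose r := Num.min b (x + d / 2).
have xr : x < r by rewrite lt_min xb ltrDl divr_gt0.
have rb : r <= b by rewrite ge_min lexx.
have i u v := continuous_integ_itv u v ch.
move: I0; rewrite (Rint_split (ltW ax) (ltW xb))// (Rint_split (ltW xr) rb)//.
have P1 : 0 <= \int[mu]_(x in `[a, x]) h x by apply: Rint_itv_ge0.
have P2 : 0 <= \int[mu]_(x in `[r, b]) h x by apply: Rint_itv_ge0.
have P3 : h x / 2 * (r - x) <= \int[mu]_(x in `[x, r]) h x.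
  rewrite -(Rint_cst_itv (h x / 2) (ltW xr)); apply: Rint_itv_le => //; first exact: integ_cst_itv.
  move=> z /andP[xz zr]; have := K z; rewrite /ball/= => Kz.
  have : `|h x - h z| < h x / 2.
    apply: Kz; rewrite distrC ger0_norm ?subr_ge0// ltrBlDl (le_lt_trans zr)//.
    by rewrite gt_min ltrD2l ltr_pdivrMr// ltr_pMr// ltr1n orbT.
  by rewrite ltr_norml => /andP[_]; lra.
have : 0 < h x / 2 * (r - x) by rewrite mulr_gt0// subr_gt0.
lra.
Qed.

(* du Bois-Reymond: with k = f - F, test against the primitive of
   eta * (k - c), where c is the eta-mean of k. *)
Lemma weak_acon f g : continuous f -> (forall a b, integ `[a, b] g) ->
  weak_deriv setT f g -> acon setT f g.
Proof.
move=> cf gi wf; have [F HF] := acon_exists gi.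
move=> a b ab _; split=> //.
have [_ <-] := HF a b ab (@subsetT _ _).
(* The segment is enlarged so that a and b are interior points, where k = c will be known. *)
pose A := a - 1; pose B := b + 1.
have AB : A < B by rewrite /A /B; lra.
pose k x := f x - F x.
have ck : continuous k by move=> x; apply: cvgB; [exact: cf|exact: acon_continuous HF x].
(* Twice the positive part of (x - A) (B - x): a continuous weight, positive exactly inside the
   segment. *)
pose eta x := (x - A) * (B - x) + `|(x - A) * (B - x)|.
have ceta : continuous eta.
  have c0 : continuous (fun x => (x - A) * (B - x)).
    by move=> x; apply: cvgM; apply: cvgB; [exact: cvg_id|exact: cvg_cst|exact: cvg_cst|exact: cvg_id].
  by move=> x; apply: cvgD; [exact: c0|apply: cvg_norm; exact: c0].
have eta0 x : 0 <= eta x.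
  by rewrite /eta addrC -(opprK ((x - A) * _)) normrN subr_ge0 ler_norm.
have etaP x : A < x < B -> 0 < eta x.
  by move=> /andP[Ax xB]; rewrite /eta ger0_norm -?mulr2n ?pmulrn_lgt0 ?mulr_ge0 ?mulr_gt0 ?subr_ge0 ?subr_gt0// ltW.
have etaN x : ~ (A < x < B) -> eta x = 0.
  move=> /negP; rewrite negb_and -!leNgt => xAB.
  rewrite /eta ler0_norm ?subrr//.
  case/orP: xAB => xAB; first by rewrite mulr_le0_ge0//; move: AB; lra.
  by rewrite mulr_ge0_le0//; move: AB; lra.
have i u : continuous u -> integ `[A, B] u by exact: continuous_integ_itv.
pose m := \int[mu]_(x in `[A, B]) eta x.
have m0 : m != 0.
  apply/eqP => /(Rint_continuous_eq0 ceta eta0)/(_ ((A + B) / 2)) E.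
  have AxB : A < (A + B) / 2 < B by apply/andP; split; lra.
  by have := etaP _ AxB; rewrite E// ltxx.
pose c := (\int[mu]_(x in `[A, B]) (eta x * k x)) / m.
pose h x := eta x * (k x - c).
have ch : continuous h.
  by move=> x; apply: cvgM; [exact: ceta|apply: cvgB; [exact: ck|exact: cvg_cst]].
have [P0 [HP0 dP0]] := continuous_primitive ch.
pose phi x := P0 x - P0 A.
have dphi x : is_derive x (1 : R) phi (h x).
  have -> : h x = h x - 0 by rewrite subr0.
  exact: is_deriveB.
have cek : continuous (fun x => eta x * k x).
  by move=> x; apply: cvgM; [exact: ceta|exact: ck].
have h_mean : \int[mu]_(x in `[A, B]) h x = 0.
  have -> : \int[mu]_(x in `[A, B]) h x = \int[mu]_(x in `[A, B]) (eta x * k x - c * eta x).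
    by apply: eq_Rintegral => x _; rewrite /h; ring.
  rewrite RintegralB//; [|exact: i|by apply: integZ => //; exact: i].
  by rewrite RintegralZl//; [rewrite -/m /c divfK ?subrr|exact: i].
have h0 x : ~ (A <= x <= B) -> h x = 0.
  by move=> xAB; rewrite /h etaN ?mul0r// => /andP[Ax xB]; apply: xAB; rewrite !ltW.
have phiAB x : ~ (A <= x <= B) -> phi x = 0.
  move=> /negP; rewrite negb_and -!ltNge => /orP[xA|Bx].
    have [_ E] := HP0 _ _ (ltW xA) (@subsetT _ _).
    rewrite /phi -opprB E (@eq_Rintegral _ _ _ _ _ (fun=> 0)) ?Rint_cst_itv ?mul0r ?oppr0 ?ltW//.
    move=> y /set_mem /=; rewrite in_itv/= => /andP[_ yA]; rewrite /h etaN ?mul0r//.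
    by move=> /andP[Ay _]; move: (lt_le_trans Ay yA); rewrite ltxx.
  have [_ E1] := HP0 _ _ (ltW AB) (@subsetT _ _).
  have [_ E2] := HP0 _ _ (ltW Bx) (@subsetT _ _).
  have E3 : P0 x - P0 B = 0.
    rewrite E2 (@eq_Rintegral _ _ _ _ _ (fun=> 0)) ?Rint_cst_itv ?mul0r ?ltW//.
    move=> y /set_mem /=; rewrite in_itv/= => /andP[By _]; rewrite /h etaN ?mul0r//.
    by move=> /andP[_ yB]; move: (le_lt_trans By yB); rewrite ltxx.
  by move: h_mean; rewrite -E1 /phi; lra.
have phi' : derive1 phi = h.
  by apply/funext => x; rewrite derive1E; case: (dphi x).
have tphi : test_fun setT phi.
  split; [by move=> x; case: (dphi x)|by rewrite phi'|].
  exists `[A, B]%classic; split => //; first exact: segment_compact.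
have E1 := wf _ tphi; have E2 := acon_weak (Om := setT) HF tphi.
rewrite phi' in E1 E2.
have kh : \int[mu]_(x in `[A, B]) (k x * h x) = 0.
  have cF := acon_continuous HF.
  have cfh : continuous (fun x => f x * h x) by move=> x; apply: cvgM; [exact: cf|exact: ch].
  have cFh : continuous (fun x => F x * h x) by move=> x; apply: cvgM; [exact: cF|exact: ch].
  have -> : \int[mu]_(x in `[A, B]) (k x * h x) = \int[mu]_(x in `[A, B]) (f x * h x - F x * h x).
    by apply: eq_Rintegral => x _; rewrite /k; ring.
  rewrite RintegralB//; [|exact: i..].
  rewrite -(@Rint_support (fun x => f x * h x))//; [|exact: ltW|by move=> x /h0 ->; rewrite mulr0].
  rewrite -(@Rint_support (fun x => F x * h x))//; [|exact: ltW|by move=> x /h0 ->; rewrite mulr0].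
  by rewrite E1 E2 subrr.
pose s x := eta x * (k x - c) ^+ 2.
have cs : continuous s.
  move=> x; apply: cvgM; first exact: ceta.
  by apply: cvgM; apply: cvgB; [exact: ck|exact: cvg_cst|exact: ck|exact: cvg_cst].
have s0 x : 0 <= s x by rewrite mulr_ge0// sqr_ge0.
(* The integral of eta (k - c)^2 is that of k h minus c times that of h; the first is zero by the
   weak equation, the second by the choice of c. *)
have sI : \int[mu]_(x in `[A, B]) s x = 0.
  have -> : \int[mu]_(x in `[A, B]) s x = \int[mu]_(x in `[A, B]) (k x * h x - c * h x).
    by apply: eq_Rintegral => x _; rewrite /s /h; ring.
  rewrite RintegralB//; last 2 first.
  - by apply: i => x; apply: cvgM; [exact: ck|exact: ch].
  - by apply: integZ => //; exact: i.
  by rewrite RintegralZl//; [rewrite h_mean kh mulr0 subrr|exact: i].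
have kc x : A < x < B -> k x = c.
  move=> xAB; have := Rint_continuous_eq0 cs s0 sI xAB.
  move/eqP; rewrite mulf_eq0 gt_eqF ?etaP//= sqrf_eq0 subr_eq0 => /eqP//.
have ka : k a = c by apply: kc; rewrite /A /B; apply/andP; split; lra.
have kb : k b = c by apply: kc; rewrite /A /B; apply/andP; split; lra.
by move: ka kb; rewrite /k => ka kb; lra.
Qed.

(** Lebesgue differentiation for the primitives based at - n, followed by a countable intersection
    over n. *)
Lemma acon_ae_derive f g : measurable_fun setT g -> acon setT f g ->
  {ae mu, forall x, is_derive x (1 : R) f (g x)}.
Proof.
move=> mg H; have gi a b : integ `[a, b] g.
  have [ab|ba] := leP a b; first by have [] := H a b ab (@subsetT _ _).
  by rewrite set_itv_ge ?bnd_simp -?ltNge//; exact: integrable_set0.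
have lg : locally_integrable setT g.
  split=> //; first exact: openT.
  move=> K _ cK; have [N [Nr HN]] := compact_bounded cK.
  have KN : K `<=` `[- (`|N| + 1), `|N| + 1].
    move=> x Kx /=; rewrite in_itv/= -ler_norml; apply: HN Kx; have := ler_norm N; lra.
  have /integrableP[_] : integ K g.
    have mK : measurable (K : set (measurableTypeR R)) by exact: compact_measurable.
    by apply: integrableS (gi (- (`|N| + 1)) (`|N| + 1)).
  by [].
have : {ae mu, forall x, forall n : nat, - n%:R < x -> is_derive x (1 : R) f (g x)}.
  apply: ae_foralln => n; have := FTC1 (fun y => gi (- n%:R) y) lg.
  apply: ae_mono => x Hx nx; have [] := Hx; first by rewrite lte_fin.
  rewrite derive1E => d1 d2.
  have /is_derive_epsP Dx : is_derive x (1 : R)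
     (fun x => \int[mu]_(t in `[- n%:R, x]) g t) (g x) by split.
  apply/is_derive_epsP => e e0; have [d d0 K] := Dx e e0.
  exists (Num.min d (x + n%:R)); first by rewrite lt_min d0; lra.
  move=> y; rewrite lt_min => /andP[yd yx].
  have ny : - n%:R <= y by move: yx; rewrite ltr_norml => /andP[]; lra.
  have [_ Ex] := H _ _ (ltW nx) (@subsetT _ _).
  have [_ Ey] := H _ _ ny (@subsetT _ _).
  by have := K y yd; rewrite -Ex -Ey opprB addrA subrK.
apply: ae_mono => x Hx; apply: (Hx (Num.truncn `|x|).+1).
have := truncnS_gt `|x|; have := ler_norm (- x); rewrite normrN; lra.
Qed.

End WeakDerivative.

(** * Rays: decay at infinity, boundary terms, the sup bound *)

Section HalfLine.
Variable R : realType.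
Notation mu := (@lebesgue_measure R).
Local Notation integ D f := (mu.-integrable D (EFin \o f)).
Implicit Types (f g h F G phi : R -> R) (a b x : R) (A : set R).

(** Average [|F x|] <= [|F y|] plus the integral of [|G|] over y in the unit segment. Both the decay
    at infinity and the embedding of H^1 into bounded functions come from this. *)
Lemma acon_avg A F G x : acon A F G -> `[x, x + 1] `<=` A ->
  `|F x| <= \int[mu]_(y in `[x, x + 1]) (`|F y| + `|G y|).
Proof.
move=> H xA; have xx1 : x <= x + 1 by rewrite lerDl.
have [gi _] := H _ _ xx1 xA.
have Fi : integ `[x, x + 1] F.
  apply: continuous_compact_integrable; first exact: segment_compact.
  exact: acon_within H xA.
have nFi := integ_norm (measurable_itv _) Fi.
have nGi := integ_norm (measurable_itv _) gi.
rewrite RintegralD//; set J := (X in _ <= _ + X).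
have E : `|F x| - J = \int[mu]_(y in `[x, x + 1]) (`|F x| - J).
  by rewrite Rint_cst_itv//; ring.
rewrite -lerBlDr E; apply: Rint_itv_le => //; first exact: integ_cst_itv.
move=> y /andP[xy yx].
have xyA : `[x, y] `<=` A by apply: subset_trans xA; exact: sub_itvcc.
have := acon_norm H xy xyA.
have : \int[mu]_(z in `[x, y]) `|G z| <= J.
  rewrite /J (Rint_split xy yx)// lerDl; exact: Rint_itv_ge0.
have := ler_normB (F y) (F y - F x); rewrite opprB addrCA subrr addr0; lra.
Qed.

Lemma Rint_cvg_sets (D : nat -> set (measurableTypeR R)) (E : set (measurableTypeR R)) G :
  measurable E -> (forall n, measurable (D n)) -> (forall n, D n `<=` E) ->
  (forall x, E x -> exists N, forall n, (N <= n)%N -> D n x) ->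
  integ E G ->
  \int[mu]_(x in D n) G x @[n --> \oo] --> \int[mu]_(x in E) G x.
Proof.
move=> mE mD DE Dx Gi.
have mG := measurable_int _ Gi.
have nGi : mu.-integrable E (fun x => `|(G x)%:E|%E) by exact: integrable_abse.
have mGn n : measurable_fun E ((EFin \o G) \_ (D n)).
  apply/measurable_restrict => //.
  by rewrite setIidr//; exact: measurable_funS mG.
have Cn : {ae mu, forall x, E x -> ((EFin \o G) \_ (D n)) x @[n --> \oo] --> (EFin \o G) x}.
  apply: aeW => x /Dx[N HN]; apply: cvg_near_cst.
  by exists N => // n /= /HN Dnx; rewrite patchT// inE.
have Bn : {ae mu, forall x n, E x -> (`|((EFin \o G) \_ (D n)) x| <= `|(G x)%:E|)%E}.
  apply: aeW => x n Ex; rewrite /patch; case: ifP => // _.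
  by rewrite -[point]/(0%E : \bar R) abse0 abse_ge0.
have [_ _ C] := dominated_convergence mE mGn mG Cn nGi Bn.
have Gf : (\int[mu]_(x in E) (EFin \o G) x)%E = (Rintegral mu E G)%:E.
  by rewrite /Rintegral fineK//; exact: integrable_fin_num.
rewrite Gf in C; have C2 := @fine_cvg _ _ _ _ _ _ C.
apply: cvg_trans (C2 eventually_filter); apply: near_eq_cvg; apply: nearW => n.
by rewrite /= /Rintegral -integral_mkcondr setIidr.
Qed.

Lemma Rint_cvg_ray G a : integ `[a, +oo[ G ->
  \int[mu]_(x in `[a, a + n%:R]) G x @[n --> \oo] --> \int[mu]_(x in `[a, +oo[) G x.
Proof.
apply: Rint_cvg_sets => //.
  by move=> n x /=; rewrite !in_itv/= andbT => /andP[].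
move=> x /=; rewrite in_itv/= andbT => ax.
exists (Num.truncn `|x - a|).+1 => n Nn; rewrite /= in_itv/= ax /= -lerBlDl.
rewrite (le_trans (ler_norm _))// (le_trans (ltW (truncnS_gt _)))//.
by rewrite ler_nat.
Qed.

Lemma sub_ray a b c : a <= b -> `[b, c]%classic `<=` `[a, +oo[%classic.
Proof.
by move=> ab x /=; rewrite !in_itv/= andbT => /andP[bx _]; exact: le_trans bx.
Qed.

(** The unit-window integrals that control F (a + n) are successive differences of a convergent
    sequence. *)
Lemma ray_vanish F G a : acon `[a, +oo[ F G ->
  integ `[a, +oo[ F -> integ `[a, +oo[ G -> F (a + n%:R) @[n --> \oo] --> (0 : R).
Proof.
move=> H Fi Gi.
have Si : integ `[a, +oo[ (fun x => `|F x| + `|G x|).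
  by apply: integD => //; exact: integ_norm.
have S := Rint_cvg_ray Si.
pose u n := \int[mu]_(y in `[a, a + n%:R]) (`|F y| + `|G y|).
have E n : \int[mu]_(y in `[a + n%:R, a + n%:R + 1]) (`|F y| + `|G y|) = u n.+1 - u n.
  rewrite /u (@Rint_split _ _ a (a + n%:R) (a + n.+1%:R)).
  - by rewrite [RHS]addrC addKr -natr1 addrA.
  - by rewrite lerDl.
  - by rewrite lerD2l ler_nat.
  - by apply: integrableS Si => //; exact: sub_ray.
have : u n.+1 - u n @[n --> \oo] --> (0 : R).
  by rewrite -[0](subrr (\int[mu]_(x in `[a, +oo[) (`|F x| + `|G x|))); apply: cvgB => //; rewrite cvg_shiftS.
move=> S0; apply/cvgr0Pnorm_lt => e e0.
move/cvgr0Pnorm_lt : S0 => /(_ e e0); apply: filterS => n.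
apply: le_lt_trans; apply: le_trans (ler_norm _); rewrite -E.
by apply: acon_avg H _; apply: sub_ray; rewrite lerDl.
Unshelve. all: by end_near. Qed.

Lemma acon_Rint_ray F G a : acon `[a, +oo[ F G ->
  integ `[a, +oo[ F -> integ `[a, +oo[ G -> \int[mu]_(x in `[a, +oo[) G x = - F a.
Proof.
move=> H Fi Gi.
have E n : F (a + n%:R) - F a = \int[mu]_(x in `[a, a + n%:R]) G x.
  by have [||_ E] := H a (a + n%:R); [rewrite lerDl|exact: sub_ray|].
have C1 := Rint_cvg_ray Gi.
have C2 : F (a + n%:R) - F a @[n --> \oo] --> (0 - F a : R).
  by apply: cvgB; [exact: ray_vanish H Fi Gi|exact: cvg_cst].
rewrite sub0r in C2.
apply: (cvg_unique (@Rhausdorff R) C1); apply: cvg_trans C2.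
by apply: near_eq_cvg; apply: nearW => n; rewrite E.
Qed.

Lemma integ_patch (D : set (measurableTypeR R)) g : measurable D -> integ D g ->
  measurable_fun setT (g \_ D) /\ integ setT (g \_ D).
Proof.
move=> mD gi; split; first by apply/(measurable_restrictT _ _).1 => //; exact: integ_meas gi.
by rewrite -restrict_EFin; exact/(integrable_mkcond _ mD).1.
Qed.

Lemma ray_opp g : integ `]-oo, 0] g -> integ `[0, +oo[ (fun x => g (- x)) /\
  \int[mu]_(x in `[0, +oo[) g (- x) = \int[mu]_(x in `]-oo, 0]) g x.
Proof.
move=> gi; have [mh hi] := integ_patch (measurable_itv _) gi.
set h := g \_ _ in mh hi.
have E : (h \o -%R) = (fun x => g (- x)) \_ `[0, +oo[.
  apply/funext => x; rewrite /h /comp /patch !mem_setE/= !in_itv/= andbT.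
  by rewrite oppr_le0.
have hoi := isom_integ (@isom_opp R) mh hi.
split.
  by apply/(integrable_mkcond _ _).2 => //; rewrite restrict_EFin -E.
rewrite Rintegral_mkcond [RHS]Rintegral_mkcond -/h -(isom_Rint (@isom_opp R) mh hi).
by congr (Rintegral _ _ _); rewrite -E.
Qed.

Lemma Rint_setT_split g : integ setT g ->
  \int[mu]_x g x = \int[mu]_(x in `]-oo, 0]) g x + \int[mu]_(x in `[0, +oo[) g x.
Proof.
move=> gi; have := @Rintegral_itvB _ g -oo%O +oo%O 0.
rewrite set_itvNyy => /(_ gi); rewrite !bnd_simp => /(_ isT isT).
rewrite Rintegral_itv_obnd_cbnd; last exact: integT.
by move=> /eqP; rewrite subr_eq addrC => /eqP.
Qed.

Lemma acon_RintT F G : acon setT F G -> integ setT F -> integ setT G ->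
  \int[mu]_x G x = 0.
Proof.
move=> H Fi Gi; rewrite Rint_setT_split//.
have iT g (gi : integ setT g) (i : interval R) : integ [set` i] g by exact: integT.
have -> : \int[mu]_(x in `[0, +oo[) G x = - F 0.
  apply: acon_Rint_ray; [exact: acon_sub H|exact: iT|exact: iT].
have [Fo _] := ray_opp (iT _ Fi `]-oo, 0]).
have [Go <-] := ray_opp (iT _ Gi `]-oo, 0]).
have nG : integ `[0, +oo[ (fun x => - G (- x)).
  by have := integZ (-1) (measurable_itv _) Go; apply: eq_integrable => // x _ /=; rewrite mulN1r.
have Ho : acon `[0, +oo[ (fun x => F (- x)) (fun x => - G (- x)).
  by apply: acon_sub (acon_opp H).
have := acon_Rint_ray Ho Fo nG; rewrite oppr0.
under eq_Rintegral do rewrite -mulN1r.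
by rewrite RintegralZl//; lra.
Qed.

Lemma Rint_even g : integ setT g -> (forall x, g (- x) = g x) ->
  \int[mu]_x g x = 2 * \int[mu]_(x in `[0, +oo[) g x.
Proof.
move=> gi ge; rewrite Rint_setT_split//.
have [_ <-] := ray_opp (integT (measurable_itv `]-oo, 0]) gi).
by under eq_Rintegral do rewrite ge; lra.
Qed.

(** [acon_avg] for f^2, whose derivative 2 f g is absorbed by f^2 + g^2. *)
Lemma acon_sup f g x : acon setT f g -> sqint f -> sqint g ->
  f x ^+ 2 <= 2 * (ip f f + ip g g).
Proof.
move=> H sf sg; have := acon_avg (aconM H H) (@subsetT _ `[x, x + 1]%classic).
have [ff gg] : integ setT (fun x => f x * f x) /\ integ setT (fun x => g x * g x).
  by split; exact: sqint_mul.
have fg : integ setT (fun y => f y * g y + f y * g y).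
  by apply: integD => //; exact: sqint_mul.
have i D : measurable D -> integ D (fun y => 2 * (f y * f y + g y * g y)).
  by move=> mD; apply: integZ => //; apply: integD => //; exact: integT.
move=> K; rewrite expr2 (le_trans (ler_norm _))// (le_trans K)//.
rewrite !ipE -RintegralD// -RintegralZl//; last exact: integD.
apply: (@le_trans _ _ (\int[mu]_(y in `[x, x + 1]) (2 * (f y * f y + g y * g y)))).
  apply: Rint_itv_le; [|exact: i|].
    by apply: integD => //; apply: integ_norm => //; exact: integT.
  move=> y _; rewrite ger0_norm -?expr2 ?sqr_ge0//.
  have -> : f y * g y + f y * g y = 2 * (f y * g y) by ring.
  rewrite normrM ger0_norm//.
  have : `|f y * g y| <= (f y ^+ 2 + g y ^+ 2) / 2.
    rewrite ler_norml; have := sqr_ge0 (f y - g y); have := sqr_ge0 (f y + g y); nra.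
  by have := sqr_ge0 (f y); have := sqr_ge0 (g y); lra.
rewrite [leLHS]Rintegral_mkcond; apply: le_Rintegral => //.
- by rewrite -restrict_EFin; apply/(integrable_mkcond _ _).1 => //; exact: i.
- exact: i.
- move=> y _; rewrite /patch; case: ifP => // _.
  by rewrite mulr_ge0// addr_ge0// -expr2 sqr_ge0.
Qed.

End HalfLine.

(** * The space H^1 *)

(** A locked copy of [wder], so that the choice behind it is never unfolded; its properties come
    from [wderP]. *)
HB.lock Definition wd {R : realType} (f : R -> R) : R -> R := wder f.

Section SobolevLine.
Variable R : realType.
Implicit Types (f g h : R -> R) (a b x : R) (A : set R).

Lemma wderP f : realH1 f -> sqint (wd f) /\ weak_deriv setT f (wd f).
Proof.
by rewrite wd.unlock; move=> [_ _ [g sg wg]]; exact: (@getPex _ [set g | sqint g /\ weak_deriv setT f g] (ex_intro _ g (conj sg wg))).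
Qed.

Lemma ip_bound_mul f g (k : R) : measurable_fun setT f -> (forall x, f x ^+ 2 <= k) -> sqint g ->
  sqint (fun x => f x * g x) /\
  ip (fun x => f x * g x) (fun x => f x * g x) <= k * ip g g.
Proof.
move=> mf fk sg; have [mg _] := sg.
have k0 : 0 <= k := le_trans (sqr_ge0 _) (fk 0).
have fk' x : `|f x| <= Num.sqrt k by rewrite -sqrtr_sqr ler_wsqrtr.
have s := sqintMb mf fk' sg; split=> //.
rewrite !ipE -RintegralZl//; last exact: sqint_mul.
apply: le_Rintegral => //; [exact: sqint_mul|by apply: integZ => //; exact: sqint_mul|].
by move=> x _; rewrite mulrACA -!expr2 ler_wpM2r ?sqr_ge0.
Qed.

End SobolevLine.

Section SobolevSpace.
Variable R : realType.
Notation mu := (@lebesgue_measure R).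
Implicit Types (f g h : R -> R) (a b x : R) (A : set R).

Lemma realH1_sq f : realH1 f -> sqint f. Proof. by case. Qed.

Lemma wder_sq f : realH1 f -> sqint (wd f).
Proof. by move/wderP => []. Qed.

Lemma realH1_cont f : realH1 f -> continuous f. Proof. by case. Qed.

Lemma realH1_acon f : realH1 f -> acon setT f (wd f).
Proof.
move=> Hf; have [sw ww] := wderP Hf.
by apply: weak_acon => //; [case: Hf|move=> a b; exact: sqint_itv].
Qed.

Lemma realH1I f g : acon setT f g -> sqint f -> sqint g -> realH1 f.
Proof.
move=> H sf sg; split=> //; first exact: acon_continuous H.
by exists g => //; exact: acon_weak.
Qed.

Lemma is_derive_unique f x (l m : R) : is_derive x (1 : R) f l ->
  is_derive x (1 : R) f m -> l = m.
Proof. by move=> [_ <-] [_ <-]. Qed.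

Lemma acon_ae_unique f g h : acon setT f g -> acon setT f h ->
  sqint g -> sqint h -> {ae mu, forall x, g x = h x}.
Proof.
move=> Hg Hh [mg _] [mh _].
have := ae_and (acon_ae_derive mg Hg) (acon_ae_derive mh Hh).
by apply: ae_mono => x [d1 d2]; exact: is_derive_unique d1 d2.
Qed.

(** This is how [wd] is computed: the chosen derivative and g both agree almost everywhere with the
    classical derivative of f, so every pairing sees the same function. *)
Lemma ip_wder f g h : acon setT f g -> sqint f -> sqint g -> sqint h ->
  ip (wd f) h = ip g h.
Proof.
move=> H sf sg sh; have Hf := realH1I H sf sg; have sw := wder_sq Hf.
by apply: ip_ae => //; exact: acon_ae_unique (realH1_acon Hf) H _ _.
Qed.

Lemma realH1D f g : realH1 f -> realH1 g -> realH1 (fun x => f x + g x).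
Proof.
move=> Hf Hg; apply: (realH1I (aconD (realH1_acon Hf) (realH1_acon Hg))).
  by apply: sqintD; exact: realH1_sq.
by apply: sqintD; exact: wder_sq.
Qed.

Lemma realH1Z (k : R) f : realH1 f -> realH1 (fun x => k * f x).
Proof.
move=> Hf; apply: (realH1I (aconZ k (realH1_acon Hf))).
  by apply: sqintZ; exact: realH1_sq.
by apply: sqintZ; exact: wder_sq.
Qed.

Lemma realH1N f : realH1 f -> realH1 (fun x => - f x).
Proof.
move=> /(realH1Z (-1)); congr realH1; apply/funext => x; exact: mulN1r.
Qed.

Lemma realH1B f g : realH1 f -> realH1 g -> realH1 (fun x => f x - g x).
Proof. by move=> Hf Hg; apply: realH1D => //; exact: realH1N. Qed.

Lemma realH1_0 : realH1 (fun=> 0 : R).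
Proof. by apply: (realH1I (@acon_cst _ _ _)); exact: sqint0. Qed.

End SobolevSpace.

HB.lock Definition hip {R : realType} (f g : R -> R) : R := ip f g + ip (wd f) (wd g).

HB.lock Definition n1 {R : realType} (f : R -> R) : R := Num.sqrt (hip f f).

Section SobolevNorm.
Variable R : realType.
Implicit Types (f g h : R -> R) (a b x : R) (A : set R).

Lemma hipE f g : hip f g = ip f g + ip (wd f) (wd g).
Proof. by rewrite hip.unlock. Qed.

Lemma n1E f : n1 f = Num.sqrt (hip f f). Proof. by rewrite n1.unlock. Qed.

Lemma hipC f g : hip f g = hip g f.
Proof. by rewrite !hipE ipC [ip (wd f) _]ipC. Qed.

Lemma ip_wderDl f g h : realH1 f -> realH1 g -> sqint h ->
  ip (wd (fun x => f x + g x)) h = ip (wd f) h + ip (wd g) h.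
Proof.
move=> Hf Hg sh.
have [sf sg] : sqint (wd f) /\ sqint (wd g) by split; exact: wder_sq.
rewrite (ip_wder (aconD (realH1_acon Hf) (realH1_acon Hg)))//.
- by rewrite ipDl.
- by apply: sqintD; exact: realH1_sq.
- exact: sqintD.
Qed.

Lemma ip_wderZl k f h : realH1 f -> sqint h ->
  ip (wd (fun x => k * f x)) h = k * ip (wd f) h.
Proof.
move=> Hf sh; have sf := wder_sq Hf.
rewrite (ip_wder (aconZ k (realH1_acon Hf)))//.
- by rewrite ipZl.
- by apply: sqintZ; exact: realH1_sq.
- exact: sqintZ.
Qed.

Lemma hipDl f g h : realH1 f -> realH1 g -> realH1 h ->
  hip (fun x => f x + g x) h = hip f h + hip g h.
Proof.
move=> Hf Hg Hh; rewrite !hipE ipDl ?ip_wderDl//; try exact: realH1_sq.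
  by ring.
exact: wder_sq.
Qed.

Lemma hipZl k f h : realH1 f -> realH1 h -> hip (fun x => k * f x) h = k * hip f h.
Proof.
move=> Hf Hh; rewrite !hipE ipZl ?ip_wderZl//; try exact: realH1_sq.
  by ring.
exact: wder_sq.
Qed.

Lemma hipDr f g h : realH1 f -> realH1 g -> realH1 h ->
  hip h (fun x => f x + g x) = hip h f + hip h g.
Proof. by move=> Hf Hg Hh; rewrite hipC hipDl// (hipC f) (hipC g). Qed.

Lemma hipZr k f h : realH1 f -> realH1 h -> hip h (fun x => k * f x) = k * hip h f.
Proof. by move=> Hf Hh; rewrite hipC hipZl// (hipC f). Qed.

Lemma hip_ge0 f : 0 <= hip f f.
Proof. by rewrite hipE addr_ge0// ip_ge0. Qed.

Lemma n1_ge0 f : 0 <= n1 f. Proof. by rewrite n1E sqrtr_ge0. Qed.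

Lemma sqr_n1 f : n1 f ^+ 2 = hip f f.
Proof. by rewrite n1E sqr_sqrtr// hip_ge0. Qed.

Lemma hip_CS f g : realH1 f -> realH1 g -> `|hip f g| <= n1 f * n1 g.
Proof.
move=> Hf Hg; rewrite !n1E; apply: quad_ge0_CS; first exact: hip_ge0.
move=> t; have Ht := realH1Z t Hg; have Hs := realH1D Hf Ht.
suff -> : hip f f + 2 * t * hip f g + t ^+ 2 * hip g g =
  hip (fun x => f x + t * g x) (fun x => f x + t * g x) by exact: hip_ge0.
by rewrite hipDl// !hipDr// !hipZl// !hipZr// (hipC g f); ring.
Qed.

Lemma n1D f g : realH1 f -> realH1 g -> n1 (fun x => f x + g x) <= n1 f + n1 g.
Proof.
move=> Hf Hg; have Hs := realH1D Hf Hg.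
rewrite -(ler_pXn2r (n := 2))//; last 2 first.
- by rewrite nnegrE n1_ge0.
- by rewrite nnegrE addr_ge0// n1_ge0.
rewrite sqr_n1 hipDl// !hipDr// (hipC g f) -!sqr_n1.
have H1 := hip_CS Hf Hg; have H2 := ler_norm (hip f g).
by move: (n1 f) (n1 g) (hip f g) H1 H2 => F G H H1 H2; nra.
Qed.

Lemma n1Z k f : realH1 f -> n1 (fun x => k * f x) = `|k| * n1 f.
Proof.
move=> Hf; have Hk := realH1Z k Hf.
rewrite !n1E hipZl// hipZr// mulrA -expr2 sqrtrM ?sqr_ge0//.
by rewrite sqrtr_sqr.
Qed.

Lemma n1N f : realH1 f -> n1 (fun x => - f x) = n1 f.
Proof.
move=> Hf; have := n1Z (-1) Hf; rewrite normrN normr1 mul1r => <-.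
by congr n1; apply/funext => x; rewrite mulN1r.
Qed.

Lemma n1B f g : realH1 f -> realH1 g -> n1 (fun x => f x - g x) <= n1 f + n1 g.
Proof. by move=> Hf Hg; rewrite -(n1N Hg); apply: n1D => //; exact: realH1N. Qed.

Lemma n1_0 : n1 (fun=> 0 : R) = 0.
Proof.
have <- : (fun x : R => 0 * (0 : R)) = (fun=> 0) by apply/funext => x; rewrite mul0r.
by rewrite (n1Z 0 (realH1_0 R)) normr0 mul0r.
Qed.

Lemma n1_le f c : 0 <= c -> hip f f <= c ^+ 2 -> n1 f <= c.
Proof.
by move=> c0 H; rewrite -(ler_pXn2r (n := 2)) ?nnegrE ?n1_ge0// sqr_n1.
Qed.

Lemma ip_le_n1 f : ip f f <= n1 f ^+ 2.
Proof. by rewrite sqr_n1 hipE lerDl ip_ge0. Qed.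

Lemma ipw_le_n1 f : ip (wd f) (wd f) <= n1 f ^+ 2.
Proof. by rewrite sqr_n1 hipE lerDr ip_ge0. Qed.

Lemma CS_n1 (A B C : R) f g : `|C| <= Num.sqrt A * Num.sqrt B ->
  A <= n1 f ^+ 2 -> B <= n1 g ^+ 2 -> `|C| <= n1 f * n1 g.
Proof.
move=> CAB Af Bg; apply: (le_trans CAB); apply: ler_pM; rewrite ?sqrtr_ge0//.
  by rewrite -[leRHS]ger0_norm ?n1_ge0// -sqrtr_sqr ler_wsqrtr.
by rewrite -[leRHS]ger0_norm ?n1_ge0// -sqrtr_sqr ler_wsqrtr.
Qed.

Lemma ip_n1 f g : realH1 f -> realH1 g -> `|ip f g| <= n1 f * n1 g.
Proof.
move=> Hf Hg; apply: CS_n1 (ip_le_n1 f) (ip_le_n1 g).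
by apply: ip_CS; exact: realH1_sq.
Qed.

Lemma ipw_n1 f g : realH1 f -> realH1 g -> `|ip (wd f) (wd g)| <= n1 f * n1 g.
Proof.
move=> Hf Hg; apply: CS_n1 (ipw_le_n1 f) (ipw_le_n1 g).
by apply: ip_CS; exact: wder_sq.
Qed.

Lemma sup_n1_sqr f x : realH1 f -> f x ^+ 2 <= 2 * n1 f ^+ 2.
Proof.
move=> Hf; rewrite sqr_n1 hipE; apply: acon_sup; first exact: realH1_acon.
  exact: realH1_sq.
exact: wder_sq.
Qed.

Lemma sup_n1 f x : realH1 f -> `|f x| <= 2 * n1 f.
Proof.
move=> Hf; have := sup_n1_sqr x Hf; have n0 := n1_ge0 f.
rewrite -(real_normK (num_real (f x))) => H.
rewrite -(ler_pXn2r (n := 2)) ?nnegrE ?mulr_ge0//; have := sqr_ge0 (n1 f); nra.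
Qed.

Lemma measM f g : measurable_fun setT f -> measurable_fun setT g ->
  measurable_fun setT (fun x => f x * g x).
Proof. exact: measurable_funM. Qed.

Lemma ip_sqD f g : sqint f -> sqint g ->
  ip (fun x => f x + g x) (fun x => f x + g x) <= 2 * (ip f f + ip g g).
Proof.
move=> sf sg; rewrite ipDl ?ipDr ?(ipC g f)//; try exact: sqintD.
have := ip_ge0 (fun x => f x - g x).
rewrite ipBl ?ipBr ?(ipC g f)//; try exact: sqintB.
lra.
Qed.

Lemma realH1M f g : realH1 f -> realH1 g -> realH1 (fun x => f x * g x).
Proof.
move=> Hf Hg.
have cm h : realH1 h -> measurable_fun setT h by move=> /realH1_sq[].
have b h : realH1 h -> forall x, h x ^+ 2 <= 2 * n1 h ^+ 2 by move=> Hh x; exact: sup_n1_sqr.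
apply: (realH1I (aconM (realH1_acon Hf) (realH1_acon Hg))).
  by have [] := ip_bound_mul (cm _ Hf) (b _ Hf) (realH1_sq Hg).
by apply: sqintD; [have [] := ip_bound_mul (cm _ Hf) (b _ Hf) (wder_sq Hg)|have [] := ip_bound_mul (cm _ Hg) (b _ Hg) (wder_sq Hf)].
Qed.

(** H^1 is an algebra in one dimension. Writing F and G for the squared norms, the sup bound f^2 <=
    2 F estimates the product by 2 F [ip g g] and its derivative by 4 F [ip g' g'] + 4 G [ip f' f'];
    the total is at most 8 F G, below 9 F G. *)
Lemma n1M f g : realH1 f -> realH1 g -> n1 (fun x => f x * g x) <= 3 * (n1 f * n1 g).
Proof.
move=> Hf Hg; have Hfg := realH1M Hf Hg.
have cm h : realH1 h -> measurable_fun setT h by move=> /realH1_sq[].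
have b h : realH1 h -> forall x, h x ^+ 2 <= 2 * n1 h ^+ 2 by move=> Hh x; exact: sup_n1_sqr.
have [s1 B1] := ip_bound_mul (cm _ Hf) (b _ Hf) (realH1_sq Hg).
have [s2 B2] := ip_bound_mul (cm _ Hf) (b _ Hf) (wder_sq Hg).
have [s3 B3] := ip_bound_mul (cm _ Hg) (b _ Hg) (wder_sq Hf).
have n0 := mulr_ge0 (n1_ge0 f) (n1_ge0 g).
apply: n1_le; first by rewrite mulr_ge0.
have s23 := sqintD s2 s3.
have H := aconM (realH1_acon Hf) (realH1_acon Hg).
rewrite hipE (ip_wder H)//; last exact: wder_sq.
rewrite [X in _ + X]ipC (ip_wder H)//.
have := ip_sqD s2 s3.
have E h : n1 h ^+ 2 = ip h h + ip (wd h) (wd h) by rewrite sqr_n1 hipE.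
have p1 := ip_ge0 f; have p2 := ip_ge0 (wd f).
have p3 := ip_ge0 g; have p4 := ip_ge0 (wd g).
have := E f; have := E g; move: (n1 f ^+ 2) (n1 g ^+ 2) B1 B2 B3 => F G B1 B2 B3 EG EF K.
have -> : (3 * (n1 f * n1 g)) ^+ 2 = 9 * (n1 f ^+ 2 * n1 g ^+ 2) by ring.
have -> : n1 f ^+ 2 = F by rewrite E EF.
have -> : n1 g ^+ 2 = G by rewrite E EG.
have : F * ip g g <= F * G by rewrite ler_wpM2l//; lra.
have : G * ip (wd f) (wd f) <= G * F by rewrite ler_wpM2l//; lra.
have : F * ip (wd g) (wd g) + F * ip g g = F * G by rewrite EG; ring.
have : 0 <= F * G by rewrite mulr_ge0//; lra.
have : 0 <= F * ip g g by rewrite mulr_ge0//; lra.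
lra.
Qed.

Lemma realH1_opp f : realH1 f -> realH1 (fun x => f (- x)).
Proof.
move=> Hf; apply: (realH1I (g := fun x => - wd f (- x))).
- by have := acon_opp (realH1_acon Hf); apply: acon_sub.
- exact: (sqint_isom (@isom_opp R) (realH1_sq Hf)).
- by apply: sqintN; exact: (sqint_isom (@isom_opp R) (wder_sq Hf)).
Qed.

Lemma ip_opp f g : sqint f -> sqint g ->
  ip (fun x => f (- x)) (fun x => g (- x)) = ip f g.
Proof. exact: (ip_isom (@isom_opp R)). Qed.

Lemma ipw_opp f g : realH1 f -> realH1 g ->
  ip (wd (fun x => f (- x))) (wd (fun x => g (- x))) = ip (wd f) (wd g).
Proof.
move=> Hf Hg.
have sf := sqint_isom (@isom_opp R) (wder_sq Hf).
have sg := sqint_isom (@isom_opp R) (wder_sq Hg).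
have H h : realH1 h -> acon setT (fun x => h (- x)) (fun x => - wd h (- x)).
  by move=> Hh; have := acon_opp (realH1_acon Hh); apply: acon_sub.
have rf := realH1_sq (realH1_opp Hf); have rg := realH1_sq (realH1_opp Hg).
rewrite (ip_wder (H f Hf))//; [|exact: sqintN|exact: wder_sq (realH1_opp Hg)].
rewrite ipC (ip_wder (H g Hg))//; [|exact: sqintN|exact: sqintN].
rewrite ipNl//; last exact: sqintN.
rewrite ipC ipNl// opprK; exact: ip_opp (wder_sq Hf) (wder_sq Hg).
Qed.

Lemma n1_opp f : realH1 f -> n1 (fun x => f (- x)) = n1 f.
Proof.
move=> Hf; rewrite !n1E !hipE ipw_opp// ip_opp//; exact: realH1_sq.
Qed.

Lemma n1_eq0 f : realH1 f -> n1 f = 0 -> forall x, f x = 0.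
Proof.
by move=> Hf f0 x; have := sup_n1 x Hf; rewrite f0 mulr0 normr_le0 => /eqP.
Qed.

End SobolevNorm.

(** * The energy identity *)

Section RealAnalysis.
Variable R : realType.
Implicit Types (f g df : R -> R) (a b n m p : R -> R -> R).

Lemma is_derive_continuous f x l : is_derive x (1 : R) f l -> {for x, continuous f}.
Proof. by move=> [d _]; exact/differentiable_continuous/derivable1_diffP. Qed.

Lemma mvt f df (x y : R) :
  (forall z, Num.min x y <= z <= Num.max x y -> is_derive z (1 : R) f (df z)) ->
  exists2 z, Num.min x y <= z <= Num.max x y & f y - f x = df z * (y - x).
Proof.
wlog xy : x y / x <= y.
  move=> W; case/orP: (le_total x y) => [xy|yx]; first exact: W.
  rewrite minC maxC => /(W _ _ yx)[z zi E]; exists z => //.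
  by rewrite -opprB E; ring.
rewrite min_l// max_r// => H.
have [||z] := @MVT_segment R f df x y xy.
- by move=> z /[!in_itv]/= /andP[/ltW xz /ltW zy]; apply: H; rewrite xz.
- apply: derivable_within_continuous => z /[!in_itv]/= zi.
  by case: (H z zi).
- by rewrite in_itv/= => zi E; exists z.
Qed.

Definition cont2 (a0 b0 : R) a := forall t s, a0 < t < b0 -> a0 < s < b0 ->
  forall e, 0 < e -> exists2 d, 0 < d & forall t' s',
    `|t' - t| < d -> `|s' - s| < d -> `|a t' s' - a t s| < e.

Lemma is_derive_addr (x d : R) : is_derive x (1 : R) (fun x => x + d) (1 : R).
Proof.
apply/is_derive_epsP => e e0; exists 1 => // y _.
have -> : y + d - (x + d) - 1 * (y - x) = 0 by ring.
by rewrite normr0 mulr_ge0// ltW.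
Qed.

(** Chain rule along t -> (t + d, t) without total differentiability: the mean value theorem is
    applied in the first variable, where the partial derivative is continuous, while the second
    variable needs its derivative at the base point alone. *)
Lemma derive_diag a p q (d t : R) : 
  (exists2 r, 0 < r & forall t' s, `|t' - (t + d)| < r -> `|s - t| < r ->
     is_derive t' (1 : R) (a^~ s) (p t' s)) ->
  (forall e, 0 < e -> exists2 r, 0 < r & forall t' s,
     `|t' - (t + d)| < r -> `|s - t| < r -> `|p t' s - p (t + d) t| < e) ->
  is_derive t (1 : R) (a (t + d)) q ->
  is_derive t (1 : R) (fun t => a (t + d) t) (p (t + d) t + q).
Proof.
move=> [r r0 da] cp /is_derive_epsP dq; apply/is_derive_epsP => e e0.
have e20 : 0 < e / 2 by rewrite divr_gt0.
have [r1 r10 Hp] := cp _ e20; have [r2 r20 Hq] := dq _ e20.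
exists (Num.min r (Num.min r1 r2)); first by rewrite !lt_min r0 r10.
move=> y; rewrite !lt_min => /and3P[yr yr1 yr2].
have btw z : Num.min (t + d) (y + d) <= z <= Num.max (t + d) (y + d) ->
    `|z - (t + d)| <= `|y - t|.
  have -> : y - t = (y + d) - (t + d) by ring.
  case/orP: (le_total (t + d) (y + d)) => h; rewrite ?(min_l h) ?(max_r h) ?(min_r h) ?(max_l h) => /andP[h1 h2].
    by rewrite !ger0_norm ?subr_ge0// lerD2r.
  by rewrite !ler0_norm ?subr_le0// lerN2 lerD2r.
have [z zi E] := @mvt (a^~ y) (p^~ y) (t + d) (y + d)
  (fun z zi => da z y (le_lt_trans (btw z zi) yr) yr).
have Hz := Hp z y (le_lt_trans (btw z zi) yr1) yr1.
have Hy := Hq y yr2.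
rewrite /= in E; rewrite /= [X in `|X| <= _](_ : _ = (p z y - p (t + d) t) * (y - t) + (a (t + d) y - a (t + d) t - q * (y - t))); last first.
  have -> : a (y + d) y = a (t + d) y + p z y * (y + d - (t + d)).
    by rewrite -E; ring.
  by ring.
apply: (le_trans (ler_normD _ _)); rewrite normrM.
have : `|p z y - p (t + d) t| * `|y - t| <= e / 2 * `|y - t| by rewrite ler_wpM2r// ltW.
lra.
Qed.

(** Extends a function that is continuous on a segment to the whole line, where it has a
    primitive. *)
Definition clamp (lo hi x : R) := Num.max lo (Num.min hi x).

Lemma clamp_id lo hi x : lo <= x <= hi -> clamp lo hi x = x.
Proof. by move=> /andP[lx xh]; rewrite /clamp min_r// max_r. Qed.

Lemma clamp_itv lo hi x : lo <= hi -> lo <= clamp lo hi x <= hi.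
Proof. by move=> lh; rewrite /clamp le_max lexx/= ge_max lh ge_min lexx. Qed.

Lemma clamp_lip lo hi x y : lo <= hi -> `|clamp lo hi x - clamp lo hi y| <= `|x - y|.
Proof.
move=> lh; wlog xy : x y / x <= y.
  by case/orP: (le_total x y) => h W; [exact: W|rewrite distrC (distrC x); exact: W].
have mono : clamp lo hi x <= clamp lo hi y.
  by rewrite /clamp ge_max !le_max lexx/= le_min !ge_min lexx xy !orbT.
rewrite !ler0_norm ?subr_le0// !opprB /clamp.
case: (leP hi y) => h1; case: (leP hi x) => h2; rewrite /Num.max; do ?case: ifP => ?; lra.
Qed.

Lemma is_derive_le_incr f df (x y l c : R) :
  (forall z, Num.min x y <= z <= Num.max x y -> is_derive z (1 : R) f (df z)) ->
  (forall z, Num.min x y <= z <= Num.max x y -> `|df z - l| <= c) ->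
  `|f y - f x - l * (y - x)| <= c * `|y - x|.
Proof.
move=> H K; have [z zi ->] := mvt H.
by rewrite -mulrBl normrM ler_wpM2r// K.
Qed.

Lemma minmax_dist (x y z c r : R) : `|x - c| < r -> `|y - c| < r ->
  Num.min x y <= z <= Num.max x y -> `|z - c| < r.
Proof.
rewrite !ltr_norml => /andP[x1 x2] /andP[y1 y2]; rewrite ge_min le_max.
by move=> /andP[/orP[] ? /orP[] ?]; apply/andP; split; lra.
Qed.

Section Diagonal.
Variables (a b n m : R -> R -> R) (a0 b0 : R).
Hypothesis aN : forall t s, a t s = - a s t.
Hypothesis bC : forall t s, a0 < t < b0 -> a0 < s < b0 -> b t s = b s t.
Hypothesis da : forall t s, a0 < t < b0 -> a0 < s < b0 ->
  is_derive t (1 : R) (a^~ s) (b t s + n t s).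
Hypothesis dn : forall t s, a0 < t < b0 -> a0 < s < b0 ->
  is_derive s (1 : R) (n t) (m t s).
Hypotheses (cb : cont2 a0 b0 b) (cn : cont2 a0 b0 n) (cm : cont2 a0 b0 m).

(** This primitive, once subtracted, removes from a (x + d) x the part due to n, which is of the
    same order d as b. *)
Let primitive d lo hi : a0 < lo - d -> 0 <= d -> lo <= hi -> hi < b0 ->
  exists P, forall x, lo <= x <= hi -> is_derive x (1 : R) P (n x (x - d)).
Proof.
move=> alo d0 lohi hib; pose nn x := n (clamp lo hi x) (clamp lo hi x - d).
have cnn : continuous nn.
  move=> x; apply/cvgrPdist_lt => z z0.
  have /andP[c1 c2] := clamp_itv x lohi.
  have [||w w0 Hw] := cn (t := clamp lo hi x) (s := clamp lo hi x - d) _ _ z0.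
  - by apply/andP; split; lra.
  - by apply/andP; split; lra.
  apply/nbhs_ballP; exists w => // y; rewrite /ball/= distrC => xy.
  rewrite distrC; have cl := clamp_lip y x lohi.
  apply: Hw; first exact: le_lt_trans xy.
  by rewrite opprB addrA subrK; exact: le_lt_trans xy.
have [P [_ dP]] := continuous_primitive cnn.
by exists P => x xlh; have := dP x; rewrite /nn clamp_id.
Qed.

(** The symmetry of b makes its two contributions cancel along the shifted diagonal, so that b need
    not be differentiable. *)
Let shifted d x : 0 < d -> a0 < x -> x + d < b0 ->
  is_derive x (1 : R) (fun x => a (x + d) x) (n (x + d) x - n x (x + d)).
Proof.
move=> d0 ax xb.
have xab : a0 < x < b0 by apply/andP; split; lra.
have xdab : a0 < x + d < b0 by apply/andP; split; lra.
have -> : n (x + d) x - n x (x + d) =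
    (b (x + d) x + n (x + d) x) + - (b x (x + d) + n x (x + d)).
  by rewrite (bC xab xdab); ring.
apply: (@derive_diag a (fun t s => b t s + n t s)).
- exists (Num.min (x - a0) (b0 - (x + d))); first by rewrite lt_min !subr_gt0 ax.
  move=> t' s; rewrite !lt_min !ltr_norml => /andP[/andP[h1 h2] /andP[h3 h4]].
  move=> /andP[/andP[h5 h6] /andP[h7 h8]].
  by apply: da; apply/andP; split; lra.
- move=> z z0; have z2 : 0 < z / 2 by rewrite divr_gt0.
  have [w1 w10 W1] := cb xdab xab z2; have [w2 w20 W2] := cn xdab xab z2.
  exists (Num.min w1 w2); first by rewrite lt_min w10.
  move=> t' s; rewrite !lt_min => /andP[t1 t2] /andP[s1 s2].
  rewrite (_ : _ - _ = (b t' s - b (x + d) x) + (n t' s - n (x + d) x)); last by ring.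
  apply: (le_lt_trans (ler_normD _ _)).
  have := W1 _ _ t1 s1; have := W2 _ _ t2 s2; lra.
- have -> : a (x + d) = (fun s => - (a^~ (x + d) s)) by apply/funext => s; exact: aN.
  exact: is_deriveN (da xab xdab).
Qed.

(** The derivative found here is - 2 d m(x, x) to first order in d, because m is the derivative of n
    in its second variable. *)
Let increment d lo hi P x : 0 < d -> a0 < lo -> hi < b0 ->
  (forall x, lo <= x <= hi -> is_derive x (1 : R) P (n x (x - d))) ->
  lo <= x -> x + d <= hi ->
  is_derive x (1 : R) (fun x => a (x + d) x - (P (x + d) - P x))
    (n x (x - d) - n x (x + d)).
Proof.
move=> d0 alo hib dP lx xh.
have dA := @shifted d x d0 (lt_le_trans alo lx) (le_lt_trans xh hib).
have dPx := dP x; have dPd := dP (x + d); rewrite addrK in dPd.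
have xlh : lo <= x <= hi by apply/andP; split; lra.
have xdlh : lo <= x + d <= hi by apply/andP; split; lra.
have dPs : is_derive x (1 : R) (fun x => P (x + d)) (n (x + d) x).
  have := @is_derive1_comp _ P (fun x => x + d) x (n (x + d) x) 1 (dPd xdlh).
  by rewrite mulr1; apply; exact: is_derive_addr.
have -> : n x (x - d) - n x (x + d) =
    (n (x + d) x - n x (x + d)) - (n (x + d) x - n x (x - d)) by ring.
by have dPx' := dPx xlh; apply: is_deriveB; apply: is_deriveB.
Qed.

(** The same quantity is itself d b(x, x) to first order: a vanishes on the diagonal, its increment
    is d (b + n) and that of P is d n. Comparison with [increment] gives the derivative of b(x,
    x). *)
Let increment_diag d lo hi P x (k c : R) : 0 < d -> a0 < lo -> hi < b0 ->
  (forall x, lo <= x <= hi -> is_derive x (1 : R) P (n x (x - d))) ->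
  lo <= x -> x + d <= hi -> 2 * d < c ->
  (forall s s', `|s - x| < c -> `|s' - x| < c ->
    `|b s s' - b x x| < k /\ `|n s s' - n x x| < k) ->
  `|a (x + d) x - (P (x + d) - P x) - d * b x x| <= d * (3 * k).
Proof.
move=> d0 alo hib dP lx xh dc H.
have axx : a x x = 0 by have := aN x x; lra.
have xab : a0 < x < b0 by apply/andP; split; lra.
have xd : x <= x + d by lra.
have self : `|x - x| < c by rewrite subrr normr0; lra.
have near z : x <= z <= x + d -> `|z - x| < c.
  by move=> /andP[h1 h2]; rewrite ger0_norm; lra.
have near' z : x <= z <= x + d -> `|z - d - x| < c.
  by move=> /andP[h1 h2]; rewrite ltr_norml; apply/andP; split; lra.
have [|u ui Eu] := @mvt (a^~ x) (fun t => b t x + n t x) x (x + d).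
  rewrite min_l// max_r// => z /andP[h1 h2].
  by apply: da => //; apply/andP; split; lra.
have [|w wi Ew] := @mvt P (fun z => n z (z - d)) x (x + d).
  rewrite min_l// max_r// => z /andP[h1 h2].
  by apply: dP; apply/andP; split; lra.
rewrite min_l// max_r// in ui; rewrite min_l// max_r// in wi.
have [H1 H2] := H u x (near _ ui) self.
have [_ H3] := H w (w - d) (near _ wi) (near' _ wi).
rewrite /= axx subr0 in Eu; rewrite Eu Ew.
have -> : (b u x + n u x) * (x + d - x) - n w (w - d) * (x + d - x) - d * b x x =
    d * ((b u x - b x x) + (n u x - n x x) - (n w (w - d) - n x x)) by ring.
rewrite normrM gtr0_norm// ler_wpM2l//; first exact: ltW.
apply: (le_trans (ler_normB _ _)).
have := ler_normD (b u x - b x x) (n u x - n x x); lra.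
Qed.

(* The increment of b(t, t) is read off a(t + d, t) / d as d tends to 0. *)
Lemma diagonal_derivative t : a0 < t < b0 ->
  is_derive t (1 : R) (fun t => b t t) (- 2 * m t t).
Proof.
move: t => t0 t0ab; apply/is_derive_epsP => e e0.
have [d0 d00 Hm] := cm t0ab t0ab (divr_gt0 e0 (ltr0n _ 2)).
have [r [r0 rd ra rb]] : exists r, [/\ 0 < r, r <= d0, a0 < t0 - r & t0 + r < b0].
  have /andP[at0 t0b] := t0ab.
  exists (Num.min d0 (Num.min ((t0 - a0) / 2) ((b0 - t0) / 2))).
  set r := Num.min _ _; have : [/\ r <= d0, r <= (t0 - a0) / 2 & r <= (b0 - t0) / 2].
    by rewrite !ge_min !lexx !orbT.
  case=> h1 h2 h3; split=> //; [|lra|lra].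
  by rewrite !lt_min d00 !divr_gt0// subr_gt0.
exists (r / 4); first by rewrite divr_gt0.
(* The slack k pays for the two end errors d (3 k / 6); the shift d may then depend on t and on
   k. *)
move=> t tr; apply/ler_addgt0Pr => k k0.
have k6 : 0 < k / 6 by rewrite divr_gt0.
have near_diag x : a0 < x < b0 -> exists2 c, 0 < c & forall s s',
    `|s - x| < c -> `|s' - x| < c -> `|b s s' - b x x| < k / 6 /\ `|n s s' - n x x| < k / 6.
  move=> xab.
  have [d1 d10 H1] := cb xab xab k6; have [d2 d20 H2] := cn xab xab k6.
  exists (Num.min d1 d2); first by rewrite lt_min d10.
  move=> s s'; rewrite !lt_min => /andP[s1 s2] /andP[s1' s2'].
  by split; [exact: H1|exact: H2].
have tab : a0 < t < b0.
  by move: tr; rewrite ltr_norml => /andP[h1 h2]; apply/andP; split; lra.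
have [c1 c10 H1] := near_diag t0 t0ab; have [c2 c20 H2] := near_diag t tab.
have [d [d_gt0 dr dc1 dc2]] : exists d, [/\ 0 < d, d <= r / 8, 2 * d < c1 & 2 * d < c2].
  exists (Num.min (r / 8) (Num.min (c1 / 3) (c2 / 3))).
  set d := Num.min _ _; have : [/\ d <= r / 8, d <= c1 / 3 & d <= c2 / 3].
    by rewrite !ge_min !lexx !orbT.
  by case=> h1 h2 h3; split=> //; [rewrite !lt_min !divr_gt0|lra|lra].
clear near_diag.
have [||||P dP] := @primitive d (t0 - r / 2) (t0 + r / 2); [lra|lra|lra|lra|].
have [lo1 hi1] : a0 < t0 - r / 2 /\ t0 + r / 2 < b0 by split; lra.
pose F x := a (x + d) x - (P (x + d) - P x).
have t0i : t0 - r / 2 <= t0 /\ t0 + d <= t0 + r / 2 by split; lra.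
have ti : t0 - r / 2 <= t /\ t + d <= t0 + r / 2.
  by move: tr; rewrite ltr_norml => /andP[h1 h2]; split; lra.
have F1 := increment_diag d_gt0 lo1 hi1 dP t0i.1 t0i.2 dc1 H1.
have F2 := increment_diag d_gt0 lo1 hi1 dP ti.1 ti.2 dc2 H2.
have btw z : Num.min t0 t <= z <= Num.max t0 t -> `|z - t0| < r / 4.
  by apply: minmax_dist => //; rewrite subrr normr0 divr_gt0.
have dFm x : `|x - t0| < r / 4 ->
    `|n x (x - d) - n x (x + d) - (- 2 * d * m t0 t0)| <= d * e.
  rewrite ltr_norml => /andP[x1 x2].
  have xx : x - d <= x + d by lra.
  have W : `|n x (x + d) - n x (x - d) - m t0 t0 * (x + d - (x - d))| <= e / 2 * `|x + d - (x - d)|.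
    apply: (@is_derive_le_incr (n x) (m x)) => z; rewrite min_l// max_r// => /andP[z1 z2].
      by apply: dn; apply/andP; split; lra.
    by apply/ltW/Hm; rewrite ltr_norml; apply/andP; split; lra.
  have E2 : x + d - (x - d) = 2 * d by ring.
  rewrite E2 [`|2 * d|]gtr0_norm ?mulr_gt0// in W.
  rewrite -normrN [X in `|X| <= _](_ : _ = n x (x + d) - n x (x - d) - m t0 t0 * (2 * d)); last by ring.
  by apply: (le_trans W); rewrite le_eqVlt; apply/orP; left; apply/eqP; field.
have KF : `|F t - F t0 - (- 2 * d * m t0 t0) * (t - t0)| <= d * e * `|t - t0|.
  apply: (@is_derive_le_incr F (fun x => n x (x - d) - n x (x + d))) => z /btw zi.
    move: (zi); rewrite ltr_norml => /andP[z1 z2].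
    by apply: (increment d_gt0 lo1 hi1 dP); lra.
  exact: dFm.
rewrite -(ler_pM2l d_gt0) -[X in X * `|_| <= _](gtr0_norm d_gt0) -normrM.
have -> : d * (b t t - b t0 t0 - - 2 * m t0 t0 * (t - t0)) =
    (F t - F t0 - (- 2 * d * m t0 t0) * (t - t0)) - (F t - d * b t t) + (F t0 - d * b t0 t0).
  by ring.
apply: (le_trans (ler_normD _ _)); have := ler_normB (F t - F t0 - (- 2 * d * m t0 t0) * (t - t0)) (F t - d * b t t).
move: F1 F2 KF; rewrite -/(F t) -/(F t0).
move: (`|F t0 - _|) (`|F t - d * _|) (`|F t - F t0 - _|) (`| _ - (F t - _)|) => A1 A2 A3 A4.
move=> u1 u2 u3 u4; have -> : d * (e * `|t - t0| + k) = d * e * `|t - t0| + (d * (3 * (k / 6)) + d * (3 * (k / 6))) by field.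
lra.
Qed.

End Diagonal.
End RealAnalysis.

(** * Continuous curves in H^1 and bounded symmetric forms *)

Section Curves.
Variable R : realType.
Implicit Types (f g h phi : R -> R) (z w : R -> R -> R) (T t s e : R).

Definition h1curve T z := forall t, 0 <= t <= T -> realH1 (z t) /\
  forall e, 0 < e -> exists2 d, 0 < d & forall s, 0 <= s <= T -> `|s - t| < d ->
    n1 (fun x => z s x - z t x) < e.

Lemma curve_H1 T z t : h1curve T z -> 0 <= t <= T -> realH1 (z t).
Proof. by move=> H /H[]. Qed.

Lemma curve_cst T f : realH1 f -> h1curve T (fun=> f).
Proof.
move=> Hf t _; split=> // e e0; exists 1 => // s _ _.
have -> : (fun x => f x - f x) = (fun=> 0) by apply/funext => x; rewrite subrr.
by rewrite n1_0.
Qed.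

Lemma curveD T z w : h1curve T z -> h1curve T w -> h1curve T (fun t x => z t x + w t x).
Proof.
move=> Hz Hw t tT; have [Hzt cz] := Hz t tT; have [Hwt cw] := Hw t tT.
split; first exact: realH1D.
move=> e e0; have e2 : 0 < e / 2 by rewrite divr_gt0.
have [d1 d10 K1] := cz _ e2; have [d2 d20 K2] := cw _ e2.
exists (Num.min d1 d2); first by rewrite lt_min d10.
move=> s sT; rewrite lt_min => /andP[s1 s2].
have -> : (fun x => z s x + w s x - (z t x + w t x)) =
   (fun x => (z s x - z t x) + (w s x - w t x)) by apply/funext => x; ring.
apply: (le_lt_trans (n1D _ _)).
- by apply: realH1B => //; exact: curve_H1 Hz sT.
- by apply: realH1B => //; exact: curve_H1 Hw sT.
- by have := K1 s sT s1; have := K2 s sT s2; lra.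
Qed.

Lemma curve_bounded_near T z t : h1curve T z -> 0 <= t <= T ->
  exists2 d, 0 < d & forall s, 0 <= s <= T -> `|s - t| < d -> n1 (z s) <= n1 (z t) + 1.
Proof.
move=> Hz tT; have [Hzt cz] := Hz t tT; have [d d0 K] := cz 1 ltr01.
exists d => // s sT sd; have Hzs := curve_H1 Hz sT.
have {1}-> : z s = (fun x => z t x + (z s x - z t x)) by apply/funext => x; ring.
apply: (le_trans (n1D Hzt (realH1B Hzs Hzt))).
by rewrite lerD2l ltW// K.
Qed.

Lemma curveM T z w : h1curve T z -> h1curve T w -> h1curve T (fun t x => z t x * w t x).
Proof.
move=> Hz Hw t tT; have [Hzt cz] := Hz t tT; have [Hwt cw] := Hw t tT.
split; first exact: realH1M.
move=> e e0; have [d0 d00 K0] := curve_bounded_near Hz tT.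
have nz := n1_ge0 (z t); have nw := n1_ge0 (w t).
have e2 : 0 < e / (6 * (n1 (z t) + n1 (w t) + 1)).
  by rewrite divr_gt0// mulr_gt0//; lra.
have [d1 d10 K1] := cz _ e2; have [d2 d20 K2] := cw _ e2.
exists (Num.min d0 (Num.min d1 d2)); first by rewrite !lt_min d00 d10.
move=> s sT; rewrite !lt_min => /and3P[s0 s1 s2].
have Hzs := curve_H1 Hz sT; have Hws := curve_H1 Hw sT.
have -> : (fun x => z s x * w s x - z t x * w t x) =
   (fun x => z s x * (w s x - w t x) + w t x * (z s x - z t x)) by apply/funext => x; ring.
have Hdz := realH1B Hzs Hzt; have Hdw := realH1B Hws Hwt.
apply: (le_lt_trans (n1D (realH1M Hzs Hdw) (realH1M Hwt Hdz))).
apply: (@le_lt_trans _ _ (3 * (n1 (z s) * n1 (fun x => w s x - w t x)) + 3 * (n1 (w t) * n1 (fun x => z s x - z t x)))).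
  by apply: lerD; exact: n1M.
have := K0 s sT s0; have := K1 s sT s1; have := K2 s sT s2.
have := n1_ge0 (fun x => w s x - w t x); have := n1_ge0 (fun x => z s x - z t x).
have := n1_ge0 (z s).
move: (n1 (z s)) (n1 (fun x => w s x - w t x)) (n1 (fun x => z s x - z t x)) => A B C A0 C0 B0 Be Ce Az.
set u := e / _ in Be Ce *.
have ue : 6 * (n1 (z t) + n1 (w t) + 1) * u = e by rewrite /u mulrC divfK//; lra.
have P1 : A * B <= (n1 (z t) + 1) * u by apply: ler_pM => //; exact: ltW.
have P2 : n1 (w t) * C <= n1 (w t) * u by rewrite ler_wpM2l// ltW.
have P3 : 3 * ((n1 (z t) + 1) * u) + 3 * (n1 (w t) * u) = e / 2 by rewrite -ue; field.
lra.
Qed.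

Lemma curveZ T (c : R -> R) z : continuous c -> h1curve T z ->
  h1curve T (fun t x => c t * z t x).
Proof.
move=> cc Hz t tT; have [Hzt cz] := Hz t tT.
split; first exact: realH1Z.
move=> e e0; have [d0 d00 K0] := curve_bounded_near Hz tT.
have nz := n1_ge0 (z t).
have e1 : 0 < e / (2 * (n1 (z t) + 1)) by rewrite divr_gt0// mulr_gt0//; lra.
have e2 : 0 < e / (2 * (`|c t| + 1)) by rewrite divr_gt0// mulr_gt0//; have := normr_ge0 (c t); lra.
have /cvgrPdist_lt/(_ _ e1)/nbhs_ballP[d1 /= d10 K1] := cc t.
have [d2 d20 K2] := cz _ e2.
exists (Num.min d0 (Num.min d1 d2)); first by rewrite !lt_min d00 d10.
move=> s sT; rewrite !lt_min => /and3P[s0 s1 s2].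
have Hzs := curve_H1 Hz sT.
have -> : (fun x => c s * z s x - c t * z t x) =
   (fun x => (c s - c t) * z s x + c t * (z s x - z t x)) by apply/funext => x; ring.
have Hdz := realH1B Hzs Hzt.
apply: (le_lt_trans (n1D (realH1Z _ Hzs) (realH1Z _ Hdz))).
rewrite !n1Z//.
have A1 := K0 s sT s0; have A2 : `|c s - c t| < e / (2 * (n1 (z t) + 1)).
  by rewrite distrC; apply: K1; rewrite /ball/= distrC.
have A3 := K2 s sT s2.
have P1 : `|c s - c t| * n1 (z s) <= e / (2 * (n1 (z t) + 1)) * (n1 (z t) + 1).
  by apply: ler_pM => //; [exact: n1_ge0|exact: ltW].
have P2 : `|c t| * n1 (fun x => z s x - z t x) <= `|c t| * (e / (2 * (`|c t| + 1))).
  by rewrite ler_wpM2l// ltW.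
have E1 : e / (2 * (n1 (z t) + 1)) * (n1 (z t) + 1) = e / 2 by field; lra.
have c0 := normr_ge0 (c t).
have P3 : `|c t| * (e / (2 * (`|c t| + 1))) < e / 2.
  have -> : `|c t| * (e / (2 * (`|c t| + 1))) = e / 2 - e / (2 * (`|c t| + 1)).
    by field; lra.
  by rewrite ltrBlDr ltrDl.
lra.
Qed.

Lemma continuous_cst_real (k : R) : continuous (fun _ : R => k).
Proof. by move=> x; exact: cvg_cst. Qed.

Lemma curveZc T (k : R) z : h1curve T z -> h1curve T (fun t x => k * z t x).
Proof. exact: (curveZ (@continuous_cst_real k)). Qed.

Lemma curveB T z w : h1curve T z -> h1curve T w -> h1curve T (fun t x => z t x - w t x).
Proof.
move=> Hz /(curveZc (-1)) Hw; have := curveD Hz Hw; congr h1curve.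
by apply/funext => t; apply/funext => x; rewrite mulN1r.
Qed.

(** The energy forms are used through these four properties only, so the point term f(0) g(0),
    bounded on H^1, needs no separate treatment. *)
Definition bform (B : (R -> R) -> (R -> R) -> R) :=
  [/\ forall f g h, realH1 f -> realH1 g -> realH1 h ->
        B (fun x => f x + g x) h = B f h + B g h,
      forall k f h, realH1 f -> realH1 h -> B (fun x => k * f x) h = k * B f h,
      forall f g, realH1 f -> realH1 g -> B f g = B g f &
      exists2 K, 0 <= K & forall f g, realH1 f -> realH1 g -> `|B f g| <= K * (n1 f * n1 g)].

Implicit Type B : (R -> R) -> (R -> R) -> R.

Lemma bformBl B f g h : bform B -> realH1 f -> realH1 g -> realH1 h ->
  B (fun x => f x - g x) h = B f h - B g h.
Proof.
move=> [BD BZ _ _] Hf Hg Hh.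
have -> : (fun x => f x - g x) = (fun x => f x + -1 * g x).
  by apply/funext => x; rewrite mulN1r.
by rewrite BD ?BZ ?mulN1r//; exact: realH1Z.
Qed.

Lemma bformBr B f g h : bform B -> realH1 f -> realH1 g -> realH1 h ->
  B h (fun x => f x - g x) = B h f - B h g.
Proof.
move=> bB Hf Hg Hh; have [_ _ BC _] := bB.
by rewrite BC ?bformBl// ?(BC h)//; exact: realH1B.
Qed.

Lemma bform_ip : bform ip.
Proof.
split.
- by move=> f g h Hf Hg Hh; rewrite ipDl//; exact: realH1_sq.
- by move=> k f h Hf Hh; rewrite ipZl//; exact: realH1_sq.
- by move=> f g _ _; exact: ipC.
- by exists 1 => // f g Hf Hg; rewrite mul1r; exact: ip_n1.
Qed.

Lemma bform_ipw : bform (fun f g => ip (wd f) (wd g)).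
Proof.
split.
- by move=> f g h Hf Hg Hh; rewrite ip_wderDl//; exact: wder_sq.
- by move=> k f h Hf Hh; rewrite ip_wderZl//; exact: wder_sq.
- by move=> f g _ _; exact: ipC.
- by exists 1 => // f g Hf Hg; rewrite mul1r; exact: ipw_n1.
Qed.

Lemma bform_eval x : bform (fun f g => f x * g x).
Proof.
split.
- by move=> f g h _ _ _; exact: mulrDl.
- by move=> k f h _ _; rewrite mulrA.
- by move=> f g _ _; exact: mulrC.
- exists 4 => // f g Hf Hg; rewrite normrM.
  have := ler_pM (normr_ge0 _) (normr_ge0 _) (sup_n1 x Hf) (sup_n1 x Hg).
  by move/le_trans; apply; rewrite le_eqVlt; apply/orP; left; apply/eqP; ring.
Qed.

Lemma bform_mul v : realH1 v -> bform (fun f g => ip (fun x => v x * f x) g).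
Proof.
move=> Hv; split.
- move=> f g h Hf Hg Hh.
  have [sf sg] : sqint (fun x => v x * f x) /\ sqint (fun x => v x * g x).
    by split; apply/realH1_sq/realH1M.
  rewrite -ipDl//; last exact: realH1_sq.
  by congr ip; apply/funext => x; exact: mulrDr.
- move=> k f h Hf Hh; rewrite -ipZl; [|by apply/realH1_sq/realH1M|exact: realH1_sq].
  by congr ip; apply/funext => x; exact: mulrCA.
- move=> f g Hf Hg; rewrite !ipE; apply: eq_Rintegral => x _; ring.
- exists (3 * n1 v); first by rewrite mulr_ge0// n1_ge0.
  move=> f g Hf Hg; apply: (le_trans (ip_n1 (realH1M Hv Hf) Hg)).
  by rewrite mulrA ler_wpM2r ?n1_ge0// -mulrA n1M.
Qed.

Lemma bform_add B1 B2 : bform B1 -> bform B2 -> bform (fun f g => B1 f g + B2 f g).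
Proof.
move=> [D1 Z1 C1 [K1 K10 H1]] [D2 Z2 C2 [K2 K20 H2]]; split.
- by move=> f g h Hf Hg Hh; rewrite D1// D2//; ring.
- by move=> k f h Hf Hh; rewrite Z1// Z2//; ring.
- by move=> f g Hf Hg; rewrite C1// C2.
- exists (K1 + K2); first exact: addr_ge0.
  move=> f g Hf Hg; apply: (le_trans (ler_normD _ _)).
  by rewrite mulrDl lerD ?H1 ?H2.
Qed.

Lemma bform_scale B (k : R) : bform B -> bform (fun f g => k * B f g).
Proof.
move=> [D1 Z1 C1 [K1 K10 H1]]; split.
- by move=> f g h Hf Hg Hh; rewrite D1//; ring.
- by move=> c f h Hf Hh; rewrite Z1//; ring.
- by move=> f g Hf Hg; rewrite C1.
- exists (`|k| * K1); first by rewrite mulr_ge0.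
  by move=> f g Hf Hg; rewrite normrM -mulrA ler_wpM2l// H1.
Qed.

Lemma bform_curve B T z w t s : bform B -> h1curve T z -> h1curve T w ->
  0 <= t <= T -> 0 <= s <= T -> forall e, 0 < e -> exists2 d, 0 < d & forall t' s',
    0 <= t' <= T -> 0 <= s' <= T -> `|t' - t| < d -> `|s' - s| < d ->
    `|B (z t') (w s') - B (z t) (w s)| < e.
Proof.
move=> bB Hz Hw tT sT e e0; have [_ _ _ [K K0 HB]] := bB.
have [Hzt cz] := Hz t tT; have [Hws cw] := Hw s sT.
have [d0 d00 N0] := curve_bounded_near Hw sT.
have nz := n1_ge0 (z t); have nw := n1_ge0 (w s).
pose M := 2 * ((K + 1) * (n1 (z t) + n1 (w s) + 1)).
have M0 : 0 < M by rewrite !mulr_gt0//; lra.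
have eM : 0 < e / M by rewrite divr_gt0.
have [d1 d10 K1] := cz _ eM; have [d2 d20 K2] := cw _ eM.
exists (Num.min d0 (Num.min d1 d2)); first by rewrite !lt_min d00 d10.
move=> t' s' t'T s'T; rewrite !lt_min => /and3P[_ t1 _] /and3P[s0 _ s2].
have Hzt' := curve_H1 Hz t'T; have Hws' := curve_H1 Hw s'T.
have -> : B (z t') (w s') - B (z t) (w s) =
    B (fun x => z t' x - z t x) (w s') + B (z t) (fun x => w s' x - w s x).
  by rewrite bformBl// bformBr//; ring.
apply: (le_lt_trans (ler_normD _ _)).
have A1 := HB _ _ (realH1B Hzt' Hzt) Hws'.
have A2 := HB _ _ Hzt (realH1B Hws' Hws).
have := N0 _ s'T s0; have := K1 _ t'T t1; have := K2 _ s'T s2.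
have := n1_ge0 (fun x => z t' x - z t x); have := n1_ge0 (fun x => w s' x - w s x).
have := n1_ge0 (w s').
move: (n1 (w s')) (n1 (fun x => z t' x - z t x)) (n1 (fun x => w s' x - w s x)) A1 A2
  => C A D A1 A2 C0 D0 A0 De Ae Cw.
have P1 : A * C <= e / M * (n1 (w s) + 1) by apply: ler_pM => //; exact: ltW.
have P2 : n1 (z t) * D <= n1 (z t) * (e / M) by rewrite ler_wpM2l// ltW.
have P3 : K * (A * C) <= K * (e / M * (n1 (w s) + 1)) by rewrite ler_wpM2l.
have P4 : K * (n1 (z t) * D) <= K * (n1 (z t) * (e / M)) by rewrite ler_wpM2l.
have E : (K + 1) * (n1 (z t) + n1 (w s) + 1) * (e / M) = e / 2.
  by rewrite /M; field; apply/andP; split; lra.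
have P5 : K * (e / M * (n1 (w s) + 1)) + K * (n1 (z t) * (e / M)) <= e / 2.
  rewrite -E -subr_ge0.
  have -> : (K + 1) * (n1 (z t) + n1 (w s) + 1) * (e / M) - (K * (e / M * (n1 (w s) + 1)) + K * (n1 (z t) * (e / M))) =
    (n1 (z t) + n1 (w s) + 1) * (e / M) by ring.
  by rewrite mulr_ge0//; [lra|exact: ltW].
lra.
Qed.

Lemma bform_cont2 B T z w : bform B -> h1curve T z -> h1curve T w ->
  cont2 0 T (fun t s => B (z t) (w s)).
Proof.
move=> bB Hz Hw t s /andP[t0 tT] /andP[s0 sT] e e0.
have [||d d0 K] := bform_curve (t := t) (s := s) bB Hz Hw _ _ e0.
- by rewrite !ltW.
- by rewrite !ltW.
exists (Num.min d (Num.min (Num.min t (T - t)) (Num.min s (T - s)))).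
  by rewrite !lt_min d0 t0 s0 !subr_gt0 tT sT.
move=> t' s'; rewrite !lt_min => /and3P[t1 /andP[t2 t3] _] /and3P[s1 _ /andP[s2 s3]].
by apply: K => //; [move: t2 t3|move: s2 s3]; rewrite !ltr_norml => /andP[? ?] /andP[? ?]; apply/andP; split; lra.
Qed.

Lemma cont2D (a0 b0 : R) (a b : R -> R -> R) : cont2 a0 b0 a -> cont2 a0 b0 b ->
  cont2 a0 b0 (fun t s => a t s + b t s).
Proof.
move=> ca cb t s tI sI e e0; have e2 : 0 < e / 2 by rewrite divr_gt0.
have [d1 d10 K1] := ca _ _ tI sI _ e2; have [d2 d20 K2] := cb _ _ tI sI _ e2.
exists (Num.min d1 d2); first by rewrite lt_min d10.
move=> t' s'; rewrite !lt_min => /andP[t1 t2] /andP[s1 s2].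
rewrite [X in `|X| < _](_ : _ = (a t' s' - a t s) + (b t' s' - b t s)); last by ring.
apply: (le_lt_trans (ler_normD _ _)).
by have := K1 _ _ t1 s1; have := K2 _ _ t2 s2; lra.
Qed.

Lemma cont2Z (a0 b0 k : R) (a : R -> R -> R) : cont2 a0 b0 a ->
  cont2 a0 b0 (fun t s => k * a t s).
Proof.
move=> ca t s tI sI e e0.
have ek : 0 < e / (`|k| + 1) by rewrite divr_gt0// ltr_wpDl.
have [d1 d10 K1] := ca _ _ tI sI _ ek; exists d1 => // t' s' t1 s1.
rewrite -mulrBr normrM; have := K1 _ _ t1 s1; rewrite ltr_pdivlMr ?ltr_wpDl//.
by have := normr_ge0 (a t' s' - a t s); have := normr_ge0 k; nra.
Qed.

(** The components of i z_t = L z - N for z = z1 + i z2, with B1 and B2 the forms of the operators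
    acting on z1 and z2, tested against all of H^1. *)
Definition weak_system T B1 B2 z1 z2 N1 N2 := forall phi, realH1 phi ->
  forall t, 0 < t < T ->
    is_derive t (1 : R) (fun s => ip (z1 s) phi) (B2 (z2 t) phi - ip (N2 t) phi) /\
    is_derive t (1 : R) (fun s => ip (z2 s) phi) (- B1 (z1 t) phi + ip (N1 t) phi).

(* Differentiating <L z, z> formally, the terms <L1 z1, L2 z2> cancel; as L z
   is only a distribution, [diagonal_derivative] is applied to
   a(t, s) = ip (z1 t) (z2 s) - ip (z2 t) (z1 s) instead. *)
Lemma energy_derivative T B1 B2 z1 z2 N1 N2 : bform B1 -> bform B2 ->
  h1curve T z1 -> h1curve T z2 -> h1curve T N1 -> h1curve T N2 ->
  weak_system T B1 B2 z1 z2 N1 N2 -> forall t, 0 < t < T ->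
  is_derive t (1 : R) (fun t => B1 (z1 t) (z1 t) + B2 (z2 t) (z2 t))
    (2 * (B2 (z2 t) (N1 t) - B1 (z1 t) (N2 t))).
Proof.
move=> b1 b2 Hz1 Hz2 HN1 HN2 W t tT.
have [_ _ C1 _] := b1; have [_ _ C2 _] := b2.
pose a t s := ip (z1 t) (z2 s) - ip (z2 t) (z1 s).
pose b t s := B1 (z1 t) (z1 s) + B2 (z2 t) (z2 s).
pose n t s := -1 * ip (N1 t) (z1 s) + -1 * ip (N2 t) (z2 s).
(* The derivative of n in s; on the diagonal the two pairings of N1 with N2 cancel. *)
pose m t s := (-1 * B2 (z2 s) (N1 t) + ip (N2 s) (N1 t)) + (B1 (z1 s) (N2 t) + -1 * ip (N1 s) (N2 t)).
have H1 u v : 0 < v < T -> h1curve T u -> realH1 (u v).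
  by move=> /andP[v0 vT] Hu; apply: (curve_H1 Hu); rewrite !ltW.
have swap B u v : bform B -> h1curve T u -> h1curve T v -> cont2 0 T (fun t s => B (u s) (v t)).
  move=> bB Hu Hv t' s' tI sI e e0.
  have [d d0 K] := bform_cont2 bB Hu Hv sI tI e0.
  by exists d => // t1 s1 h1 h2; apply: K.
have cb : cont2 0 T b by apply: cont2D; exact: bform_cont2.
have cn : cont2 0 T n.
  by apply: cont2D; apply: cont2Z; apply: bform_cont2 => //; exact: bform_ip.
have cm : cont2 0 T m.
  apply: cont2D; apply: cont2D.
  - by apply: cont2Z; exact: swap.
  - by apply: swap => //; exact: bform_ip.
  - exact: swap.
  - by apply: cont2Z; apply: swap => //; exact: bform_ip.
have := @diagonal_derivative R a b n m 0 T _ _ _ _ cb cn cm t tT.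
have -> : -2 * m t t = 2 * (B2 (z2 t) (N1 t) - B1 (z1 t) (N2 t)).
  by rewrite /m (ipC (N2 t)); ring.
apply.
- by move=> u v; rewrite /a [ip (z1 u) _]ipC [ip (z2 u) _]ipC; ring.
- by move=> u v uT vT; rewrite /b C1 ?(C2 (z2 u))//; exact: H1.
- move=> u v uT vT.
  have [D1 _] := W _ (H1 _ _ vT Hz2) u uT; have [_ D2] := W _ (H1 _ _ vT Hz1) u uT.
  apply: is_derive_eq (is_deriveB D1 D2) _.
  by rewrite /b /n; ring.
- move=> u v uT vT.
  have [D1 _] := W _ (H1 _ _ uT HN1) v vT; have [_ D2] := W _ (H1 _ _ uT HN2) v vT.
  have -> : n u = (fun s => -1 * ip (z1 s) (N1 u) + -1 * ip (z2 s) (N2 u)).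
    by apply/funext => s; rewrite /n ipC [ip (N2 u) _]ipC.
  have D1' := is_deriveZ (-1) D1; have D2' := is_deriveZ (-1) D2.
  apply: is_derive_eq (is_deriveD D1' D2') _.
  by rewrite /m /GRing.scale /=; ring.
Qed.

End Curves.

(** * Density of the domain of the point interaction *)

Section Steklov.
Variable R : realType.
Notation mu := (@lebesgue_measure R).
Local Notation integ D f := (mu.-integrable D (EFin \o f)).
Implicit Types (f g h F G u : R -> R) (a b x : R) (A : set R).

(** Monotone convergence along an exhaustion, for functions whose integrals can be estimated on
    segments only. *)
Lemma bounded_integ (D : nat -> set (measurableTypeR R)) (E : set (measurableTypeR R)) h M :
  measurable E -> (forall n, measurable (D n)) -> nondecreasing_seq D ->
  \bigcup_n D n = E -> measurable_fun E h -> (forall x, E x -> 0 <= h x) ->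
  (forall n, integ (D n) h) -> (forall n, \int[mu]_(x in D n) h x <= M) ->
  integ E h /\ \int[mu]_(x in E) h x <= M.
Proof.
move=> mE mD ndD DE mh h0 hi hM.
have DsE n : D n `<=` E by rewrite -DE; exact: bigcup_sup.
have mhD n : measurable_fun (D n) (EFin \o h).
  by apply/measurable_EFinP; exact: measurable_funS mh.
have C := ge0_nondecreasing_set_cvg_integral (mu := mu) ndD mD mhD
  (fun n x Dx => h0 x (DsE n x Dx)).
rewrite DE in C.
have le_M : (\int[mu]_(x in E) (EFin \o h) x <= M%:E)%E.
  apply: (cvge_to_le C); apply: nearW => n.
  rewrite -[leLHS]fineK; last exact: integrable_fin_num.
  by rewrite lee_fin; exact: hM.
have iE : integ E h.
  apply/integrableP; split; first exact/measurable_EFinP.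
  have -> : (\int[mu]_(x in E) `|(EFin \o h) x|)%E = (\int[mu]_(x in E) (EFin \o h) x)%E.
    by apply: eq_integral => x /set_mem Ex; rewrite /= ger0_norm// h0.
  exact: le_lt_trans (ltry M).
split=> //; rewrite -lee_fin /Rintegral fineK//; exact: integrable_fin_num.
Qed.

Lemma bounded_integT h M : measurable_fun setT h -> (forall x, 0 <= h x) ->
  (forall a b, integ `[a, b] h) ->
  (forall n : nat, \int[mu]_(x in `[- n%:R, n%:R]) h x <= M) ->
  integ setT h /\ \int[mu]_x h x <= M.
Proof.
move=> mh h0 hi hM; apply: (@bounded_integ (fun n => `[- n%:R, n%:R]%classic)) => //.
- apply/nondecreasing_seqP => n; apply/subsetPset; apply: sub_itvcc.
    by rewrite lerN2 ler_nat.
  by rewrite ler_nat.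
- apply/seteqP; split=> // x _; exists (Num.truncn `|x|).+1 => //=.
  by rewrite in_itv/= -ler_norml ltW// truncnS_gt.
Qed.

Lemma bounded_integ_ray h a M : measurable_fun `[a, +oo[ h -> (forall x, a <= x -> 0 <= h x) ->
  (forall b, integ `[a, b] h) ->
  (forall n : nat, \int[mu]_(x in `[a, a + n%:R]) h x <= M) ->
  integ `[a, +oo[ h /\ \int[mu]_(x in `[a, +oo[) h x <= M.
Proof.
move=> mh h0 hi hM; apply: (@bounded_integ (fun n => `[a, a + n%:R]%classic)) => //.
- apply/nondecreasing_seqP => n; apply/subsetPset; apply: sub_itvcc => //.
  by rewrite lerD2l ler_nat.
- apply/seteqP; split=> [x [n _ /=]|x /=]; first by rewrite !in_itv/= andbT => /andP[].
  rewrite in_itv/= andbT => ax; exists (Num.truncn `|x - a|).+1 => //=.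
  rewrite in_itv/= ax/= -lerBlDl (le_trans (ler_norm _))//.
  by rewrite ltW// truncnS_gt.
- by move=> x; rewrite /= in_itv/= andbT; exact: h0.
Qed.

Lemma sq_Rint_le f a b : a <= b -> integ `[a, b] f -> integ `[a, b] (fun x => f x ^+ 2) ->
  (\int[mu]_(x in `[a, b]) f x) ^+ 2 <= (b - a) * \int[mu]_(x in `[a, b]) (f x ^+ 2).
Proof.
move=> ab fi f2i; have [->|ab'] := eqVneq a b.
  by rewrite set_itv1 !Rintegral_set1 expr0n mulr0.
set I := \int[mu]_(x in _) f x; set J := \int[mu]_(x in _) _.
have ba : 0 < b - a by rewrite subr_gt0 lt_neqAle ab'.
pose m := I / (b - a).
have : 0 <= \int[mu]_(x in `[a, b]) ((f x ^+ 2 - 2 * m * f x) + m ^+ 2).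
  apply: Rint_itv_ge0 => x _.
  have -> : (f x ^+ 2 - 2 * m * f x) + m ^+ 2 = (f x - m) ^+ 2 by ring.
  exact: sqr_ge0.
have i1 : integ `[a, b] (fun x => 2 * m * f x) by exact: integZ.
rewrite RintegralD//; [|exact: integB|exact: integ_cst_itv].
rewrite RintegralB// RintegralZl// Rint_cst_itv// -/I -/J.
have -> : J - 2 * m * I + m ^+ 2 * (b - a) = J - I ^+ 2 / (b - a).
  by rewrite /m; field; lra.
by rewrite subr_ge0 ler_pdivrMr// mulrC.
Qed.

(** When F is a primitive of f this is the mean of f over [x - e, x + e]. Written through F it is
    absolutely continuous, and its derivative is the same expression with f in place of F. *)
Definition steklov F (e x : R) := (F (x + e) - F (x - e)) / (2 * e).

Lemma is_derive_shift F x c l : is_derive (x + c) (1 : R) F l ->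
  is_derive x (1 : R) (fun x => F (x + c)) l.
Proof.
move=> d; have := @is_derive1_comp _ F (fun x => x + c) x l 1 d.
by rewrite mulr1; apply; exact: is_derive_addr.
Qed.

Lemma Rint_shift_primitive F f c a b : (forall x, is_derive x (1 : R) F (f x)) ->
  continuous f -> a <= b ->
  \int[mu]_(x in `[a, b]) f (x + c) = F (b + c) - F (a + c).
Proof.
move=> dF cf ab.
have H : acon setT (fun x => F (x + c)) (fun x => f (x + c)).
  apply: acon_derive => x _; first exact: is_derive_shift.
  by apply: continuous_comp; [apply: cvgD; [exact: cvg_id|exact: cvg_cst]|exact: cf].
by have [_ ->] := H a b ab (@subsetT _ _).
Qed.

(** Averaging contracts L^2: the square of a mean is at most the mean of the square, and the latter
    has the same total integral. *)
Lemma steklov_bound F f (e : R) : 0 < e -> acon setT F f -> sqint f ->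
  sqint (steklov F e) /\ ip (steklov F e) (steklov F e) <= ip f f.
Proof.
move=> e0 H sf; have [mf f2] := sf.
have cF := acon_continuous H.
have cA : continuous (steklov F e).
  move=> x; apply: cvgM; last exact: cvg_cst.
  apply: cvgB.
    by apply: continuous_comp; [apply: cvgD; [exact: cvg_id|exact: cvg_cst]|exact: cF].
  by apply: continuous_comp; [apply: cvgB; [exact: cvg_id|exact: cvg_cst]|exact: cF].
have f2l a b : integ `[a, b] (fun x => f x ^+ 2) by exact: integT.
have [P HP] := acon_exists f2l.
have Pmon x y : x <= y -> P x <= P y.
  move=> xy; have [_ E] := HP x y xy (@subsetT _ _).
  by rewrite -subr_ge0 E; apply: Rint_itv_ge0 => z _; exact: sqr_ge0.
(* A second primitive of f^2 replaces Fubini: it evaluates the integral of P (x + e) - P (x - e),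
   and monotonicity of P bounds the result by 2 e N. *)
have [S [HS dS]] := continuous_primitive (acon_continuous HP).
pose N := ip f f.
have PN x y : x <= y -> P y - P x <= N.
  move=> xy; have [_ ->] := HP x y xy (@subsetT _ _).
  rewrite /N ipE (_ : \int[mu]_x (f x * f x) = \int[mu]_x (f x ^+ 2)); last first.
    by apply: eq_Rintegral => z _; rewrite expr2.
  rewrite Rintegral_mkcond; apply: le_Rintegral => //.
    by rewrite -restrict_EFin; exact/(integrable_mkcond _ _).1.
  by move=> z _; rewrite /patch; case: ifP => // _; exact: sqr_ge0.
have A2 x : steklov F e x ^+ 2 <= (P (x + e) - P (x - e)) / (2 * e).
  have xe : x - e <= x + e by lra.
  have [fi Ef] := H _ _ xe (@subsetT _ _).
  have [_ EP] := HP _ _ xe (@subsetT _ _).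
  rewrite /steklov EP Ef exprMn exprVn ler_pdivrMr; last by rewrite exprn_gt0// mulr_gt0.
  have := sq_Rint_le xe fi (f2l _ _).
  have -> : x + e - (x - e) = 2 * e by ring.
  move=> K; apply: (le_trans K); rewrite le_eqVlt; apply/orP; left; apply/eqP; field; lra.
have mA2 : measurable_fun setT (fun x => steklov F e x ^+ 2).
  by apply: measurable_funX; exact: continuous_measurable.
have cA2 : continuous (fun x => steklov F e x ^+ 2).
  by move=> x; apply: cvgM; exact: cA.
have ci a b : integ `[a, b] (fun x => steklov F e x ^+ 2) by exact: continuous_integ_itv.
have cP c : continuous (fun x => P (x + c)).
  move=> x; apply: continuous_comp; last exact: (acon_continuous HP).
  by apply: cvgD; [exact: cvg_id|exact: cvg_cst].
have [|i B] := @bounded_integT _ N mA2 (fun x => sqr_ge0 _) ci.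
  move=> n; have nn : - n%:R <= n%:R :> R by rewrite lerNl; apply: (@le_trans _ _ 0); rewrite ?oppr_le0.
  apply: (@le_trans _ _ (\int[mu]_(x in `[- n%:R, n%:R]) ((2 * e)^-1 * (P (x + e) - P (x - e))))).
    apply: Rint_itv_le => //.
      apply: integZ => //; apply: integB => //; apply: continuous_integ_itv; exact: cP.
    by move=> x _; rewrite mulrC; exact: A2.
  have ie := continuous_integ_itv (- n%:R) n%:R (cP e).
  have ie' := continuous_integ_itv (- n%:R) n%:R (cP (- e)).
  rewrite RintegralZl//; last exact: integB.
  rewrite RintegralB// !(Rint_shift_primitive _ dS (acon_continuous HP) nn).
  have S1 : S (n%:R + e) - S (n%:R - e) <= 2 * e * P (n%:R + e).
    have [|_ ->] := HS (n%:R - e) (n%:R + e) _ (@subsetT _ _); first by lra.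
    have -> : 2 * e * P (n%:R + e) = P (n%:R + e) * (n%:R + e - (n%:R - e)) by ring.
    rewrite -Rint_cst_itv; last by lra.
    apply: Rint_itv_le; [exact: continuous_integ_itv (acon_continuous HP)|exact: integ_cst_itv|].
    by move=> x /andP[_ /Pmon].
  have S2 : 2 * e * P (- n%:R - e) <= S (- n%:R + e) - S (- n%:R - e).
    have [|_ ->] := HS (- n%:R - e) (- n%:R + e) _ (@subsetT _ _); first by lra.
    have -> : 2 * e * P (- n%:R - e) = P (- n%:R - e) * (- n%:R + e - (- n%:R - e)) by ring.
    rewrite -Rint_cst_itv; last by lra.
    apply: Rint_itv_le; [exact: integ_cst_itv|exact: continuous_integ_itv (acon_continuous HP)|].
    by move=> x /andP[/Pmon].
  have PNn : P (n%:R + e) - P (- n%:R - e) <= N by apply: PN; lra.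
  rewrite mulrC ler_pdivrMr ?mulr_gt0//.
  have : 2 * e * (P (n%:R + e) - P (- n%:R - e)) <= 2 * e * N by rewrite ler_wpM2l ?mulr_ge0// ltW.
  lra.
split; first by split=> //; exact: continuous_measurable.
by rewrite ipE (_ : \int[mu]_x _ = \int[mu]_x (steklov F e x ^+ 2))//; apply: eq_Rintegral => x _; rewrite expr2.
Qed.

Lemma steklov_cvg F x l : is_derive x (1 : R) F l ->
  steklov F n.+1%:R^-1 x @[n --> \oo] --> l.
Proof.
move=> /is_derive_epsP H; apply/cvgrPdist_lt => e e0.
have e2 : 0 < e / 2 by rewrite divr_gt0.
have [d d0 K] := H _ e2.
near=> n.
have h0 : 0 < n.+1%:R^-1 :> R by rewrite invr_gt0.
have hd : n.+1%:R^-1 < d.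
  by near: n; have := @near_infty_natSinv_lt R (PosNum d0).
move: (n.+1%:R^-1) h0 hd => k k0 kd; rewrite distrC.
have := K (x + k); rewrite addrC addKr (gtr0_norm k0) => /(_ kd) K1.
have := K (x - k); rewrite addrC addKr normrN (gtr0_norm k0) => /(_ kd) K2.
have -> : steklov F k x - l =
    ((F (x + k) - F x - l * k) - (F (x - k) - F x - l * - k)) / (2 * k).
  by rewrite /steklov; field; lra.
rewrite normrM normfV (gtr0_norm (x := 2 * k)) ?mulr_gt0// ltr_pdivrMr ?mulr_gt0//.
have := ler_normB (F (x + k) - F x - l * k) (F (x - k) - F x - l * - k).
have : 0 < e * k by rewrite mulr_gt0.
lra.
Unshelve. all: by end_near. Qed.

(* Split |h| |u_n - u| according to whether |u_n - u| exceeds M |h|. *)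
Lemma weak_cvg_ae (u_ : nat -> R -> R) u h K : (forall n, sqint (u_ n)) -> sqint u -> sqint h ->
  (forall n, ip (u_ n) (u_ n) <= K) ->
  {ae mu, forall x, u_ n x @[n --> \oo] --> u x} ->
  ip (u_ n) h @[n --> \oo] --> ip u h.
Proof.
move=> su_ su sh uK uu; apply/cvgrPdist_lt => e e0.
have K0 : 0 <= K := le_trans (ip_ge0 _) (uK 0%N).
pose L := 2 * (K + ip u u).
have L0 : 0 <= L by rewrite mulr_ge0// addr_ge0// ip_ge0.
(* L bounds the squared norm of u_n - u; with this M the part where the difference is large
   contributes at most L / M <= e / 2. *)
pose M := 2 * (L + 1) / e.
have M0 : 0 < M by rewrite divr_gt0// mulr_gt0//; lra.
have [mh h2] := sh; have [mu_ _] := su.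
have sd n : sqint (fun x => u_ n x - u x) by exact: sqintB.
pose Gd x := M * h x ^+ 2.
pose G n x := Num.min (`|h x| * `|u_ n x - u x|) (M * h x ^+ 2).
have mG n : measurable_fun setT (G n).
  have [m1 _] := sd n; apply: measurable_minr.
    by apply: measurable_funM; exact: measurableT_comp.
  by apply: measurable_funM => //; exact: measurable_funX.
have G0 n x : 0 <= G n x.
  by rewrite /G le_min mulr_ge0//= mulr_ge0 ?sqr_ge0// ltW.
have GM n x : G n x <= Gd x by rewrite ge_min lexx orbT.
have iM : integ setT Gd by exact: integZ.
have iG n : integ setT (G n).
  by apply: (integ_le _ (mG n) iM) => // x _; rewrite ger0_norm.
pose Z0 := fun _ : R => 0 : R.
have CG : \int[mu]_x G n x @[n --> \oo] --> (0 : R).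
  have A1 : {ae mu, forall x, setT x -> (EFin \o G n) x @[n --> \oo] --> (EFin \o Z0) x}.
    apply: ae_mono uu => x ux _; apply: cvg_EFin; first by apply: nearW.
    rewrite /=; apply/cvgr0Pnorm_lt => r r0.
    have hr : 0 < r / (`|h x| + 1) by rewrite divr_gt0// ltr_wpDl.
    move/cvgrPdist_lt : ux => /(_ _ hr); apply: filterS => n /=.
    move=> Hn; rewrite (ger0_norm (G0 n x)); rewrite ltr_pdivlMr ?ltr_wpDl// in Hn.
    apply: le_lt_trans Hn; rewrite ge_min; apply/orP; left.
    by rewrite distrC mulrC ler_wpM2l// lerDl.
  have A2 : {ae mu, forall x n, setT x -> (`|(EFin \o G n) x| <= (EFin \o Gd) x)%E}.
    by apply: aeW => x n _; rewrite /= lee_fin ger0_norm ?G0 ?GM.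
  have mGE n : measurable_fun setT (EFin \o G n) by exact/measurable_EFinP.
  have m0 : measurable_fun setT (EFin \o Z0).
    by apply/measurable_EFinP; exact: measurable_cst.
  have [_ _ C] := dominated_convergence (mu := mu) measurableT mGE m0 A1 iM A2.
  have z : (\int[mu]_x (EFin \o Z0) x)%E = 0%:E by rewrite integral0.
  rewrite z in C; have C2 := @fine_cvg _ _ _ _ _ _ C.
  exact: C2 eventually_filter.
have e2 : 0 < e / 2 by rewrite divr_gt0.
move/cvgr0Pnorm_lt : CG => /(_ _ e2); apply: filterS => n Gn.
rewrite distrC -ipBl//.
have dL : ip (fun x => u_ n x - u x) (fun x => u_ n x - u x) <= L.
  have := ip_sqD (su_ n) (sqintN su); rewrite [ip (fun x => - u x) _]ipNl//; last exact: sqintN.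
  rewrite (ipC u) ipNl// opprK => /le_trans; apply.
  by rewrite /L ler_pM2l// lerD2r.
rewrite ipE.
have i1 := sqint_mul (sd n) sh.
apply: (le_lt_trans (le_normr_Rintegral measurableT i1)).
have i2 : integ setT (fun x => M^-1 * ((u_ n x - u x) * (u_ n x - u x))).
  by apply: integZ => //; exact: sqint_mul.
apply: (@le_lt_trans _ _ (\int[mu]_x (G n x + M^-1 * ((u_ n x - u x) * (u_ n x - u x))))).
  apply: le_Rintegral => //; [exact: integ_norm|exact: integD|].
  move=> x _; rewrite normrM mulrC /G -expr2 -(real_normK (num_real (u_ n x - u x))).
  rewrite -(real_normK (num_real (h x))).
  have := normr_ge0 (h x); have := normr_ge0 (u_ n x - u x).
  move: (`|h x|) (`|u_ n x - u x|) => p q q0 p0.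
  have q2 : 0 <= M^-1 * q ^+ 2 by rewrite mulr_ge0 ?sqr_ge0// invr_ge0 ltW.
  rewrite minElt; case: ifP => _; first by lra.
  have [qp|pq] := leP q (M * p).
    have : p * q <= p * (M * p) by rewrite ler_wpM2l.
    have -> : p * (M * p) = M * p ^+ 2 by ring.
    lra.
  have : p * q <= M^-1 * q ^+ 2.
    rewrite expr2 mulrA ler_wpM2r//; rewrite mulrC ler_pdivlMr// mulrC; exact: ltW.
  have : 0 <= M * p ^+ 2 by rewrite mulr_ge0 ?sqr_ge0// ltW.
  lra.
rewrite RintegralD// RintegralZl//; last exact: sqint_mul.
rewrite -ipE; have GG : \int[mu]_x G n x < e / 2 := le_lt_trans (ler_norm _) Gn.
have : M^-1 * ip (fun x => u_ n x - u x) (fun x => u_ n x - u x) <= M^-1 * L.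
  by rewrite ler_wpM2l// invr_ge0 ltW.
have : M^-1 * L <= e / 2.
  rewrite /M invf_div mulrC -subr_ge0.
  have -> : e / 2 - L * (e / (2 * (L + 1))) = e / 2 * (L + 1)^-1 by field; lra.
  by rewrite mulr_ge0 ?ltW// invr_gt0; lra.
move=> ML IL; rewrite [ltRHS]splitr; apply: ltr_leD => //.
exact: le_trans IL ML.
Qed.

End Steklov.

(** * Even extension and integration by parts across the origin *)

Section EvenExtension.
Variable R : realType.
Notation mu := (@lebesgue_measure R).
Local Notation integ D f := (mu.-integrable D (EFin \o f)).
Implicit Types (f g h p w phi : R -> R) (a b c x : R) (A : set R).

Lemma ae_neq c : {ae mu, forall x, x != c}.
Proof.
exists [set c]; split; [exact: measurable_set1|exact: lebesgue_measure_set1|].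
by move=> x /= /negP; rewrite negbK => /eqP.
Qed.

(** For even extensions: [Num.sg] is 0 at 0, so the derivative formula may be off at that single
    point. *)
Lemma acon_point A f g h c : acon A f g -> (forall x, A x -> x != c -> h x = g x) ->
  acon A f h.
Proof.
move=> H gh; pose k := h c - g c; pose d x := k * \1_[set c] x.
have dc x : d x = if x == c then k else 0.
  rewrite /d indicE; case: eqVneq => [->|xc]; first by rewrite mem_set// mulr1.
  by rewrite memNset ?mulr0// => /= /eqP; rewrite (negbTE xc).
have md : measurable_fun setT d.
  by apply: measurable_funM => //; exact: measurable_indic.
have D0 : acon A (fun=> 0) d.
  move=> a b ab abA.
  have mdi : measurable_fun `[a, b] d by exact: measurable_funS md.
  split.
    apply: (@integ_le _ _ _ (fun=> `|k|)) => //; first exact: integ_cst_itv.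
    by move=> x _; rewrite dc; case: ifP; rewrite ?normr0.
  rewrite subrr (@Rint_ae_eq _ _ d (fun=> 0))//; first by rewrite Rint_cst_itv ?mul0r.
  by apply: ae_mono (ae_neq c) => x xc _; rewrite dc (negbTE xc).
have := aconD H D0; apply: acon_eq => x Ax; first by rewrite addr0.
by rewrite dc; case: eqVneq => [->|xc]; [rewrite /k addrC subrK|rewrite addr0 gh].
Qed.

Lemma acon_even f g : acon `[0, +oo[ f g ->
  acon setT (fun x => f `|x|) (fun x => Num.sg x * g `|x|).
Proof.
move=> H; apply: (@acon_glue _ 0).
- have Ho : acon `]-oo, 0] (fun x => f (- x)) (fun x => - g (- x)).
    by apply: acon_sub (acon_opp H) => x /=; rewrite !in_itv/= andbT oppr_ge0.
  apply: (@acon_point _ _ (fun x => - g (- x)) _ 0).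
    by apply: acon_eq Ho => // x /=; rewrite in_itv/= => x0; rewrite ler0_norm.
  move=> x /=; rewrite in_itv/= => x0 xn0.
  have {}x0 : x < 0 by rewrite lt_neqAle xn0.
  by rewrite ltr0_sg// ltr0_norm// mulN1r.
- apply: (@acon_point _ _ g _ 0).
    by apply: acon_eq H => // x /=; rewrite in_itv/= andbT => x0; rewrite ger0_norm.
  move=> x /=; rewrite in_itv/= andbT => x0 xn0.
  have {}x0 : 0 < x by rewrite lt_def xn0.
  by rewrite gtr0_sg// gtr0_norm// mul1r.
Qed.

Lemma even_integ g : integ `[0, +oo[ g -> integ setT (fun x => g `|x|) /\
  \int[mu]_x g `|x| = 2 * \int[mu]_(x in `[0, +oo[) g x.
Proof.
move=> gi; have [mh hi] := integ_patch (measurable_itv _) gi.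
have ho := isom_integ (@isom_opp R) mh hi.
have iT : integ setT (fun x => g `|x|).
  have -> : setT = (`]-oo, (0 : R)] `|` `[0, +oo[)%classic.
    apply/seteqP; split=> // x _ /=; rewrite !in_itv/= andbT.
    by case/orP: (le_total x 0); [left|right].
  apply: integ_setU => //.
  - have : integ `]-oo, 0] ((g \_ `[0, +oo[) \o -%R) by exact: integT.
    apply: eq_integrable => // x /set_mem /=; rewrite in_itv/= => x0.
    rewrite ler0_norm// /patch mem_set//= in_itv/= andbT oppr_ge0//.
  - apply: eq_integrable gi => // x /set_mem /=; rewrite in_itv/= andbT => x0.
    by rewrite ger0_norm.
split=> //; rewrite Rint_even//; last by move=> x; rewrite normrN.
congr (_ * _); apply: eq_Rintegral => x /set_mem /=; rewrite in_itv/= andbT => x0.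
by rewrite ger0_norm.
Qed.

Lemma Rint_fold g : integ setT g ->
  integ `[0, +oo[ (fun x => g x + g (- x)) /\
  \int[mu]_x g x = \int[mu]_(x in `[0, +oo[) (g x + g (- x)).
Proof.
move=> gi; have [go Eo] := ray_opp (integT (measurable_itv `]-oo, 0]) gi).
have gr : integ `[0, +oo[ g by exact: integT.
split; first exact: integD.
by rewrite Rint_setT_split// RintegralD// -Eo addrC.
Qed.

Lemma measurable_sg : measurable_fun setT (@Num.sg R).
Proof.
have -> : @Num.sg R = (fun x => \1_`]0, +oo[ x - \1_`]-oo, 0[ x).
  apply/funext => x; rewrite !indicE !mem_setE /= !in_itv/= andbT.
  case: (ltgtP x 0) => [x0|x0|->]; first by rewrite ltr0_sg// sub0r.
    by rewrite gtr0_sg// subr0.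
  by rewrite sgr0 subrr.
by apply: measurable_funB; exact: measurable_indic.
Qed.

Lemma sqint_sg g : sqint g -> sqint (fun x => Num.sg x * g x).
Proof.
apply: (@sqintMb _ _ _ 1); first exact: measurable_sg.
by move=> x; rewrite normr_sg; case: (x != 0).
Qed.

(** Folding the integrals onto the half-line leaves one integration by parts there, with w(x) + w(-
    x) as a factor. Its boundary term at 0 is what the point interaction has to match. *)
Lemma even_IBP p p' w : acon `[0, +oo[ p p' -> sqint (fun x => p `|x|) ->
  sqint (fun x => p' `|x|) -> realH1 w ->
  ip (wd w) (fun x => Num.sg x * p `|x|) = - 2 * w 0 * p 0 - ip w (fun x => p' `|x|).
Proof.
move=> H sp sp' Hw; have sw := realH1_sq Hw; have sw' := wder_sq Hw.
have ssp := sqint_sg sp.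
have sub : `[0, +oo[%classic `<=` [set x : R | True] by [].
have HW : acon `[0, +oo[ (fun x => w x + w (- x)) (fun x => wd w x + - wd w (- x)).
  apply: (acon_sub sub); apply: aconD; first exact: realH1_acon.
  by have := acon_opp (realH1_acon Hw); apply: acon_sub.
have HWp := aconM HW H.
have [i1 E1] := Rint_fold (sqint_mul sw' ssp).
have [i2 E2] := Rint_fold (sqint_mul sw sp').
have [i3 _] := Rint_fold (sqint_mul sw sp).
have ray x : x \in `[0, +oo[%classic -> 0 <= x.
  by move=> /set_mem; rewrite /= in_itv/= andbT.
have F1 : {in `[0, +oo[%classic, (fun x => wd w x * (Num.sg x * p `|x|) + wd w (- x) * (Num.sg (- x) * p `|- x|))
    =1 (fun x => Num.sg x * (p x * (wd w x + - wd w (- x))))}.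
  by move=> x /ray x0; rewrite sgrN normrN ger0_norm//; ring.
have F2 : {in `[0, +oo[%classic, (fun x => w x * p' `|x| + w (- x) * p' `|- x|)
    =1 (fun x => (w x + w (- x)) * p' x)}.
  by move=> x /ray x0; rewrite normrN ger0_norm//; ring.
have i3' : integ `[0, +oo[ (fun x => (w x + w (- x)) * p x).
  apply: eq_integrable i3 => // x /ray x0 /=.
  by rewrite normrN ger0_norm//; congr EFin; ring.
have i2' : integ `[0, +oo[ (fun x => (w x + w (- x)) * p' x).
  by apply: eq_integrable i2 => // x xi /=; rewrite F2.
have mq : measurable_fun (`[0, +oo[%classic : set (measurableTypeR R)) (fun x => p x * (wd w x + - wd w (- x))).
  have : measurable_fun setT (fun x => p `|x| * (wd w x + - wd w (- x))).
    have [m1 _] := sp; have [m2 _] := sw'.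
    have [m3 _] := sqint_isom (@isom_opp R) sw'.
    apply: measurable_funM => //; apply: measurable_funD => //.
    exact: measurableT_comp m3.
  move=> m; have {}m : measurable_fun (`[0, +oo[%classic : set (measurableTypeR R))
      (fun x => p `|x| * (wd w x + - wd w (- x))).
    exact: (measurable_funS measurableT (@subsetT _ _) m).
  by apply: eq_measurable_fun m => x /ray x0; rewrite ger0_norm.
have i1' : integ `[0, +oo[ (fun x => p x * (wd w x + - wd w (- x))).
  apply: (@integ_le _ _ _ (fun x => Num.norm (wd w x * p `|x|) + Num.norm (wd w (- x) * p `|- x|))) => //.
    apply: integD => //; apply: integ_norm => //; first exact: integT (sqint_mul sw' sp).
    by have := sqint_mul (sqint_isom (@isom_opp R) sw') (sqint_isom (@isom_opp R) sp); exact: integT.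
  move=> x /=; rewrite in_itv/= andbT => x0; rewrite normrN (ger0_norm x0).
  have -> : p x * (wd w x + - wd w (- x)) = wd w x * p x - wd w (- x) * p x by ring.
  exact: ler_normB.
have -> : ip (wd w) (fun x => Num.sg x * p `|x|) =
    \int[mu]_(x in `[0, +oo[) (p x * (wd w x + - wd w (- x))).
  rewrite ipE E1; etransitivity; first by apply: eq_Rintegral => x xi; exact: (F1 x xi).
  apply: Rint_ae_eq => //.
    by apply: measurable_funM => //; exact: measurable_funS measurable_sg.
  apply: ae_mono (ae_neq 0) => x x0 /=; rewrite in_itv/= andbT => x0'.
  by rewrite gtr0_sg ?mul1r// lt_def x0.
have -> : ip w (fun x => p' `|x|) = \int[mu]_(x in `[0, +oo[) ((w x + w (- x)) * p' x).
  by rewrite ipE E2; apply: eq_Rintegral => x xi; exact: (F2 x xi).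
have iG : integ `[0, +oo[ (fun x => (w x + w (- x)) * p' x + p x * (wd w x + - wd w (- x))).
  exact: integD.
have := acon_Rint_ray HWp i3' iG.
rewrite RintegralD// oppr0 => E.
have aux (X Y c d : R) : X + Y = - ((c + c) * d) -> Y = - 2 * c * d - X by move=> e; lra.
exact: aux E.
Qed.

End EvenExtension.

(** * Domain elements and passage to H^1 test functions *)

Section Domain.
Variable R : realType.
Notation mu := (@lebesgue_measure R).
Local Notation integ D f := (mu.-integrable D (EFin \o f)).
Implicit Types (f g h p w phi psi : R -> R) (a b c e q x : R) (A : set R).

Lemma ip_le_abs f g : sqint f -> sqint g -> (forall x, `|f x| <= `|g x|) -> ip f f <= ip g g.
Proof.
move=> sf sg fg; rewrite !ipE; apply: le_Rintegral => //; [exact: sqint_mul..|].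
move=> x _; rewrite -!expr2 -(real_normK (num_real (f x))) -(real_normK (num_real (g x))).
by rewrite ler_sqr// nnegrE.
Qed.

Lemma ip_IBP f f' g g' : acon setT f f' -> acon setT g g' -> sqint f -> sqint f' ->
  sqint g -> sqint g' -> ip f' g = - ip f g'.
Proof.
move=> Hf Hg sf sf' sg sg'.
have := acon_RintT (aconM Hf Hg) (sqint_mul sf sg) (integD measurableT (sqint_mul sf sg') (sqint_mul sg sf')).
rewrite RintegralD//; [|exact: sqint_mul..].
by rewrite -!ipE (ipC f') => E; apply/eqP; rewrite -addr_eq0 addrC E.
Qed.

Lemma expRN_le_inv (y : R) : 0 < y -> expR (- y) <= y^-1.
Proof.
move=> y0; rewrite expRN lef_pV2 ?posrE ?expR_gt0//.
by apply: le_trans (expR_ge1Dx y); rewrite lerDr.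
Qed.

Lemma is_derive_expRZ (k y : R) : is_derive y (1 : R) (fun y => expR (k * y)) (k * expR (k * y)).
Proof.
have d1 : is_derive y (1 : R) (fun y => k * y) k.
  by rewrite -[X in is_derive _ _ _ X]mulr1; exact: is_deriveZ.
by have := is_derive1_comp (is_derive_expR (k * y)) d1; rewrite mulrC.
Qed.

Lemma continuous_expRZ (k : R) : continuous (fun y => expR (k * y)).
Proof. by move=> y; have := is_derive_expRZ k y; exact: is_derive_continuous. Qed.

Lemma integ_exp_ray (k : R) : 0 < k -> integ `[0, +oo[ (fun y => expR (- k * y)).
Proof.
move=> k0; have mE : measurable_fun setT (fun y : R => expR (- k * y)).
  by apply: continuous_measurable; exact: continuous_expRZ.
have [] // := @bounded_integ_ray _ (fun y => expR (- k * y)) 0 k^-1.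
- exact: measurable_funS mE.
- by move=> b; apply: continuous_integ_itv; exact: continuous_expRZ.
move=> n; rewrite add0r.
have H : acon setT (fun y => - k^-1 * expR (- k * y)) (fun y => - k^-1 * (- k * expR (- k * y))).
  apply: acon_derive => x _; first by apply: is_deriveZ; exact: is_derive_expRZ.
  by apply: cvgM; [exact: cvg_cst|apply: cvgM; [exact: cvg_cst|exact: continuous_expRZ]].
have [//|_ E] := H 0 n%:R _ (@subsetT _ _).
have -> : \int[mu]_(x in `[0, n%:R]) expR (- k * x) =
   \int[mu]_(x in `[0, n%:R]) (- k^-1 * (- k * expR (- k * x))).
  by apply: eq_Rintegral => x _; rewrite mulrA mulrNN mulVf ?mul1r// gt_eqF.
rewrite -E mulr0 expR0 mulr1 opprK gerDr mulNr oppr_le0 mulr_ge0 ?expR_ge0//.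
by rewrite invr_ge0 ltW.
Qed.

Lemma continuous_comp_norm f : continuous f -> continuous (fun x => f `|x|).
Proof. by move=> cf x; apply: continuous_comp; [exact: norm_continuous|exact: cf]. Qed.

Lemma sqint_exp (k : R) : 0 < k -> sqint (fun x => expR (- k * `|x|)).
Proof.
move=> k0; split.
  apply: continuous_measurable; apply: (@continuous_comp_norm (fun y => expR (- k * y))).
  exact: continuous_expRZ.
have k2 : 0 < 2 * k by rewrite mulr_gt0.
have [+ _] := even_integ (integ_exp_ray k2).
apply: eq_integrable => // x _ /=; congr EFin.
by rewrite expr2 -expRD; congr expR; ring.
Qed.

Lemma acon_shift f g c : acon setT f g -> sqint g -> acon setT (fun x => f (x + c)) (fun x => g (x + c)).
Proof.
move=> H sg a b ab _; have sgc := sqint_isom (isom_shift c) sg.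
split; first exact: sqint_itv.
have ab' : a + c <= b + c by rewrite lerD2r.
have [i ->] := H _ _ ab' (@subsetT _ _).
have mg : measurable_fun `[a + c, b + c] g by exact: integ_meas i.
have [mp ip] := integ_patch (measurable_itv _) i.
rewrite Rintegral_mkcond -(isom_Rint (isom_shift c) mp ip) [RHS]Rintegral_mkcond.
apply: eq_Rintegral => x _; rewrite /patch; congr (if _ then _ else _).
by rewrite !mem_setE/= !in_itv/= !lerD2r.
Qed.

Lemma acon_steklov f g e : acon setT f g -> sqint g ->
  acon setT (steklov f e) (steklov g e) /\ sqint (steklov g e).
Proof.
move=> H sg; have k1 := acon_shift e H sg; have k2 := acon_shift (- e) H sg.
have s1 := sqint_isom (isom_shift e) sg; have s2 := sqint_isom (isom_shift (- e)) sg.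
split.
  have := aconZ (2 * e)^-1 (aconB k1 k2).
  by apply: acon_eq => x _; rewrite /steklov mulrC.
have := sqintZ (2 * e)^-1 (sqintB s1 s2).
by rewrite (_ : (fun x => _) = steklov g e)//; apply/funext => x; rewrite /steklov /= mulrC.
Qed.

Lemma test_fun_realH1 A phi : test_fun A phi ->
  [/\ realH1 phi, acon setT phi (derive1 phi) & sqint (derive1 phi)].
Proof.
move=> t; have H := test_fun_acon t; have [_ c' _] := t.
have [M [M0 z1 z2]] := test_fun_support t.
have sq f : continuous f -> (forall x, ~ (- M <= x <= M) -> f x = 0) -> sqint f.
  move=> cf fz; split; first exact: continuous_measurable.
  apply: (@integ_support _ (fun x => f x ^+ 2) (- M) M).
    by apply: continuous_integ_itv => x; apply: cvgM; exact: cf.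
  by move=> x /fz ->; rewrite expr0n.
have cphi := acon_continuous H.
by split=> //; [apply: realH1I H _ _; exact: sq|exact: sq].
Qed.

Lemma ip_expR_IBP (N : R) w : 0 < N -> realH1 w ->
  ip (wd w) (fun x => Num.sg x * expR (- N * `|x|)) =
  - 2 * w 0 + N * ip w (fun x => expR (- N * `|x|)).
Proof.
move=> N0 Hw; have sE := sqint_exp N0.
have H : acon `[0, +oo[ (fun y => expR (- N * y)) (fun y => - N * expR (- N * y)).
  apply: acon_derive => x _; first exact: is_derive_expRZ.
  by apply: cvgM; [exact: cvg_cst|exact: continuous_expRZ].
rewrite (even_IBP H sE (sqintZ _ sE) Hw) ipZr//; last exact: realH1_sq.
by rewrite mulr0 expR0 mulr1; ring.
Qed.

(* An element of the domain near phi: a Steklov mean of phi, whose derivative is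
   absolutely continuous, plus a small multiple of exp (- N |x|) / N that
   creates the jump required at the origin. *)
Section DomainElement.
Variables (q e N : R) (Phi phi phi' : R -> R).
Hypotheses (q2 : `|q| <= 2^-1) (e0 : 0 < e) (N1 : 1 <= N).
Hypotheses (HPhi : acon setT Phi phi) (Hphi : acon setT phi phi').
Hypotheses (sphi : sqint phi) (sphi' : sqint phi').

Let N0 : 0 < N. Proof. exact: lt_le_trans ltr01 N1. Qed.

Definition dom_exp x := expR (- N * `|x|).
(** The solution c of c = q (s + c / N), where s is the Steklov mean at 0. The jump condition is
    implicit because the corrector also changes the value at 0. *)
Definition dom_coef := q * steklov Phi e 0 / (1 - q / N).
Definition dom_fun x := steklov Phi e x + dom_coef * (N^-1 * dom_exp x).
Definition dom_der x := steklov phi e x - dom_coef * (Num.sg x * dom_exp x).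
Definition dom_op x := - (steklov phi' e x + dom_coef * (N * dom_exp x)).

Lemma dom_exp_sq : sqint dom_exp.
Proof. exact: sqint_exp N0. Qed.

Lemma dom_sg_exp_sq : sqint (fun x => Num.sg x * dom_exp x).
Proof. exact: sqint_sg dom_exp_sq. Qed.

Lemma dom_fun_acon : acon setT dom_fun dom_der.
Proof.
have [H1 _] := acon_steklov e HPhi sphi.
have H : acon `[0, +oo[ (fun y => N^-1 * expR (- N * y)) (fun y => - expR (- N * y)).
  have : acon `[0, +oo[ (fun y => expR (- N * y)) (fun y => - N * expR (- N * y)).
    apply: acon_derive => x _; first exact: is_derive_expRZ.
    by apply: cvgM; [exact: cvg_cst|exact: continuous_expRZ].
  move/(aconZ N^-1); apply: acon_eq => // x _.
  by rewrite mulrA mulrN mulVf ?mulN1r// gt_eqF ?N0.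
have := aconD H1 (aconZ dom_coef (acon_even H)).
by apply: acon_eq => // x _; rewrite /dom_der mulrN mulrN.
Qed.

Lemma dom_fun_sq : [/\ sqint dom_fun, sqint dom_der & sqint dom_op].
Proof.
have [s1 _] := steklov_bound e0 HPhi sphi; have [s2 _] := steklov_bound e0 Hphi sphi'.
have [_ s3] := acon_steklov e Hphi sphi'.
have sE := dom_exp_sq; have sg := dom_sg_exp_sq.
split; [apply: sqintD s1 _|apply: sqintB s2 _|apply: sqintN; apply: sqintD s3 _].
- by apply: sqintZ; exact: sqintZ.
- exact: sqintZ.
- by apply: sqintZ; exact: sqintZ.
Qed.

Lemma dom_fun_H1 : realH1 dom_fun.
Proof. by have [? ? ?] := dom_fun_sq; exact: realH1I dom_fun_acon _ _. Qed.

(** The origin of the condition [|q|] <= 1/2: the coefficient stays bounded uniformly in N. *)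
Lemma dom_denom : 2^-1 <= 1 - q / N.
Proof.
have qN : `|q / N| <= 2^-1.
  rewrite normrM normfV (gtr0_norm N0) ler_pdivrMr; last exact: N0.
  by apply: le_trans q2 _; rewrite ler_peMr.
by move: qN; rewrite ler_norml => /andP[h1 h2]; lra.
Qed.

Lemma dom_coefE : dom_coef = q * dom_fun 0.
Proof.
have N00 : N != 0 by rewrite gt_eqF ?N0.
have D0 : N - q != 0.
  have -> : N - q = N * (1 - q / N) by field.
  by rewrite mulf_neq0// gt_eqF//; have := dom_denom; lra.
rewrite /dom_fun /dom_exp normr0 mulr0 expR0 mulr1 /dom_coef; field.
by rewrite N00.
Qed.

Lemma dom_coef_le : `|dom_coef| <= `|steklov Phi e 0|.
Proof.
have h3 := dom_denom.
have h4 : 0 < 1 - q / N by lra.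
rewrite /dom_coef normrM normfV (gtr0_norm h4) ler_pdivrMr//.
by rewrite normrM mulrC ler_wpM2l//; apply: le_trans q2 _.
Qed.

(** Integrating the corrector by parts leaves a multiple of w(0), which [dom_coefE] identifies with
    the point term of the form. *)
Lemma dom_fun_weak w : realH1 w ->
  ip w dom_op = ip (wd w) dom_der - 2 * q * w 0 * dom_fun 0.
Proof.
move=> Hw; have sw := realH1_sq Hw; have sw' := wder_sq Hw.
have [s2 _] := steklov_bound e0 Hphi sphi'.
have [H2 s3] := acon_steklov e Hphi sphi'.
have sE := dom_exp_sq; have sg := dom_sg_exp_sq.
have I1 := ip_expR_IBP N0 Hw; have I2 := ip_IBP (realH1_acon Hw) H2 sw sw' s2 s3.
have zE := sqintZ N sE; have zE' := sqintZ dom_coef zE.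
rewrite /dom_op /dom_der (ipC w) ipNl//; last exact: sqintD.
rewrite ipDl// ipZl// ipZl// ipBr//; last exact: sqintZ.
rewrite ipZr// /dom_exp I1 I2 (ipC w) (ipC w).
have -> : 2 * q * w 0 * dom_fun 0 = 2 * w 0 * dom_coef by rewrite dom_coefE; ring.
by rewrite /dom_exp; ring.
Qed.

Lemma dom_delta_op : delta_op q dom_fun dom_op.
Proof.
have H := dom_fun_acon; have [sf sd so] := dom_fun_sq.
have [H2 s3] := acon_steklov e Hphi sphi'.
have [s2 _] := steklov_bound e0 Hphi sphi'.
have sE := dom_exp_sq; have sg := dom_sg_exp_sq.
have cst := acon_continuous H2.
have cE : continuous dom_exp.
  by apply: (@continuous_comp_norm (fun y => expR (- N * y))); exact: continuous_expRZ.
have E0 : dom_exp 0 = 1 by rewrite /dom_exp normr0 mulr0 expR0.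
(* The derivative with the sign frozen to s: continuous everywhere, it gives continuity off the
   origin and the one-sided limits at 0. *)
pose dp s x := steklov phi e x - dom_coef * (s * dom_exp x).
have cdp s : continuous (dp s).
  move=> x; apply: cvgB; first exact: cst.
  by apply: cvgM; [exact: cvg_cst|apply: cvgM; [exact: cvg_cst|exact: cE]].
split=> //; first exact: acon_continuous H.
exists dom_der; split=> //.
- move=> x /=; rewrite inE /= => /eqP x0.
  have [xn|xp] := ltP x 0.
    have := cdp (- 1) x; rewrite /continuous_at /dp /dom_der ltr0_sg//.
    apply: cvg_trans; apply: near_eq_cvg; near=> y.
    have y0 : y < 0 by near: y; exact: lt_nbhsl.
    by rewrite ltr0_sg.
  have {}xp : 0 < x by rewrite lt_def x0.
  have := cdp 1 x; rewrite /continuous_at /dp /dom_der gtr0_sg//.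
  apply: cvg_trans; apply: near_eq_cvg; near=> y.
  have y0 : 0 < y by near: y; exact: lt_nbhsr.
  by rewrite gtr0_sg.
- exact: acon_weak.
(* Test functions supported away from the origin vanish at 0, which removes the point term. *)
- move=> p tp; have [Hp ap sp'] := test_fun_realH1 tp.
  have sp := realH1_sq Hp; have swp := wder_sq Hp.
  have p0 : p 0 = 0.
    by have [_ _ [K [_ K0 Kz]]] := tp; apply: Kz => /K0 /= /(_ erefl).
  rewrite -!ipE ipNl// opprK (ipC dom_op) (dom_fun_weak Hp) p0 mulr0 mul0r subr0.
  by rewrite (ip_wder ap sp sp' sd) ipC.
exists (dp (- 1) 0), (dp 1 0); split.
- have : dp (- 1) x @[x --> 0^'-] --> dp (- 1) 0 by apply: cvg_at_left_filter; exact: cdp.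
  apply: cvg_trans; apply: near_eq_cvg; near=> y.
  by rewrite /dom_der /dp ltr0_sg.
- have : dp 1 x @[x --> 0^'+] --> dp 1 0 by apply: cvg_at_right_filter; exact: cdp.
  apply: cvg_trans; apply: near_eq_cvg; near=> y.
  by rewrite /dom_der /dp gtr0_sg.
- by rewrite /dp E0 -mulrA -dom_coefE; ring.
Unshelve. all: by end_near. Qed.

Let S := ip phi phi + ip phi' phi'.
Let X := ip (fun x : R => expR (- 1 * `|x|)) (fun x => expR (- 1 * `|x|)).

Lemma dom_coef_sq : dom_coef ^+ 2 <= 2 * S.
Proof.
have [s1 b1] := steklov_bound e0 HPhi sphi; have [s2 b2] := steklov_bound e0 Hphi sphi'.
have [H1 _] := acon_steklov e HPhi sphi.
have := acon_sup 0 H1 s1 s2; rewrite -(real_normK (num_real (steklov _ _ _))).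
rewrite -(real_normK (num_real dom_coef)).
have := dom_coef_le; rewrite -ler_sqr ?nnegrE//.
have : 2 * (ip (steklov Phi e) (steklov Phi e) + ip (steklov phi e) (steklov phi e)) <= 2 * S.
  by rewrite ler_pM2l// lerD.
by move=> h1 h2 h3; exact: le_trans h2 (le_trans h3 h1).
Qed.

Lemma dom_corr_bound f : sqint f -> (forall x, `|f x| <= dom_exp x) ->
  ip (fun x => dom_coef * f x) (fun x => dom_coef * f x) <= 2 * S * X.
Proof.
move=> sf fE; rewrite ipZl//; last exact: sqintZ.
rewrite ipZr// mulrA -expr2.
apply: ler_pM; [exact: sqr_ge0|exact: ip_ge0|exact: dom_coef_sq|].
apply: ip_le_abs => //; first exact: sqint_exp.
move=> x; rewrite (ger0_norm (expR_ge0 _)); apply: le_trans (fE x) _.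
by rewrite /dom_exp ler_expR !mulNr lerN2 ler_wpM2r.
Qed.

(** Neither e nor N enters the bound: Steklov means contract L^2, and for N >= 1 the function exp (-
    N |x|) is at most its value at N = 1. *)
Lemma dom_bound : ip dom_fun dom_fun <= 2 * (S + 2 * S * X) /\
  ip dom_der dom_der <= 2 * (S + 2 * S * X).
Proof.
have [s1 b1] := steklov_bound e0 HPhi sphi; have [s2 b2] := steklov_bound e0 Hphi sphi'.
have sE := dom_exp_sq; have sg := dom_sg_exp_sq.
have E1 x : `|dom_exp x| <= dom_exp x by rewrite ger0_norm// expR_ge0.
split.
  apply: le_trans (ip_sqD s1 _) _; first by apply: sqintZ; exact: sqintZ.
  rewrite ler_pM2l//; apply: lerD.
    by apply: le_trans b1 _; rewrite lerDl ip_ge0.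
  apply: dom_corr_bound => [|x]; first exact: sqintZ.
  rewrite normrM; apply: le_trans (E1 x); rewrite ler_piMl// gtr0_norm ?invr_gt0//.
  by rewrite invf_le1.
have -> : dom_der = fun x => steklov phi e x + dom_coef * (- (Num.sg x * dom_exp x)).
  by apply/funext => x; rewrite /dom_der mulrN.
apply: le_trans (ip_sqD s2 _) _; first by apply: sqintZ; exact: sqintN.
rewrite ler_pM2l//; apply: lerD.
  by apply: le_trans b2 _; rewrite lerDr ip_ge0.
apply: dom_corr_bound => [|x]; first exact: sqintN.
rewrite normrN normrM; apply: le_trans (E1 x); rewrite ler_piMl// normr_sg.
by case: (x != 0).
Qed.

End DomainElement.

Lemma invS_cvg0 : (n.+1%:R^-1 : R) @[n --> \oo] --> (0 : R).
Proof.
apply/cvgr0Pnorm_lt => r r0; near=> n.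
rewrite gtr0_norm ?invr_gt0//.
by near: n; exact: (@near_infty_natSinv_lt R (PosNum r0)).
Unshelve. all: by end_near. Qed.

Lemma bounded_cvg0 (u v : nat -> R) K : (forall n, `|u n| <= K) -> v n @[n --> \oo] --> (0 : R) ->
  u n * v n @[n --> \oo] --> (0 : R).
Proof.
move=> uK v0; apply/cvgr0Pnorm_lt => r r0.
have K0 : 0 <= K := le_trans (normr_ge0 _) (uK 0%N).
have K1 : 0 < K + 1 by lra.
have rK : 0 < r / (K + 1) by rewrite divr_gt0.
move/cvgr0Pnorm_lt : v0 => /(_ _ rK); apply: filterS => n; rewrite ltr_pdivlMr// => H.
rewrite normrM mulrC; apply: le_lt_trans H; rewrite ler_wpM2l//.
by apply: le_trans (uK n) _; lra.
Qed.

(** Built with e = 1 / (n + 1) and N = n + 1. Convergence is weak in L^2, from boundedness and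
    convergence almost everywhere of the functions and their derivatives; with the values at 0 this
    suffices for every term of an energy form. *)
Lemma domain_approx q phi : `|q| <= 2^-1 -> realH1 phi ->
  exists psi g : nat -> R -> R,
  [/\ forall n, delta_op q (psi n) (g n) /\ realH1 (psi n),
      exists K, forall n, n1 (psi n) <= K,
      forall w n, realH1 w -> ip w (g n) = ip (wd w) (wd (psi n)) - 2 * q * w 0 * psi n 0 &
      forall w, sqint w -> [/\ ip w (psi n) @[n --> \oo] --> ip w phi,
        ip w (wd (psi n)) @[n --> \oo] --> ip w (wd phi) &
        psi n 0 @[n --> \oo] --> phi 0]].
Proof.
move=> q2 Hp; have sp := realH1_sq Hp; have sp' := wder_sq Hp; have ap := realH1_acon Hp.
have [Phi [HPhi dPhi]] := continuous_primitive (realH1_cont Hp).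
pose e n : R := n.+1%:R^-1; pose N n : R := n.+1%:R.
have e0 n : 0 < e n by rewrite invr_gt0.
have N1 n : 1 <= N n by rewrite ler1n.
pose psi n := dom_fun q (e n) (N n) Phi.
pose d n := dom_der q (e n) (N n) Phi phi.
pose g n := dom_op q (e n) (N n) Phi (wd phi).
have Hd n : acon setT (psi n) (d n) by exact: dom_fun_acon.
have Hs n : [/\ sqint (psi n), sqint (d n) & sqint (g n)] by apply: dom_fun_sq ap _ _.
have wpsi w n : sqint w -> ip w (wd (psi n)) = ip w (d n).
  by move=> sw; have [s1 s2 _] := Hs n; rewrite ipC (ip_wder (Hd n)) 1?ipC.
have HB n := dom_bound q2 (e0 n) (N1 n) HPhi ap sp sp'.
set K := 2 * _ in HB.
have cK n : `|dom_coef q (e n) (N n) Phi| <= Num.sqrt (2 * (ip phi phi + ip (wd phi) (wd phi))).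
  by rewrite -sqrtr_sqr ler_wsqrtr// (dom_coef_sq q2 (e0 n) (N1 n) HPhi ap sp sp').
have Ecvg x : (N n)^-1 * dom_exp (N n) x @[n --> \oo] --> (0 : R).
  apply: (@squeeze_cvgr _ _ _ _ (fun=> 0) e); [|exact: cvg_cst|exact: invS_cvg0].
  apply: nearW => n; rewrite mulr_ge0 ?expR_ge0 ?invr_ge0//=.
  rewrite ler_piMr ?invr_ge0// /dom_exp -expR0 ler_expR mulNr oppr_le0 mulr_ge0//.
have psi_cvg x : psi n x @[n --> \oo] --> phi x.
  rewrite -[phi x]addr0; apply: cvgD; first exact: steklov_cvg.
  exact: bounded_cvg0 cK (Ecvg x).
have d_cvg : {ae mu, forall x, d n x @[n --> \oo] --> wd phi x}.
  have A1 := acon_ae_derive sp'.1 ap.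
  apply: ae_mono (ae_and A1 (ae_neq 0)) => x [dx x0].
  rewrite -[wd phi x]subr0; apply: cvgB; first exact: steklov_cvg.
  apply: bounded_cvg0 cK _; rewrite -[X in _ --> X](mulr0 (Num.sg x)).
  apply: cvgM; first exact: cvg_cst.
  apply: (@squeeze_cvgr _ _ _ _ (fun=> 0) (fun n => e n * `|x|^-1)); [|exact: cvg_cst|].
    apply: nearW => n; rewrite expR_ge0/= /dom_exp mulNr -invfM.
    by apply: expRN_le_inv; rewrite mulr_gt0 ?normr_gt0.
  rewrite -[X in _ --> X](mul0r `|x|^-1); apply: cvgM; [exact: invS_cvg0|exact: cvg_cst].
exists psi, g; split.
- by move=> n; split; [exact: (dom_delta_op q2 (e0 n) (N1 n) HPhi ap sp sp')|exact: (dom_fun_H1 q (e0 n) (N1 n) HPhi ap sp sp')].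
- exists (Num.sqrt (K + K)) => n; rewrite n1E ler_wsqrtr// hipE; have [b1 b2] := HB n.
  have [s1 s2 _] := Hs n.
  rewrite (ip_wder (Hd n) s1 s2 (wder_sq (realH1I (Hd n) s1 s2))) (wpsi _ _ s2).
  exact: lerD b1 b2.
- move=> w n Hw; rewrite wpsi; last exact: wder_sq.
  exact: (dom_fun_weak Phi q2 (e0 n) (N1 n) ap sp' Hw).
move=> w sw; split; last exact: psi_cvg.
- under eq_fun do rewrite ipC; rewrite ipC.
  have H1 n : sqint (psi n) by have [] := Hs n.
  have H2 n : ip (psi n) (psi n) <= K by have [] := HB n.
  have H3 : {ae mu, forall x, psi n x @[n --> \oo] --> phi x} by apply: aeW.
  exact: weak_cvg_ae H1 sp sw H2 H3.
- under eq_fun do rewrite wpsi// ipC; rewrite ipC.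
  have H1 n : sqint (d n) by have [] := Hs n.
  have H2 n : ip (d n) (d n) <= K by have [] := HB n.
  exact: weak_cvg_ae H1 sp' sw H2 d_cvg.
Qed.

(** For each n the mean value inequality bounds the first-order remainder by e [|s - t|], for s in a
    neighbourhood of t that depends on y and K but not on n. The estimate therefore survives the
    limit. *)
Lemma weak_limit_derive T B z y (psi : nat -> R -> R) phi K :
  bform B -> h1curve T z -> h1curve T y -> realH1 phi ->
  (forall n, realH1 (psi n)) -> (forall n, n1 (psi n) <= K) ->
  (forall w, realH1 w -> ip w (psi n) @[n --> \oo] --> ip w phi) ->
  (forall w, realH1 w -> B w (psi n) @[n --> \oo] --> B w phi) ->
  (forall n t, 0 < t < T -> is_derive t (1 : R) (fun s => ip (z s) (psi n)) (B (y t) (psi n))) ->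
  forall t, 0 < t < T -> is_derive t (1 : R) (fun s => ip (z s) phi) (B (y t) phi).
Proof.
move=> HB Hz Hy Hphi Hpsi psiK cz cB dn t t0T; have /andP[t0 tT] := t0T.
have [_ _ _ [M M0 BM]] := HB.
have K0 : 0 <= K := le_trans (n1_ge0 _) (psiK 0%N).
have tT' : 0 <= t <= T by rewrite !ltW.
apply/is_derive_epsP => e e0.
have MK0 : 0 < M * K + 1 by rewrite ltr_wpDl// mulr_ge0.
have eM : 0 < e / (M * K + 1) by rewrite divr_gt0.
have [Hyt /(_ _ eM) [d d0 Hd]] := Hy t tT'.
exists (Num.min d (Num.min t (T - t))); first by rewrite !lt_min d0 t0 subr_gt0 tT.
move=> s; rewrite !lt_min => /and3P[sd st sT].
have near z' : Num.min t s <= z' <= Num.max t s -> 0 < z' < T /\ `|z' - t| < d.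
  move=> hz; have tt u : 0 < u -> `|t - t| < u by rewrite subrr normr0.
  have h1 := minmax_dist (tt _ d0) sd hz; have h2 := minmax_dist (tt _ t0) st hz.
  have Tt0 : 0 < T - t by rewrite subr_gt0.
  have h3 := minmax_dist (tt _ Tt0) sT hz.
  by split=> //; move: h2 h3; rewrite !ltr_norml => /andP[h4 _] /andP[_ h5]; apply/andP; split; lra.
have step n : `|ip (z s) (psi n) - ip (z t) (psi n) - B (y t) (psi n) * (s - t)| <= e * `|s - t|.
  apply: (@is_derive_le_incr _ (fun s => ip (z s) (psi n)) (fun s => B (y s) (psi n))).
    by move=> z' /near[z0T _]; exact: dn.
  move=> z' /near [z0T zd].
  have z0T' : 0 <= z' <= T by case/andP : z0T => ? ?; rewrite !ltW.
  have Hyz := curve_H1 Hy z0T'.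
  rewrite -(bformBl HB)//; apply: le_trans (BM _ _ (realH1B Hyz Hyt) (Hpsi n)) _.
  have h := ltW (Hd z' z0T' zd); rewrite mulrCA.
  have MK : M * n1 (psi n) <= M * K + 1.
    by apply: le_trans (ler_wpM2l M0 (psiK n)) _; rewrite lerDl.
  have := ler_pM (n1_ge0 _) (mulr_ge0 M0 (n1_ge0 _)) h MK.
  by rewrite divfK// gt_eqF.
have [z0T _] : 0 < s < T /\ `|s - t| < d by apply: near; rewrite ge_min le_max lexx !orbT.
have Hzs : realH1 (z s) by apply: (curve_H1 Hz); case/andP : z0T => ? ?; rewrite !ltW.
have Hzt : realH1 (z t) by exact: (curve_H1 Hz).
have C : `|ip (z s) (psi n) - ip (z t) (psi n) - B (y t) (psi n) * (s - t)| @[n --> \oo] -->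
   `|ip (z s) phi - ip (z t) phi - B (y t) phi * (s - t)|.
  apply: cvg_norm; apply: cvgB; first by apply: cvgB; exact: cz.
  by apply: cvgM; [exact: cB|exact: cvg_cst].
by apply: (cvgr_to_le C); apply: nearW => n; exact: step.
Qed.

End Domain.

(** * The soliton *)

Section Profile.
Variable R : realType.
Implicit Types (f g : R -> R) (x y : R).

Lemma isD_eq f x (l m : R) : is_derive x (1 : R) f l -> l = m -> is_derive x (1 : R) f m.
Proof. by move=> ? <-. Qed.

Lemma isD_M f g x (f' g' : R) : is_derive x (1 : R) f f' -> is_derive x (1 : R) g g' ->
  is_derive x (1 : R) (fun x => f x * g x) (f x * g' + g x * f').
Proof. exact: is_deriveM. Qed.

Lemma isD_D f g x (f' g' : R) : is_derive x (1 : R) f f' -> is_derive x (1 : R) g g' ->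
  is_derive x (1 : R) (fun x => f x + g x) (f' + g').
Proof. exact: is_deriveD. Qed.

Lemma isD_B f g x (f' g' : R) : is_derive x (1 : R) f f' -> is_derive x (1 : R) g g' ->
  is_derive x (1 : R) (fun x => f x - g x) (f' - g').
Proof. exact: is_deriveB. Qed.

Lemma isD_Z f x (k f' : R) : is_derive x (1 : R) f f' ->
  is_derive x (1 : R) (fun x => k * f x) (k * f').
Proof. exact: is_deriveZ. Qed.

Lemma isD_comp f g x (f' g' : R) : is_derive x (1 : R) g g' -> is_derive (g x) (1 : R) f f' ->
  is_derive x (1 : R) (fun x => f (g x)) (f' * g').
Proof. by move=> dg df; exact: is_derive1_comp. Qed.

Lemma isD_id x : is_derive x (1 : R) (fun x => x) (1 : R).
Proof. exact: is_derive_id. Qed.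

Lemma isD_cst (k x : R) : is_derive x (1 : R) (fun=> k) (0 : R).
Proof. exact: is_derive_cst. Qed.

Lemma isD_V f x (f' : R) : is_derive x (1 : R) f f' -> f x != 0 ->
  is_derive x (1 : R) (fun x => (f x)^-1) (- (f x) ^- 2 * f').
Proof. by move=> d f0; exact: is_deriveV. Qed.

Lemma normrM4 (c1 c2 c3 c4 : R) : `|c1 * (c2 * (c3 * c4))| = `|c1| * (`|c2| * (`|c3| * `|c4|)).
Proof. by rewrite !normrM. Qed.

Definition th y : R := (expR y - expR (- y)) / (expR y + expR (- y)).

Lemma cosh2_gt0 y : 0 < expR y + expR (- y).
Proof. by rewrite addr_gt0// expR_gt0. Qed.

Lemma sech_gt0 y : 0 < sech y.
Proof. by rewrite /sech divr_gt0// cosh2_gt0. Qed.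

Lemma th_sech y : th y ^+ 2 + sech y ^+ 2 = 1.
Proof.
rewrite /th /sech; have h := cosh2_gt0 y.
have e : expR (- y) = (expR y)^-1 by rewrite expRN.
have E0 := expR_gt0 y.
have e1 : expR y * expR (- y) = 1 by rewrite e mulfV// gt_eqF.
move: h e1; move: (expR y) (expR (- y)) => p r h e1.
rewrite !exprMn exprVn -mulrDl; apply/eqP; rewrite -subr_eq0 -[X in _ - X](@mulfV _ ((p + r) ^+ 2)); last first.
  by rewrite expf_neq0// gt_eqF.
rewrite -mulrBl; have -> : (p - r) ^+ 2 + 2 ^+ 2 - (p + r) ^+ 2 = 4 * (1 - p * r) by ring.
by rewrite e1 subrr mulr0 mul0r.
Qed.

Lemma th_le1 y : `|th y| <= 1.
Proof.
rewrite -(@ler_pXn2r _ 2)// ?nnegrE// expr1n real_normK ?num_real//.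
by rewrite -(th_sech y) lerDl sqr_ge0.
Qed.

Lemma sech_le1 y : sech y <= 1.
Proof.
rewrite -(@ler_pXn2r _ 2)// ?nnegrE// ?(ltW (sech_gt0 _))// expr1n.
by rewrite -(th_sech y) lerDr sqr_ge0.
Qed.

Lemma sech_exp y : sech y <= 2 * expR (- y).
Proof.
rewrite /sech ler_wpM2l// [leRHS]expRN lef_pV2 ?posrE ?expR_gt0 ?cosh2_gt0//.
by rewrite lerDl expR_ge0.
Qed.

Lemma is_derive_cosh2 y : is_derive y (1 : R) (fun y => expR y + expR (- y)) (expR y - expR (- y)).
Proof.
have := isD_D (is_derive_expR y) (is_derive_expRZ (- 1) y).
rewrite mulN1r; under eq_fun do rewrite mulN1r.
by rewrite mulN1r.
Qed.

Lemma is_derive_sinh2 y : is_derive y (1 : R) (fun y => expR y - expR (- y)) (expR y + expR (- y)).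
Proof.
have := isD_B (is_derive_expR y) (is_derive_expRZ (- 1) y).
rewrite mulN1r opprK; under eq_fun do rewrite mulN1r.
by rewrite mulN1r.
Qed.

Lemma is_derive_sech y : is_derive y (1 : R) (@sech R) (- (sech y * th y)).
Proof.
have h := cosh2_gt0 y; have h0 : expR y + expR (- y) != 0 by rewrite gt_eqF.
have := isD_Z 2 (isD_V (is_derive_cosh2 y) h0).
move/isD_eq; apply; rewrite /sech /th; field.
by [].
Qed.

Lemma is_derive_th y : is_derive y (1 : R) th (sech y ^+ 2).
Proof.
have h := cosh2_gt0 y; have h0 : expR y + expR (- y) != 0 by rewrite gt_eqF.
have := isD_M (is_derive_sinh2 y) (isD_V (is_derive_cosh2 y) h0).
move/isD_eq; apply.
have -> : sech y ^+ 2 = 1 - th y ^+ 2 by rewrite -(th_sech y) addrC addKr.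
by rewrite /th; field.
Qed.

Lemma th_artanh (tau : R) : `|tau| < 1 -> th (artanh tau) = tau.
Proof.
rewrite ltr_norml => /andP[t1 t2].
have p1 : 0 < 1 + tau by lra.
have p2 : 0 < 1 - tau by lra.
have pd : 0 < (1 + tau) / (1 - tau) by rewrite divr_gt0.
set a := artanh tau.
have E2 : expR a * expR a = (1 + tau) / (1 - tau).
  by rewrite -expRD -splitr lnK.
have E1 : expR (- a) * expR a = 1 by rewrite -expRD addNr expR0.
have E0 := expR_gt0 a.
rewrite /th -[LHS](@mulfK _ (expR a)); last by rewrite gt_eqF.
have -> : (expR a - expR (- a)) / (expR a + expR (- a)) * expR a / expR a =
  (expR a * expR a - expR (- a) * expR a) / (expR a * expR a + expR (- a) * expR a).
  have h := cosh2_gt0 a; field.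
  by rewrite !gt_eqF// -mulrDl mulr_gt0.
rewrite E1 E2; field; apply/andP; split; lra.
Qed.

Lemma expRN_artanh (tau : R) : `|tau| <= 20^-1 -> expR (- artanh tau) <= 2.
Proof.
rewrite ler_norml => /andP[t1 t2].
have p1 : 0 < 1 + tau by lra.
have p2 : 0 < 1 - tau by lra.
have pd : 0 < (1 + tau) / (1 - tau) by rewrite divr_gt0.
rewrite -(@ler_pXn2r _ 2)// ?nnegrE ?expR_ge0// expr2 -expRD.
rewrite -opprD -splitr expRN lnK ?posrE// invf_div ler_pdivrMr//; lra.
Qed.

Lemma is_derive_artanh (tau : R) : `|tau| < 1 -> is_derive tau (1 : R) (@artanh R) (1 - tau ^+ 2)^-1.
Proof.
rewrite ltr_norml => /andP[t1 t2].
have p1 : 0 < 1 + tau by lra.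
have p2 : 0 < 1 - tau by lra.
have pd : 0 < (1 + tau) / (1 - tau) by rewrite divr_gt0.
have p20 : 1 - tau != 0 by rewrite gt_eqF.
have d1 : is_derive tau (1 : R) (fun y => (1 + y) / (1 - y)) (2 / (1 - tau) ^+ 2).
  have := isD_M (isD_D (isD_cst 1 tau) (isD_id tau)) (isD_V (isD_B (isD_cst 1 tau) (isD_id tau)) p20).
  by move/isD_eq; apply; field.
have := isD_Z 2^-1 (isD_comp d1 (is_derive1_ln pd)).
rewrite /artanh; under eq_fun do rewrite mulrC.
move/isD_eq; apply; field.
have -> : 1 - tau ^+ 2 = (1 - tau) * (1 + tau) by ring.
by rewrite mulf_neq0 ?p20 ?gt_eqF.
Qed.

End Profile.

(** * The soliton and its derivative in lam on the half-line *)

Section Soliton.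
Variable R : realType.
Implicit Types (f g w phi : R -> R) (x y : R).
Variables lam q : R.
Hypotheses (lam0 : 0 < lam) (qlam : `|q| <= 20^-1 * lam).

(* On y >= 0 the soliton is vp and its derivative in lam is dp, where
   sT y = tanh (lam y + artanh (q / lam)). *)
Definition sS y := sech (lam * y + artanh (q / lam)).
Definition sT y := th (lam * y + artanh (q / lam)).

(** Minus the derivative of artanh (q / lam) in lam, so that y - [skap] is the derivative of the
    argument lam y + artanh (q / lam). *)
Definition skap := q / (lam ^+ 2 - q ^+ 2).
Definition vp y := lam * sS y.
Definition vp' y := - lam ^+ 2 * (sS y * sT y).
(** The right-hand side of the profile equation, that is, L_- v = 0 off the origin. [dp''] below is
    this equation differentiated in lam, that is, L_+ d_lam v = - lam v. *)
Definition vp'' y := lam ^+ 2 * vp y - 2 * vp y ^+ 3.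
Definition dp y := sS y * (1 - lam * (sT y * (y - skap))).
Definition dp' y := - 2 * lam * (sS y * sT y) +
  lam ^+ 2 * (sS y * ((y - skap) * (sT y * sT y - sS y * sS y))).
Definition dp'' y := lam ^+ 2 * dp y - 6 * vp y ^+ 2 * dp y + 2 * lam * vp y.

Lemma tau_le : `|q / lam| <= 20^-1.
Proof. by rewrite normrM normfV (gtr0_norm lam0) ler_pdivrMr. Qed.

Lemma tau_lt1 : `|q / lam| < 1.
Proof. by apply: le_lt_trans tau_le _; lra. Qed.

Lemma sTS y : sT y ^+ 2 = 1 - sS y ^+ 2.
Proof. by rewrite -(th_sech (lam * y + artanh (q / lam))) addrK. Qed.

Lemma sT0 : sT 0 = q / lam.
Proof. by rewrite /sT mulr0 add0r th_artanh// tau_lt1. Qed.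

Lemma is_derive_lin y : is_derive y (1 : R) (fun y => lam * y + artanh (q / lam)) lam.
Proof.
have := isD_D (isD_Z lam (isD_id y)) (isD_cst (artanh (q / lam)) y).
by rewrite mulr1 addr0.
Qed.

Lemma is_derive_sS y : is_derive y (1 : R) sS (- lam * (sS y * sT y)).
Proof.
have := isD_comp (is_derive_lin y) (is_derive_sech _).
by move/isD_eq; apply; rewrite /sS /sT; ring.
Qed.

Lemma is_derive_sT y : is_derive y (1 : R) sT (lam * sS y ^+ 2).
Proof.
have := isD_comp (is_derive_lin y) (is_derive_th _).
by move/isD_eq; apply; rewrite /sS mulrC.
Qed.

Lemma is_derive_vp y : is_derive y (1 : R) vp (vp' y).
Proof. by have := isD_Z lam (is_derive_sS y); move/isD_eq; apply; rewrite /vp'; ring. Qed.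

Lemma is_derive_vp' y : is_derive y (1 : R) vp' (vp'' y).
Proof.
have := isD_Z (- lam ^+ 2) (isD_M (is_derive_sS y) (is_derive_sT y)).
move/isD_eq; apply; rewrite /vp'' /vp.
have -> : - lam ^+ 2 * (sS y * (lam * sS y ^+ 2) + sT y * (- lam * (sS y * sT y))) =
  lam ^+ 3 * sS y * (sT y ^+ 2 - sS y ^+ 2) by ring.
by rewrite sTS; ring.
Qed.

Lemma is_derive_kap y : is_derive y (1 : R) (fun y => y - skap) (1 : R).
Proof. by have := isD_B (isD_id y) (isD_cst skap y); rewrite subr0. Qed.

Lemma is_derive_dp y : is_derive y (1 : R) dp (dp' y).
Proof.
have := isD_M (is_derive_sS y) (isD_B (isD_cst 1 y) (isD_Z lam (isD_M (is_derive_sT y) (is_derive_kap y)))).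
by move/isD_eq; apply; rewrite /dp'; ring.
Qed.

Lemma is_derive_dp' y : is_derive y (1 : R) dp' (dp'' y).
Proof.
have dS := is_derive_sS y; have dT := is_derive_sT y.
have d1 := isD_Z (- 2 * lam) (isD_M dS dT).
have d2 := isD_B (isD_M dT dT) (isD_M dS dS).
have := isD_D d1 (isD_Z (lam ^+ 2) (isD_M dS (isD_M (is_derive_kap y) d2))).
move/isD_eq; apply; rewrite /dp'' /dp /vp; have := sTS y.
move: (sT y) (sS y) => t s E.
have Et : t ^+ 2 = 1 - s ^+ 2 by [].
apply/eqP; rewrite -subr_eq0; apply/eqP.
set X := (X in X = 0); have -> : X = (t ^+ 2 - (1 - s ^+ 2)) * (lam ^+ 2 * s * (3 - lam * t * (y - skap))).
  rewrite /X; ring.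
by rewrite Et subrr mul0r.
Qed.

Lemma sech_decay y : 0 <= y -> sS y <= 4 * expR (- lam * y).
Proof.
move=> y0; apply: le_trans (sech_exp _) _.
rewrite opprD expRD mulNr mulrCA -[leRHS]mulrC ler_wpM2l ?expR_ge0//.
have := expRN_artanh tau_le; lra.
Qed.

Lemma sS_gt0 y : 0 < sS y. Proof. exact: sech_gt0. Qed.
Lemma sT_le1 y : `|sT y| <= 1. Proof. exact: th_le1. Qed.

Lemma lin_exp y : lam * y <= 2 * expR (2^-1 * (lam * y)).
Proof. by have := expR_ge1Dx (2^-1 * (lam * y)); lra. Qed.

Lemma skap_le : lam * `|skap| <= 10^-1.
Proof.
have t := tau_le; have lam00 : lam != 0 by rewrite gt_eqF.
have q2 : q ^+ 2 <= 400^-1 * lam ^+ 2.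
  rewrite -(real_normK (num_real q)); have := ler_pM (normr_ge0 q) (normr_ge0 q) qlam qlam.
  by rewrite -expr2; lra.
have l2 : 0 < lam ^+ 2 by rewrite exprn_gt0.
have d : 2^-1 * lam ^+ 2 <= lam ^+ 2 - q ^+ 2 by lra.
have d0 : 0 < lam ^+ 2 - q ^+ 2 by lra.
rewrite /skap normrM normfV (gtr0_norm d0) mulrA ler_pdivrMr//.
have : lam * `|q| <= lam * (20^-1 * lam) by rewrite ler_pM2l.
have -> : lam * (20^-1 * lam) = 20^-1 * lam ^+ 2 by ring.
lra.
Qed.

Lemma sol_exp_half y : 0 <= y -> expR (- lam * y) <= expR (- (2^-1 * lam) * y) /\
  expR (- lam * y) * expR (2^-1 * (lam * y)) = expR (- (2^-1 * lam) * y).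
Proof.
move=> y0; split; last by rewrite -expRD; congr expR; lra.
by rewrite ler_expR; have := mulr_ge0 (ltW lam0) y0; lra.
Qed.

(* [|y| exp (- lam y)] is absorbed by half of the exponential decay. *)
Lemma sS_lin_decay y : 0 <= y -> lam * (sS y * `|y - skap|) <= 10 * expR (- (2^-1 * lam) * y).
Proof.
move=> y0; have [h1 h2] := sol_exp_half y0.
have k := skap_le.
have : lam * `|y - skap| <= 2 * expR (2^-1 * (lam * y)) + 10^-1.
  have := ler_normB y skap; rewrite (ger0_norm y0) => h.
  have := ler_wpM2l (ltW lam0) h; have := lin_exp y; lra.
have s0 := ltW (sS_gt0 y).
move/(ler_wpM2l s0); rewrite mulrCA => h; apply: le_trans h _.
have e1 : 0 <= 2 * expR (2^-1 * (lam * y)) + 10^-1 by have := expR_ge0 (2^-1 * (lam * y)); lra.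
apply: le_trans (ler_wpM2r e1 (sech_decay y0)) _.
rewrite -h2; have := expR_ge0 (- (2^-1 * lam) * y); rewrite -h2; lra.
Qed.

Lemma vp_decay y : 0 <= y -> `|vp y| <= 20 * lam * expR (- (2^-1 * lam) * y).
Proof.
move=> y0; have [h1 _] := sol_exp_half y0; have s0 := sS_gt0 y.
have -> : 20 * lam * expR (- (2^-1 * lam) * y) = lam * (20 * expR (- (2^-1 * lam) * y)) by ring.
rewrite /vp normrM !gtr0_norm// ler_pM2l//.
by have := sech_decay y0; lra.
Qed.

Lemma vp'_decay y : 0 <= y -> `|vp' y| <= 20 * lam ^+ 2 * expR (- (2^-1 * lam) * y).
Proof.
move=> y0; have [h1 _] := sol_exp_half y0; have s0 := sS_gt0 y.
have l2 : 0 < lam ^+ 2 by rewrite exprn_gt0.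
have -> : 20 * lam ^+ 2 * expR (- (2^-1 * lam) * y) = lam ^+ 2 * (20 * expR (- (2^-1 * lam) * y)) by ring.
rewrite /vp' normrM normrN (gtr0_norm l2) ler_pM2l// normrM (gtr0_norm s0).
have := ler_wpM2l (ltW s0) (sT_le1 y); have := sech_decay y0; lra.
Qed.

Lemma dp_decay y : 0 <= y -> `|dp y| <= 20 * expR (- (2^-1 * lam) * y).
Proof.
move=> y0; have [h1 _] := sol_exp_half y0; have s0 := sS_gt0 y.
have := sS_lin_decay y0; have := sech_decay y0.
have -> : dp y = sS y - lam * (sS y * (sT y * (y - skap))) by rewrite /dp; ring.
have := ler_normB (sS y) (lam * (sS y * (sT y * (y - skap)))).
have -> : `|lam * (sS y * (sT y * (y - skap)))| = lam * (sS y * (`|sT y| * `|y - skap|)).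
  by rewrite normrM4 (gtr0_norm lam0) (gtr0_norm s0).
rewrite (gtr0_norm s0).
have : lam * (sS y * (`|sT y| * `|y - skap|)) <= lam * (sS y * `|y - skap|).
  by do 2!(apply: ler_wpM2l; first exact: ltW); rewrite ler_piMl// sT_le1.
lra.
Qed.

Lemma dp'_decay y : 0 <= y -> `|dp' y| <= 20 * lam * expR (- (2^-1 * lam) * y).
Proof.
move=> y0; have [h1 _] := sol_exp_half y0; have s0 := sS_gt0 y.
have := sS_lin_decay y0; have := sech_decay y0 => h2 h3.
pose k := sT y * sT y - sS y * sS y.
have k1 : `|k| <= 1.
  rewrite ler_norml /k -!expr2; have := sTS y; have := sqr_ge0 (sT y); have := sqr_ge0 (sS y).
  by move=> ? ? ?; apply/andP; split; lra.
have -> : dp' y = lam * (- (2 * (sS y * sT y)) + lam * (sS y * ((y - skap) * k))).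
  by rewrite /dp' /k; ring.
have -> : 20 * lam * expR (- (2^-1 * lam) * y) = lam * (20 * expR (- (2^-1 * lam) * y)) by ring.
rewrite normrM (gtr0_norm lam0) ler_pM2l//.
apply: le_trans (ler_normD _ _) _.
have -> : 2 * (sS y * sT y) = 1 * (2 * (sS y * sT y)) by rewrite mul1r.
rewrite normrN !normrM4 (gtr0_norm lam0) (gtr0_norm s0) normr1 mul1r [`|2|]ger0_norm//.
have : sS y * `|sT y| <= sS y by rewrite ler_piMr ?sT_le1// ltW.
have : lam * (sS y * (`|y - skap| * `|k|)) <= lam * (sS y * `|y - skap|).
  by do 2!(apply: ler_wpM2l; first exact: ltW); rewrite ler_piMr.
lra.
Qed.

End Soliton.

(** The form of (1/2) (lam^2 - d^2/dx^2 - 2 k v^2 - 2 q delta_0): L_+ for k = 3, L_- for k = 1, and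
    for k = 0 the operator without the soliton potential. *)
HB.lock Definition Bpot {R : realType} (lam q k : R) (v f g : R -> R) : R :=
  2^-1 * ip (wd f) (wd g) + (2^-1 * lam ^+ 2) * ip f g + (- q) * (f 0 * g 0)
  + (- k) * ip (fun x => (v x * v x) * f x) g.

Lemma BpotE {R : realType} (lam q k : R) (v f g : R -> R) : Bpot lam q k v f g =
  2^-1 * ip (wd f) (wd g) + (2^-1 * lam ^+ 2) * ip f g + (- q) * (f 0 * g 0)
  + (- k) * ip (fun x => (v x * v x) * f x) g.
Proof. by rewrite Bpot.unlock. Qed.

(** * The energy forms, and the soliton as an element of H^1 *)

Section SolitonLine.
Variable R : realType.
Notation mu := (@lebesgue_measure R).
Local Notation integ D f := (mu.-integrable D (EFin \o f)).
Implicit Types (f g p w phi v : R -> R) (x y k : R).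

Lemma bform_Bpot lam q k v : realH1 v -> bform (Bpot lam q k v).
Proof.
move=> Hv.
have H := bform_add (bform_add (bform_add (bform_scale 2^-1 (@bform_ipw R))
  (bform_scale (2^-1 * lam ^+ 2) (@bform_ip R))) (bform_scale (- q) (@bform_eval R 0)))
  (bform_scale (- k) (bform_mul (realH1M Hv Hv))).
suff -> : Bpot lam q k v = fun f g => 2^-1 * ip (wd f) (wd g) + (2^-1 * lam ^+ 2) * ip f g
    + (- q) * (f 0 * g 0) + (- k) * ip (fun x => (v x * v x) * f x) g by exact: H.
by apply/funext => f; apply/funext => g; rewrite BpotE.
Qed.

Lemma ip_mul_bound (h f g : R -> R) k : measurable_fun setT h -> (forall x, h x ^+ 2 <= k ^+ 2) -> 0 <= k ->
  realH1 f -> realH1 g -> `|ip (fun x => h x * f x) g| <= k * (n1 f * n1 g).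
Proof.
move=> mh hk k0 Hf Hg; have sf := realH1_sq Hf; have sg := realH1_sq Hg.
have [s1 b1] := ip_bound_mul mh hk sf.
apply: le_trans (ip_CS s1 sg) _; rewrite mulrA; apply: ler_pM; rewrite ?sqrtr_ge0//.
  apply: le_trans (_ : Num.sqrt (k ^+ 2 * n1 f ^+ 2) <= _).
    by rewrite ler_wsqrtr//; apply: le_trans b1 _; rewrite ler_wpM2l ?sqr_ge0// ip_le_n1.
  by rewrite -exprMn sqrtr_sqr ger0_norm// mulr_ge0// n1_ge0.
apply: le_trans (_ : Num.sqrt (n1 g ^+ 2) <= _); first by rewrite ler_wsqrtr// ip_le_n1.
by rewrite sqrtr_sqr ger0_norm// n1_ge0.
Qed.

Lemma Bpot_bound lam q k v M f g : realH1 v -> 0 <= k -> 0 <= M -> (forall x, `|v x| <= M) ->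
  realH1 f -> realH1 g ->
  `|Bpot lam q k v f g| <= (1 + lam ^+ 2 + 4 * `|q| + k * M ^+ 2) * (n1 f * n1 g).
Proof.
move=> Hv k0 M0 vM Hf Hg.
have N0 : 0 <= n1 f * n1 g by rewrite mulr_ge0// n1_ge0.
have b1 := ipw_n1 Hf Hg; have b2 := ip_n1 Hf Hg.
have b3 : `|f 0 * g 0| <= 4 * (n1 f * n1 g).
  rewrite normrM; have := ler_pM (normr_ge0 _) (normr_ge0 _) (sup_n1 0 Hf) (sup_n1 0 Hg).
  by move/le_trans; apply; rewrite le_eqVlt; apply/orP; left; apply/eqP; ring.
have b4 : `|ip (fun x => (v x * v x) * f x) g| <= M ^+ 2 * (n1 f * n1 g).
  apply: ip_mul_bound => //; last exact: sqr_ge0.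
    have mv : measurable_fun setT v by exact: continuous_measurable (realH1_cont Hv).
    exact: measM.
  move=> x; rewrite -(real_normK (num_real (v x * v x))) ler_sqr ?nnegrE ?sqr_ge0//.
  by rewrite normrM expr2; apply: ler_pM.
have l0 := sqr_ge0 lam.
have tri (x1 x2 x3 x4 : R) : `|x1 + x2 + x3 + x4| <= `|x1| + `|x2| + `|x3| + `|x4|.
  by do 3!(apply: le_trans (ler_normD _ _) _; rewrite ?lerD2r).
rewrite BpotE; apply: le_trans (tri _ _ _ _) _.
rewrite !(normrM _ (ip _ _)) (normrM _ (f 0 * g 0)) !normrN (ger0_norm k0).
rewrite (ger0_norm (x := 2^-1 * lam ^+ 2)); last by rewrite mulr_ge0.
rewrite (ger0_norm (x := 2^-1))//.
have h3 := ler_wpM2l (normr_ge0 q) b3; have h4 := ler_wpM2l k0 b4.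
have h2 := ler_wpM2l l0 b2; have := mulr_ge0 l0 N0.
move: h2 h3 h4 b1; lra.
Qed.

Lemma even_profile_H1 p p' : acon `[0, +oo[ p p' -> sqint (fun x => p `|x|) ->
  sqint (fun x => p' `|x|) -> realH1 (fun x => p `|x|) /\
  forall h, sqint h -> ip (wd (fun x => p `|x|)) h = ip (fun x => Num.sg x * p' `|x|) h.
Proof.
move=> H sp sp'; have He := acon_even H; have ss := sqint_sg sp'.
by split=> [|h sh]; [exact: realH1I He _ _|exact: ip_wder He _ _ _].
Qed.

Lemma sqint_decay p c (m : R) : 0 < m -> continuous p -> (forall y, 0 <= y -> `|p y| <= c * expR (- m * y)) ->
  sqint (fun x => p `|x|) /\
  ip (fun x => p `|x|) (fun x => p `|x|) <=
    c ^+ 2 * ip (fun x => expR (- m * `|x|)) (fun x => expR (- m * `|x|)).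
Proof.
move=> m0 cp pc; have sE := sqint_exp m0; have sC := sqintZ c sE.
have b x : `|p `|x| | <= `|c * expR (- m * `|x|)|.
  by apply: le_trans (ler_norm _); exact: pc.
have sp : sqint (fun x => p `|x|).
  apply: (@sqint_bound _ _ _ 1 _ sC); last by move=> x; rewrite mul1r.
  by apply: continuous_measurable; exact: continuous_comp_norm.
split=> //; apply: le_trans (ip_le_abs sp sC b) _.
by rewrite ipZl// ipZr// mulrA -expr2.
Qed.

Lemma is_derive_fun_continuous f f' : (forall x, is_derive x (1 : R) f (f' x)) -> continuous f.
Proof. by move=> d x; exact: is_derive_continuous (d x). Qed.

Lemma is_derive_acon A f f' f'' : (forall x, is_derive x (1 : R) f (f' x)) ->
  (forall x, is_derive x (1 : R) f' (f'' x)) -> acon A f f'.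
Proof. by move=> d d'; apply: acon_derive => x _ //; exact: is_derive_fun_continuous d' x. Qed.

Lemma continuousX f n : continuous f -> continuous (fun x => f x ^+ n).
Proof.
move=> cf; elim: n => [|n IH] x; first exact: cvg_cst.
by under eq_fun do rewrite exprS; apply: cvgM; [exact: cf|exact: IH].
Qed.

Section Params.
Variables (lam q m M : R).
Hypotheses (m0 : 0 < m) (mlam : m <= lam) (lamM : lam <= M) (qm : `|q| <= 20^-1 * m).

Let lam0 : 0 < lam. Proof. exact: lt_le_trans m0 mlam. Qed.
Let qlam : `|q| <= 20^-1 * lam. Proof. by apply: le_trans qm _; rewrite ler_pM2l. Qed.

Local Notation v := (vsol lam q).
Definition dsol x : R := dp lam q `|x|.
(** The decay estimates have the constant 20 times 1, lam or lam^2, and (1 + M)^2 dominates all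
    three. *)
Definition sol_cst := 20 * (1 + M) ^+ 2.
Local Notation Em := (fun x : R => expR (- (2^-1 * m) * `|x|)).

Lemma vsolE x : v x = vp lam q `|x|. Proof. by []. Qed.

Lemma sol_decay_uniform (z k y : R) : 0 <= y -> 0 <= k -> k <= (1 + M) ^+ 2 ->
  z <= 20 * k * expR (- (2^-1 * lam) * y) -> z <= sol_cst * expR (- (2^-1 * m) * y).
Proof.
move=> y0 k0 kM zk; apply: le_trans zk _; apply: ler_pM; rewrite ?expR_ge0 ?mulr_ge0//.
  by rewrite /sol_cst ler_pM2l.
by rewrite ler_expR !mulNr lerN2 ler_wpM2r// ler_pM2l.
Qed.

Let M0 : 0 < M. Proof. exact: lt_le_trans lam0 lamM. Qed.

Let kM2 : lam ^+ 2 <= (1 + M) ^+ 2.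
Proof. by rewrite ler_sqr ?nnegrE; have := lamM; have := ltW lam0; lra. Qed.
Let kM1 : lam <= (1 + M) ^+ 2.
Proof.
have -> : (1 + M) ^+ 2 = M + (1 + M + M ^+ 2) by ring.
by apply: le_trans lamM _; rewrite lerDl; have := M0; have := sqr_ge0 M; lra.
Qed.
Let kM0 : 1 <= (1 + M) ^+ 2.
Proof. by rewrite expr_ge1// ?ler_wpDr// ltW// addr_gt0. Qed.

Let m20 : 0 < 2^-1 * m. Proof. by rewrite mulr_gt0// invr_gt0. Qed.

Lemma vp_sq : sqint v /\ ip v v <= sol_cst ^+ 2 * ip Em Em.
Proof.
apply: (@sqint_decay (vp lam q)) => //; first exact: is_derive_fun_continuous (is_derive_vp lam q).
by move=> y y0; apply: (sol_decay_uniform y0 (ltW lam0) kM1 (vp_decay lam0 qlam y0)).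
Qed.

Lemma vp'_sq : sqint (fun x => vp' lam q `|x|) /\
  ip (fun x => vp' lam q `|x|) (fun x => vp' lam q `|x|) <= sol_cst ^+ 2 * ip Em Em.
Proof.
apply: sqint_decay => //; first exact: is_derive_fun_continuous (is_derive_vp' lam q).
by move=> y y0; apply: (sol_decay_uniform y0 (sqr_ge0 lam) kM2 (vp'_decay lam0 qlam y0)).
Qed.

Lemma dp_sq : sqint dsol /\ ip dsol dsol <= sol_cst ^+ 2 * ip Em Em.
Proof.
apply: (@sqint_decay (dp lam q)) => //; first exact: is_derive_fun_continuous (is_derive_dp lam q).
by move=> y y0; apply: (sol_decay_uniform y0 _ kM0) => //; rewrite mulr1; exact: dp_decay.
Qed.

Lemma dp'_sq : sqint (fun x => dp' lam q `|x|) /\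
  ip (fun x => dp' lam q `|x|) (fun x => dp' lam q `|x|) <= sol_cst ^+ 2 * ip Em Em.
Proof.
apply: sqint_decay => //; first exact: is_derive_fun_continuous (is_derive_dp' lam q).
by move=> y y0; apply: (sol_decay_uniform y0 (ltW lam0) kM1 (dp'_decay lam0 qlam y0)).
Qed.

Lemma sg_bound g : sqint g -> ip (fun x => Num.sg x * g x) (fun x => Num.sg x * g x) <= ip g g.
Proof.
move=> sg; apply: ip_le_abs => //; first exact: sqint_sg.
by move=> x; rewrite normrM ler_piMl// normr_sg; case: (x != 0).
Qed.

(** The factor 2 counts the function and its derivative, which share one exponential majorant. *)
Definition sol_bound := Num.sqrt (2 * (sol_cst ^+ 2 * ip Em Em)).

Lemma even_profile_n1 p p' : acon `[0, +oo[ p p' ->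
  sqint (fun x => p `|x|) /\ ip (fun x => p `|x|) (fun x => p `|x|) <= sol_cst ^+ 2 * ip Em Em ->
  sqint (fun x => p' `|x|) /\ ip (fun x => p' `|x|) (fun x => p' `|x|) <= sol_cst ^+ 2 * ip Em Em ->
  realH1 (fun x => p `|x|) /\ n1 (fun x => p `|x|) <= sol_bound.
Proof.
move=> H [s1 b1] [s2 b2]; have [HH E] := even_profile_H1 H s1 s2.
split=> //; rewrite n1E ler_wsqrtr// hipE E; last exact: wder_sq.
rewrite ipC E; last exact: sqint_sg.
have := le_trans (sg_bound s2) b2; move: b1; lra.
Qed.

Lemma vsol_H1 : realH1 v /\ n1 v <= sol_bound.
Proof.
apply: (@even_profile_n1 (vp lam q)) vp_sq vp'_sq.
exact: is_derive_acon (is_derive_vp lam q) (is_derive_vp' lam q).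
Qed.

Lemma dsol_H1 : realH1 dsol /\ n1 dsol <= sol_bound.
Proof.
apply: (@even_profile_n1 (dp lam q)) dp_sq dp'_sq.
exact: is_derive_acon (is_derive_dp lam q) (is_derive_dp' lam q).
Qed.

(** [even_IBP] applied to p': the condition p'(0) = - q p(0) makes its boundary term cancel the
    point term of the form, and the differential equation leaves r alone. *)
Lemma even_profile_weak k p p' p'' r phi : acon `[0, +oo[ p p' -> acon `[0, +oo[ p' p'' ->
  sqint (fun x => p `|x|) -> sqint (fun x => p' `|x|) -> sqint r ->
  p' 0 = - q * p 0 ->
  (forall y, 0 <= y -> p'' y = lam ^+ 2 * p y - 2 * k * (vp lam q y ^+ 2 * p y) + 2 * r y) ->
  (forall x, r `|x| = r x) -> realH1 phi ->
  Bpot lam q k v (fun x => p `|x|) phi = - ip r phi.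
Proof.
move=> H H' sp sp' sr jump ode re Hphi.
have sphi := realH1_sq Hphi; have swphi := wder_sq Hphi.
have [HH E] := even_profile_H1 H sp sp'.
have [Hv _] := vsol_H1.
have sVp : sqint (fun x => v x * v x * p `|x|) by exact: realH1_sq (realH1M (realH1M Hv Hv) HH).
have Ep'' x : p'' `|x| = lam ^+ 2 * p `|x| - (2 * k) * (v x * v x * p `|x|) + 2 * r x.
  by rewrite ode// re -expr2.
have s1 := sqintZ (lam ^+ 2) sp; have s2 := sqintZ (2 * k) sVp; have s3 := sqintZ 2 sr.
have sp'' : sqint (fun x => p'' `|x|).
  have := sqintD (sqintB s1 s2) s3.
  by under eq_fun do rewrite -Ep''.
have IBP := even_IBP H' sp' sp'' Hphi.
have Ip'' : ip phi (fun x => p'' `|x|) = lam ^+ 2 * ip (fun x => p `|x|) phi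
    - 2 * k * ip (fun x => v x * v x * p `|x|) phi + 2 * ip r phi.
  rewrite ipC; under [fun x => p'' _]eq_fun do rewrite Ep''.
  by rewrite ipDl// ?ipBl// ?ipZl//; exact: sqintB.
have EA : ip (wd (fun x => p `|x|)) (wd phi) = 2 * (q * (p 0 * phi 0)) -
    (lam ^+ 2 * ip (fun x => p `|x|) phi - 2 * k * ip (fun x => v x * v x * p `|x|) phi + 2 * ip r phi).
  by rewrite E// ipC IBP Ip'' jump; ring.
rewrite BpotE EA normr0.
move: (ip _ phi) (ip r phi) (ip _ phi) => A B C; by field.
Qed.

(** This is what the shift artanh (q / lam) is for: it makes tanh equal to q / lam at the origin. *)
Lemma jump_vp : vp' lam q 0 = - q * vp lam q 0.
Proof.
rewrite /vp' /vp (sT0 lam0 qlam); field; by rewrite gt_eqF// lam0.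
Qed.

(** The relation [jump_vp] differentiated in lam at fixed q, here checked on the formulas. *)
Lemma jump_dp : dp' lam q 0 = - q * dp lam q 0.
Proof.
have [lam1 q1] := (gt_eqF lam0, tau_le lam0 qlam).
have E := sTS lam q 0; rewrite (sT0 lam0 qlam) in E.
have l0 : lam != 0 by rewrite lam1.
have d0 : lam ^+ 2 - q ^+ 2 != 0.
  have -> : lam ^+ 2 - q ^+ 2 = lam ^+ 2 * (1 - (q / lam) ^+ 2) by field.
  rewrite E mulf_neq0 ?expf_neq0// opprB addrC subrK expf_neq0// gt_eqF//.
  exact: sS_gt0.
rewrite /dp' /dp (sT0 lam0 qlam) sub0r.
have -> : sS lam q 0 * sS lam q 0 = 1 - (q / lam) ^+ 2 by rewrite E; ring.
rewrite /skap; field; by rewrite l0 d0.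
Qed.

Lemma Bm_vsol phi : realH1 phi -> Bpot lam q 1 v v phi = 0.
Proof.
move=> Hphi; have [s1 _] := vp_sq; have [s2 _] := vp'_sq.
have H0 := @even_profile_weak 1 (vp lam q) (vp' lam q) (vp'' lam q) (fun=> 0) phi.
rewrite {}H0//.
- by rewrite -[RHS]oppr0; congr (- _); have := @ipZl R 0 _ _ (@sqint0 R) (realH1_sq Hphi);
    under eq_fun do rewrite mul0r; rewrite mul0r.
- exact: is_derive_acon (is_derive_vp lam q) (is_derive_vp' lam q).
- apply: acon_derive => x _; first exact: is_derive_vp'.
  have c1 := is_derive_fun_continuous (is_derive_vp lam q).
  apply: cvgB; first by apply: cvgM; [exact: cvg_cst|exact: c1].
  apply: cvgM; first exact: cvg_cst.
  exact: continuousX.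
- exact: sqint0.
- exact: jump_vp.
- by move=> y _; rewrite /vp''; ring.
Qed.

Lemma Bp_dsol phi : realH1 phi -> Bpot lam q 3 v dsol phi = - lam * ip v phi.
Proof.
move=> Hphi; have [s1 _] := dp_sq; have [s2 _] := dp'_sq; have [s3 _] := vp_sq.
have H0 := @even_profile_weak 3 (dp lam q) (dp' lam q) (dp'' lam q) (fun x => lam * v x) phi.
rewrite /dsol {}H0//.
- by rewrite ipZl ?mulNr//; exact: realH1_sq.
- exact: is_derive_acon (is_derive_dp lam q) (is_derive_dp' lam q).
- apply: acon_derive => x _; first exact: is_derive_dp'.
  have c1 := is_derive_fun_continuous (is_derive_vp lam q); have c2 := is_derive_fun_continuous (is_derive_dp lam q).
  apply: cvgD; last by apply: cvgM; [exact: cvg_cst|exact: c1].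
  apply: cvgB; first by apply: cvgM; [exact: cvg_cst|exact: c2].
  apply: cvgM; last exact: c2.
  apply: cvgM; first exact: cvg_cst.
  exact: continuousX.
- exact: sqintZ.
- exact: jump_dp.
- by move=> y y0; rewrite vsolE ger0_norm// /dp''; ring.
- by move=> x; rewrite !vsolE normr_id.
Qed.

(** Half the derivative in lam of the mass of v, which is 2 (lam - q). *)
Lemma ip_vsol_dsol : ip v dsol = 1.
Proof.
have [s1 _] := vp_sq; have [s2 _] := dp_sq.
have i1 := sqint_mul s1 s2.
(* The mass of v on [y, +oo) is lam (1 - T y); half of its derivative in lam is - F y. *)
pose F y := 2^-1 * (sT lam q y - 1) + 2^-1 * lam * ((y - skap lam q) * sS lam q y ^+ 2).
pose G y := vp lam q y * dp lam q y.
have dF y : is_derive y (1 : R) F (G y).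
  have dS := is_derive_sS lam q y; have dT := is_derive_sT lam q y.
  have d1 := isD_Z 2^-1 (isD_B dT (isD_cst 1 y)).
  have d2 := isD_Z (2^-1 * lam) (isD_M (is_derive_kap lam q y) (isD_M dS dS)).
  have := isD_D d1 d2; rewrite /F /G /vp /dp.
  move/isD_eq; apply.
  have := sTS lam q y; move: (sT lam q y) (sS lam q y) => t s E.
  by rewrite expr2; field.
have i2 : integ `[0, +oo[ G.
  have : integ `[0, +oo[ (fun x => v x * dsol x) by exact: integT.
  apply: eq_integrable => // x /set_mem; rewrite /= in_itv/= andbT => x0.
  by rewrite vsolE /dsol ger0_norm.
(* Integrating up to infinity requires F to be integrable, hence the normalisation T - 1, which
   decays like S. *)
have F9 y : 0 <= y -> `|F y| <= 9 * expR (- (2^-1 * lam) * y).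
  move=> y0; have [h1 _] := sol_exp_half lam0 y0.
  have h2 := sech_decay lam0 qlam y0; have h3 := sS_lin_decay lam0 qlam y0.
  have s0 := sS_gt0 lam q y; have s1' : sS lam q y <= 1 := sech_le1 _.
  have eY : expR (- (lam * y + artanh (q / lam))) <= 2.
    rewrite opprD expRD; have := expRN_artanh (tau_le lam0 qlam).
    have e1 : expR (- (lam * y)) <= 1.
      by rewrite -expR0 ler_expR oppr_le0 mulr_ge0// ltW.
    by have := ler_pM (expR_ge0 _) (expR_ge0 _) e1; move=> h /h; rewrite mul1r.
  have T1 : `|sT lam q y - 1| <= 2 * sS lam q y.
    have -> : sT lam q y - 1 = - (sS lam q y * expR (- (lam * y + artanh (q / lam)))).
      rewrite /sT /sS /th /sech; field; rewrite gt_eqF//; exact: cosh2_gt0.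
    rewrite normrN normrM (gtr0_norm s0) (ger0_norm (expR_ge0 _)) mulrC ler_wpM2r//; exact: ltW.
  have T2 : `|2^-1 * lam * ((y - skap lam q) * sS lam q y ^+ 2)| <=
      2^-1 * (lam * (sS lam q y * `|y - skap lam q|)).
    rewrite 2!normrM [X in _ * X]normrM (gtr0_norm lam0) [`|2^-1|]ger0_norm// -mulrA ler_pM2l//.
    rewrite ler_pM2l// mulrC ler_wpM2r// ger0_norm ?sqr_ge0// expr2 ler_piMr//; exact: ltW.
  rewrite /F; apply: le_trans (ler_normD _ _) _.
  rewrite normrM [`|2^-1|]ger0_norm//; lra.
have cF : continuous F by exact: is_derive_fun_continuous dF.
have cG : continuous G.
  by move=> x; apply: cvgM; [exact: is_derive_fun_continuous (is_derive_vp lam q) x|exact: is_derive_fun_continuous (is_derive_dp lam q) x].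
have iF : integ `[0, +oo[ F.
  have l20 : 0 < 2^-1 * lam by rewrite mulr_gt0// invr_gt0.
  have iE := @integZ R _ _ 9 (measurable_itv `[0, +oo[) (integ_exp_ray l20).
  apply: (integ_le _ _ iE) => //.
    by apply: measurable_funS (continuous_measurable cF).
  by move=> x; rewrite /= in_itv/= andbT => x0; exact: F9.
have AF : acon `[0, +oo[ F G by apply: acon_derive => x _ //; exact: cG.
have E1 := acon_Rint_ray AF iF i2.
have [_ E2] := even_integ i2.
have -> : ip v dsol = \int[mu]_x G `|x| by rewrite ipE.
have l0 : lam != 0 by rewrite gt_eqF// lam0.
have E := sTS lam q 0; rewrite (sT0 lam0 qlam) in E.
have d0 : lam ^+ 2 - q ^+ 2 != 0.
  have -> : lam ^+ 2 - q ^+ 2 = lam ^+ 2 * (1 - (q / lam) ^+ 2) by field.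
  rewrite E mulf_neq0 ?expf_neq0// opprB addrC subrK expf_neq0// gt_eqF//.
  exact: sS_gt0.
have -> : \int[mu]_x G `|x| = 2 * \int[mu]_(x in `[0, +oo[) G x by exact: E2.
rewrite E1 /F (sT0 lam0 qlam) sub0r.
have -> : sS lam q 0 ^+ 2 = 1 - (q / lam) ^+ 2 by rewrite E; ring.
rewrite /skap; field; by rewrite l0 d0.
Qed.

Lemma vsol_gt0 x : 0 < v x.
Proof. by rewrite vsolE /vp mulr_gt0 ?sS_gt0. Qed.

Lemma vsol_le x : `|v x| <= M.
Proof.
rewrite gtr0_norm ?vsol_gt0// vsolE /vp; apply: le_trans lamM.
by rewrite ler_piMr ?sech_le1// ltW.
Qed.

(** The factor 1 - lam T (y - skap) is positive, as lam [|skap|] <= 1/10. The range covers 0 and (5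
    lam)^{-1}, the two points where d_lam v must not vanish. *)
Lemma dsol_gt0 x : lam * `|x| <= 5^-1 -> 0 < dsol x.
Proof.
move=> hx; rewrite /dsol /dp mulr_gt0 ?sS_gt0// subr_gt0.
apply: le_lt_trans (ler_norm _) _; rewrite normrM (gtr0_norm lam0) normrM.
have h1 : `|sT lam q `|x| | * `| `|x| - skap lam q| <= `|x| + `|skap lam q|.
  apply: le_trans (_ : 1 * `| `|x| - skap lam q| <= _).
    by rewrite ler_wpM2r// sT_le1.
  by rewrite mul1r; apply: le_trans (ler_normB _ _) _; rewrite normr_id.
have := ler_wpM2l (ltW lam0) h1; have := skap_le lam0 qlam; lra.
Qed.

End Params.
End SolitonLine.

(** * Coercivity *)

Section Riccati.
Variable R : realType.
Notation mu := (@lebesgue_measure R).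
Local Notation integ D f := (mu.-integrable D (EFin \o f)).
Implicit Types (f g h U W : R -> R) (x y a b c : R).

Lemma ray_split h a b : a <= b -> integ setT h ->
  \int[mu]_(x in `[a, +oo[) h x = \int[mu]_(x in `[a, b]) h x + \int[mu]_(x in `[b, +oo[) h x.
Proof.
move=> ab hi; have := @Rintegral_itvB _ h (BLeft a) +oo%O b.
have ia : integ `[a, +oo[ h by exact: integT.
move=> /(_ ia); rewrite !bnd_simp => /(_ ab isT).
rewrite Rintegral_itv_obnd_cbnd; last exact: integT.
by move=> /eqP; rewrite subr_eq addrC => /eqP.
Qed.

(* [f'^2 >= 2 W f f' - W^2 f^2 = (W f^2)' - (W' + W^2) f^2] *)
Lemma riccati_itv f f' U W W' a b : acon setT f f' -> a <= b ->
  (forall y, a <= y <= b -> is_derive y (1 : R) W (W' y)) ->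
  (forall y, a <= y <= b -> {for y, continuous W'}) ->
  (forall y, a <= y <= b -> W' y + W y ^+ 2 <= U y) ->
  integ setT (fun x => f' x ^+ 2 + U x * f x ^+ 2) ->
  W b * f b ^+ 2 - W a * f a ^+ 2 <= \int[mu]_(x in `[a, b]) (f' x ^+ 2 + U x * f x ^+ 2).
Proof.
move=> H ab dW cW HU hi.
have AW : acon `[a, b] W W'.
  by apply: acon_derive => y; rewrite /= in_itv/= => yab; exact: cW.
have sub : `[a, b]%classic `<=` [set: R] by [].
have Hs := acon_sub sub H.
have [i E] := aconM AW (aconM Hs Hs) ab (@subset_refl _ _).
rewrite !expr2 E; apply: Rint_itv_le => //; first exact: integT.
move=> x xab; have := HU x xab; have f2 := sqr_ge0 (f x).
move/(ler_wpM2r f2); have := sqr_ge0 (f' x - W x * f x).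
rewrite !expr2; lra.
Qed.

Lemma riccati_ray f f' U W W' a K : acon setT f f' -> sqint f -> sqint f' ->
  (forall y, a <= y -> is_derive y (1 : R) W (W' y)) ->
  (forall y, a <= y -> {for y, continuous W'}) ->
  (forall y, a <= y -> W' y + W y ^+ 2 <= U y) ->
  (forall y, a <= y -> `|W y| <= K) ->
  integ setT (fun x => f' x ^+ 2 + U x * f x ^+ 2) ->
  - (W a * f a ^+ 2) <= \int[mu]_(x in `[a, +oo[) (f' x ^+ 2 + U x * f x ^+ 2).
Proof.
move=> H sf sf' dW cW HU WK hi.
have i1 := sqint_mul sf sf; have i2 := integD measurableT (sqint_mul sf sf') (sqint_mul sf sf').
have V : f (a + n%:R) * f (a + n%:R) @[n --> \oo] --> (0 : R).
  apply: (@ray_vanish _ (fun x => f x * f x) _ a _ _ (integT _ i2)) => //; last exact: integT.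
  by apply: acon_sub (aconM H H).
have an n : a <= a + n%:R :> R by rewrite lerDl.
have C1 := Rint_cvg_ray (integT (measurable_itv `[a, +oo[) hi).
have C2 : W (a + n%:R) * (f (a + n%:R) * f (a + n%:R)) - W a * f a ^+ 2 @[n --> \oo] -->
    0 - W a * f a ^+ 2.
  apply: cvgB; last exact: cvg_cst.
  by apply: bounded_cvg0 V => n; exact: WK.
rewrite -[X in X <= _]sub0r; apply: (ler_cvg_to C2 C1); apply: nearW => n.
rewrite -expr2; apply: riccati_itv => // y /andP[ay _]; [exact: dW|exact: cW|exact: HU].
Qed.

(** Up to the factor lam^2 this is the excess U - W' - W^2 of the outer weight of [half_plus], in
    the variable j = 1 / T; it holds because j^4 <= 1000 j for j <= 10. *)
Lemma riccati_outer_ge0 (j : R) : 1 <= j -> j <= 10 ->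
  0 <= (10 * 10 * 10)^-1 * (2 * j - (10 * 10 * 10)^-1 * (j ^+ 2 * j ^+ 2) - 1).
Proof.
move=> j1 j2.
have h1 : j ^+ 2 <= 100 by nra.
have h2 : j ^+ 2 * j ^+ 2 <= 100 * (10 * j).
  by apply: ler_pM; rewrite ?sqr_ge0//; nra.
rewrite pmulr_rge0 ?invr_gt0//; move: h2; move: (j ^+ 2 * j ^+ 2) => z h2.
have h3 : (10 * 10 * 10)^-1 * z <= j by rewrite mulrC ler_pdivrMr//; lra.
lra.
Qed.

Lemma riccati_outer_le (j t : R) : 1 <= j -> j <= 10 -> -1 <= t -> t <= 1 ->
  `|j - 2 * t + (10 * 10 * 10)^-1 * (j * j)| <= 13.
Proof.
move=> j1 j2 t0 t1; rewrite ler_norml.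
have h : j * j <= 100 by nra.
have h' : 0 <= j * j by nra.
apply/andP; split; lra.
Qed.

(** * Riccati weights and coercivity of the two forms *)

Section Half.
Variables lam q : R.
Hypotheses (lam0 : 0 < lam) (qlam : `|q| <= 20^-1 * lam).

Local Notation v := (vsol lam q).
Local Notation S := (sS lam q).
Local Notation T := (sT lam q).

Lemma sT_incr x y : x <= y -> T x <= T y.
Proof.
move=> xy.
have H : acon setT T (fun y => lam * S y ^+ 2).
  apply: acon_derive => z _; first exact: is_derive_sT.
  apply: cvgM; first exact: cvg_cst.
  by apply: continuousX; exact: is_derive_fun_continuous (is_derive_sS lam q).
have [_ E] := H x y xy (@subsetT _ _).
by rewrite -subr_ge0 E; apply: Rint_itv_ge0 => z _; rewrite mulr_ge0 ?sqr_ge0// ltW.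
Qed.

Lemma sT_lb y : 0 <= y -> - 20^-1 <= T y.
Proof.
move=> y0; apply: le_trans (sT_incr y0); rewrite (sT0 lam0 qlam).
by have := tau_le lam0 qlam; rewrite ler_norml => /andP[].
Qed.

Lemma sT_itv y : - 1 <= T y <= 1.
Proof. by have := sT_le1 lam q y; rewrite ler_norml. Qed.

Lemma sT_x0 y : (5 * lam)^-1 <= y -> 10^-1 <= T y.
Proof.
move=> hy; apply: le_trans (sT_incr hy).
have -> : T (5 * lam)^-1 = th (5^-1 + artanh (q / lam)).
  by rewrite /sT (_ : lam * (5 * lam)^-1 = 5^-1)//; field; rewrite gt_eqF.
(* th Y >= 1/10 amounts to exp (2 Y) >= 11/9, and exp (2/5) >= 7/5 together with (1 + tau) / (1 -
   tau) >= 19/21 for tau = q / lam leaves room. *)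
set Y := 5^-1 + _.
have E2 : 11 / 9 <= expR Y * expR Y.
  have t := tau_le lam0 qlam; have t1 := tau_lt1 lam0 qlam.
  move: t t1; rewrite !ler_norml ltr_norml => /andP[t1 t2] /andP[t3 t4].
  have p1 : 0 < 1 + q / lam by lra.
  have p2 : 0 < 1 - q / lam by lra.
  have -> : expR Y * expR Y = expR (2 / 5) * ((1 + q / lam) / (1 - q / lam)).
    have -> : (1 + q / lam) / (1 - q / lam) = expR (artanh (q / lam) * 2).
      by rewrite /artanh divfK// lnK// posrE divr_gt0.
    by rewrite -!expRD; congr expR; rewrite /Y; field.
  have e := expR_ge1Dx (2 / 5 : R).
  have r : 19 / 21 <= (1 + q / lam) / (1 - q / lam) by rewrite ler_pdivlMr//; lra.
  have h1 : 0 <= 1 + 2 / 5 :> R by lra.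
  have h2 : 0 <= 19 / 21 :> R by lra.
  have := ler_pM h1 h2 e r; lra.
have E0 := expR_gt0 Y.
have E1 : expR (- Y) * expR Y = 1 by rewrite -expRD addNr expR0.
rewrite /th ler_pdivlMr ?cosh2_gt0// -(ler_pM2r E0).
rewrite -mulrA !mulrDl mulNr E1; lra.
Qed.

Lemma vsol_ray y : 0 <= y -> v y ^+ 2 = lam ^+ 2 * (1 - T y ^+ 2).
Proof.
move=> y0; rewrite vsolE ger0_norm// /vp exprMn; congr (_ * _).
by rewrite sTS; ring.
Qed.

(* - lam T is the logarithmic derivative of v, which lies in the kernel of L_-. *)
Lemma half_minus f f' (U : R -> R) : acon setT f f' -> sqint f -> sqint f' -> f 0 = 0 ->
  (forall y, U y = lam ^+ 2 - 2 * v y ^+ 2 - lam ^+ 2 * (10 * 10 * 10)^-1) ->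
  integ setT (fun x => f' x ^+ 2 + U x * f x ^+ 2) ->
  0 <= \int[mu]_(x in `[0, +oo[) (f' x ^+ 2 + U x * f x ^+ 2).
Proof.
move=> H sf sf' f0 UE hi.
(* The weight - lam T gives equality for the potential lam^2 - 2 v^2; the factor 21/20 and the shift
   1/10 gain the lam^2 / 1000 taken off U. *)
pose W y := lam * (- (21 / 20) * T y + 10^-1).
pose W' y := lam * (- (21 / 20) * (lam * S y ^+ 2)).
have dW y : is_derive y (1 : R) W (W' y).
  have := isD_Z lam (isD_D (isD_Z (- (21 / 20)) (is_derive_sT lam q y)) (isD_cst 10^-1 y)).
  by rewrite addr0.
rewrite -[X in X <= _](_ : - (W 0 * f 0 ^+ 2) = 0); last by rewrite f0 expr0n mulr0 oppr0.
apply: (@riccati_ray _ _ _ _ W' _ (2 * lam)) => // y y0.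
- do 3!(apply: cvgM; first exact: cvg_cst).
  by apply: continuousX; exact: is_derive_fun_continuous (is_derive_sS lam q).
- have := sT_lb y0; have := sT_itv y => /andP[_ t1] t0.
  rewrite UE vsol_ray// /W /W'.
  have -> : S y ^+ 2 = 1 - T y ^+ 2 by rewrite sTS; ring.
  move: (T y) t0 t1 => t t0 t1; rewrite -subr_ge0.
  have -> : lam ^+ 2 - 2 * (lam ^+ 2 * (1 - t ^+ 2)) - lam ^+ 2 / (10 * 10 * 10) -
    (lam * (- (21 / 20) * (lam * (1 - t ^+ 2))) + (lam * (- (21 / 20) * t + 10^-1)) ^+ 2) =
    lam ^+ 2 * (- (61 / (20 * 20)) * t ^+ 2 + 21 / 100 * t + 39 / (10 * 10 * 10)) by field.
  by apply: mulr_ge0; [exact: sqr_ge0|nra].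
- have /andP[t0 t1] := sT_itv y.
  rewrite /W normrM (gtr0_norm lam0) mulrC ler_pM2r// ler_norml; apply/andP; split; lra.
Qed.

(* Near 0 a linear weight absorbs the point interaction; beyond (5 lam)^-1 the
   weight perturbs lam (1 / T - 2 T), the logarithmic derivative of v'. *)
Lemma half_plus f f' (U : R -> R) (p : R) : acon setT f f' -> sqint f -> sqint f' ->
  f (5 * lam)^-1 = 0 -> `|p| <= 19^-1 * lam ->
  (forall y, U y = lam ^+ 2 - 6 * v y ^+ 2 - lam ^+ 2 * (10 * 10 * 10)^-1) ->
  integ setT (fun x => f' x ^+ 2 + U x * f x ^+ 2) ->
  p * f 0 ^+ 2 <= \int[mu]_(x in `[0, +oo[) (f' x ^+ 2 + U x * f x ^+ 2).
Proof.
move=> H sf sf' f0 pl UE hi.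
have l00 : lam != 0 by rewrite gt_eqF.
have x00 : 0 <= (5 * lam)^-1 by rewrite invr_ge0 mulr_ge0// ltW.
rewrite (ray_split x00 hi) -[leLHS]addr0; apply: lerD.
  (* W(0) = - p pays for the point term. On this interval [|W|] <= (39/19) lam, so W' + W^2 is below
     - 5.7 lam^2, whereas U is at least - 5.001 lam^2 because v^2 <= lam^2. *)
  pose W y := - (10 * lam ^+ 2) * y - p.
  have dW y : is_derive y (1 : R) W (- (10 * lam ^+ 2)).
    have := isD_B (isD_Z (- (10 * lam ^+ 2)) (isD_id y)) (isD_cst p y).
    by rewrite mulr1 subr0.
  have -> : p * f 0 ^+ 2 = W (5 * lam)^-1 * f (5 * lam)^-1 ^+ 2 - W 0 * f 0 ^+ 2.
    by rewrite f0 /W; ring.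
  apply: riccati_itv => // [y _|y /andP[y0 y1]]; first exact: cvg_cst.
  rewrite UE vsol_ray// /W.
  have t2 := sqr_ge0 (T y); have l2 := sqr_ge0 lam.
  have z0 : 0 <= 10 * lam ^+ 2 * y by rewrite mulr_ge0// mulr_ge0.
  have z1 : 10 * lam ^+ 2 * y <= 2 * lam.
    have := ler_wpM2l l2 y1; have -> : lam ^+ 2 / (5 * lam) = 5^-1 * lam by field.
    lra.
  move: pl; rewrite ler_norml => /andP[p1 p2].
  have zb : (- (10 * lam ^+ 2) * y - p) ^+ 2 <= (lam * (39 / 19)) ^+ 2.
    rewrite -(real_normK (num_real (- _ * y - p))) ler_sqr ?nnegrE//; last first.
      by rewrite mulr_ge0// ltW.
    rewrite ler_norml; apply/andP; split; lra.
  rewrite exprMn in zb; have := mulr_ge0 l2 t2; nra.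
(* J <= 10 on this ray because T >= 1/10. Without d the weight solves W' + W^2 = lam^2 - 6 v^2
   exactly; the term d J^2 opens the gap lam^2 / 1000. *)
pose J y := (T y)^-1; pose d : R := (10 * 10 * 10)^-1.
pose J' y := - J y ^+ 2 * (lam * S y ^+ 2).
pose W y := lam * (J y - 2 * T y + d * (J y * J y)).
pose W' y := lam * (J' y - 2 * (lam * S y ^+ 2) + d * (J y * J' y + J y * J' y)).
have T0 y : (5 * lam)^-1 <= y -> T y != 0.
  by move=> /sT_x0 t; rewrite gt_eqF//; lra.
have dJ y : (5 * lam)^-1 <= y -> is_derive y (1 : R) J (J' y).
  move=> y0; have := isD_V (is_derive_sT lam q y) (T0 y y0).
  by move/isD_eq; apply; rewrite /J' /J exprVn.
have dW y : (5 * lam)^-1 <= y -> is_derive y (1 : R) W (W' y).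
  move=> y0; have d1 := dJ y y0; have dT := is_derive_sT lam q y.
  exact: (isD_Z lam (isD_D (isD_B d1 (isD_Z 2 dT)) (isD_Z d (isD_M d1 d1)))).
have jb y : (5 * lam)^-1 <= y -> 1 <= J y <= 10.
  move=> /sT_x0 t; have /andP[_ t1] := sT_itv y.
  have t0 : 0 < T y by lra.
  rewrite /J invf_ge1// t1/= -[leRHS]invrK lef_pV2 ?posrE ?invr_gt0//.
rewrite -[X in X <= _](_ : - (W (5 * lam)^-1 * f (5 * lam)^-1 ^+ 2) = 0); last first.
  by rewrite f0 expr0n mulr0 oppr0.
apply: (@riccati_ray _ _ _ W W' _ (13 * lam)) => // y y0.
- have cJ : {for y, continuous J} by exact: is_derive_continuous (dJ y y0).
  have cS : {for y, continuous (fun y => lam * S y ^+ 2)}.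
    apply: cvgM; first exact: cvg_cst.
    by apply: continuousX; exact: is_derive_fun_continuous (is_derive_sS lam q).
  have cJ' : {for y, continuous J'}.
    apply: cvgM; last exact: cS.
    apply: cvgN; rewrite /J; under eq_fun do rewrite expr2.
    by rewrite expr2; apply: cvgM; exact: cJ.
  apply: cvgM; first exact: cvg_cst.
  apply: cvgD.
    by apply: cvgB; [exact: cJ'|apply: cvgM; [exact: cvg_cst|exact: cS]].
  by apply: cvgM; [exact: cvg_cst|apply: cvgD; apply: cvgM; [exact: cJ|exact: cJ'|exact: cJ|exact: cJ']].
- have /andP[j1 j2] := jb y y0; have x0 := le_trans x00 y0.
  rewrite UE vsol_ray// /W /W' /J'.
  have -> : S y ^+ 2 = 1 - T y ^+ 2 by rewrite sTS; ring.
  have -> : T y = (J y)^-1 by rewrite /J invrK.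
  move: (J y) j1 j2 => j j1 j2; have jn : j != 0 by rewrite gt_eqF//; lra.
  rewrite -subr_ge0 /d.
  set X := (X in 0 <= X).
  have -> : X = lam ^+ 2 * ((10 * 10 * 10)^-1 * (2 * j - (10 * 10 * 10)^-1 * (j ^+ 2 * j ^+ 2) - 1)).
    by rewrite /X; field.
  by apply: mulr_ge0; [exact: sqr_ge0|exact: riccati_outer_ge0].
- have /andP[j1 j2] := jb y y0; have /andP[t0 t1] := sT_itv y.
  rewrite /W normrM (gtr0_norm lam0) mulrC ler_pM2r//.
  exact: riccati_outer_le.
Qed.

Lemma vsol_sq_le x : v x ^+ 2 <= lam ^+ 2.
Proof. rewrite vsolE /vp exprMn; apply: ler_piMr; first exact: sqr_ge0.
have s0 := ltW (sS_gt0 lam q `|x|); have s1 : S `|x| <= 1 by exact: sech_le1.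
by rewrite expr2; exact: mulr_ile1. Qed.

Lemma vsol_opp x : v (- x) = v x. Proof. by rewrite !vsolE normrN. Qed.

(* A fraction 1/12000 of the derivative is kept aside, the Riccati inequality
   being used for the rest of the form. *)
Lemma coercive_of_half k (c : R) f (U : R -> R) : realH1 v -> 0 <= k <= 3 ->
  realH1 f -> (forall y, U y = lam ^+ 2 - 2 * k * v y ^+ 2 - lam ^+ 2 * (10 * 10 * 10)^-1) ->
  (integ setT (fun x => wd f x ^+ 2 + U x * f x ^+ 2) ->
   c <= \int[mu]_(x in `[0, +oo[) (wd f x ^+ 2 + U x * f x ^+ 2)) ->
  (integ setT (fun x => wd f (- x) ^+ 2 + U x * f (- x) ^+ 2) ->
   c <= \int[mu]_(x in `[0, +oo[) (wd f (- x) ^+ 2 + U x * f (- x) ^+ 2)) ->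
  q * f 0 ^+ 2 <= (1 - 12^-1 * (10 * 10 * 10)^-1) * c ->
  n1 f ^+ 2 <= (24 * (10 * 10 * 10) + 4 * (10 * 10 * 10) / lam ^+ 2) * Bpot lam q k v f f.
Proof.
move=> Hv /andP[k0 k3] Hf UE h1 h2 hc.
have sf := realH1_sq Hf; have sw := wder_sq Hf.
have svf : sqint (fun x => v x * v x * f x) by exact: realH1_sq (realH1M (realH1M Hv Hv) Hf).
have iX := sqint_mul sw sw; have iY := sqint_mul sf sf; have iZ := sqint_mul svf sf.
pose a := lam ^+ 2 * (1 - (10 * 10 * 10)^-1); pose b := 2 * k.
pose h x := wd f x ^+ 2 + U x * f x ^+ 2.
have hE x : h x = wd f x * wd f x + (a * (f x * f x) - b * (v x * v x * f x * f x)).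
  by rewrite /h UE /a /b; ring.
have ia := integZ a measurableT iY; have ib := integZ b measurableT iZ.
have iab := integB measurableT ia ib.
have hi : integ setT h.
  by apply: eq_integrable (integD measurableT iX iab) => // x _; rewrite /= hE.
have Ih : \int[mu]_x h x = ip (wd f) (wd f) + (a * ip f f - b * ip (fun x => v x * v x * f x) f).
  rewrite !ipE; transitivity (\int[mu]_x (wd f x * wd f x + (a * (f x * f x) - b * (v x * v x * f x * f x)))).
    by apply: eq_Rintegral => x _; exact: hE.
  rewrite RintegralD// RintegralB// RintegralZl// RintegralZl//.
have [hl El] := ray_opp (integT (measurable_itv `]-oo, 0]) hi).
have h2c : 2 * c <= \int[mu]_x h x.
  have mh : measurable_fun setT h by exact: integ_meas hi.
  have ho : integ setT (fun x => h (- x)) by exact: isom_integ (@isom_opp R) mh hi.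
  rewrite Rint_setT_split// -El.
  have h1' := h1 hi.
  have hEo : (fun x => h (- x)) = (fun x => wd f (- x) ^+ 2 + U x * f (- x) ^+ 2).
    by apply/funext => x; rewrite /h !UE vsol_opp.
  rewrite hEo in ho; have := h2 ho; rewrite -hEo; move: h1'; rewrite -/h.
  lra.
have ZY : ip (fun x => v x * v x * f x) f <= lam ^+ 2 * ip f f.
  rewrite !ipE -RintegralZl//; apply: le_Rintegral => //; first exact: integZ.
  move=> x _; rewrite -mulrA -!expr2; apply: ler_wpM2r; first exact: sqr_ge0.
  exact: vsol_sq_le.
have Y0 := ip_ge0 f; have X0 := ip_ge0 (wd f).
have Z0 : 0 <= ip (fun x => v x * v x * f x) f.
  by rewrite ipE; apply: Rintegral_ge0 => x _; rewrite -mulrA -!expr2 mulr_ge0 ?sqr_ge0.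
have BE := BpotE lam q k v f f.
rewrite sqr_n1 hipE.
rewrite Ih in h2c.
move: BE hc h2c ZY Y0 X0 Z0; rewrite /a /b.
move: (ip (wd f) (wd f)) (ip f f) (ip (fun x => v x * v x * f x) f) (Bpot _ _ _ _ _ _) (f 0) => X Y Z B f0 BE hc h2c ZY Y0 X0 Z0.
have l2 : 0 < lam ^+ 2 by rewrite exprn_gt0.
have kZ : k * Z <= 3 * (lam ^+ 2 * Y).
  by apply: ler_pM.
(* Keeping 1/12000 of the derivative costs 2 k Z / 12000 <= lam^2 Y / 2000, half of the lam^2 Y /
   1000 that was set aside in U. *)
have key : 12^-1 * (10 * 10 * 10)^-1 * X + 2^-1 * (10 * 10 * 10)^-1 * (lam ^+ 2 * Y) <= 2 * B.
  rewrite BE; have LY := mulr_ge0 (ltW l2) Y0.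
  move: kZ LY h2c hc; rewrite expr2.
  have -> : lam ^+ 2 * (1 - (10 * 10 * 10)^-1) * Y = (1 - (10 * 10 * 10)^-1) * (lam ^+ 2 * Y) by ring.
  have -> : 2^-1 * lam ^+ 2 * Y = 2^-1 * (lam ^+ 2 * Y) by ring.
  have -> : - q * (f0 * f0) = - (q * (f0 * f0)) by ring.
  have -> : 2 * k * Z = 2 * (k * Z) by ring.
  have -> : - k * Z = - (k * Z) by ring.
  move: (lam ^+ 2 * Y) (q * (f0 * f0)) (k * Z) => LY Q KZ; lra.
have XB : X <= 24 * (10 * 10 * 10) * B by have := mulr_ge0 (ltW l2) Y0; lra.
have YB : Y <= 4 * (10 * 10 * 10) / lam ^+ 2 * B.
  rewrite -mulrAC ler_pdivlMr//; have : Y * lam ^+ 2 = lam ^+ 2 * Y by rewrite mulrC.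
  lra.
lra.
Qed.

(** As f(0) = 0 the point term drops out, and [half_minus] with c = 0 treats f and its reflection
    alike. *)
Lemma coercive_minus f : realH1 v -> realH1 f -> f 0 = 0 ->
  n1 f ^+ 2 <= (24 * (10 * 10 * 10) + 4 * (10 * 10 * 10) / lam ^+ 2) * Bpot lam q 1 v f f.
Proof.
move=> Hv Hf f0; have sf := realH1_sq Hf; have sw := wder_sq Hf; have ac := realH1_acon Hf.
have [so swo] := (sqint_isom (@isom_opp R) sf, sqint_isom (@isom_opp R) sw).
pose U y := lam ^+ 2 - 2 * v y ^+ 2 - lam ^+ 2 * (10 * 10 * 10)^-1.
apply: (@coercive_of_half 1 0 f U) => //; first by rewrite ler01 ler1n.
- by move=> y; rewrite mulr1.
- exact: half_minus ac sf sw f0 _.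
- have -> : (fun x => wd f (- x) ^+ 2 + U x * f (- x) ^+ 2) =
      (fun x => (- wd f (- x)) ^+ 2 + U x * f (- x) ^+ 2).
    by apply/funext => x; rewrite sqrrN.
  apply: (@half_minus (fun x => f (- x)) (fun x => - wd f (- x)) U) => //; last by rewrite oppr0.
    by have := acon_opp ac; apply: acon_sub.
  by apply: sqintN.
- by rewrite f0 expr0n !mulr0.
Qed.

(** Each half-line requires a zero at distance (5 lam)^{-1} from the origin; evenness supplies the
    second one. *)
Lemma coercive_plus f : realH1 v -> realH1 f -> (forall x, f (- x) = f x) -> f (5 * lam)^-1 = 0 ->
  n1 f ^+ 2 <= (24 * (10 * 10 * 10) + 4 * (10 * 10 * 10) / lam ^+ 2) * Bpot lam q 3 v f f.
Proof.
move=> Hv Hf ev f0; have sf := realH1_sq Hf; have sw := wder_sq Hf; have ac := realH1_acon Hf.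
have [so swo] := (sqint_isom (@isom_opp R) sf, sqint_isom (@isom_opp R) sw).
pose U y := lam ^+ 2 - 6 * v y ^+ 2 - lam ^+ 2 * (10 * 10 * 10)^-1.
(* Slightly more than q, so that the point term is still paid for after the fraction 1/12000 is put
   aside; hence lam / 19 instead of lam / 20. *)
pose p := q / (1 - 12^-1 * (10 * 10 * 10)^-1).
have pl : `|p| <= 19^-1 * lam.
  rewrite /p normrM normfV (ger0_norm (x := 1 - 12^-1 * (10 * 10 * 10)^-1)); last by lra.
  rewrite ler_pdivrMr; last by lra.
  by apply: le_trans qlam _; have := lam0; lra.
apply: (@coercive_of_half 3 (p * f 0 ^+ 2) f U) => //; first by rewrite ler0n lexx.
- by move=> y; rewrite /U; ring.
- exact: half_plus ac sf sw f0 pl _.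
- have -> : (fun x => wd f (- x) ^+ 2 + U x * f (- x) ^+ 2) =
      (fun x => (- wd f (- x)) ^+ 2 + U x * f (- x) ^+ 2).
    by apply/funext => x; rewrite sqrrN.
  have -> : p * f 0 ^+ 2 = p * f (- 0) ^+ 2 by rewrite oppr0.
  apply: (@half_plus (fun x => f (- x)) (fun x => - wd f (- x)) U p) => //; last by rewrite ev.
    by have := acon_opp ac; apply: acon_sub.
  by apply: sqintN.
- have t0 : 0 < 1 - 12^-1 * (10 * 10 * 10)^-1 :> R by lra.
  have pE : p * (1 - 12^-1 * (10 * 10 * 10)^-1) = q by rewrite /p divfK// gt_eqF.
  by rewrite (mulrCA (1 - 12^-1 * (10 * 10 * 10)^-1)) mulrA pE.
Qed.

End Half.
End Riccati.

(** * Stability *)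

Section Dynamics.
Variable R : realType.
Implicit Types (f g phi v : R -> R) (t s x y k T : R) (z w : R -> R -> R).

Lemma MVT_eps f (df : R -> R) s : 0 < s ->
  (forall t, 0 < t < s -> is_derive t (1 : R) f (df t)) ->
  (forall t, 0 <= t <= s -> forall e, 0 < e -> exists2 d, 0 < d &
     forall y, 0 <= y <= s -> `|y - t| < d -> `|f y - f t| < e) ->
  exists2 c, 0 < c < s & f s - f 0 = df c * s.
Proof.
move=> s0 df' cf.
have D t : t \in `]0, s[ -> is_derive t (1 : R) f (df t).
  by rewrite in_itv/=; exact: df'.
have W : {within `[0, s], continuous f} by exact: eps_within.
have [c + E] := MVT s0 D W.
by rewrite in_itv/= => hc; exists c => //; rewrite E subr0.
Qed.

Definition cont_on T f := forall t, 0 <= t <= T -> forall e, 0 < e -> exists2 d, 0 < d &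
  forall y, 0 <= y <= T -> `|y - t| < d -> `|f y - f t| < e.

Lemma cont_on_sub T s f : s <= T -> cont_on T f -> cont_on s f.
Proof.
move=> sT H t /andP[t0 ts] e e0.
have [|d d0 Hd] := H t _ e e0; first by rewrite t0 (le_trans ts).
by exists d => // y /andP[y0 ys]; apply: Hd; rewrite y0 (le_trans ys).
Qed.

Lemma deriv_bound_le T f (df : R -> R) C t : 0 <= t <= T -> cont_on T f ->
  (forall t, 0 < t < T -> is_derive t (1 : R) f (df t)) ->
  (forall s, 0 < s < t -> df s <= C) -> f t - f 0 <= C * t.
Proof.
move=> /andP[t0 tT] cf d H; have [->|tn] := eqVneq t 0; first by rewrite subrr mulr0.
have {}t0 : 0 < t by rewrite lt_def tn.
have [||c hc ->] := @MVT_eps f df t t0.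
- by move=> s /andP[s0 st]; apply: d; rewrite s0 (lt_le_trans st).
- exact: cont_on_sub cf.
- by rewrite ler_pM2r// H.
Qed.

Lemma cont_onN T f : cont_on T f -> cont_on T (fun t => - f t).
Proof.
move=> H t ht e e0; have [d d0 Hd] := H t ht e e0.
by exists d => // y hy yt; rewrite -opprD normrN; exact: Hd.
Qed.

Lemma deriv_bound_norm T f (df : R -> R) C t : 0 <= t <= T -> cont_on T f ->
  (forall t, 0 < t < T -> is_derive t (1 : R) f (df t)) ->
  (forall s, 0 < s < t -> `|df s| <= C) -> `|f t - f 0| <= C * t.
Proof.
move=> ht cf d H; rewrite ler_norml; apply/andP; split; last first.
  by apply: (deriv_bound_le ht cf d) => s hs; apply: le_trans (H s hs); exact: ler_norm.
have dN s : 0 < s < T -> is_derive s (1 : R) (fun t => - f t) (- df s).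
  by move=> hs; have := d s hs; exact: is_deriveN.
have := deriv_bound_le ht (cont_onN cf) dN (C := C).
rewrite lerNl opprB opprK addrC; apply => s hs.
by apply: le_trans (H s hs); rewrite -normrN; exact: ler_norm.
Qed.

Lemma cont_onM T f g : cont_on T f -> continuous g -> cont_on T (fun t => f t * g t).
Proof.
move=> H cg t ht.
have W : {within `[0, T], continuous (fun t => f t * g t)}.
  have W1 : {within `[0, T], continuous f} by exact: eps_within.
  have W2 : {within `[0, T], continuous g} by exact: continuous_subspaceT.
  by move=> x; apply: cvgM; [exact: W1|exact: W2].
exact: within_itv_eps.
Qed.

(** The sign version, by an integrating factor: for an energy that is at most 0 initially. *)
Lemma gronwall T f (df : R -> R) K t : 0 <= t <= T -> cont_on T f ->
  (forall t, 0 < t < T -> is_derive t (1 : R) f (df t)) ->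
  (forall s, 0 < s < T -> df s <= K * f s) -> f 0 <= 0 -> f t <= 0.
Proof.
move=> ht cf d H f0.
pose E t := expR (- K * t).
have dE s : 0 < s < T -> is_derive s (1 : R) (fun t => f t * E t) ((df s - K * f s) * E s).
  move=> hs; have := isD_M (d s hs) (is_derive_expRZ (- K) s).
  by move/isD_eq; apply; rewrite /E; ring.
have := deriv_bound_le ht (cont_onM cf (@continuous_expRZ _ (- K))) dE (C := 0).
rewrite mul0r => B.
have {}B : f t * E t <= f 0.
  rewrite -subr_le0 -[f 0]mulr1 -(@expR0 R) -[X in expR X](mulr0 (- K)); apply: B => s /andP[s0 st].
  have /andP[_ tT] := ht.
  by apply: mulr_le0_ge0; rewrite ?expR_ge0// subr_le0 H// s0 (lt_le_trans st).
have := le_trans B f0; rewrite pmulr_lle0//; exact: expR_gt0.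
Qed.

Lemma bform_cont_on B T z w : bform B -> h1curve T z -> h1curve T w ->
  cont_on T (fun t => B (z t) (w t)).
Proof.
move=> HB Hz Hw t ht e e0.
have [d d0 Hd] := bform_curve HB Hz Hw ht ht e0.
by exists d => // y hy yt; exact: Hd.
Qed.

Lemma cont_on_n1 T z : h1curve T z -> cont_on T (fun t => n1 (z t)).
Proof.
move=> Hz t ht e e0; have [Ht /(_ e e0) [d d0 Hd]] := Hz t ht.
exists d => // y hy yt; apply: le_lt_trans (Hd y hy yt).
have Hy := curve_H1 Hz hy.
have a1 : n1 (z y) <= n1 (z t) + n1 (fun x => z y x - z t x).
  have := n1D Ht (realH1B Hy Ht); congr (n1 _ <= _); apply/funext => x; ring.
have a2 : n1 (z t) <= n1 (z y) + n1 (fun x => z y x - z t x).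
  have := n1B Hy (realH1B Hy Ht); congr (n1 _ <= _); apply/funext => x; ring.
by rewrite ler_norml; apply/andP; split; lra.
Qed.

Lemma cont_onD T f g : cont_on T f -> cont_on T g -> cont_on T (fun t => f t + g t).
Proof.
move=> Hf Hg t ht e e0; have e2 : 0 < e / 2 by rewrite divr_gt0.
have [d1 d10 H1] := Hf t ht _ e2; have [d2 d20 H2] := Hg t ht _ e2.
exists (Num.min d1 d2) => [|y hy]; first by rewrite lt_min d10.
rewrite lt_min => /andP[y1 y2]; have -> : f y + g y - (f t + g t) = (f y - f t) + (g y - g t) by ring.
apply: le_lt_trans (ler_normD _ _) _; rewrite [ltRHS]splitr.
by apply: ltrD; [exact: H1|exact: H2].
Qed.

Lemma cont_on_max T f : 0 <= T -> cont_on T f ->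
  exists2 c, 0 <= c <= T & forall t, 0 <= t <= T -> f t <= f c.
Proof.
move=> T0 cf; have W : {within `[0, T], continuous f} by exact: eps_within.
have [c + H] := EVT_max T0 W; rewrite in_itv/= => hc.
by exists c => // t ht; apply: H; rewrite in_itv.
Qed.

(* Continuous induction: a bound that improves itself persists. *)
Lemma bootstrap T f h : 0 <= T -> cont_on T f -> f 0 < h ->
  (forall s, 0 <= s <= T -> (forall t, 0 <= t <= s -> f t <= h) -> f s < h) ->
  forall t, 0 <= t <= T -> f t <= h.
Proof.
move=> T0 cf f0 H.
suff P s : 0 <= s <= T -> forall t, 0 <= t <= s -> f t <= h.
  by move=> t ht; apply: (P t ht); case/andP : ht => -> _ /=.
apply: (@real_induction _ (fun s => forall t, 0 <= t <= s -> f t <= h)) => //.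
- by move=> t /le_anti <-; exact: ltW.
- move=> x /andP[x0 xT] Px; have hx : 0 <= x <= T by rewrite x0 ltW.
  have fx := H x hx Px; have e0 : 0 < h - f x by rewrite subr_gt0.
  have [d d0 Hd] := cf x hx _ e0; exists d => // y /andP[xy yd] yT t /andP[t0 ty].
  have [tx|xt] := leP t x; first by apply: Px; rewrite t0.
  have := Hd t; rewrite t0 (le_trans ty yT) => /(_ isT).
  rewrite gtr0_norm ?subr_gt0// => /(_ _); have td : t - x < d by lra.
  by move=> /(_ td); have := ler_norm (f t - f x); lra.
- move=> x /andP[x0 xT] Px t /andP[t0 tx].
  have [tx'|xt] := ltP t x; first by apply: (Px t) => //; rewrite ?t0//= lexx.
  have -> : t = x by apply/le_anti; rewrite tx xt.
  have hx : 0 <= x <= T by rewrite ltW.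
  rewrite leNgt; apply/negP => hf; have e0 : 0 < f x - h by rewrite subr_gt0.
  have [d d0 Hd] := cf x hx _ e0.
  pose y := Num.max 0 (x - d / 2).
  have yx : 0 <= y < x by rewrite /y le_max lexx gt_max x0; lra.
  have yd : `|y - x| < d.
    case/andP: yx => y0 yx; rewrite distrC gtr0_norm ?subr_gt0//.
    have : x - d / 2 <= y by rewrite /y le_max lexx orbT.
    lra.
  have hy : 0 <= y <= T by case/andP: yx => y0 yx; rewrite y0 (le_trans (ltW yx)).
  have fy : f y <= h by apply: (Px y yx); case/andP : yx => -> _; rewrite lexx.
  have := Hd y hy yd; rewrite distrC => /(le_lt_trans (ler_norm _)); lra.
Qed.

End Dynamics.

(** * Coercivity modulo one direction for each form, and the energy estimate *)

Section Stability.
Variable R : realType.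
Implicit Types (f g phi : R -> R) (t s x : R) (z w N : R -> R -> R).
Variables (lam q m M : R).
Hypotheses (m0 : 0 < m) (mlam : m <= lam) (lamM : lam <= M) (qm : `|q| <= 20^-1 * m).

Let lam0 : 0 < lam. Proof. exact: lt_le_trans m0 mlam. Qed.
Let M0 : 0 < M. Proof. exact: lt_le_trans lam0 lamM. Qed.
Let qlam : `|q| <= 20^-1 * lam. Proof. by apply: le_trans qm _; rewrite ler_pM2l. Qed.

Local Notation v := (vsol lam q).
Local Notation D := (dsol lam q).
Local Notation Bp := (Bpot lam q 3 v).
Local Notation Bm := (Bpot lam q 1 v).
Local Notation Cs := (sol_bound m M).

(** The constant of [coercive_minus] and [coercive_plus] at lam = m, the worst case for lam >= m. *)
Definition coer_cst := 24 * (10 * 10 * 10) + 4 * (10 * 10 * 10) / m ^+ 2.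
Definition coer_A := (2 + 4 * Cs ^+ 4) * coer_cst.
Definition coer_B := 4 * Cs ^+ 2.

Lemma vsolH : realH1 v. Proof. exact: (vsol_H1 m0 mlam lamM qm).1. Qed.
Lemma vsoln : n1 v <= Cs. Proof. exact: (vsol_H1 m0 mlam lamM qm).2. Qed.
Lemma dsolH : realH1 D. Proof. exact: (dsol_H1 m0 mlam lamM qm).1. Qed.
Lemma dsoln : n1 D <= Cs. Proof. exact: (dsol_H1 m0 mlam lamM qm).2. Qed.
Lemma Cs_ge0 : 0 <= Cs. Proof. exact: sqrtr_ge0. Qed.
Lemma bformp : bform Bp. Proof. exact: bform_Bpot vsolH. Qed.
Lemma bformm : bform Bm. Proof. exact: bform_Bpot vsolH. Qed.

Lemma coer_cst_gt0 : 0 < coer_cst.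
Proof. by rewrite ltr_pwDl// ?mulr_gt0// mulr_ge0// ?mulr_ge0// invr_ge0 sqr_ge0. Qed.

Lemma coer_cst_le : 24 * (10 * 10 * 10) + 4 * (10 * 10 * 10) / lam ^+ 2 <= coer_cst.
Proof.
rewrite lerD2l ler_wpM2l// ?mulr_ge0// lef_pV2 ?posrE ?exprn_gt0//.
by rewrite ler_sqr ?nnegrE// ltW.
Qed.

Lemma coer_A_ge0 : 0 <= coer_A.
Proof.
apply: mulr_ge0; last exact: ltW coer_cst_gt0.
by rewrite addr_ge0// mulr_ge0// exprn_ge0// Cs_ge0.
Qed.

Lemma coer_le f (B : R) :
  n1 f ^+ 2 <= (24 * (10 * 10 * 10) + 4 * (10 * 10 * 10) / lam ^+ 2) * B ->
  0 <= B /\ n1 f ^+ 2 <= coer_cst * B.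
Proof.
move=> H; have B0 : 0 <= B.
  have c0 : 0 < 24 * (10 * 10 * 10) + 4 * (10 * 10 * 10) / lam ^+ 2 :> R.
    by rewrite ltr_pwDl// ?mulr_gt0// mulr_ge0// ?mulr_ge0// invr_ge0 sqr_ge0.
  by rewrite -(pmulr_rge0 _ c0); apply: le_trans H; exact: sqr_ge0.
by split=> //; apply: le_trans H _; rewrite ler_wpM2r// coer_cst_le.
Qed.

(* [f = g + c e] with [g] controlled by coercivity and [c] by the pairing of [f] with [d]. *)
Lemma coer_decomp f g d e (c : R) : realH1 g -> realH1 e -> realH1 d -> n1 e <= Cs -> n1 d <= Cs ->
  (forall x, f x = g x + c * e x) -> ip e d = 1 ->
  n1 f ^+ 2 <= (2 + 4 * Cs ^+ 4) * n1 g ^+ 2 + coer_B * ip f d ^+ 2.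
Proof.
move=> Hg He Hd eC dC fE ed; have C0 := Cs_ge0.
have Hc := realH1Z c He.
have ff : f = fun x => g x + c * e x by apply/funext.
have iE : ip f d = ip g d + c.
  by rewrite ff ipDl ?ipZl ?ed ?mulr1//; exact: realH1_sq.
have gd : `|ip g d| <= n1 g * Cs.
  by apply: le_trans (ip_n1 Hg Hd) _; rewrite ler_wpM2l// n1_ge0.
have nf : n1 f <= n1 g + `|c| * Cs.
  rewrite ff; apply: le_trans (n1D Hg Hc) _; rewrite lerD2l n1Z//.
  by rewrite ler_wpM2l.
have nf2 : n1 f ^+ 2 <= 2 * n1 g ^+ 2 + 2 * (c ^+ 2 * Cs ^+ 2).
  have h : n1 f ^+ 2 <= (n1 g + `|c| * Cs) ^+ 2.
    by rewrite ler_sqr ?nnegrE ?addr_ge0 ?mulr_ge0 ?n1_ge0.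
  apply: le_trans h _; rewrite -(real_normK (num_real c)) -exprMn.
  move: (n1 g) (`|c| * Cs) => a b; have := sqr_ge0 (a - b); lra.
have cE : c ^+ 2 <= 2 * ip f d ^+ 2 + 2 * (n1 g ^+ 2 * Cs ^+ 2).
  have h : ip g d ^+ 2 <= n1 g ^+ 2 * Cs ^+ 2.
    rewrite -exprMn -(real_normK (num_real (ip g d))) ler_sqr ?nnegrE//.
    by rewrite mulr_ge0// n1_ge0.
  have -> : c = ip f d - ip g d by rewrite iE addrAC subrr add0r.
  move: h; move: (ip f d) (ip g d) (n1 g ^+ 2 * _) => a b k h; have := sqr_ge0 (a + b); lra.
apply: le_trans nf2 _; have C2 := sqr_ge0 Cs.
have := ler_wpM2r C2 cE; rewrite /coer_B.
have -> : Cs ^+ 4 = Cs ^+ 2 * Cs ^+ 2 by rewrite -exprD.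
move: (c ^+ 2) (ip f d ^+ 2) (n1 g ^+ 2) (Cs ^+ 2) => c2 i2 g2 C; lra.
Qed.

(** The multiple of v that makes f vanish at 0 leaves the form unchanged, v being in the kernel of
    L_-. *)
Lemma coer_full_minus f : realH1 f ->
  n1 f ^+ 2 <= coer_A * Bm f f + coer_B * ip f D ^+ 2.
Proof.
move=> Hf; have HB := bformm; have Hv := vsolH; have Hd := dsolH.
pose c := f 0 / v 0; pose g x := f x - c * v x.
have Hcv := realH1Z c Hv; have Hg : realH1 g by exact: realH1B.
have v0 : v 0 != 0 by rewrite gt_eqF//; exact: (@vsol_gt0 R lam q m m0 mlam 0).
have g0 : g 0 = 0 by rewrite /g /c divfK// subrr.
have fE x : f x = g x + c * v x by rewrite /g subrK.
have BE : Bm g g = Bm f f.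
  have [_ BZ BC _] := HB.
  have Bv h : realH1 h -> Bm v h = 0 by exact: (Bm_vsol m0 mlam lamM qm).
  rewrite /g (bformBl HB)// (bformBr HB)// BZ// (BC f)//.
  have Bvg := Bv _ Hg; rewrite /g in Bvg.
  by rewrite BZ// (Bv f)// Bvg; ring.
have [B0 B1] := coer_le (coercive_minus lam0 qlam Hv Hg g0).
apply: le_trans (coer_decomp Hg Hv Hd vsoln dsoln fE (ip_vsol_dsol m0 mlam lamM qm)) _.
rewrite lerD2r -BE /coer_A -mulrA ler_wpM2l//.
by rewrite addr_ge0// mulr_ge0// exprn_ge0// Cs_ge0.
Qed.

(** Subtracting c d_lam v changes the form by 2 c lam <f, v> - c^2 lam, because L_+ d_lam v = - lam
    v and <v, d_lam v> = 1. Completing the square, this is at most lam <f, v>^2, whatever c is. *)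
Lemma coer_full_plus f : realH1 f -> (forall x, f (- x) = f x) ->
  0 <= Bp f f + M * ip f v ^+ 2 /\
  n1 f ^+ 2 <= coer_A * (Bp f f + M * ip f v ^+ 2) + coer_B * ip f v ^+ 2.
Proof.
move=> Hf ev; have HB := bformp; have Hv := vsolH; have Hd := dsolH.
pose x0 := (5 * lam)^-1.
pose c := f x0 / D x0; pose g x := f x - c * D x.
have Hcd := realH1Z c Hd; have Hg : realH1 g by exact: realH1B.
have d0 : D x0 != 0.
  rewrite gt_eqF//; apply: (dsol_gt0 m0 mlam qm).
  rewrite ger0_norm /x0 ?invr_ge0 ?mulr_ge0 ?(ltW lam0)// invfM mulrCA divff ?mulr1//.
  by rewrite gt_eqF// lam0.
have g0 : g x0 = 0 by rewrite /g /c divfK// subrr.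
have fE x : f x = g x + c * D x by rewrite /g subrK.
have gev x : g (- x) = g x by rewrite /g ev /dsol normrN.
have vD := ip_vsol_dsol m0 mlam lamM qm.
have BE : Bp g g = Bp f f + 2 * c * lam * ip f v - c ^+ 2 * lam.
  have [_ BZ BC _] := HB.
  have Bd h : realH1 h -> Bp D h = - lam * ip v h by exact: (Bp_dsol m0 mlam lamM qm).
  rewrite /g (bformBl HB)// (bformBr HB)// BZ// (BC f)//.
  have Bdg := Bd _ Hg; rewrite /g in Bdg.
  rewrite BZ// (Bd f)// Bdg.
  have [sD sv] := (realH1_sq Hd, realH1_sq Hv).
  rewrite (ipBr (realH1_sq Hf) (realH1_sq Hcd) sv) (ipZr c sD sv) vD.
  by rewrite (ipC v f); ring.
have Bg : Bp g g <= Bp f f + M * ip f v ^+ 2.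
  have : lam * ip f v ^+ 2 <= M * ip f v ^+ 2 by rewrite ler_wpM2r// sqr_ge0.
  have := mulr_ge0 (ltW lam0) (sqr_ge0 (c - ip f v)).
  by rewrite BE; move: (ip f v) => a; lra.
have [B0 B1] := coer_le (coercive_plus lam0 qlam Hv Hg gev g0).
split; first exact: le_trans B0 Bg.
have dv : ip D v = 1 by rewrite ipC.
apply: le_trans (coer_decomp Hg Hd Hv dsoln vsoln fE dv) _.
rewrite lerD2r /coer_A -mulrA; apply: ler_wpM2l.
  by rewrite addr_ge0// mulr_ge0// exprn_ge0// Cs_ge0.
by apply: le_trans B1 _; rewrite ler_wpM2l// ltW// coer_cst_gt0.
Qed.

(** From 1 + lam^2 + 4 |q| + k M^2, with lam <= M, 4 |q| <= m and k <= 3. *)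
Definition bnd_cst := 1 + 4 * M ^+ 2 + m.

Lemma Bpot_le k f g : 0 <= k <= 3 -> realH1 f -> realH1 g ->
  `|Bpot lam q k v f g| <= bnd_cst * (n1 f * n1 g).
Proof.
move=> /andP[k0 k3] Hf Hg.
have vM x : `|v x| <= M by exact: (@vsol_le R lam q m M m0 mlam lamM x).
apply: le_trans (Bpot_bound lam q vsolH k0 (ltW M0) vM Hf Hg) _.
rewrite ler_wpM2r// ?mulr_ge0 ?n1_ge0//.
have l2 : lam ^+ 2 <= M ^+ 2 by rewrite ler_sqr ?nnegrE ?(ltW lam0) ?(ltW M0).
have := ler_wpM2r (sqr_ge0 M) k3; rewrite /bnd_cst; have := qm; have := m0.
lra.
Qed.

Definition st_A1 := 4 * coer_A * bnd_cst.
Definition st_A2 := coer_A * (M * Cs ^+ 2) + coer_B * (Cs ^+ 2 + ((1 + M) * Cs) ^+ 2).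

Section System.
Variables (T : R) (z1 z2 N1 N2 : R -> R -> R).
Hypotheses (Hz1 : h1curve T z1) (Hz2 : h1curve T z2) (HN1 : h1curve T N1) (HN2 : h1curve T N2).
Hypotheses (W : weak_system T Bp Bm z1 z2 N1 N2).
Hypotheses (ev : forall t, 0 <= t <= T -> forall x, z1 t (- x) = z1 t x).
Hypotheses (al0 : ip (z1 0) v = 0) (be0 : ip (z2 0) D = 0).
Variables (s nu X : R).
Hypotheses (sT : 0 <= s <= T) (nu0 : 0 <= nu) (X0 : 0 <= X).
Hypothesis HN : forall t, 0 <= t <= s -> n1 (N1 t) <= nu /\ n1 (N2 t) <= nu.
Hypothesis HX : forall t, 0 <= t <= s -> n1 (z1 t) <= X /\ n1 (z2 t) <= X.

Let inT t : 0 <= t <= s -> 0 <= t <= T.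
Proof. by case/andP: sT => _ h /andP[-> ts]; exact: le_trans ts h. Qed.

Let sub t r : 0 <= t <= s -> 0 < r < t -> 0 <= r <= s.
Proof. by move=> /andP[_ ts] /andP[r0 rt]; rewrite ltW//= ltW// (lt_le_trans rt). Qed.

Lemma ip_z1_v t : 0 <= t <= s -> `|ip (z1 t) v| <= Cs * nu * t.
Proof.
move=> ht; have Hv := vsolH.
have d r : 0 < r < T -> is_derive r (1 : R) (fun t => ip (z1 t) v) (- ip (N2 r) v).
  move=> hr; have [d1 _] := W Hv hr; have hr' : 0 <= r <= T by case/andP: hr => *; rewrite !ltW.
  have [_ _ BC _] := bformm.
  move/isD_eq: d1; apply; rewrite BC//; last exact: curve_H1 Hz2 hr'.
  by rewrite (Bm_vsol m0 mlam lamM qm) ?sub0r//; exact: curve_H1 Hz2 hr'.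
have := deriv_bound_norm (inT ht) (bform_cont_on (@bform_ip R) Hz1 (@curve_cst _ T _ Hv)) d.
rewrite al0 subr0; apply => r hr; have hrs := sub ht hr.
rewrite normrN; apply: le_trans (ip_n1 (curve_H1 HN2 (inT hrs)) Hv) _.
rewrite mulrC; apply: ler_pM; rewrite ?n1_ge0 ?vsoln//; exact: (HN hrs).2.
Qed.

(** beta is driven by lam alpha, and alpha may already have grown linearly; hence the quadratic
    growth in s. *)
Lemma ip_z2_d t : 0 <= t <= s -> `|ip (z2 t) D| <= (M * (Cs * nu * s) + Cs * nu) * t.
Proof.
move=> ht; have Hd := dsolH; have Hv := vsolH.
have d r : 0 < r < T -> is_derive r (1 : R) (fun t => ip (z2 t) D) (lam * ip (z1 r) v + ip (N1 r) D).
  move=> hr; have [_ d1] := W Hd hr; have hr' : 0 <= r <= T by case/andP: hr => *; rewrite !ltW.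
  have [_ _ BC _] := bformp.
  move/isD_eq: d1; apply; rewrite BC//; last exact: curve_H1 Hz1 hr'.
  rewrite (Bp_dsol m0 mlam lamM qm); last exact: curve_H1 Hz1 hr'.
  by rewrite mulNr opprK ipC.
have := deriv_bound_norm (inT ht) (bform_cont_on (@bform_ip R) Hz2 (@curve_cst _ T _ Hd)) d.
rewrite be0 subr0; apply => r hr; have hrs := sub ht hr.
apply: le_trans (ler_normD _ _) _; apply: lerD.
  rewrite normrM (gtr0_norm lam0); apply: ler_pM => //; first exact: ltW.
  apply: le_trans (ip_z1_v hrs) _; apply: ler_wpM2l; last by case/andP: hrs.
  by rewrite mulr_ge0 ?Cs_ge0.
apply: le_trans (ip_n1 (curve_H1 HN1 (inT hrs)) Hd) _.
rewrite mulrC; apply: ler_pM; rewrite ?n1_ge0 ?dsoln//; exact: (HN hrs).1.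
Qed.

Lemma energy_bound t : 0 <= t <= s ->
  Bp (z1 t) (z1 t) + Bm (z2 t) (z2 t) <=
  Bp (z1 0) (z1 0) + Bm (z2 0) (z2 0) + 4 * bnd_cst * X * nu * t.
Proof.
move=> ht; have dE := energy_derivative bformp bformm Hz1 Hz2 HN1 HN2 W.
have cE := cont_onD (bform_cont_on bformp Hz1 Hz1) (bform_cont_on bformm Hz2 Hz2).
have b0 : 0 <= bnd_cst.
  by rewrite /bnd_cst; have := sqr_ge0 M; have := m0; lra.
have := deriv_bound_le (inT ht) cE dE (C := 4 * bnd_cst * X * nu).
move=> K; rewrite -lerBlDl; apply: K => r hr; have hrs := sub ht hr.
have [[n1' n2'] [x1 x2]] := (HN hrs, HX hrs); have ir := inT hrs.
have k3 : 0 <= (3 : R) <= 3 by rewrite lexx andbT ler0n.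
have k1 : 0 <= (1 : R) <= 3 by rewrite ler01 ler1n.
have b1 := Bpot_le k1 (curve_H1 Hz2 ir) (curve_H1 HN1 ir).
have b2 := Bpot_le k3 (curve_H1 Hz1 ir) (curve_H1 HN2 ir).
have c1 : bnd_cst * (n1 (z2 r) * n1 (N1 r)) <= bnd_cst * (X * nu).
  by rewrite ler_wpM2l//; apply: ler_pM; rewrite ?n1_ge0.
have c2 : bnd_cst * (n1 (z1 r) * n1 (N2 r)) <= bnd_cst * (X * nu).
  by rewrite ler_wpM2l//; apply: ler_pM; rewrite ?n1_ge0.
have := le_trans b1 c1; have := le_trans b2 c2; rewrite !ler_norml => /andP[h1 h2] /andP[h3 h4].
have -> : 4 * bnd_cst * X * nu = 4 * (bnd_cst * (X * nu)) by ring.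
lra.
Qed.

(** The energy grows at a rate linear in the unknown, so its size X on [0, s] stays explicit; it is
    later taken to be a maximum, and the resulting quadratic inequality solved. For nu = 0 only the
    initial energy remains. *)
Lemma modulated_energy_bound t : 0 <= t <= s -> n1 (z1 t) ^+ 2 + n1 (z2 t) ^+ 2 <=
  coer_A * (Bp (z1 0) (z1 0) + Bm (z2 0) (z2 0)) + st_A1 * X * (nu * (s * (1 + s)))
  + st_A2 * (nu * (s * (1 + s))) ^+ 2.
Proof.
move=> ht; have ir := inT ht; have C0 := Cs_ge0.
have /andP[t0 ts] := ht; have s0 := le_trans t0 ts.
have [E1 c1] := coer_full_plus (curve_H1 Hz1 ir) (ev ir).
have c2 := coer_full_minus (curve_H1 Hz2 ir).
have e := energy_bound ht.
set Y := nu * (s * (1 + s)).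
have Y0 : 0 <= Y by rewrite !mulr_ge0// addr_ge0.
have sY : nu * s <= Y by rewrite /Y ler_wpM2l// ler_peMr// lerDl.
have s2Y : nu * s * s <= Y by rewrite /Y -mulrA ler_wpM2l// ler_wpM2l// lerDr.
have M1 : 0 <= 1 + M by rewrite addr_ge0// ltW.
have P1 : 0 <= Cs * Y by rewrite mulr_ge0.
have P2 : 0 <= (1 + M) * Cs * Y by rewrite mulr_ge0// mulr_ge0.
have a : ip (z1 t) v ^+ 2 <= (Cs * Y) ^+ 2.
  rewrite -(real_normK (num_real (ip (z1 t) v))) ler_sqr ?nnegrE//.
  apply: le_trans (ip_z1_v ht) _; rewrite -mulrA ler_wpM2l//.
  by apply: le_trans sY; rewrite ler_wpM2l.
have b : ip (z2 t) D ^+ 2 <= ((1 + M) * Cs * Y) ^+ 2.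
  rewrite -(real_normK (num_real (ip (z2 t) D))) ler_sqr ?nnegrE//.
  apply: le_trans (ip_z2_d ht) _.
  have k0 : 0 <= M * (Cs * nu * s) + Cs * nu.
    by rewrite addr_ge0// ?mulr_ge0// ltW.
  apply: le_trans (ler_wpM2l k0 ts) _.
  have -> : (M * (Cs * nu * s) + Cs * nu) * s = (M * Cs) * (nu * s * s) + Cs * (nu * s) by ring.
  have -> : (1 + M) * Cs * Y = (M * Cs) * Y + Cs * Y by ring.
  by apply: lerD; apply: ler_wpM2l => //; rewrite mulr_ge0// ltW.
have en : 4 * bnd_cst * X * nu * t <= 4 * bnd_cst * X * Y.
  rewrite -mulrA; apply: ler_wpM2l.
    rewrite !mulr_ge0//; have := sqr_ge0 M; have := m0; rewrite /bnd_cst; lra.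
  by apply: le_trans sY; rewrite ler_wpM2l.
have Ma := ler_wpM2l (ltW M0) a.
have A0 := coer_A_ge0; have B0 : 0 <= coer_B by rewrite mulr_ge0// sqr_ge0.
have Aen := ler_wpM2l A0 (lerD (le_trans e (lerD (lexx _) en)) Ma).
have Ba := ler_wpM2l B0 (lerD a b).
have -> : coer_A * (Bp (z1 0) (z1 0) + Bm (z2 0) (z2 0)) + st_A1 * X * Y + st_A2 * Y ^+ 2 =
   coer_A * (Bp (z1 0) (z1 0) + Bm (z2 0) (z2 0) + 4 * bnd_cst * X * Y + M * (Cs * Y) ^+ 2) +
   coer_B * ((Cs * Y) ^+ 2 + ((1 + M) * Cs * Y) ^+ 2).
  by rewrite /st_A1 /st_A2; ring.
apply: le_trans (lerD Aen Ba).
have -> : forall e1 e2 a2 b2 : R, coer_A * (e1 + e2 + M * a2) + coer_B * (a2 + b2) =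
   (coer_A * (e1 + M * a2) + coer_B * a2) + (coer_A * e2 + coer_B * b2).
  by move=> *; ring.
exact: lerD.
Qed.

End System.
End Stability.

(** * Evenness of the linear flow *)

Section Parity.
Variable R : realType.
Implicit Types (f g phi v : R -> R) (t s x y : R) (z w : R -> R -> R).

Lemma is_derive_local T f g t (l : R) : (forall s, 0 < s < T -> f s = g s) -> 0 < t < T ->
  is_derive t (1 : R) f l -> is_derive t (1 : R) g l.
Proof.
move=> fg /andP[t0 tT] /is_derive_epsP H; apply/is_derive_epsP => e e0.
have [d d0 Hd] := H e e0.
exists (Num.min d (Num.min t (T - t))); first by rewrite !lt_min d0 t0 subr_gt0 tT.
move=> y; rewrite !lt_min => /and3P[yd yt yT].
rewrite -!fg ?t0//; first exact: Hd.
by move: yt yT; rewrite !ltr_norml => /andP[? ?] /andP[? ?]; apply/andP; split; lra.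
Qed.

Lemma ip0l f : sqint f -> ip (fun=> 0 : R) f = 0.
Proof.
move=> sf; have := @ipZl R 0 _ _ (@sqint0 R) sf.
by under eq_fun do rewrite mul0r; rewrite mul0r.
Qed.

Lemma curve_opp T z : h1curve T z -> h1curve T (fun t x => z t (- x)).
Proof.
move=> Hz t ht; have [Ht Hc] := Hz t ht; split; first exact: realH1_opp.
move=> e e0; have [d d0 Hd] := Hc e e0; exists d => // s hs sd.
have Hs := curve_H1 Hz hs.
by have := n1_opp (realH1B Hs Ht); move=> ->; exact: Hd.
Qed.

Lemma Bpot_opp lam q k v f g : realH1 v -> (forall x, v (- x) = v x) -> realH1 f -> realH1 g ->
  Bpot lam q k v (fun x => f (- x)) (fun x => g (- x)) = Bpot lam q k v f g.
Proof.
move=> Hv ev Hf Hg; rewrite !BpotE oppr0 ipw_opp// ip_opp//; try exact: realH1_sq.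
congr (_ + _ * _); have Hvf := realH1M (realH1M Hv Hv) Hf.
rewrite -[RHS](ip_opp (realH1_sq Hvf) (realH1_sq Hg)).
by congr ip; apply/funext => x; rewrite ev.
Qed.

Lemma ip_opp_adj f g : sqint f -> sqint g -> ip (fun x => f (- x)) g = ip f (fun x => g (- x)).
Proof.
move=> sf sg; have sgo := sqint_isom (@isom_opp R) sg.
rewrite -(ip_opp sf sgo); congr ip; apply/funext => x /=; by rewrite opprK.
Qed.

Lemma Bpot_opp_adj lam q k v f g : realH1 v -> (forall x, v (- x) = v x) -> realH1 f -> realH1 g ->
  Bpot lam q k v (fun x => f (- x)) g = Bpot lam q k v f (fun x => g (- x)).
Proof.
move=> Hv ev Hf Hg; have Hgo := realH1_opp Hg.
rewrite -(Bpot_opp lam q k Hv ev Hf Hgo); congr Bpot; apply/funext => x; by rewrite opprK.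
Qed.

Lemma Bpot_free lam q k v f g : realH1 v -> realH1 f -> realH1 g ->
  Bpot lam q k v f g = Bpot lam q 0 v f g - k * ip (fun x => v x * (v x * f x)) g.
Proof.
move=> Hv Hf Hg; rewrite !BpotE oppr0 mul0r addr0.
have -> : (fun x => v x * (v x * f x)) = (fun x => v x * v x * f x).
  by apply/funext => x; rewrite mulrA.
by rewrite (mulNr k).
Qed.

(** The odd difference z(x) - z(- x) vanishes at 0, so the point term drops out and the form with k
    = 0 controls its H^1 norm directly. The potentials go into N1 and N2, bounded by the difference
    itself. *)
Lemma weak_system_even lam q v T z1 z2 : 0 < lam -> realH1 v -> (forall x, v (- x) = v x) ->
  h1curve T z1 -> h1curve T z2 ->
  weak_system T (Bpot lam q 3 v) (Bpot lam q 1 v) z1 z2 (fun _ _ => 0) (fun _ _ => 0) ->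
  (forall x, z1 0 (- x) = z1 0 x) -> (forall x, z2 0 (- x) = z2 0 x) ->
  forall t, 0 <= t <= T -> forall x, z1 t (- x) = z1 t x /\ z2 t (- x) = z2 t x.
Proof.
move=> lam0 Hv ev Hz1 Hz2 W e1 e2.
pose y1 t x := z1 t x - z1 t (- x); pose y2 t x := z2 t x - z2 t (- x).
have Ho1 := curve_opp Hz1; have Ho2 := curve_opp Hz2.
have Hy1 : h1curve T y1 by exact: curveB.
have Hy2 : h1curve T y2 by exact: curveB.
have cv := @curve_cst _ T _ Hv.
pose N1 t x := 3 * (v x * (v x * y1 t x)); pose N2 t x := v x * (v x * y2 t x).
have HN2 : h1curve T N2 by exact: curveM cv (curveM cv Hy2).
have HN1 : h1curve T N1 by exact: curveZc (curveM cv (curveM cv Hy1)).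
pose H := Bpot lam q 0 v.
have HB : bform H by exact: bform_Bpot.
have inT s : 0 < s < T -> 0 <= s <= T by move=> /andP[? ?]; rewrite !ltW.
have W' : weak_system T H H y1 y2 N1 N2.
  move=> phi Hphi t ht; have [d1 d2] := W phi Hphi t ht.
  (* The reflected curve satisfies the same system: the reflection is moved onto the test function,
     v being even. *)
  have Hpo := realH1_opp Hphi; have [d3 d4] := W _ Hpo t ht.
  have sp := realH1_sq Hphi; have spo := realH1_sq Hpo.
  have [h1 h2] := (curve_H1 Hz1 (inT t ht), curve_H1 Hz2 (inT t ht)).
  have [h1o h2o] := (realH1_opp h1, realH1_opp h2).
  have [hy1 hy2] := (curve_H1 Hy1 (inT t ht), curve_H1 Hy2 (inT t ht)).
  rewrite !ip0l// in d1 d2 d3 d4.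
  have BE k z (Hz : h1curve T z) : Bpot lam q k v (z t) phi - Bpot lam q k v (z t) (fun x => phi (- x)) =
      H (fun x => z t x - z t (- x)) phi -
      k * ip (fun x => v x * (v x * (z t x - z t (- x)))) phi.
    have hz := curve_H1 Hz (inT t ht); have hzo := realH1_opp hz.
    by rewrite -(Bpot_opp_adj _ _ _ Hv ev hz Hphi) -(bformBl (bform_Bpot lam q k Hv))// Bpot_free//; exact: realH1B.
  split.
    apply: (@is_derive_local T (fun s => ip (z1 s) phi - ip (z1 s) (fun x => phi (- x)))) => //.
      move=> s hs; have sz := realH1_sq (curve_H1 Hz1 (inT s hs)).
      by rewrite -(ip_opp_adj sz sp) -ipBl//; exact: sqint_isom (@isom_opp R) sz.
    move/isD_eq: (isD_B d1 d3); apply; rewrite !subr0.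
    by rewrite (BE _ _ Hz2) mul1r.
  apply: (@is_derive_local T (fun s => ip (z2 s) phi - ip (z2 s) (fun x => phi (- x)))) => //.
    move=> s hs; have sz := realH1_sq (curve_H1 Hz2 (inT s hs)).
    by rewrite -(ip_opp_adj sz sp) -ipBl//; exact: sqint_isom (@isom_opp R) sz.
  move/isD_eq: (isD_B d2 d4); apply; rewrite !addr0 opprK addrC.
  have := BE 3 _ Hz1 => E.
  have -> : ip (N1 t) phi = 3 * ip (fun x => v x * (v x * y1 t x)) phi.
    by rewrite /N1 ipZl//; apply: realH1_sq; apply: realH1M => //; exact: realH1M.
  rewrite /y1; move: E; lra.
(* Without the point term the form is (1/2) X + (1/2) lam^2 Y, and this multiple of it dominates X +
   Y. *)
pose k0 := 2 + 2 / lam ^+ 2.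
have l2 : 0 < lam ^+ 2 by rewrite exprn_gt0.
have k00 : 0 <= k0 by rewrite addr_ge0// divr_ge0// ltW.
have coer f : realH1 f -> f 0 = 0 -> n1 f ^+ 2 <= k0 * H f f.
  move=> Hf f0; rewrite sqr_n1 hipE /H BpotE f0 mulr0 mulr0 oppr0 mul0r !addr0.
  have := ip_ge0 f; have := ip_ge0 (wd f); move: (ip f f) (ip (wd f) _) => Y X X0 Y0.
  have -> : k0 * (2^-1 * X + 2^-1 * lam ^+ 2 * Y) = X + Y + lam ^+ 2 * Y + X / lam ^+ 2.
    by rewrite /k0; field; rewrite gt_eqF.
  have := mulr_ge0 (ltW l2) Y0; have : 0 <= X / lam ^+ 2 by rewrite divr_ge0// ltW.
  lra.
have [_ _ _ [K K0 BK]] := HB.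
pose L := 27 * n1 v ^+ 2.
have nv f : realH1 f -> n1 (fun x => v x * (v x * f x)) <= 9 * n1 v ^+ 2 * n1 f.
  move=> Hf; apply: le_trans (n1M Hv (realH1M Hv Hf)) _.
  have := ler_wpM2l (n1_ge0 v) (n1M Hv Hf); rewrite expr2; lra.
have z0 f : n1 (f : R -> R) >= 0 by exact: n1_ge0.
pose E t := H (y1 t) (y1 t) + H (y2 t) (y2 t).
have y10 t : y1 t 0 = 0 by rewrite /y1 oppr0 subrr.
have y20 t : y2 t 0 = 0 by rewrite /y2 oppr0 subrr.
have dE := energy_derivative HB HB Hy1 Hy2 HN1 HN2 W'.
have cE : cont_on T E by apply: cont_onD; exact: bform_cont_on.
have E0 t : 0 <= t <= T -> E t <= 0.
  move=> ht; apply: (gronwall (K := 2 * K * L * k0) ht cE dE) => [s hs|]; last first.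
    have zz : (fun=> 0 : R) = y1 0 by apply/funext => x; rewrite /y1 e1 subrr.
    have zz2 : (fun=> 0 : R) = y2 0 by apply/funext => x; rewrite /y2 e2 subrr.
    rewrite /E -zz -zz2; have H0 := realH1_0 R.
    by have := BK _ _ H0 H0; rewrite n1_0 mulr0 mulr0 normr_le0 => /eqP ->; rewrite addr0.
  have [h1 h2] := (curve_H1 Hy1 (inT s hs), curve_H1 Hy2 (inT s hs)).
  have a1 := coer _ h1 (y10 s); have a2 := coer _ h2 (y20 s).
  have nN1 : n1 (N1 s) <= L * n1 (y1 s).
    rewrite /N1 n1Z ?ger0_norm//; last by apply: realH1M => //; exact: realH1M.
    have := nv _ h1; rewrite /L; lra.
  have nN2 : n1 (N2 s) <= L * n1 (y2 s).
    apply: le_trans (nv _ h2) _; rewrite ler_wpM2r ?z0// /L ler_wpM2r ?sqr_ge0//.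
    by rewrite ler_nat.
  have b1 := BK _ _ h2 (curve_H1 HN1 (inT s hs)); have b2 := BK _ _ h1 (curve_H1 HN2 (inT s hs)).
  have c1 : K * (n1 (y2 s) * n1 (N1 s)) <= K * (n1 (y2 s) * (L * n1 (y1 s))).
    by apply: ler_wpM2l => //; apply: ler_wpM2l => //; exact: n1_ge0.
  have c2 : K * (n1 (y1 s) * n1 (N2 s)) <= K * (n1 (y1 s) * (L * n1 (y2 s))).
    by apply: ler_wpM2l => //; apply: ler_wpM2l => //; exact: n1_ge0.
  have := le_trans b1 c1; have := le_trans b2 c2; rewrite !ler_norml => /andP[g1 g2] /andP[g3 g4].
  have KL : 0 <= K * L by rewrite mulr_ge0// mulr_ge0// sqr_ge0.
  have AG : 2 * (K * (n1 (y2 s) * (L * n1 (y1 s))) + K * (n1 (y1 s) * (L * n1 (y2 s)))) <=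
      2 * (K * L) * (n1 (y1 s) ^+ 2 + n1 (y2 s) ^+ 2).
    have := mulr_ge0 KL (sqr_ge0 (n1 (y1 s) - n1 (y2 s))); lra.
  have KLE : 2 * (K * L) * (n1 (y1 s) ^+ 2 + n1 (y2 s) ^+ 2) <= 2 * K * L * k0 * E s.
    have -> : 2 * K * L * k0 * E s = 2 * (K * L) * (k0 * E s) by ring.
    by apply: ler_wpM2l; [rewrite mulr_ge0|rewrite /E mulrDr lerD].
  lra.
move=> t ht x; have [h1 h2] := (curve_H1 Hy1 ht, curve_H1 Hy2 ht).
have a1 := coer _ h1 (y10 t); have a2 := coer _ h2 (y20 t).
have kE : k0 * H (y1 t) (y1 t) + k0 * H (y2 t) (y2 t) <= 0.
  by rewrite -mulrDr mulr_ge0_le0// E0.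
have s1 := sqr_ge0 (n1 (y1 t)); have s2 := sqr_ge0 (n1 (y2 t)).
have n0 f : realH1 f -> n1 f ^+ 2 <= 0 -> f x = 0.
  move=> Hf hf; apply: n1_eq0 => //; apply/eqP; rewrite -sqrf_eq0 -[_ == 0]/(_ == 0).
  by rewrite eq_le hf sqr_ge0.
split; apply/esym/eqP; rewrite -subr_eq0; apply/eqP.
  by apply: (n0 _ h1); lra.
by apply: (n0 _ h2); lra.
Qed.

End Parity.

(** * Real and imaginary parts *)

Section Components.
Variable R : realType.
Local Open Scope complex_scope.
Implicit Types (f g : R -> R) (a b u v : R -> R[i]) (t s x : R).

Lemma rpartB a b : rpart (fun x => a x - b x) = fun x => rpart a x - rpart b x.
Proof. by apply/funext => x; rewrite /rpart; case: (a x) (b x) => ? ? []. Qed.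

Lemma ipartB a b : ipart (fun x => a x - b x) = fun x => ipart a x - ipart b x.
Proof. by apply/funext => x; rewrite /ipart; case: (a x) (b x) => ? ? []. Qed.

Lemma rinnerE a b : sqint (rpart a) -> sqint (ipart a) -> sqint (rpart b) -> sqint (ipart b) ->
  rinner a b = ip (rpart a) (rpart b) + ip (ipart a) (ipart b).
Proof.
move=> a1 a2 b1 b2; rewrite !ipE -RintegralD//; [|exact: sqint_mul..].
apply: eq_Rintegral => x _; rewrite /rpart /ipart.
by case: (a x) (b x) => p r [p' r'] /=; rewrite mulrN opprK.
Qed.

Lemma omegaE a b : sqint (rpart a) -> sqint (ipart a) -> sqint (rpart b) -> sqint (ipart b) ->
  omega a b = ip (ipart a) (rpart b) - ip (rpart a) (ipart b).
Proof.
move=> a1 a2 b1 b2; rewrite !ipE -RintegralB//; [|exact: sqint_mul..].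
apply: eq_Rintegral => x _; rewrite /rpart /ipart.
by case: (a x) (b x) => p r [p' r'] /=; rewrite mulrN addrC.
Qed.

Lemma rpart_Dx a : rpart (Dx a) = wd (rpart a).
Proof. by rewrite wd.unlock. Qed.

Lemma ipart_Dx a : ipart (Dx a) = wd (ipart a).
Proof. by rewrite wd.unlock. Qed.

Lemma H1normE a : H1 a -> H1norm a = Num.sqrt (n1 (rpart a) ^+ 2 + n1 (ipart a) ^+ 2).
Proof.
move=> [Hr Hi]; rewrite /H1norm; congr Num.sqrt.
have [s1 s2] := (realH1_sq Hr, realH1_sq Hi); have [w1 w2] := (wder_sq Hr, wder_sq Hi).
rewrite !rinnerE ?rpart_Dx ?ipart_Dx// !sqr_n1 !hipE; ring.
Qed.

Lemma n1_rpart_le a : H1 a -> n1 (rpart a) <= H1norm a /\ n1 (ipart a) <= H1norm a.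
Proof.
move=> Ha; rewrite (H1normE Ha); split.
  rewrite -[leLHS]ger0_norm ?n1_ge0// -sqrtr_sqr; apply: ler_wsqrtr.
  by rewrite lerDl sqr_ge0.
rewrite -[leLHS]ger0_norm ?n1_ge0// -sqrtr_sqr; apply: ler_wsqrtr.
by rewrite lerDr sqr_ge0.
Qed.

Lemma H1norm_le a : H1 a -> H1norm a <= n1 (rpart a) + n1 (ipart a).
Proof.
move=> Ha; rewrite (H1normE Ha); have r0 := n1_ge0 (rpart a); have i0 := n1_ge0 (ipart a).
rewrite -[leRHS]ger0_norm ?addr_ge0// -sqrtr_sqr; apply: ler_wsqrtr.
have := mulr_ge0 r0 i0; move: (n1 _) (n1 _) r0 i0 => p r p0 r0; lra.
Qed.

Lemma H1_B a b : H1 a -> H1 b -> H1 (fun x => a x - b x).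
Proof. by move=> [? ?] [? ?]; split; rewrite ?rpartB ?ipartB; exact: realH1B. Qed.

Lemma H1_curve_parts T (u : R -> R -> R[i]) : H1_curve T u ->
  h1curve T (fun t => rpart (u t)) /\ h1curve T (fun t => ipart (u t)).
Proof.
move=> H; have aux (p : (R -> R[i]) -> R -> R) : (forall a, H1 a -> realH1 (p a)) ->
    (forall a b, p (fun x => a x - b x) = fun x => p a x - p b x) ->
    (forall a, H1 a -> n1 (p a) <= H1norm a) -> h1curve T (fun t => p (u t)).
  move=> Hp pB pn t ht; have [Ht C] := H t ht; split; first exact: Hp.
  move=> e e0; move/cvgr0Pnorm_lt : C => /(_ _ e0); rewrite /within/= => /nbhs_ballP[d d0 Hd].
  exists d => // s hs sd; have := Hd s; rewrite /ball/= distrC => /(_ sd).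
  have [Hs _] := H s hs; have HB := H1_B Hs Ht.
  rewrite in_itv/= => /(_ hs); apply: le_lt_trans.
  rewrite -pB; apply: le_trans (pn _ HB) _; exact: ler_norm.
split; apply: aux => [a [? ?]//|a b|a Ha].
- exact: rpartB.
- exact: (n1_rpart_le Ha).1.
- exact: ipartB.
- exact: (n1_rpart_le Ha).2.
Qed.

End Components.

(** * The linear and nonlinear equations as real systems *)

Section Equations.
Variable R : realType.
Local Open Scope complex_scope.
Implicit Types (f g phi psi v : R -> R) (u : R -> R -> R[i]) (t s x lam q T k : R).

(** The zero component of purely real and purely imaginary test functions for L. *)
Lemma delta_op0 q : delta_op q (fun=> 0 : R) (fun=> 0).
Proof.
have c0 : continuous (fun _ : R => 0 : R) by move=> x; exact: cvg_cst.
have w0 (Om : set R) : weak_deriv Om (fun=> 0 : R) (fun=> 0) by exact: acon_weak (@acon_cst R setT 0).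
split=> //; [exact: sqint0|exact: sqint0|].
exists (fun=> 0); split=> //; first exact: sqint0.
- have -> : (fun _ : R => - 0 : R) = (fun=> 0) by apply/funext => x; rewrite oppr0.
  exact: w0.
- by exists 0, 0; split; [exact: cvg_cst|exact: cvg_cst|rewrite mulr0 subr0].
Qed.

(** The image of psi under L_+ for k = 6 and under L_- for k = 2, if g is its image under - d^2/dx^2
    - 2 q delta_0. This k is twice that of [Bpot]. *)
Definition Lop_fun lam q k psi g x : R := 2^-1 * (lam ^+ 2 * psi x + g x - k * vsol lam q x ^+ 2 * psi x).

Lemma Lop_zero lam q k x : Lop_fun lam q k (fun=> 0) (fun=> 0) x = 0.
Proof. by rewrite /Lop_fun !mulr0 addr0 subr0 mulr0. Qed.

Lemma ip_Lop_fun lam q k z psi g : realH1 (vsol lam q) -> realH1 z -> realH1 psi -> sqint g ->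
  ip z g = ip (wd z) (wd psi) - 2 * q * z 0 * psi 0 ->
  sqint (Lop_fun lam q (2 * k) psi g) /\
  ip z (Lop_fun lam q (2 * k) psi g) = Bpot lam q k (vsol lam q) z psi.
Proof.
set v := vsol lam q => Hv Hz Hpsi sg E.
have sz := realH1_sq Hz; have sp := realH1_sq Hpsi.
have svp := realH1_sq (realH1M (realH1M Hv Hv) Hpsi).
have LE : Lop_fun lam q (2 * k) psi g = fun x => (2^-1 * lam ^+ 2 * psi x + 2^-1 * g x) - k * (v x * v x * psi x).
  by apply/funext => x; rewrite /Lop_fun -/(v x); field.
have s1 := sqintZ (2^-1 * lam ^+ 2) sp; have s2 := sqintZ 2^-1 sg; have s3 := sqintZ k svp.
rewrite LE; split; first by apply: sqintB => //; exact: sqintD.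
rewrite (ipBr (sqintD s1 s2) s3 sz) (ipDr s1 s2 sz) (ipZr _ sp sz) (ipZr _ sg sz) (ipZr _ svp sz) E BpotE.
have -> : ip z (fun x => v x * v x * psi x) = ip (fun x => v x * v x * z x) psi.
  by rewrite !ipE; apply: eq_Rintegral => x _; ring.
by field.
Qed.

Lemma Bpot_cvg lam q k v w (psi : nat -> R -> R) phi : realH1 v -> realH1 w -> realH1 phi ->
  (forall n, realH1 (psi n)) ->
  (forall w, sqint w -> [/\ ip w (psi n) @[n --> \oo] --> ip w phi,
     ip w (wd (psi n)) @[n --> \oo] --> ip w (wd phi) & psi n 0 @[n --> \oo] --> phi 0]) ->
  Bpot lam q k v w (psi n) @[n --> \oo] --> Bpot lam q k v w phi.
Proof.
move=> Hv Hw Hphi Hpsi C; rewrite BpotE; under eq_fun do rewrite BpotE.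
have [c1 _ c3] := C w (realH1_sq Hw); have [_ c2 _] := C _ (wder_sq Hw).
have [c4 _ _] := C _ (realH1_sq (realH1M (realH1M Hv Hv) Hw)).
apply: cvgD; last by apply: cvgM => //; exact: cvg_cst.
apply: cvgD; last by apply: cvgM; [exact: cvg_cst|apply: cvgM => //; exact: cvg_cst].
by apply: cvgD; apply: cvgM => //; exact: cvg_cst.
Qed.

(** On domain elements the operator can be replaced by its form; [domain_approx] and
    [weak_limit_derive] then reach every H^1 test function. *)
Lemma linear_flow_weak lam q T (phi0 : R -> R[i]) (w : R -> R -> R[i]) :
  realH1 (vsol lam q) -> `|q| <= 2^-1 -> linear_flow lam q T phi0 w ->
  weak_system T (Bpot lam q 3 (vsol lam q)) (Bpot lam q 1 (vsol lam q))
    (fun t => rpart (w t)) (fun t => ipart (w t)) (fun _ _ => 0) (fun _ _ => 0).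
Proof.
move=> Hv q2 [Hc _ Hw]; have [Hz1 Hz2] := H1_curve_parts Hc.
set v := vsol lam q in Hv *; have bf k := bform_Bpot lam q k Hv.
have inT s : 0 < s < T -> 0 <= s <= T by move=> /andP[? ?]; rewrite !ltW.
have s0 := @sqint0 R.
have iw s : rpart (fun x => 'i * w s x) = (fun x => - ipart (w s) x) /\
    ipart (fun x => 'i * w s x) = rpart (w s).
  by split; apply/funext => x; rewrite /rpart/ipart; case: (w s x) => a b /=; ring.
have sw s : 0 < s < T -> sqint (rpart (w s)) /\ sqint (ipart (w s)).
  by move=> hs; split; apply: realH1_sq; [exact: curve_H1 Hz1 (inT s hs)|exact: curve_H1 Hz2 (inT s hs)].
have dm psi g : delta_op q psi g -> realH1 psi ->
    (forall z, realH1 z -> ip z g = ip (wd z) (wd psi) - 2 * q * z 0 * psi 0) ->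
    forall t, 0 < t < T -> is_derive t (1 : R) (fun s => ip (rpart (w s)) psi) (Bpot lam q 1 v (ipart (w t)) psi).
  move=> dop Hpsi wk t ht; have [_ sp sg _] := dop.
  have hz2 := curve_H1 Hz2 (inT t ht).
  have [sL IL] := ip_Lop_fun 1 Hv hz2 Hpsi sg (wk _ hz2); rewrite mulr1 in sL IL.
  (* Against i psi the pairing with i w sees only the real part of w, and L w enters through L_-. *)
  have LL : Lop lam q (fun x => 0 +i* psi x) (fun x => 0 +i* Lop_fun lam q 2 psi g x).
    split; first by exists (fun=> 0) => [|x]; [exact: delta_op0|exact: (esym (Lop_zero lam q 6 x))].
    by exists g.
  have := Hw _ _ LL t ht.
  have [sw1 sw2] := sw t ht.
  rewrite (rinnerE (b := fun x => 0 +i* Lop_fun lam q 2 psi g x) sw1 sw2 s0 sL).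
  rewrite (ipC _ (fun=> 0)) ip0l// add0r [ip (ipart (w t)) _]IL.
  apply: is_derive_local ht => s hs; have [sw1' sw2'] := sw s hs; have [i1 i2] := iw s.
  rewrite (rinnerE (b := fun x => 0 +i* psi x)) ?i1 ?i2//; last exact: sqintN.
  by rewrite (ipC _ (fun=> 0)) ip0l ?add0r//; exact: sqintN.
have dp psi g : delta_op q psi g -> realH1 psi ->
    (forall z, realH1 z -> ip z g = ip (wd z) (wd psi) - 2 * q * z 0 * psi 0) ->
    forall t, 0 < t < T -> is_derive t (1 : R) (fun s => ip (ipart (w s)) psi) (- 1 * Bpot lam q 3 v (rpart (w t)) psi).
  move=> dop Hpsi wk t ht; have [_ sp sg _] := dop.
  have hz1 := curve_H1 Hz1 (inT t ht).
  have [sL IL] := ip_Lop_fun 3 Hv hz1 Hpsi sg (wk _ hz1).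
  have e6 : 2 * 3 = 6 :> R by ring.
  rewrite e6 in sL IL.
  have LL : Lop lam q (fun x => psi x +i* 0) (fun x => Lop_fun lam q 6 psi g x +i* 0).
    split; first by exists g.
    by exists (fun=> 0) => [|x]; [exact: delta_op0|exact: (esym (Lop_zero lam q 2 x))].
  have := Hw _ _ LL t ht.
  have [sw1 sw2] := sw t ht.
  rewrite (rinnerE (b := fun x => Lop_fun lam q 6 psi g x +i* 0) sw1 sw2 sL s0).
  rewrite (ipC _ (fun=> 0)) ip0l// addr0 [ip (rpart (w t)) _]IL => d.
  have := isD_Z (- 1) d.
  apply: is_derive_local ht => s hs; have [sw1' sw2'] := sw s hs; have [i1 i2] := iw s.
  rewrite (rinnerE (b := fun x => psi x +i* 0)) ?i1 ?i2//; last exact: sqintN.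
  rewrite (ipC _ (fun=> 0)) ip0l ?addr0//.
  by have := ipNl sw2' sp => ->; rewrite mulN1r opprK.
move=> phi Hphi t ht; rewrite !ip0l; [|exact: realH1_sq..].
have [psi [g [Hd [K HK] wk C]]] := domain_approx q2 Hphi.
have cip z : realH1 z -> ip z (psi n) @[n --> \oo] --> ip z phi.
  by move=> Hz; have [] := C z (realH1_sq Hz).
have cB k z : realH1 z -> Bpot lam q k v z (psi n) @[n --> \oo] --> Bpot lam q k v z phi.
  by move=> Hz; apply: Bpot_cvg => // n; have [] := Hd n.
have Hpsi n : realH1 (psi n) by have [] := Hd n.
split.
  rewrite subr0; apply: (weak_limit_derive (bf 1) Hz1 Hz2 Hphi Hpsi HK cip (cB 1)) ht => n s hs.
  by apply: (dm _ (g n)) => //; [have [] := Hd n|move=> z; exact: wk].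
rewrite addr0 -mulN1r.
apply: (weak_limit_derive (bform_scale (- 1) (bf 3)) Hz2 Hz1 Hphi Hpsi HK cip _ _ ht) => [z Hz|n s hs].
  by apply: cvgM; [exact: cvg_cst|exact: cB].
by apply: (dp _ (g n)) => //; [have [] := Hd n|move=> z; exact: wk].
Qed.

(** The real part of |z|^2 z for z = f + i g; exchanging the arguments gives the imaginary part. *)
Definition cubic f g x : R := (f x * f x + g x * g x) * f x.

Lemma cubic_H1 f g : realH1 f -> realH1 g -> realH1 (cubic f g).
Proof. by move=> Hf Hg; apply: realH1M => //; apply: realH1D; exact: realH1M. Qed.

Lemma curve_cubic T z1 z2 : h1curve T z1 -> h1curve T z2 -> h1curve T (fun t => cubic (z1 t) (z2 t)).
Proof. by move=> H1 H2; apply: curveM => //; apply: curveD; exact: curveM. Qed.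

(** At lam = 0 and k = 0 [Bpot] is the form of - (1/2) d^2/dx^2 - q delta_0, the linear part of the
    equation before the phase is removed. *)
Lemma nls_weak q T (u : R -> R -> R[i]) v : NLS_solution q T u -> realH1 v ->
  weak_system T (Bpot 0 q 0 v) (Bpot 0 q 0 v) (fun t => rpart (u t)) (fun t => ipart (u t))
    (fun t => cubic (rpart (u t)) (ipart (u t))) (fun t => cubic (ipart (u t)) (rpart (u t))).
Proof.
move=> [Hc Hu] Hv phi Hphi t ht; have [Hz1 Hz2] := H1_curve_parts Hc.
have inT s : 0 < s < T -> 0 <= s <= T by move=> /andP[? ?]; rewrite !ltW.
have s0 := @sqint0 R; have H0 := realH1_0 R; have sp := realH1_sq Hphi; have swp := wder_sq Hphi.
have iu s : rpart (fun x => 'i * u s x) = (fun x => - ipart (u s) x) /\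
    ipart (fun x => 'i * u s x) = rpart (u s).
  by split; apply/funext => x; rewrite /rpart/ipart; case: (u s x) => a b /=; ring.
have su s : 0 < s < T -> realH1 (rpart (u s)) /\ realH1 (ipart (u s)).
  by move=> hs; split; [exact: curve_H1 Hz1 (inT s hs)|exact: curve_H1 Hz2 (inT s hs)].
have [h1 h2] := su t ht.
have cub : rpart (fun x => u t x * `|u t x| ^+ 2) = cubic (rpart (u t)) (ipart (u t)) /\
    ipart (fun x => u t x * `|u t x| ^+ 2) = cubic (ipart (u t)) (rpart (u t)).
  split; apply/funext => x; rewrite /rpart/ipart/cubic -add_Re2_Im2; case: (u t x) => a b /=; ring.
have [c1 c2] := cub.
have [sc1 sc2] := (realH1_sq (cubic_H1 h1 h2), realH1_sq (cubic_H1 h2 h1)).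
have w0 f : sqint f -> ip f (wd (fun=> 0 : R)) = 0.
  by move=> sf; rewrite ipC (ip_wder (@acon_cst R setT 0)) ?ip0l.
have sw0 : sqint (wd (fun=> 0 : R)) by exact: wder_sq.
have [sw1 sw2] := (wder_sq h1, wder_sq h2).
have [st1 st2] := (realH1_sq h1, realH1_sq h2).
have BE f : Bpot 0 q 0 v f phi = 2^-1 * ip (wd f) (wd phi) - q * (f 0 * phi 0).
  by rewrite BpotE expr0n /= mulr0 mul0r addr0 oppr0 mul0r addr0 mulNr.
split.
  have Hi : H1 (fun x => 0 +i* phi x) by [].
  have := Hu _ Hi t ht; rewrite !rinnerE ?rpart_Dx ?ipart_Dx ?c1 ?c2//.
  rewrite w0// (ipC _ (fun=> 0)) ip0l// !add0r => d.
  have {}d := isD_eq d _; apply: (is_derive_local _ ht); last first.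
    apply: d; rewrite BE; congr (_ - _ - _); congr (_ * _).
    by rewrite /ipart; case: (u t 0) => a b /=; ring.
  move=> s hs; have [h1' h2'] := su s hs; have [i1 i2] := iu s.
  have [sr si] := (realH1_sq h1', realH1_sq h2').
  rewrite rinnerE ?i1 ?i2//; last exact: sqintN.
  by rewrite (ipC _ (fun=> 0)) ip0l ?add0r//; exact: sqintN.
have Hi : H1 (fun x => phi x +i* 0) by [].
have := Hu _ Hi t ht; rewrite !rinnerE ?rpart_Dx ?ipart_Dx ?c1 ?c2//.
rewrite [ip (wd (ipart (u t))) _]w0// !(ipC _ (fun=> 0)) ip0l// !addr0 => d.
have {}d := isD_eq (isD_Z (- 1) d) _; apply: (is_derive_local _ ht); last first.
  apply: d; rewrite BE.
  have -> : complex.Re (u t 0 * (phi 0 +i* 0)^*%C) = rpart (u t) 0 * phi 0.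
    by rewrite /rpart; case: (u t 0) => a b /=; ring.
  have -> : rpart (fun x => phi x +i* 0) = phi by [].
  ring.
move=> s hs; have [h1' h2'] := su s hs; have [i1 i2] := iu s.
have [sr si] := (realH1_sq h1', realH1_sq h2').
rewrite rinnerE ?i1 ?i2//; last exact: sqintN.
rewrite (ipC _ (fun=> 0)) ip0l ?addr0//.
by have := ipNl si sp => ->; rewrite mulN1r opprK.
Qed.

End Equations.

(** * Removing the phase and expanding around the soliton *)

Section Perturbation.
Variable R : realType.
Implicit Types (f g phi v : R -> R) (z w N : R -> R -> R) (t s x lam q T : R).

Lemma is_derive_phase (theta lam t : R) :
  is_derive t (1 : R) (fun t => theta + t * lam ^+ 2 / 2) (lam ^+ 2 / 2).
Proof.
have := isD_D (isD_cst theta t) (isD_Z (lam ^+ 2 / 2) (isD_id t)).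
rewrite mulr1 add0r; under eq_fun do rewrite mulrC mulrA.
by [].
Qed.

(** Here u = e^{i eta} (U1 + i U2). Differentiating the phase adds (lam^2 / 2) <f, g> to the form,
    and the cubic term is gauge invariant. *)
Lemma rotation_weak lam q T v theta u1 u2 : realH1 v -> h1curve T u1 -> h1curve T u2 ->
  weak_system T (Bpot 0 q 0 v) (Bpot 0 q 0 v) u1 u2
    (fun t => cubic (u1 t) (u2 t)) (fun t => cubic (u2 t) (u1 t)) ->
  let eta t := theta + t * lam ^+ 2 / 2 in
  let U1 t x := cos (eta t) * u1 t x + sin (eta t) * u2 t x in
  let U2 t x := cos (eta t) * u2 t x - sin (eta t) * u1 t x in
  [/\ h1curve T U1, h1curve T U2 & weak_system T (Bpot lam q 0 v) (Bpot lam q 0 v) U1 U2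
    (fun t => cubic (U1 t) (U2 t)) (fun t => cubic (U2 t) (U1 t))].
Proof.
move=> Hv H1 H2 W eta U1 U2.
have deta t : is_derive t (1 : R) eta (lam ^+ 2 / 2) by exact: is_derive_phase.
have dcos t := isD_comp (deta t) (is_derive_cos (eta t)).
have dsin t := isD_comp (deta t) (is_derive_sin (eta t)).
have ccos : continuous (fun t => cos (eta t)) by exact: is_derive_fun_continuous dcos.
have csin : continuous (fun t => sin (eta t)) by exact: is_derive_fun_continuous dsin.
have HU1 : h1curve T U1 by apply: curveD; exact: curveZ.
have HU2 : h1curve T U2 by apply: curveB; exact: curveZ.
split=> // phi Hphi t ht; have [d1 d2] := W phi Hphi t ht.
have inT s : 0 < s < T -> 0 <= s <= T by move=> /andP[? ?]; rewrite !ltW.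
have sp := realH1_sq Hphi.
have [h1 h2] := (curve_H1 H1 (inT t ht), curve_H1 H2 (inT t ht)).
have [hc1 hc2] := (cubic_H1 h1 h2, cubic_H1 h2 h1).
have [sk1 sk2] := (realH1_sq hc1, realH1_sq hc2).
set c := cos (eta t); set n := sin (eta t).
have cn : c ^+ 2 + n ^+ 2 = 1 by exact: cos2Dsin2.
have ipU1 s : 0 < s < T -> cos (eta s) * ip (u1 s) phi + sin (eta s) * ip (u2 s) phi = ip (U1 s) phi.
  move=> hs; have [a1 a2] := (realH1_sq (curve_H1 H1 (inT s hs)), realH1_sq (curve_H1 H2 (inT s hs))).
  by rewrite /U1 (ipDl (sqintZ _ a1) (sqintZ _ a2) sp) !ipZl.
have ipU2 s : 0 < s < T -> cos (eta s) * ip (u2 s) phi - sin (eta s) * ip (u1 s) phi = ip (U2 s) phi.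
  move=> hs; have [a1 a2] := (realH1_sq (curve_H1 H1 (inT s hs)), realH1_sq (curve_H1 H2 (inT s hs))).
  by rewrite /U2 (ipBl (sqintZ _ a2) (sqintZ _ a1) sp) !ipZl.
have BE f : Bpot lam q 0 v f phi = Bpot 0 q 0 v f phi + lam ^+ 2 / 2 * ip f phi.
  by rewrite !BpotE expr0n /= mulr0 mul0r; field.
have bf := bform_Bpot 0 q 0 Hv; have [BD BZ _ _] := bf.
have [hz1 hz2] := (realH1Z c h1, realH1Z n h2).
have [hz3 hz4] := (realH1Z c h2, realH1Z n h1).
have BU1 : Bpot 0 q 0 v (U1 t) phi = c * Bpot 0 q 0 v (u1 t) phi + n * Bpot 0 q 0 v (u2 t) phi.
  by rewrite /U1 BD// !BZ.
have BU2 : Bpot 0 q 0 v (U2 t) phi = c * Bpot 0 q 0 v (u2 t) phi - n * Bpot 0 q 0 v (u1 t) phi.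
  by rewrite /U2 (bformBl bf)// !BZ.
(* The modulus is unchanged, so [cubic] rotates like u itself. *)
have mod x : U1 t x * U1 t x + U2 t x * U2 t x = u1 t x * u1 t x + u2 t x * u2 t x.
  rewrite /U1 /U2 -/c -/n; set a := u1 t x; set b := u2 t x.
  have -> : (c * a + n * b) * (c * a + n * b) + (c * b - n * a) * (c * b - n * a) =
    (c ^+ 2 + n ^+ 2) * (a * a + b * b) by ring.
  by rewrite cn mul1r.
have C1 : ip (cubic (U1 t) (U2 t)) phi =
    c * ip (cubic (u1 t) (u2 t)) phi + n * ip (cubic (u2 t) (u1 t)) phi.
  rewrite -(ipZl c sk1 sp) -(ipZl n sk2 sp) -(ipDl (sqintZ c sk1) (sqintZ n sk2) sp).
  by congr ip; apply/funext => x; rewrite /cubic mod /U1 -/c -/n; ring.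
have C2 : ip (cubic (U2 t) (U1 t)) phi =
    c * ip (cubic (u2 t) (u1 t)) phi - n * ip (cubic (u1 t) (u2 t)) phi.
  rewrite -(ipZl c sk2 sp) -(ipZl n sk1 sp) -(ipBl (sqintZ c sk2) (sqintZ n sk1) sp).
  by congr ip; apply/funext => x; rewrite /cubic [U2 t x * _ + _]addrC mod /U2 -/c -/n; ring.
split.
  apply: (is_derive_local ipU1 ht).
  move/isD_eq: (isD_D (isD_M (dcos t) d1) (isD_M (dsin t) d2)); apply.
  by rewrite BE BU2 C2 -(ipU2 t ht) -/c -/n; field.
apply: (is_derive_local ipU2 ht).
move/isD_eq: (isD_B (isD_M (dcos t) d2) (isD_M (dsin t) d1)); apply.
by rewrite BE BU1 C1 -(ipU1 t ht) -/c -/n; field.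
Qed.

(** With p = f + i g, [nl1] and [nl2] are the real and imaginary parts of |v + p|^2 (v + p) from
    which the terms of degree 0 and 1 in p have been removed. *)
Definition nl1 v f g x : R := 3 * (v x * (f x * f x)) + v x * (g x * g x) + cubic f g x.
Definition nl2 v f g x : R := 2 * (v x * (f x * g x)) + cubic g f x.

Lemma nl_bound v f g (Cs P : R) : realH1 v -> realH1 f -> realH1 g ->
  n1 v <= Cs -> n1 f <= P -> n1 g <= P ->
  n1 (nl1 v f g) <= (36 * Cs + 18 * P) * P ^+ 2 /\ n1 (nl2 v f g) <= (36 * Cs + 18 * P) * P ^+ 2.
Proof.
move=> Hv Hf Hg vC fP gP; have P0 := le_trans (n1_ge0 f) fP; have C0 := le_trans (n1_ge0 v) vC.
have pr a b : realH1 a -> realH1 b -> n1 a <= P -> n1 b <= P ->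
    n1 (fun x => a x * b x) <= 3 * P ^+ 2.
  move=> Ha Hb aP bP; apply: le_trans (n1M Ha Hb) _; rewrite ler_pM2l// expr2.
  by apply: ler_pM; rewrite ?n1_ge0.
have vpr a b : realH1 a -> realH1 b -> n1 a <= P -> n1 b <= P ->
    n1 (fun x => v x * (a x * b x)) <= 9 * Cs * P ^+ 2.
  move=> Ha Hb aP bP; apply: le_trans (n1M Hv (realH1M Ha Hb)) _.
  have : n1 v * n1 (fun x => a x * b x) <= Cs * (3 * P ^+ 2).
    by apply: ler_pM; rewrite ?n1_ge0// pr.
  lra.
have cb a b : realH1 a -> realH1 b -> n1 a <= P -> n1 b <= P -> n1 (cubic a b) <= 18 * P * P ^+ 2.
  move=> Ha Hb aP bP; have [Haa Hbb] := (realH1M Ha Ha, realH1M Hb Hb).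
  apply: le_trans (n1M (realH1D Haa Hbb) Ha) _.
  have h : n1 (fun x => a x * a x + b x * b x) <= 6 * P ^+ 2.
    apply: le_trans (n1D Haa Hbb) _; have := pr _ _ Ha Ha aP aP; have := pr _ _ Hb Hb bP bP; lra.
  have : n1 (fun x => a x * a x + b x * b x) * n1 a <= (6 * P ^+ 2) * P.
    by apply: ler_pM; rewrite ?n1_ge0.
  lra.
have [Hff Hgg] := (realH1M Hf Hf, realH1M Hg Hg).
have Hfg := realH1M Hf Hg.
have CP : 0 <= Cs * P ^+ 2 by rewrite mulr_ge0// sqr_ge0.
split.
  have Hc := cubic_H1 Hf Hg; have h1 := realH1Z 3 (realH1M Hv Hff); have h2 := realH1M Hv Hgg.
  apply: le_trans (n1D (realH1D h1 h2) Hc) _.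
  have := n1D h1 h2; rewrite (n1Z 3 (realH1M Hv Hff)) ger0_norm//.
  have := vpr _ _ Hf Hf fP fP; have := vpr _ _ Hg Hg gP gP; have := cb _ _ Hf Hg fP gP; lra.
have Hc := cubic_H1 Hg Hf; have h1 := realH1Z 2 (realH1M Hv Hfg).
apply: le_trans (n1D h1 Hc) _; rewrite (n1Z 2 (realH1M Hv Hfg)) ger0_norm//.
have := vpr _ _ Hf Hg fP gP; have := cb _ _ Hg Hf gP fP; lra.
Qed.

Lemma curve_nl T v z1 z2 : realH1 v -> h1curve T z1 -> h1curve T z2 ->
  h1curve T (fun t => nl1 v (z1 t) (z2 t)) /\ h1curve T (fun t => nl2 v (z1 t) (z2 t)).
Proof.
move=> Hv H1 H2; have cv := @curve_cst _ T _ Hv.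
split; apply: curveD; try exact: curve_cubic.
  apply: curveD; last exact: curveM cv (curveM H2 H2).
  exact: curveZc (curveM cv (curveM H1 H1)).
exact: curveZc (curveM cv (curveM H1 H2)).
Qed.

(** The terms linear in p turn the form with k = 0 into those of L_+ and L_-, and the terms of
    degree 0 cancel because L_- v = 0. *)
Lemma perturbation_weak lam q T v U1 U2 z1 z2 : realH1 v ->
  (forall phi, realH1 phi -> Bpot lam q 1 v v phi = 0) ->
  h1curve T U1 -> h1curve T U2 -> h1curve T z1 -> h1curve T z2 ->
  weak_system T (Bpot lam q 0 v) (Bpot lam q 0 v) U1 U2
    (fun t => cubic (U1 t) (U2 t)) (fun t => cubic (U2 t) (U1 t)) ->
  weak_system T (Bpot lam q 3 v) (Bpot lam q 1 v) z1 z2 (fun _ _ => 0) (fun _ _ => 0) ->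
  let p1 t x := U1 t x - v x in
  weak_system T (Bpot lam q 3 v) (Bpot lam q 1 v)
    (fun t x => p1 t x - z1 t x) (fun t x => U2 t x - z2 t x)
    (fun t => nl1 v (p1 t) (U2 t)) (fun t => nl2 v (p1 t) (U2 t)).
Proof.
move=> Hv Bv H1 H2 Hz1 Hz2 WU Wz p1 phi Hphi t ht.
have [d1 d2] := WU phi Hphi t ht; have [e1 e2] := Wz phi Hphi t ht.
have inT s : 0 < s < T -> 0 <= s <= T by move=> /andP[? ?]; rewrite !ltW.
have sp := realH1_sq Hphi; have sv := realH1_sq Hv.
rewrite !ip0l// subr0 addr0 in e1 e2.
have cv := @curve_cst _ T _ Hv.
have Hp1 : h1curve T p1 by exact: curveB.
have [h1 h2] := (curve_H1 H1 (inT t ht), curve_H1 H2 (inT t ht)).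
have [hz1 hz2] := (curve_H1 Hz1 (inT t ht), curve_H1 Hz2 (inT t ht)).
have hp1 := curve_H1 Hp1 (inT t ht).
have [hn1 hn2] := curve_nl Hv Hp1 H2.
have [hn1t hn2t] := (curve_H1 hn1 (inT t ht), curve_H1 hn2 (inT t ht)).
have bf k := bform_Bpot lam q k Hv.
split.
  apply: (@is_derive_local R T (fun s => ip (U1 s) phi - ip v phi - ip (z1 s) phi)) => //.
    move=> s hs; have [a1 a2] := (realH1_sq (curve_H1 H1 (inT s hs)), realH1_sq (curve_H1 Hz1 (inT s hs))).
    by rewrite (ipBl (sqintB a1 sv) a2 sp) (ipBl a1 sv sp).
  move/isD_eq: (isD_B (isD_B d1 (isD_cst (ip v phi) t)) e1); apply.
  rewrite subr0 (bformBl (bf 1))// [Bpot lam q 1 v (U2 t) phi]Bpot_free// mul1r.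
  have -> : ip (cubic (U2 t) (U1 t)) phi =
      ip (nl2 v (p1 t) (U2 t)) phi + ip (fun x => v x * (v x * U2 t x)) phi.
    rewrite -ipDl//; [|exact: realH1_sq|by apply: realH1_sq; do 2!apply: realH1M => //].
    by congr ip; apply/funext => x; rewrite /nl2 /cubic /p1; ring.
  ring.
apply: (@is_derive_local R T (fun s => ip (U2 s) phi - ip (z2 s) phi)) => //.
  move=> s hs; have [a1 a2] := (realH1_sq (curve_H1 H2 (inT s hs)), realH1_sq (curve_H1 Hz2 (inT s hs))).
  by rewrite (ipBl a1 a2 sp).
move/isD_eq: (isD_B d2 e2); apply.
rewrite (bformBl (bf 3))// [Bpot lam q 3 v (p1 t) phi]Bpot_free//.
have Hvv f : realH1 f -> realH1 (fun x => v x * (v x * f x)) by move=> Hf; do 2!apply: realH1M => //.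
have hv3 := Hvv _ Hv; have hvp := Hvv _ hp1.
have -> : ip (cubic (U1 t) (U2 t)) phi = ip (nl1 v (p1 t) (U2 t)) phi +
    (ip (fun x => v x * (v x * v x)) phi + 3 * ip (fun x => v x * (v x * p1 t x)) phi).
  have s3 := realH1_sq hvp; have s4 := realH1_sq hv3; have s5 := sqintZ 3 s3.
  rewrite -(ipZl 3 s3 sp) -(ipDl s4 s5 sp) -(ipDl (realH1_sq hn1t) (sqintD s4 s5) sp).
  by congr ip; apply/funext => x; rewrite /nl1 /cubic /p1; ring.
(* L_- v = 0 expresses the form of v with k = 0 by the pairing of v^3, the degree 0 part of the
   cubic. *)
have := Bv phi Hphi; rewrite (Bpot_free lam q 1 Hv Hv Hphi) mul1r => E.
have -> : Bpot lam q 0 v (p1 t) phi = Bpot lam q 0 v (U1 t) phi - Bpot lam q 0 v v phi.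
  exact: (bformBl (bf 0)).
move: E; move: (Bpot lam q 0 v v phi) => b E.
have -> : b = ip (fun x => v x * (v x * v x)) phi by apply/eqP; rewrite -subr_eq0 E.
ring.
Qed.

End Perturbation.

(** * The bootstrap for the remainder *)

Section Final.
Variable R : realType.
Implicit Types (f g phi v : R -> R) (t s x : R).

(** Connects the closed formula [dsol] with the derivative that defines [dvsol]; lam enters v also
    through artanh (q / lam), whence [skap]. *)
Lemma is_derive_vsol (lam q x : R) : 0 < lam -> `|q| <= 20^-1 * lam ->
  is_derive lam (1 : R) (fun l => vsol l q x) (dsol lam q x).
Proof.
move=> lam0 qlam; have l0 : lam != 0 by rewrite gt_eqF.
have dq : is_derive lam (1 : R) (fun l => q / l) (- q / lam ^+ 2).
  by move/isD_eq: (isD_Z q (isD_V (isD_id lam) l0)); apply; field.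
have t1 := tau_lt1 lam0 qlam.
have dY := isD_D (isD_M (isD_id lam) (isD_cst `|x| lam)) (isD_comp dq (is_derive_artanh t1)).
move/isD_eq: (isD_M (isD_id lam) (isD_comp dY (is_derive_sech _))); apply.
rewrite /dsol /dp /sS /sT; move: (sech _) (th _) => S T.
have d0 : 1 - (q / lam) ^+ 2 != 0.
  rewrite gt_eqF// subr_gt0 -(real_normK (num_real (q / lam))).
  by rewrite expr_lt1.
have d1 : lam ^+ 2 - q ^+ 2 != 0.
  have -> : lam ^+ 2 - q ^+ 2 = lam ^+ 2 * (1 - (q / lam) ^+ 2) by field.
  by rewrite mulf_neq0// expf_neq0.
have -> : (1 - (q / lam) ^+ 2)^-1 = lam ^+ 2 / (lam ^+ 2 - q ^+ 2).
  rewrite -[RHS]invrK invfM invrK; congr (_^-1); field; exact: l0.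
by rewrite /skap; field; rewrite l0 d1.
Qed.

Variables m M : R.
Local Notation Cs := (sol_bound m M).
Local Notation A := (coer_A m M).
Local Notation Kb := (bnd_cst m M).

(** Initial components of norm at most 2 h have energy at most 8 [Kb] h^2, and [A] converts it into
    squared norms; the 1 is spent in taking the square root. *)
Definition flow_cst := 1 + 8 * (A * Kb).
(** [nl_bound] for a perturbation of size ([flow_cst] + 1) h with h <= 1, in units of h^2. *)
Definition nl_cst := (36 * Cs + 18 * (flow_cst + 1)) * (flow_cst + 1) ^+ 2.
Definition rem_cst := (2 * st_A1 m M + 2 * st_A2 m M + 1) * nl_cst.

Hypotheses (m0 : 0 < m) (mM : m <= M).

Lemma Kb_ge0 : 0 <= Kb.
Proof. by rewrite /bnd_cst; have := sqr_ge0 M; have := m0; lra. Qed.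

Lemma A_ge0 : 0 <= A.
Proof. exact: coer_A_ge0. Qed.

Lemma flow_cst_ge1 : 1 <= flow_cst.
Proof. by rewrite lerDl mulr_ge0// mulr_ge0// ?A_ge0 ?Kb_ge0. Qed.

Lemma nl_cst_ge0 : 0 <= nl_cst.
Proof.
have h := flow_cst_ge1; have C0 := @Cs_ge0 R m M.
by rewrite mulr_ge0 ?sqr_ge0// addr_ge0// mulr_ge0//; lra.
Qed.

Lemma st_A1_ge0 : 0 <= st_A1 m M.
Proof. by rewrite mulr_ge0 ?Kb_ge0// mulr_ge0// A_ge0. Qed.

Lemma st_A2_ge0 : 0 <= st_A2 m M.
Proof.
have Mg : 0 <= M by apply: le_trans mM; exact: ltW.
rewrite addr_ge0// mulr_ge0 ?A_ge0//; first by rewrite mulr_ge0 ?sqr_ge0.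
  by rewrite mulr_ge0// sqr_ge0.
by rewrite addr_ge0// sqr_ge0.
Qed.

Lemma rem_cst_ge0 : 0 <= rem_cst.
Proof.
rewrite mulr_ge0 ?nl_cst_ge0//; have := st_A1_ge0; have := st_A2_ge0; lra.
Qed.

Variables lam q : R.
Hypotheses (mlam : m <= lam) (lamM : lam <= M) (qm : `|q| <= 20^-1 * m).

Local Notation v := (vsol lam q).
Local Notation D := (dsol lam q).
Local Notation Bp := (Bpot lam q 3 v).
Local Notation Bm := (Bpot lam q 1 v).

Let Hv : realH1 v. Proof. exact: (vsolH m0 mlam lamM qm). Qed.

Section Remainder.
Variables (T h : R) (U1 U2 z1 z2 : R -> R -> R).
Hypotheses (HU1 : h1curve T U1) (HU2 : h1curve T U2) (Hz1 : h1curve T z1) (Hz2 : h1curve T z2).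
Hypothesis WU : weak_system T (Bpot lam q 0 v) (Bpot lam q 0 v) U1 U2
    (fun t => cubic (U1 t) (U2 t)) (fun t => cubic (U2 t) (U1 t)).
Hypothesis Wz : weak_system T Bp Bm z1 z2 (fun _ _ => 0) (fun _ _ => 0).
Hypothesis evU : forall t, 0 <= t <= T -> forall x, U1 t (- x) = U1 t x /\ U2 t (- x) = U2 t x.
Hypotheses (z10 : forall x, z1 0 x = U1 0 x - v x) (z20 : forall x, z2 0 x = U2 0 x).
Hypotheses (al0 : ip (z1 0) v = 0) (be0 : ip (z2 0) D = 0).
Hypotheses (h0 : 0 < h) (h1 : h <= 1) (T0 : 0 <= T).
Hypotheses (zh1 : n1 (z1 0) <= 2 * h) (zh2 : n1 (z2 0) <= 2 * h).

Let lam0 : 0 < lam. Proof. exact: lt_le_trans m0 mlam. Qed.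
Let T00 : 0 <= (0 : R) <= T. Proof. by rewrite lexx. Qed.
Let vev x : v (- x) = v x. Proof. exact: vsol_opp. Qed.

Lemma z_even t : 0 <= t <= T -> forall x, z1 t (- x) = z1 t x /\ z2 t (- x) = z2 t x.
Proof.
move=> ht x; have [e1 e2] : (forall x, z1 0 (- x) = z1 0 x) /\ (forall x, z2 0 (- x) = z2 0 x).
  by split=> y; rewrite ?z10 ?z20; have [a b] := evU T00 y; rewrite ?vev ?a ?b.
exact: (weak_system_even lam0 Hv vev Hz1 Hz2 Wz e1 e2 ht).
Qed.

Lemma sq_le_mul (y K : R) : 0 <= y -> 1 <= K -> y ^+ 2 <= (K - 1) * h ^+ 2 -> y <= K * h.
Proof.
move=> y0 K1 H; have Kh : 0 <= K * h by rewrite mulr_ge0 ?ltW//; lra.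
rewrite -ler_sqr ?nnegrE//; apply: le_trans H _; rewrite exprMn ler_wpM2r ?sqr_ge0//.
by rewrite expr2; nra.
Qed.

(** Without N, alpha and beta remain zero and the energy is conserved, so the bound does not grow
    with t. *)
Lemma z_bound t : 0 <= t <= T -> n1 (z1 t) <= flow_cst * h /\ n1 (z2 t) <= flow_cst * h.
Proof.
move=> ht.
have c0 : h1curve T (fun _ _ => 0 : R) by exact: curve_cst (realH1_0 R).
have [c hc Hmax] := cont_on_max T0 (cont_onD (cont_on_n1 Hz1) (cont_on_n1 Hz2)).
pose X := n1 (z1 c) + n1 (z2 c).
have X0 : 0 <= X by rewrite addr_ge0// n1_ge0.
have TT : 0 <= T <= T by rewrite T0 lexx.
have HN t' : 0 <= t' <= T -> n1 (fun=> 0 : R) <= 0 /\ n1 (fun=> 0 : R) <= 0 by rewrite n1_0.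
have HX t' : 0 <= t' <= T -> n1 (z1 t') <= X /\ n1 (z2 t') <= X.
  move=> ht'; have := Hmax t' ht'; rewrite -/X => b.
  by split; [have := n1_ge0 (z2 t')|have := n1_ge0 (z1 t')]; lra.
have ev t' : 0 <= t' <= T -> forall x, z1 t' (- x) = z1 t' x by move=> ht' x; have [] := z_even ht' x.
have := modulated_energy_bound m0 mlam lamM qm Hz1 Hz2 c0 c0 Wz ev al0 be0 TT (lexx 0) X0 HN HX ht.
rewrite mul0r mulr0 expr0n /= mulr0 !addr0 => S.
have k3 : 0 <= (3 : R) <= 3 by rewrite lexx andbT ler0n.
have k1 : 0 <= (1 : R) <= 3 by rewrite ler01 ler1n.
have [i1 i2] := (curve_H1 Hz1 T00, curve_H1 Hz2 T00).
have sq4 y : 0 <= y -> y <= 2 * h -> y * y <= 4 * h ^+ 2.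
  by move=> y0 yh; have := ler_pM y0 y0 yh yh; rewrite expr2; lra.
have b1 := le_trans (ler_norm _) (Bpot_le m0 mlam lamM qm k3 i1 i1).
have b2 := le_trans (ler_norm _) (Bpot_le m0 mlam lamM qm k1 i2 i2).
have g1 := ler_wpM2l Kb_ge0 (sq4 _ (n1_ge0 _) zh1).
have g2 := ler_wpM2l Kb_ge0 (sq4 _ (n1_ge0 _) zh2).
have e : Bp (z1 0) (z1 0) + Bm (z2 0) (z2 0) <= Kb * (8 * h ^+ 2) by lra.
have {}S := le_trans S (ler_wpM2l A_ge0 e).
have {}S : n1 (z1 t) ^+ 2 + n1 (z2 t) ^+ 2 <= (flow_cst - 1) * h ^+ 2.
  apply: le_trans S _; rewrite /flow_cst addrAC subrr add0r.
  by rewrite le_eqVlt; apply/orP; left; apply/eqP; ring.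
have [s1 s2] := (sqr_ge0 (n1 (z1 t)), sqr_ge0 (n1 (z2 t))).
by split; apply: sq_le_mul; rewrite ?n1_ge0 ?flow_cst_ge1//; lra.
Qed.

Let r1 t x := U1 t x - v x - z1 t x.
Let r2 t x := U2 t x - z2 t x.
Let p1 t x := U1 t x - v x.

(** If X > Y then Y^2 <= X Y, and the inequality can be divided by X. *)
Lemma quadratic_improve (X Y a b : R) : 0 <= X -> 0 <= Y -> 0 <= a -> 0 <= b ->
  X ^+ 2 <= 2 * a * X * Y + 2 * b * Y ^+ 2 -> X <= (2 * a + 2 * b + 1) * Y.
Proof.
move=> X0 Y0 a0 b0 H; have aY := mulr_ge0 a0 Y0; have bY := mulr_ge0 b0 Y0.
have [XY|YX] := leP X Y; first by lra.
have Xp : 0 < X by exact: le_lt_trans YX.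
rewrite -(ler_pM2r Xp) -expr2; apply: le_trans H _.
have := ler_wpM2l bY (ltW YX); rewrite expr2.
have := mulr_ge0 Y0 X0; lra.
Qed.

Lemma r_curve : h1curve T r1 /\ h1curve T r2.
Proof. by split; apply: curveB => //; apply: curveB => //; exact: curve_cst. Qed.

(** The self-improving step. While r is at most h the perturbation is at most ([flow_cst] + 1) h, N
    is at most [nl_cst] h^2, and the energy estimate starts from r = 0. *)
Lemma r_local s : 0 <= s <= T -> (forall t, 0 <= t <= s -> n1 (r1 t) + n1 (r2 t) <= h) ->
  n1 (r1 s) + n1 (r2 s) <= rem_cst * (s * (1 + s) * h ^+ 2).
Proof.
move=> hs Hr; have [Hr1 Hr2] := r_curve; have /andP[s0 sT] := hs.
have inT t : 0 <= t <= s -> 0 <= t <= T by move=> /andP[-> ts] /=; exact: le_trans sT.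
have cv := @curve_cst _ T _ Hv; have Hp1 : h1curve T p1 by exact: curveB.
have [HN1 HN2] := curve_nl Hv Hp1 HU2.
have W := perturbation_weak Hv (Bm_vsol m0 mlam lamM qm) HU1 HU2 Hz1 Hz2 WU Wz.
have r10 : r1 0 = fun=> 0 by apply/funext => x; rewrite /r1 z10 subrr.
have r20 : r2 0 = fun=> 0 by apply/funext => x; rewrite /r2 z20 subrr.
have evr t : 0 <= t <= T -> forall x, r1 t (- x) = r1 t x.
  move=> ht x; have [a _] := evU ht x; have [b _] := z_even ht x.
  by rewrite /r1 a b vev.
have fh := flow_cst_ge1.
have pb t : 0 <= t <= s -> n1 (p1 t) <= (flow_cst + 1) * h /\ n1 (U2 t) <= (flow_cst + 1) * h.
  move=> ht; have [a1 a2] := z_bound (inT t ht); have b := Hr t ht.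
  have [i1 i2] := (curve_H1 Hr1 (inT t ht), curve_H1 Hr2 (inT t ht)).
  have [j1 j2] := (curve_H1 Hz1 (inT t ht), curve_H1 Hz2 (inT t ht)).
  have e1 : p1 t = fun x => r1 t x + z1 t x by apply/funext => x; rewrite /r1 /p1 subrK.
  have e2 : U2 t = fun x => r2 t x + z2 t x by apply/funext => x; rewrite /r2 subrK.
  have := n1D i1 j1; have := n1D i2 j2; rewrite -e1 -e2.
  have := n1_ge0 (r1 t); have := n1_ge0 (r2 t); split; lra.
pose nu := nl_cst * h ^+ 2.
have nu0 : 0 <= nu by rewrite mulr_ge0 ?sqr_ge0// nl_cst_ge0.
have HN t : 0 <= t <= s -> n1 (nl1 v (p1 t) (U2 t)) <= nu /\ n1 (nl2 v (p1 t) (U2 t)) <= nu.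
  move=> ht; have [b1 b2] := pb t ht.
  have [i1 i2] := (curve_H1 Hp1 (inT t ht), curve_H1 HU2 (inT t ht)).
  have [c1 c2] := nl_bound Hv i1 i2 (vsoln m0 mlam lamM qm) b1 b2.
  have le : (36 * Cs + 18 * ((flow_cst + 1) * h)) * ((flow_cst + 1) * h) ^+ 2 <= nu.
    rewrite exprMn [leLHS]mulrA /nu /nl_cst; apply: ler_wpM2r; first exact: sqr_ge0.
    apply: ler_wpM2r; first exact: sqr_ge0.
    (* h <= 1 lets the cubic contribution be counted as quadratic. *)
    rewrite lerD2l; apply: ler_wpM2l => //; apply: ler_piMr => //; lra.
  by split; exact: le_trans le.
(* The estimate is used at the time where the sum of the norms is largest, so that X bounds
   itself. *)
have [c hc Hmax] := cont_on_max s0 (cont_on_sub sT (cont_onD (cont_on_n1 Hr1) (cont_on_n1 Hr2))).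
pose X := n1 (r1 c) + n1 (r2 c).
have X0 : 0 <= X by rewrite addr_ge0// n1_ge0.
have HX t : 0 <= t <= s -> n1 (r1 t) <= X /\ n1 (r2 t) <= X.
  move=> ht; have := Hmax t ht; rewrite -/X => b.
  by split; [have := n1_ge0 (r2 t)|have := n1_ge0 (r1 t)]; lra.
have al : ip (r1 0) v = 0 by rewrite r10 ip0l//; exact: realH1_sq.
have be : ip (r2 0) D = 0 by rewrite r20 ip0l//; exact: realH1_sq (dsolH m0 mlam lamM qm).
have S := modulated_energy_bound m0 mlam lamM qm Hr1 Hr2 HN1 HN2 W evr al be hs nu0 X0 HN HX hc.
have H0 := realH1_0 R.
have k3 : 0 <= (3 : R) <= 3 by rewrite lexx andbT ler0n.
have k1 : 0 <= (1 : R) <= 3 by rewrite ler01 ler1n.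
have B0 k : 0 <= k <= 3 -> Bpot lam q k v (fun=> 0) (fun=> 0) = 0.
  move=> hk; have := Bpot_le m0 mlam lamM qm hk H0 H0.
  by rewrite n1_0 mulr0 mulr0 normr_le0 => /eqP.
have S' : n1 (r1 c) ^+ 2 + n1 (r2 c) ^+ 2 <=
    st_A1 m M * X * (nu * (s * (1 + s))) + st_A2 m M * (nu * (s * (1 + s))) ^+ 2.
  by move: S; rewrite -/(r1 0) -/(r2 0) r10 r20 !B0// addr0 mulr0 add0r.
set Y := nu * (s * (1 + s)) in S'.
have Y0 : 0 <= Y by rewrite mulr_ge0// mulr_ge0// addr_ge0.
have XY : X ^+ 2 <= 2 * st_A1 m M * X * Y + 2 * st_A2 m M * Y ^+ 2.
  have : X ^+ 2 <= 2 * (n1 (r1 c) ^+ 2 + n1 (r2 c) ^+ 2).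
    by rewrite /X; move: (n1 (r1 c)) (n1 (r2 c)) => a b; have := sqr_ge0 (a - b); lra.
  move/le_trans; apply; move: S'; lra.
have ss : 0 <= s <= s by rewrite s0 lexx.
apply: le_trans (Hmax s ss) _.
apply: le_trans (quadratic_improve X0 Y0 st_A1_ge0 st_A2_ge0 XY) _.
by rewrite /Y /nu /rem_cst le_eqVlt; apply/orP; left; apply/eqP; ring.
Qed.

(** Here k stands for h^{-1/2}. With c the prefactor of k, s <= c k gives s^2 h <= c^2 <= c and, as
    h <= 1, s h <= c; the bound is then at most 2 [rem_cst] c h <= h / 2, strictly below h. *)
Lemma remainder_bound t k : 0 <= t <= T -> 0 < k -> k ^+ 2 * h = 1 ->
  t <= (1 + 4 * rem_cst)^-1 * k -> n1 (r1 t) + n1 (r2 t) <= rem_cst * (t * (1 + t) * h ^+ 2).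
Proof.
move=> ht k0 kh tk; have /andP[t0 tT] := ht; have [Hr1 Hr2] := r_curve.
have R0 := rem_cst_ge0; set c := (1 + 4 * rem_cst)^-1 in tk.
have d0 : 0 < 1 + 4 * rem_cst by lra.
have c0 : 0 < c by rewrite invr_gt0.
have c1 : c <= 1 by rewrite invf_le1//; lra.
have cR : rem_cst * c <= 4^-1.
  by rewrite /c -ler_pdivlMr ?invr_gt0// invrK; lra.
have small s : 0 <= s -> s <= t -> rem_cst * (s * (1 + s) * h ^+ 2) < h.
  move=> s0 st; have sk : s <= c * k by exact: le_trans tk.
  have s2 : s * s * h <= c * c.
    have := ler_wpM2r (ltW h0) (ler_pM s0 s0 sk sk).
    have -> : c * k * (c * k) * h = c * c * (k ^+ 2 * h) by ring.
    by rewrite kh mulr1.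
  have s1 : s * h <= c.
    rewrite -ler_sqr ?nnegrE ?mulr_ge0 ?(ltW c0) ?(ltW h0)//.
    have -> : (s * h) ^+ 2 = s * s * h * h by ring.
    rewrite expr2; apply: le_trans (ler_wpM2r (ltW h0) s2) _.
    by rewrite ler_piMr// mulr_ge0// ltW.
  have cc : c * c <= c by rewrite ler_piMr// ltW.
  have e : s * (1 + s) * h ^+ 2 <= 2 * c * h.
    have -> : s * (1 + s) * h ^+ 2 = (s * h + s * s * h) * h by ring.
    by apply: ler_wpM2r; [exact: ltW|lra].
  apply: le_lt_trans (ler_wpM2l R0 e) _.
  have -> : rem_cst * (2 * c * h) = 2 * (rem_cst * c) * h by ring.
  rewrite -[ltRHS]mul1r ltr_pM2r//; lra.
have z0 : n1 (r1 0) + n1 (r2 0) = 0.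
  have -> : r1 0 = fun=> 0 by apply/funext => x; rewrite /r1 z10 subrr.
  have -> : r2 0 = fun=> 0 by apply/funext => x; rewrite /r2 z20 subrr.
  by rewrite n1_0 addr0.
apply: r_local => // s hs.
(* The induction runs on [0, t] and not on [0, T], since the improved bound is known to be below h
   up to t only. *)
apply: (@bootstrap R t (fun s => n1 (r1 s) + n1 (r2 s)) h t0) hs.
- exact: cont_on_sub tT (cont_onD (cont_on_n1 Hr1) (cont_on_n1 Hr2)).
- by rewrite z0.
- move=> s' /andP[s0' st'] H; apply: le_lt_trans (small s' s0' st').
  by apply: r_local => //; rewrite s0' (le_trans st').
Qed.

End Remainder.
End Final.

(** * From the complex statement to the real systems *)

Section Reduction.
Variable R : realType.
Local Open Scope complex_scope.

Lemma compact_pos_bounds (I : set R) : compact (closure I) -> closure I `<=` [set x | 0 < x] ->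
  exists m M : R, [/\ 0 < m, m <= M & forall x, I x -> m <= x <= M].
Proof.
(* For an empty I any pair 0 < m <= M will do. *)
move=> cI pI; have [->|/set0P[x0 Ix0]] := eqVneq I set0; first by exists 1, 1; split.
have sI : I `<=` closure I by exact: subset_closure.
have n0 : closure I !=set0 by exists x0; exact: sI.
have ci : {within closure I, continuous (@idfun R)} by apply: continuous_subspaceT => x; exact: cvg_id.
have [m /set_mem Im Hm] := compact_EVT_min n0 cI ci.
have [M /set_mem IM HM] := compact_EVT_max n0 cI ci.
have H x : I x -> m <= x <= M.
  by move=> /sI Ix; rewrite Hm ?HM// inE.
exists m, M; split=> //; first exact: pI.
by have /andP[h1 h2] := H _ Ix0; exact: le_trans h1 h2.
Qed.

Lemma parts_rot (theta : R) (a : R -> R[i]) :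
  rpart (fun x => expi theta * a x) = (fun x => cos theta * rpart a x - sin theta * ipart a x) /\
  ipart (fun x => expi theta * a x) = (fun x => cos theta * ipart a x + sin theta * rpart a x).
Proof.
by split; apply/funext => x; rewrite /rpart /ipart /expi; case: (a x) => p r /=.
Qed.

Lemma n1_rot_le (c n : R) f g : `|c| <= 1 -> `|n| <= 1 -> realH1 f -> realH1 g ->
  n1 (fun x => c * f x - n * g x) <= n1 f + n1 g /\
  n1 (fun x => c * f x + n * g x) <= n1 f + n1 g.
Proof.
move=> c1 n1' Hf Hg; have [Hcf Hng] := (realH1Z c Hf, realH1Z n Hg).
have h1 : n1 (fun x => c * f x) <= n1 f by rewrite n1Z// ler_piMl ?n1_ge0.
have h2 : n1 (fun x => n * g x) <= n1 g by rewrite n1Z// ler_piMl ?n1_ge0.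
split; first by apply: le_trans (n1B Hcf Hng) _; exact: lerD.
by apply: le_trans (n1D Hcf Hng) _; exact: lerD.
Qed.

Lemma norm_cos_le1 (t : R) : `|cos t| <= 1.
Proof. by rewrite ler_norml cos_geN1 cos_le1. Qed.

Lemma norm_sin_le1 (t : R) : `|sin t| <= 1.
Proof. by rewrite ler_norml sin_geN1 sin_le1. Qed.

(** Evaluation at x = 0 suffices: the imaginary part there is a pairing times v(0), the real part
    the other pairing times d_lam v at 0, and neither value is zero. *)
Lemma Pproj_orth (lam q : R) (phi : R -> R[i]) : vsol lam q 0 != 0 -> dsol lam q 0 != 0 ->
  dvsol lam q = (fun x => (dsol lam q x)%:C) -> realH1 (vsol lam q) -> realH1 (dsol lam q) ->
  realH1 (rpart phi) -> realH1 (ipart phi) ->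
  (forall x, Pproj lam q phi x = 0) ->
  ip (rpart phi) (vsol lam q) = 0 /\ ip (ipart phi) (dsol lam q) = 0.
Proof.
move=> v0 d0 dvE Hv Hd Hr Hi H.
have [sr si] := (realH1_sq Hr, realH1_sq Hi); have [sv sd] := (realH1_sq Hv, realH1_sq Hd).
have s0 := @sqint0 R.
have iE : rpart (ivsol lam q) = (fun=> 0) /\ ipart (ivsol lam q) = vsol lam q.
  by split; apply/funext => x; rewrite /rpart /ipart /ivsol /vsolC /=; ring.
have [iE1 iE2] := iE.
have := H 0; rewrite /Pproj.
have -> : omega phi (ivsol lam q) = - ip (rpart phi) (vsol lam q).
  by rewrite omegaE ?iE1 ?iE2// (ipC _ (fun=> 0)) ip0l// sub0r.
have -> : omega phi (dvsol lam q) = ip (ipart phi) (dsol lam q).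
  rewrite dvE omegaE//; have -> : ipart (fun x => (dsol lam q x)%:C) = (fun=> 0) by [].
  by rewrite [ip (rpart _) _]ipC ip0l// subr0.
rewrite dvE /ivsol /vsolC; move: (ip _ _) (ip _ _) => A B [].
rewrite !(mul0r, mulr0, subr0, sub0r, addr0, add0r, oppr0, mul1r, mulrN, mulNr, opprK).
move=> /eqP; rewrite mulf_eq0 (negbTE d0) orbF => /eqP ->.
by move=> /eqP; rewrite mulf_eq0 (negbTE v0) orbF => /eqP ->.
Qed.

Lemma expiD (a b : R) : expi a * expi b = expi (a + b).
Proof. by rewrite /expi cosD sinD; apply/eqP; rewrite eq_complex /= [X in _ && (_ == X)]addrC !eqxx. Qed.

End Reduction.

Local Open Scope complex_scope.

Theorem theorem2 (R : realType) (I : set R)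
    (Icompact : compact (closure I))
    (Ipos : closure I `<=` [set x | 0 < x]) :
  exists q0 h0 c C : R,
    [/\ 0 < q0, 0 < h0, 0 < c & 0 < C] /\
    forall q h : R, `|q| <= q0 -> 0 < h <= h0 ->
    forall (T : R) (u : R -> R -> R[i]),
      NLS_solution q T u ->
      (forall t, 0 <= t <= T -> forall x, u t (- x) = u t x) ->
    forall lam theta : R, I lam ->
      let w0 := fun x => u 0 x - expi theta * vsolC lam q x in
      H1norm w0 <= h ->
      (forall x, Pproj lam q (fun y => expi (- theta) * w0 y) x = 0) ->
    forall w : R -> R -> R[i],
      linear_flow lam q T (fun x => expi (- theta) * w0 x) w ->
    forall t : R, 0 <= t <= T -> t <= c * h `^ (- 2^-1) ->
      H1norm (fun x => u t x
                - expi theta * expi (t * lam ^+ 2 / 2)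
                  * (vsolC lam q x + w t x))
      <= C * (t * (1 + t) * h ^+ 2).
Proof.
have [m [M [m0 mM mMI]]] := compact_pos_bounds Icompact Ipos.
have R0 := rem_cst_ge0 m0 mM; set K := rem_cst m M in R0.
(* m / 20 serves coercivity and the decay of v, 1/2 the approximation by domain elements. In C the
   factor 2 is lost when the components are rotated back, and the 1 ensures positivity. *)
exists (Num.min (20^-1 * m) 2^-1), 1, (1 + 4 * K)^-1, (2 * K + 1).
split.
  have m20 : 0 < 20^-1 * m by rewrite mulr_gt0// invr_gt0.
  by split; rewrite ?lt_min ?m20 ?invr_gt0//; lra.
move=> q h; rewrite le_min => /andP[qm q2] /andP[h0 h1] T u Hu evu lam theta Ilam w0 w0h Pw w Hw t ht tc.
have /andP[mlam lamM] := mMI _ Ilam.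
have lam0 : 0 < lam by exact: lt_le_trans mlam.
have qlam : `|q| <= 20^-1 * lam by apply: le_trans qm _; rewrite ler_pM2l.
have /andP[t0 tT] := ht; have T0 : 0 <= T by exact: le_trans tT.
have T00 : 0 <= (0 : R) <= T by rewrite lexx.
set v := vsol lam q.
have Hv : realH1 v by exact: (vsolH m0 mlam lamM qm).
have Hd : realH1 (dsol lam q) by exact: (dsolH m0 mlam lamM qm).
have [Hcu _] := Hu; have [Hu1 Hu2] := H1_curve_parts Hcu.
have [Hcw w00 _] := Hw; have [Hz1 Hz2] := H1_curve_parts Hcw.
have Wu := nls_weak Hu Hv.
have [HU1 HU2 WU] := rotation_weak lam theta Hv Hu1 Hu2 Wu.
set U1 := (fun t x => _) in HU1; set U2 := (fun t x => _) in HU2.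
have Wz := linear_flow_weak Hv q2 Hw.
have vC : rpart (vsolC lam q) = v /\ ipart (vsolC lam q) = (fun=> 0) by [].
have [vC1 vC2] := vC.
have Hw0 : H1 w0.
  have Hev : H1 (fun x => expi theta * vsolC lam q x).
    have [e1 e2] := parts_rot theta (vsolC lam q); rewrite /H1 e1 e2 vC1 vC2.
    by split; [apply: realH1B|apply: realH1D]; apply: realH1Z => //; exact: realH1_0.
  by have [Hut _] := Hcu 0 T00; exact: H1_B.
have w0E : rpart w0 = (fun x => rpart (u 0) x - cos theta * v x) /\
    ipart w0 = (fun x => ipart (u 0) x - sin theta * v x).
  rewrite /w0 rpartB ipartB; have [-> ->] := parts_rot theta (vsolC lam q).
  by rewrite vC1 vC2; split; apply/funext => x; rewrite mulr0 ?subr0 ?add0r.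
have [w0r w0i] := w0E.
have [e1 e2] := parts_rot (- theta) w0.
have [Hw0r Hw0i] := Hw0.
have w0n : w 0 = (fun x => expi (- theta) * w0 x) by apply/funext => x; exact: w00.
have z1E : rpart (w 0) = fun x => cos theta * rpart w0 x + sin theta * ipart w0 x.
  by rewrite w0n e1; apply/funext => x; rewrite cosN sinN mulNr opprK.
have z2E : ipart (w 0) = fun x => cos theta * ipart w0 x - sin theta * rpart w0 x.
  by rewrite w0n e2; apply/funext => x; rewrite cosN sinN mulNr.
have th0 : theta + 0 * lam ^+ 2 / 2 = theta by rewrite !mul0r addr0.
have cs := cos2Dsin2 theta.
(* The phase at time 0 is theta, so the rotated perturbation and w(0) coincide: the remainder starts
   from zero. *)
have z10 x : rpart (w 0) x = U1 0 x - v x.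
  rewrite z1E w0r w0i /U1 th0 -[v x in RHS]mul1r -cs; ring.
have z20 x : ipart (w 0) x = U2 0 x.
  by rewrite z2E w0r w0i /U2 th0; ring.
have [nr ni] := n1_rpart_le Hw0.
have [_ zh1] := n1_rot_le (norm_cos_le1 theta) (norm_sin_le1 theta) Hw0r Hw0i.
have [zh2 _] := n1_rot_le (norm_cos_le1 theta) (norm_sin_le1 theta) Hw0i Hw0r.
have zb1 : n1 (rpart (w 0)) <= 2 * h by rewrite z1E; move: zh1 nr ni w0h; lra.
have zb2 : n1 (ipart (w 0)) <= 2 * h by rewrite z2E; move: zh2 nr ni w0h; lra.
have dvE : dvsol lam q = (fun x => (dsol lam q x)%:C).
  apply/funext => x; rewrite /dvsol derive1E; congr (_%:C).
  by have d := is_derive_vsol x lam0 qlam; exact: derive_val.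
have v0 : v 0 != 0 by rewrite gt_eqF//; exact: (@vsol_gt0 R lam q m m0 mlam 0).
have d0 : dsol lam q 0 != 0.
  by rewrite gt_eqF//; apply: (dsol_gt0 m0 mlam qm); rewrite normr0 mulr0.
have [Hwr Hwi] : H1 (w 0) by have [] := Hcw 0 T00.
rewrite -w0n in Pw.
have [al be] := Pproj_orth v0 d0 dvE Hv Hd Hwr Hwi Pw.
have evU s : 0 <= s <= T -> forall x, U1 s (- x) = U1 s x /\ U2 s (- x) = U2 s x.
  by move=> hs x; rewrite /U1 /U2 /rpart /ipart !evu.
(* The time restriction is used only through k > 0 and k^2 h = 1. *)
pose k : R := h `^ (- 2^-1).
have k0 : 0 < k by exact: powR_gt0.
have kh : k ^+ 2 * h = 1.
  rewrite /k expr2 -powRD; last by rewrite (gt_eqF h0) implybT.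
  have -> : - 2^-1 + - 2^-1 = - 1 :> R by lra.
  by rewrite powR_inv1 ?ltW// mulVf// gt_eqF.
have B := remainder_bound m0 mM mlam lamM qm HU1 HU2 Hz1 Hz2 WU Wz evU z10 z20 al be h0 h1 T0 zb1 zb2 ht k0 kh tc.
set eta := theta + t * lam ^+ 2 / 2.
pose r1 x := U1 t x - v x - rpart (w t) x; pose r2 x := U2 t x - ipart (w t) x.
have cse := cos2Dsin2 eta.
have Hr1 : realH1 r1.
  apply: realH1B; last exact: curve_H1 Hz1 ht.
  by apply: realH1B => //; exact: curve_H1 HU1 ht.
have Hr2 : realH1 r2 by apply: realH1B; [exact: curve_H1 HU2 ht|exact: curve_H1 Hz2 ht].
set d := (fun x => _) in |- *.
(* The error is e^{i eta} (r1 + i r2); inserting cos^2 + sin^2 = 1 recovers u from its rotated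
   components. *)
have dr : rpart d = (fun x => cos eta * r1 x - sin eta * r2 x).
  apply/funext => x; rewrite /d expiD -/eta /rpart /r1 /r2 /U1 /U2 /rpart /ipart -/eta /vsolC -/v.
  case: (u t x) (w t x) => a b [a' b'] /=.
  by rewrite -[X in X - _]mul1r -cse; ring.
have di : ipart d = (fun x => cos eta * r2 x + sin eta * r1 x).
  apply/funext => x; rewrite /d expiD -/eta /ipart /r1 /r2 /U1 /U2 /rpart /ipart -/eta /vsolC -/v.
  case: (u t x) (w t x) => a b [a' b'] /=.
  by rewrite -[X in X - _]mul1r -cse; ring.
have Hdd : H1 d.
  by rewrite /H1 dr di; split; [apply: realH1B|apply: realH1D]; exact: realH1Z.
apply: le_trans (H1norm_le Hdd) _; rewrite dr di.
have [n1' _] := n1_rot_le (norm_cos_le1 eta) (norm_sin_le1 eta) Hr1 Hr2.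
have [_ n2'] := n1_rot_le (norm_cos_le1 eta) (norm_sin_le1 eta) Hr2 Hr1.
have P : 0 <= t * (1 + t) * h ^+ 2 by rewrite mulr_ge0 ?sqr_ge0// mulr_ge0// addr_ge0.
apply: le_trans (lerD n1' n2') _.
have : n1 r1 + n1 r2 <= K * (t * (1 + t) * h ^+ 2) by exact: B.
move: P; move: (t * (1 + t) * h ^+ 2) => Y; lra.
Qed.
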